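(* Let $W:\mathbb{R}\to\mathbb{R}$ be a stationary Gaussian process having a.s. twice continuously differentiable sample paths. Assume that the spectrum of $W$ has a continuous component and that the variance of the number of zeros $W_x(y)=0$, $y\in[0,1]$, is finite. For $x=(x_1,x_2,x_3)$ put $$\xi(x)=(W(x_1),\,W_x(x_1-x_2),\,W_x(x_1+x_3)),\qquad \Gamma_x=\{z\in\mathbb{R};\ x_1-x_2\le z\le x_1+x_3\},$$ $$\alpha(x)=W_x(x_1)^-\,W_{xx}(x_1-x_2)^-\,W_{xx}(x_1+x_3)^+\,\mathbf{1}_{\{W_x(z)\le 0,\ \forall z\in\Gamma_x\}},$$ and define $h_s(x,y)=h_s(x_1,x_2,x_3,y_1,y_2)$ by $$h_s(x,y)=\mathsf{E}[\alpha(x)\mid \xi(x)=0,\,W(x_1-x_2)=y_1,\,W(x_1+x_3)=y_2]\; f_{\xi(x),W(x_1-x_2),W(x_1+x_3)}(0,y_1,y_2).$$ Then the Palm distribution $F^{\mathrm{space}}_{x_2,x_3,H_2,H_3}$ is given by $$F^{\mathrm{space}}_{x_2,x_3,H_2,H_3}(r,s,u,w)=\frac{\int_0^r\int_0^s\int_0^u\int_{-\infty}^w h_s(0,x_2,x_3,y_1,y_2)\,dy_2\,dy_1\,dx_3\,dx_2}{\mathsf{E}[W_x(0)^-\mid W(0)=0]\,f_{W(0)}(0)},$$ having the density $$f^{\mathrm{space}}_{x_2,x_3,H_2,H_3}(r,s,u,w)=\frac{h_s(0,r,s,u,w)}{\mathsf{E}[W_x(0)^-\mid W(0)=0]\,f_{W(0)}(0)},$$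 where $r,s,u>0$ and $w<0$.
   Context: $W_x,W_{xx}$ denote the first and second derivatives of $W$; $a^+=\max(a,0)$, $a^-=\max(-a,0)$. In the paper $W(x)=W(x,0)$ is the sea elevation along a line at time $0$. Spatial Palm distribution of distances and heights. For a zero-downcrossing $x_1$ of $W$ (wave center), $x_2>0$ is the distance to the closest local maximum before $x_1$ and $x_3>0$ the distance to the closest local minimum after $x_1$, with heights $H_2=W(x_1-x_2)$, $H_3=W(x_1+x_3)$. $F^{\mathrm{space}}_{x_2,x_3,H_2,H_3}(r,s,u,w)$ is the ratio of the expected number of downcrossings $x_1\in[0,1]$ with $(x_2,x_3,H_2,H_3)\le(r,s,u,w)$ (componentwise) to the expected number of downcrossings in $[0,1]$. Precisely, with $B=\{x\in\mathbb{R}^3;\ 0\le x_1\le1,\ 0<x_2\le r,\ 0<x_3\le s\}$, $$F^{\mathrm{space}}_{x_2,x_3,H_2,H_3}(r,s,u,w)=\frac{\mathsf{E}[\#\{x\in B;\ \xi(x)=0\text{ and (i), (ii) hold}\}]}{\mathsf{E}[\#\{x_1\in[0,1];\ W(x_1)=0,\ W_x(x_1)<0\}]},$$ where (i) is: $W_{xx}(x_1-x_2)<0$, $W_{xx}(x_1+x_3)>0$ and $W_x(z)\le0$ for all $z\in\Gamma_x$; and (ii) is: $W(x_1-x_2)\le u$ and $W(x_1+x_3)\le w$. $f_X$ denotes the density of a random vector $X$; conditional expectations given values of a Gaussian vector are taken with respect to the conditional Gaussian law (Gaussian regression). *)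

(* Defs.v *)
From HB Require Import structures.
From mathcomp Require Import all_boot all_order all_algebra.
From mathcomp Require Import all_classical all_reals all_analysis.
From mathcomp Require Import measurable_realfun.

Set Implicit Arguments.
Unset Strict Implicit.
Unset Printing Implicit Defensive.

Import Order.TTheory GRing.Theory Num.Theory.
Import numFieldNormedType.Exports.

Local Open Scope ring_scope.
Local Open Scope classical_set_scope.

Definition pos_part (R : realType) (a : R) : R := Num.max a 0.
Definition neg_part (R : realType) (a : R) : R := Num.max (- a) 0.

Definition C2 (R : realType) (w : R -> R) : Prop :=
  [/\ forall t, derivable w t 1,
      forall t, derivable (derive1 w) t 1
    & continuous (derive1n 2 w)].

(* Sample paths are smooth only almost surely, so derivatives and counts of
   zeros need only agree with a measurable function off a negligible set.
   Below, expectations of such functions, and probabilities of the events they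
   define, are therefore always written as integrals (for a nonnegative
   function the library's integral is a lower integral, insensitive to
   negligible sets) rather than as values of [P]. *)

Section gaussian_processes.
Context (R : realType) (d : measure_display) (T : measurableType d).
Variable P : probability T R.

(* A constant is a (degenerate) normal variable. *)
Definition gaussian_rv (X : T -> R) : Prop :=
  exists m s : R, forall A : set R, measurable A ->
    P (X @^-1` A) = if s == 0 then \d_m A else normal_prob m s A.

Definition gaussian_process (W : R -> {RV P >-> R}) : Prop :=
  forall (n : nat) (t a : 'I_n -> R),
    gaussian_rv (fun omega => \sum_(i < n) a i * W (t i) omega).

Definition stationary_process (W : R -> {RV P >-> R}) : Prop :=
  forall (n : nat) (t : 'I_n -> R) (h : R) (A : 'I_n -> set R),
    (forall i, measurable (A i)) ->
    P [set omega | forall i, A i (W (t i + h) omega)] =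
    P [set omega | forall i, A i (W (t i) omega)].

(* Two-sided real form of the spectral representation of the covariance
   function; the finite symmetric measure [F] is then unique. *)
Definition spectral_measure (W : R -> {RV P >-> R})
    (F : {finite_measure set R -> \bar R}) : Prop :=
  (forall A : set R, measurable A -> F (-%R @^-1` A) = F A) /\
  forall s t : R,
    covariance P (W s) (W t) = (\int[F]_l (cos (l * (t - s)))%:E)%E.

(* In the decomposition of the spectrum into a discrete and a continuous part,
   the latter is the restriction of [F] to the set of points that are not
   atoms. *)
Definition spectrum_has_continuous_component
    (W : R -> {RV P >-> R}) : Prop :=
  exists2 F : {finite_measure set R -> \bar R},
    spectral_measure W F & (0 < F [set l | F [set l] = 0])%E.

Definition finite_variance (N : T -> \bar R) : Prop :=
  (\int[P]_omega N omega < +oo /\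
   \int[P]_omega ((N omega - \int[P]_omega' N omega') ^+ 2) < +oo)%E.

(* Density of a random vector. [orthant_integral a f] is the iterated integral
   of [f] over the orthant of points below [a], coordinate by coordinate. *)
Fixpoint orthant_integral (a : seq R) (f : seq R -> \bar R) : \bar R :=
  if a is a0 :: a' then
    (\int[lebesgue_measure]_(x in `]-oo, a0])
       orthant_integral a' (fun s => f (x :: s)))%E
  else f [::].

Definition row_of_seq (n : nat) (s : seq R) : 'rV[R]_n := \row_(i < n) s`_i.

Definition is_continuous_density (n : nat) (V : T -> 'rV[R]_n)
    (f : 'rV[R]_n -> R) : Prop :=
  [/\ continuous f, (forall v, 0 <= f v)
    & forall a : n.-tuple R,
      'E_P[\1_[set omega | forall i, (V omega ord0 i <= tnth a i)%R]]%E =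
      orthant_integral a (fun s => (f (row_of_seq n s))%:E)].

(* A density is determined only up to null sets; pointwise values refer to its
   continuous version, which is unique (0 if there is none). *)
Definition density (n : nat) (V : T -> 'rV[R]_n) (v : 'rV[R]_n) : R :=
  xget 0 [set y | exists2 f, is_continuous_density V f & f v = y].

Section gaussian_regression.
Variables (W : R -> {RV P >-> R}) (n : nat) (V : T -> 'rV[R]_n).

Definition cov_matrix : 'M[R]_n :=
  \matrix_(i, j) fine (covariance P (fun omega => V omega 0 i)
                                    (fun omega => V omega 0 j)).

Definition cov_with (t : R) : 'rV[R]_n :=
  \row_j fine (covariance P (W t) (fun omega => V omega 0 j)).

(* When the process and [V] are jointly Gaussian with [cov_matrix] invertible,
   the residual of the regression of the process on [V] is independent of [V],
   and so the conditional law of the process given [V = v] is the law of the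
   process
     W(t) + Cov(W(t), V) Cov(V, V)^-1 (v - V). *)
Definition conditioned_path (v : 'rV[R]_n) (omega : T) (t : R) : R :=
  W t omega + (cov_with t *m invmx cov_matrix *m (v - V omega)^T) 0 0.

(* Conditional expectation, given V = v, of the functional [phi] of the path
   of the process. *)
Definition cond_expectation (phi : (R -> R) -> R) (v : 'rV[R]_n) : \bar R :=
  'E_P[fun omega => phi (conditioned_path v omega)]%E.

End gaussian_regression.

End gaussian_processes.

Section path_functionals.
Context (R : realType).
Implicit Types (w : R -> R) (x : R * R * R).

Definition Gamma x : set R :=
  let '(x1, x2, x3) := x in [set z | x1 - x2 <= z <= x1 + x3].

Definition xi w x : R * R * R :=
  let '(x1, x2, x3) := x in (w x1, derive1 w (x1 - x2), derive1 w (x1 + x3)).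

Definition nonincreasing_on_Gamma w x : Prop :=
  forall z, Gamma x z -> derive1 w z <= 0.

Definition alpha w x : R :=
  let '(x1, x2, x3) := x in
  neg_part (derive1 w x1) * neg_part (derive1n 2 w (x1 - x2))
    * pos_part (derive1n 2 w (x1 + x3))
    * \1_[set w' | nonincreasing_on_Gamma w' x] w.

(* The values of (xi(x), W(x1 - x2), W(x1 + x3)) along the path [w]. *)
Definition xi_heights w x : 'rV[R]_5 :=
  let '(x1, x2, x3) := x in
  row_of_seq 5 [:: (xi w x).1.1; (xi w x).1.2; (xi w x).2;
                   w (x1 - x2); w (x1 + x3)].

Definition box_B (r s : R) : set (R * R * R) :=
  [set x | let '(x1, x2, x3) := x in
           [/\ 0 <= x1 <= 1, 0 < x2 <= r & 0 < x3 <= s]].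

Definition condition_i w x : Prop :=
  let '(x1, x2, x3) := x in
  [/\ derive1n 2 w (x1 - x2) < 0, 0 < derive1n 2 w (x1 + x3)
    & nonincreasing_on_Gamma w x].

Definition condition_ii (u v : R) w x : Prop :=
  let '(x1, x2, x3) := x in w (x1 - x2) <= u /\ w (x1 + x3) <= v.

Definition marked_downcrossings (r s u v : R) w : set (R * R * R) :=
  [set x | [/\ box_B r s x, xi w x = (0, 0, 0), condition_i w x
             & condition_ii u v w x]].

Definition downcrossings w : set R :=
  [set x1 | [/\ 0 <= x1 <= 1, w x1 = 0 & derive1 w x1 < 0]].

Definition derivative_zeros w : set R :=
  [set y | 0 <= y <= 1 /\ derive1 w y = 0].

End path_functionals.

Section palm.
Context (R : realType) (d : measure_display) (T : measurableType d).
Variables (P : probability T R) (W : R -> {RV P >-> R}).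

Definition sample_path (omega : T) : R -> R := fun t => W t omega.

Definition F_space (r s u w : R) : \bar R :=
  ((\int[P]_omega counting (marked_downcrossings r s u w (sample_path omega)))
   / \int[P]_omega counting (downcrossings (sample_path omega)))%E.

Definition h_s (x : R * R * R) (y1 y2 : R) : \bar R :=
  let V := fun omega => xi_heights (sample_path omega) x in
  let v := row_of_seq 5 [:: 0; 0; 0; y1; y2] in
  (cond_expectation W V (fun w => alpha w x) v * (density P V v)%:E)%E.

(* E[W_x(0)^- | W(0) = 0] f_{W(0)}(0) *)
Definition downcrossing_intensity : \bar R :=
  let V := fun omega => row_of_seq 1 [:: W 0 omega] in
  (cond_expectation W V (fun w => neg_part (derive1 w 0)) 0
   * (density P V 0)%:E)%E.

End palm.

(* [F], a function of (r, s, u, w) with r, s, u > 0 and w < 0, is on that domain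
   the distribution function of a measure with Lebesgue density [f]. *)
Definition has_density4 (R : realType) (F : R -> R -> R -> R -> \bar R)
    (f : R -> R -> R -> R -> \bar R) : Prop :=
  let mu := @lebesgue_measure R in
  let domain : set (R * R * R * R) :=
    [set q | let '(a, b, y1, y2) := q in
             [/\ 0 < a, 0 < b, 0 < y1 & y2 < 0]] in
  let below (r s u w : R) : set (R * R * R * R) :=
    [set q | let '(a, b, y1, y2) := q in
             [/\ a <= r, b <= s, y1 <= u & y2 <= w]] in
  let g (q : R * R * R * R) : \bar R :=
    let '(a, b, y1, y2) := q in f a b y1 y2 in
  [/\ measurable_fun domain g,
      forall q, domain q -> (0 <= g q)%E
    & forall r s u w : R, 0 < r -> 0 < s -> 0 < u -> w < 0 ->
        F r s u w =
        (\int[((mu \x mu) \x mu) \x mu]_(q in domain `&` below r s u w)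
           g q)%E].

(* Main.v *)
(* The expected number of marked downcrossings is computed by a three-point Rice formula. Marked triples
   (top, downcrossing, bottom) are isolated by rational strips on which the path, respectively its derivative,
   is strictly monotone, so that in a given strip each coordinate is the unique zero of a monotone function.
   For one strip, the expectation of a functional of the path is obtained by sliding the path along the
   regression direction of the value that vanishes, which leaves the Gaussian law quasi-invariant; this turns the
   sum over zeros into an integral over the location of the zero of the conditioned path times the density.
   Iterating for the three zeros, conditioning on the two heights, and summing over strips gives the integral
   of the Palm density; stationarity removes the dependence on the location of the downcrossing. The
   continuous spectral component makes the five conditioning variables linearly independent: a vanishing
   combination would be a trigonometric polynomial with polynomial coefficients vanishing on an uncountable
   set of frequencies. *)
From HB Require Import structures.
From mathcomp Require Import all_boot all_order all_algebra.
From mathcomp Require Import all_classical all_reals all_analysis.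
From mathcomp Require Import measurable_realfun ring lra.
Require Import Defs.

Set Implicit Arguments.
Unset Strict Implicit.
Unset Printing Implicit Defensive.

Import Order.TTheory GRing.Theory Num.Theory.
Import numFieldNormedType.Exports.

Local Open Scope classical_set_scope.
Local Open Scope ring_scope.

(** * Moments and Fourier transform of the normal density *)

Section normal_transform.
Context {R : realType}.
Notation mu := (@lebesgue_measure R).

(** Conditional laws enter only through Gaussian regression: given [Lf e X t = v], the path is the
    original one plus a random multiple of a deterministic function, hence again a random path on
    the same probability space. Conditioning on five values is five such slides, one scalar at a
    time ([chain]); the matrix formula and the continuous density of the statement are identified
    with this chain separately. The obstacle is that the regression direction depends on the
    location of the zero, whereas a change of variables along a slide needs one fixed direction. On
    a short interval a fixed direction is admissible and the area formula applies path by path; a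
    Gaussian identity then trades it for the direction attached to each location, and a continuous
    induction, based on additivity in the interval, removes the shortness. Most equalities of path
    laws are read off from cosine and sine transforms of finite combinations of values. Strips need
    a nonzero slope at each zero: condition (i) provides it at the two extremes, and at the centre a
    small-ball estimate of Bulinskaya type excludes tangential zeros in [0, 1] almost surely. *)

Lemma integral_derive0 (h h' : R -> R) :
  (forall x, is_derive (x:R) (1:R) h (h' x)) -> continuous h' ->
  mu.-integrable setT (EFin \o h') ->
  (h n.+1%:R @[n --> \oo] --> 0) -> (h (- n.+1%:R) @[n --> \oo] --> 0) ->
  \int[mu]_x (h' x) = 0.
Proof.
move=> dh ch ih hp hm.
pose I (n : nat) := [set` `[- n.+1%:R, (n.+1%:R:R)]].
pose f n := ((EFin \o h') \_ (I n)).
have mI n : measurable (I n) by exact: measurable_itv.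
have mh : measurable_fun setT (EFin \o h') by exact: measurable_int ih.
have e1 : forall n, measurable_fun setT (f n).
  by move=> n; apply/(measurable_restrictT _ _).1 => //; exact: measurable_funTS.
have e2 : {ae mu, forall x, setT x -> f ^~ x @ \oo --> (EFin \o h') x}.
  apply: aeW => x _.
  apply: cvg_near_cst.
  have [N Nx] : exists N, `|x| <= N%:R.
    by exists (Num.truncn `|x|).+1; rewrite ltW// truncnS_gt.
  exists N => // n /= Nn; rewrite /f patchE ifT// inE /I /= in_itv/=.
  rewrite -ler_norml (le_trans Nx)// ler_nat; exact: leq_trans Nn _.
have e3 : mu.-integrable setT (fun x : R => `|h' x|%:E).
  exact: (integrable_norm ih).
have e4 : {ae mu, forall x n, setT x -> (`|f n x| <= `|h' x|%:E)%E}.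
  apply: aeW => x n _; rewrite /f patchE; case: ifPn => // _.
  by rewrite abse0 lee_fin.
have [_ _ cv] := @dominated_convergence _ _ _ mu setT measurableT f _ _ e1 mh e2 e3 e4.
have cv2 : (\int[mu]_x f n x)%E @[n --> \oo] --> 0%E.
  have -> : (fun n => \int[mu]_x f n x)%E = (fun n => ((h n.+1%:R) - (h (- n.+1%:R)))%:E).
    apply/funext => n; rewrite /f -integral_mkcond.
    rewrite (@continuous_FTC2 _ h' h) ?EFinB//.
    - by rewrite gtrN// ltr0n.
    - exact: continuous_subspaceT.
    - have dc y : h x @[x --> y] --> h y.
        by apply/differentiable_continuous/derivable1_diffP; case: (dh y).
      split; [by move=> y _; case: (dh y) | exact: cvg_at_right_filter | exact: cvg_at_left_filter].
    - by move=> y _; rewrite derive1E; case: (dh y).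
  apply: cvg_EFin; first by exact: nearW.
  rewrite -[X in _ --> X](subrr (0:R)).
  exact: (cvgB hp hm).
rewrite /Rintegral (_ : (\int[mu]_x (h' x)%:E)%E = 0%E) //.
by apply: cvg_unique cv cv2; exact: ereal_hausdorff.
Qed.


Lemma is_derive_normal_pdf (s x : R) : s != 0 ->
  is_derive x (1 : R) (normal_pdf 0 s) (- (x / s ^+ 2) * normal_pdf 0 s x).
Proof.
move=> s0; rewrite normal_pdfE// /normal_fun.
have -> : (fun x : R => normal_peak s * expR (- (x - 0) ^+ 2 / (s ^+ 2 *+ 2))) =
  (fun x => normal_peak s * expR (- (x ^+ 2) * (s ^+ 2 *+ 2)^-1)).
  by apply/funext => y; rewrite subr0.
apply: is_derive_eq.
rewrite /= !scaler1 subr0 /GRing.scale /=; field.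
by rewrite s0.
Qed.

(** A quadratic weight is absorbed by doubling the deviation: y <= exp y for y = x^2 / (4 s^2)
    leaves the exponent - x^2 / (4 s^2), which is below - x^2 / (8 s^2). The right-hand side is the
    integrable majorant of every integrand of quadratic growth. *)
Lemma le_sqr_normal_pdf (s x : R) : s != 0 ->
  x ^+ 2 * normal_pdf 0 s x <=
  4 * s ^+ 2 * normal_peak s / normal_peak (2 * s) * normal_pdf 0 (2 * s) x.
Proof.
move=> s0; have s20 : 2 * s != 0 by rewrite mulf_neq0.
rewrite !normal_pdfE// /normal_fun subr0.
have p2 := normal_peak_gt0 s20; have p1 := normal_peak_gt0 s0.
have s2 : 0 < s ^+ 2 by rewrite exprn_even_gt0.
have p4 : 0 < 4 * s ^+ 2 by rewrite mulr_gt0// ltr0n.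
rewrite [leRHS](_ : _ = normal_peak s * (4 * s ^+ 2 *
    expR (- x ^+ 2 / ((2 * s) ^+ 2 *+ 2)))); last first.
  by field; rewrite gt_eqF.
rewrite mulrCA ler_pM2l//.
have h : x ^+ 2 / (4 * s ^+ 2) <= expR (x ^+ 2 / (4 * s ^+ 2)).
  apply: le_trans (expR_ge1Dx _); lra.
have {}h : x ^+ 2 <= 4 * s ^+ 2 * expR (x ^+ 2 / (4 * s ^+ 2)).
  by rewrite mulrC -ler_pdivrMr.
apply: le_trans (ler_wpM2r (expR_ge0 _) h) _.
rewrite -[X in X <= _]mulrA ler_pM2l// -expRD ler_expR.
rewrite -subr_ge0 [leRHS](_ : _ = x ^+ 2 / s ^+ 2 / 8); first by apply: divr_ge0 => //; apply: divr_ge0; rewrite ?sqr_ge0//.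
by field; rewrite s0.
Qed.

Let K_ge0 (s : R) : 0 <= 4 * s ^+ 2 * normal_peak s / normal_peak (2 * s).
Proof.
apply: divr_ge0; last exact: normal_peak_ge0.
apply: mulr_ge0; last exact: normal_peak_ge0.
by apply: mulr_ge0; rewrite ?sqr_ge0.
Qed.

Lemma integrable_normal_mul (s C : R) (g : R -> R) : s != 0 ->
  measurable_fun setT g -> (forall x, `|g x| <= C * (1 + x ^+ 2)) ->
  mu.-integrable setT (fun x => (g x * normal_pdf 0 s x)%:E).
Proof.
move=> s0 mg gC; have C0 : 0 <= C.
  by have := le_trans (normr_ge0 _) (gC 0); rewrite expr0n addr0 mulr1.
pose K := 4 * s ^+ 2 * normal_peak s / normal_peak (2 * s).
have i1 := integrable_normal_pdf (0:R) s.
have i2 := integrable_normal_pdf (0:R) (2 * s).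
have i3 : mu.-integrable setT (fun x => (C%:E * ((normal_pdf 0 s x)%:E + K%:E * (normal_pdf 0 (2 * s) x)%:E))%E).
  apply: integrableZl => //; apply: integrableD => //; exact: integrableZl.
apply: le_integrable i3 => //.
  apply/measurable_EFinP; apply: measurable_funM => //; exact: measurable_normal_pdf.
move=> x _; rewrite /= lee_fin normrM.
rewrite (ger0_norm (normal_pdf_ge0 _ _ _)).
apply: le_trans (ler_wpM2r (normal_pdf_ge0 _ _ _) (gC x)) _.
rewrite ger0_norm.
  rewrite -mulrA ler_wpM2l// mulrDl mul1r lerD2l.
  exact: le_sqr_normal_pdf.
rewrite mulr_ge0// addr_ge0 ?normal_pdf_ge0// mulr_ge0 ?normal_pdf_ge0//.
exact: K_ge0.
Qed.

Lemma normal_mul_cvg0 (s C : R) (g : R -> R) (e : R) : s != 0 -> `|e| = 1 ->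
  (forall x, `|g x| <= C * (1 + `|x|)) ->
  (g (e * n.+1%:R) * normal_pdf 0 s (e * n.+1%:R)) @[n --> \oo] --> 0.
Proof.
move=> s0 e1 gC; have C0 : 0 <= C.
  by have := le_trans (normr_ge0 _) (gC 0); rewrite normr0 addr0 mulr1.
pose K := 4 * s ^+ 2 * normal_peak s / normal_peak (2 * s) * normal_peak (2 * s).
have s20 : 2 * s != 0 by rewrite mulf_neq0.
apply/norm_cvg0P; apply: (@squeeze_cvgr _ _ _ _ (cst 0) (fun n => (2 * C * K) * n.+1%:R^-1)).
- apply: nearW => n; rewrite normr_ge0/=.
  set x := e * n.+1%:R; have nx : `|x| = n.+1%:R by rewrite /x normrM e1 mul1r normr_nat.
  have x1 : 1 <= `|x| by rewrite nx ler1n.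
  have h : x ^+ 2 * normal_pdf 0 s x <= K.
    apply: le_trans (le_sqr_normal_pdf x s0) _; rewrite /K ler_wpM2l ?K_ge0//.
    exact: normal_pdf_ub.
  rewrite normrM (ger0_norm (normal_pdf_ge0 _ _ _)) -nx ler_pdivlMr ?(lt_le_trans _ x1)//.
  apply: (@le_trans _ _ (C * (1 + `|x|) * normal_pdf 0 s x * `|x|)).
    by rewrite !ler_wpM2r ?normal_pdf_ge0.
  apply: (@le_trans _ _ (2 * C * (x ^+ 2 * normal_pdf 0 s x))); last by rewrite ler_wpM2l ?mulr_ge0.
  rewrite -[x ^+ 2]real_normK ?num_real//.
  have := normal_pdf_ge0 0 s x; set p := normal_pdf _ _ _ => p0.
  rewrite -subr_ge0 (_ : _ - _ = C * p * `|x| * (`|x| - 1)); last by ring.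
  by rewrite !mulr_ge0// subr_ge0.
- exact: cvg_cst.
- rewrite -(mulr0 (2 * C * K)); apply: cvgMr; exact: cvg_harmonic.
Qed.

(** Integration by parts, the derivative of the density being - x / s^2 times the density. Linear
    growth of [g] kills the boundary terms, and the growth bounds make both integrands
    integrable. *)
Lemma normal_stein (s C : R) (g g' : R -> R) : s != 0 ->
  (forall x : R, is_derive x (1:R) g (g' x)) -> continuous g' ->
  (forall x, `|g x| <= C * (1 + `|x|)) ->
  (forall x, `|g' x| <= C * (1 + x ^+ 2)) ->
  \int[mu]_x (g x * x * normal_pdf 0 s x) = s ^+ 2 * \int[mu]_x (g' x * normal_pdf 0 s x).
Proof.
move=> s0 dg cg gC g'C.
have C0 : 0 <= C.
  by have := le_trans (normr_ge0 _) (gC 0); rewrite normr0 addr0 mulr1.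
have cont_g : continuous g.
  by move=> x; apply/differentiable_continuous/derivable1_diffP; case: (dg x).
have mg := continuous_measurable_fun cont_g.
have mg' := continuous_measurable_fun cg.
have i1 : mu.-integrable setT (fun x => (g' x * normal_pdf 0 s x)%:E).
  exact: integrable_normal_mul g'C.
have i2 : mu.-integrable setT (fun x => (g x * x * normal_pdf 0 s x)%:E).
  apply: (@integrable_normal_mul _ (2 * C)) => //.
    exact: measurable_funM.
  move=> x; rewrite normrM; apply: le_trans (ler_wpM2r (normr_ge0 _) (gC x)) _.
  rewrite -[x ^+ 2]real_normK ?num_real//.
  rewrite -subr_ge0 (_ : _ - _ = C * ((1 - `|x|) ^+ 2 + 1 + `|x|)); last by ring.
  by rewrite mulr_ge0// addr_ge0 ?normr_ge0// addr_ge0 ?sqr_ge0.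
have := @integral_derive0 (fun x => g x * normal_pdf 0 s x)
  (fun x => g' x * normal_pdf 0 s x - (s ^+ 2)^-1 * (g x * x * normal_pdf 0 s x)).
have i3 : mu.-integrable setT (EFin \o (fun x => (s ^+ 2)^-1 * (g x * x * normal_pdf 0 s x))).
  rewrite /comp; under eq_fun do rewrite EFinM; exact: integrableZl.
rewrite RintegralB// RintegralZl// => H.
have /eqP : \int[mu]_x (g' x * normal_pdf 0 s x) -
    (s ^+ 2)^-1 * \int[mu]_x (g x * x * normal_pdf 0 s x) = 0.
  apply: H.
  - move=> x; have d1 := dg x; have d2 := is_derive_normal_pdf x s0.
    apply: is_derive_eq; rewrite /GRing.scale /=; field; by rewrite s0.
  - have cp := @continuous_normal_pdf R 0 s s0.
    move=> x; apply: cvgB; first by apply: cvgM; [exact: cg|exact: cp].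
    apply: cvgMr; apply: cvgM; last exact: cp.
    by apply: cvgM; [exact: cont_g|exact: cvg_id].
  - rewrite (_ : _ \o _ = (fun x => (g' x * normal_pdf 0 s x)%:E - ((s ^+ 2)^-1 * (g x * x * normal_pdf 0 s x))%:E)%E).
      exact: integrableB.
    by apply/funext => x; rewrite /= EFinB.
  - have := @normal_mul_cvg0 s C g 1 s0 (normr1 _) gC.
    by under eq_fun do rewrite mul1r.
  - have := @normal_mul_cvg0 s C g (-1) s0 _ gC.
    rewrite normrN1 => /(_ erefl).
    by under eq_fun do rewrite mulN1r.
rewrite subr_eq0 => /eqP ->; rewrite mulVKf//.
by rewrite expf_neq0.
Qed.

Section trig_normal.
Variables (c c' : R -> R) (s : R).
Hypothesis s0 : s != 0.
Hypothesis dc : forall x : R, is_derive x (1:R) c (c' x).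
Hypothesis dc' : forall x : R, is_derive x (1:R) c' (- c x).
Hypothesis c1 : forall x, `|c x| <= 1.
Hypothesis c'1 : forall x, `|c' x| <= 1.

Let F (t : R) := \int[mu]_x (c (t * x) * normal_pdf 0 s x).

Let cc : continuous c.
Proof. by move=> x; apply/differentiable_continuous/derivable1_diffP; case: (dc x). Qed.
Let cc' : continuous c'.
Proof. by move=> x; apply/differentiable_continuous/derivable1_diffP; case: (dc' x). Qed.

Let mcomp (h : R -> R) (t : R) : continuous h -> measurable_fun setT (fun x : R => h (t * x)).
Proof.
move=> ch; apply: continuous_measurable_fun => x.
apply: (@continuous_comp _ _ _ (fun x => t * x) h); last exact: ch.
by apply: cvgMr; exact: cvg_id.
Qed.

Let scale_derive (h : R -> R) (h' : R) (a x : R) : is_derive (a * x) (1:R) h h' ->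
  is_derive x (1:R) (fun x : R => h (a * x)) (a * h').
Proof.
move=> dh.
have d1 : is_derive x (1:R) (fun x : R => a * x) a.
  by apply: is_derive_eq; rewrite /GRing.scale /= mulr1.
have := @is_derive1_comp R h (fun x : R => a * x) x h' a dh d1.
by rewrite /comp mulrC.
Qed.

(** Differentiation under the integral produces the integral of c'(t x) x against the density, and
    Stein's identity for x |-> c'(t x) returns to [F]. Only c'' = - c enters, so cosine and sine are
    treated at once. *)
Lemma trig_normal_derive (t : R) : is_derive t (1:R) F (- (s ^+ 2 * t) * F t).
Proof.
have iF (h : R -> R) (x : R) : continuous h -> (forall x, `|h x| <= 1) ->
    mu.-integrable setT (EFin \o (fun y => h (x * y) * normal_pdf 0 s y)).
  move=> ch h1; apply: (@integrable_normal_mul s 1) => //; first exact: mcomp.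
  by move=> y; rewrite mul1r (le_trans (h1 _))// lerDl sqr_ge0.
have It : `]t - 1, t + 1[%classic t by rewrite /= in_itv/= ltrDl ltrBlDr ltrDl ltr01.
have e1 : forall x : R, `]t - 1, t + 1[%classic x -> mu.-integrable setT (EFin \o (fun y => c (x * y) * normal_pdf 0 s y)).
  by move=> x _; apply: iF.
have de : forall x y : R, is_derive x (1:R) (fun x : R => c (x * y) * normal_pdf 0 s y) (c' (x * y) * y * normal_pdf 0 s y).
  move=> x y.
  have -> : (fun x => c (x * y) * normal_pdf 0 s y) = (fun x => normal_pdf 0 s y * c (y * x)).
    by apply/funext => z; rewrite mulrC (mulrC z).
  have d1 : is_derive x (1:R) (fun x : R => c (y * x)) (y * c' (y * x)) by apply: scale_derive; exact: dc.
  by apply: is_derive_eq; rewrite /GRing.scale /= (mulrC y x); ring.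
have e2 : forall x y : R, `]t - 1, t + 1[%classic x -> [set: R] y -> derivable (fun x : R => c (x * y) * normal_pdf 0 s y) x 1.
  by move=> x y _ _; case: (de x y).
pose G y := `|y| * normal_pdf 0 s y.
have G0 y : 0 <= G y by rewrite mulr_ge0 ?normal_pdf_ge0.
have iG : mu.-integrable setT (EFin \o G).
  apply: (@integrable_normal_mul s 1) => //.
  move=> x; rewrite normr_id mul1r -[x ^+ 2]real_normK ?num_real//.
  have := sqr_ge0 (`|x| - 2^-1); rewrite sqrrB; set a := `|x|; lra.
pose f (t x : R) : R := c (t * x) * normal_pdf 0 s x.
have p1 (x y : R) : partial1of2 f x y = c' (x * y) * y * normal_pdf 0 s y.
  by rewrite /partial1of2 derive1E /f; case: (de x y).
have e3 : forall x y : R, `]t - 1, t + 1[%classic x -> [set: R] y -> `|partial1of2 f x y| <= G y.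
  move=> x y _ _; rewrite p1 !normrM (ger0_norm (normal_pdf_ge0 _ _ _)) /G.
  by rewrite ler_wpM2r ?normal_pdf_ge0// ler_piMl.
apply: DeriveDef.
  exact: (@derivable_under_integral R _ _ mu f setT measurableT _ _ _ It e1 e2 G G0 iG e3).
rewrite -derive1E (@differentiation_under_integral R _ _ mu f setT measurableT _ _ _ It e1 e2 G G0 iG e3).
under eq_Rintegral do rewrite p1.
have ST : \int[mu]_x (c' (t * x) * x * normal_pdf 0 s x) =
    s ^+ 2 * \int[mu]_x (t * - c (t * x) * normal_pdf 0 s x).
  apply: (@normal_stein s (1 + `|t|)) => //.
  - by move=> x; apply: scale_derive; exact: dc'.
  - move=> x; apply: cvgMr; apply: cvgN.
    apply: (@continuous_comp _ _ _ (fun x => t * x) c); last exact: cc.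
    by apply: cvgMr; exact: cvg_id.
  - by move=> x; apply: le_trans (c'1 _) _; rewrite -[leLHS]mulr1 ler_pM// lerDl//.
  - move=> x; rewrite normrM normrN; apply: ler_pM => //.
    + by rewrite lerDr.
    + by apply: le_trans (c1 _) _; rewrite lerDl sqr_ge0.
rewrite ST.
under eq_Rintegral do rewrite mulrN mulNr -mulrA -mulNr.
rewrite RintegralZl//; last exact: iF.
by rewrite /F; ring.
Qed.

(** By [trig_normal_derive], the product of [F] and exp (s^2 t^2 / 2) has zero derivative. *)
Lemma trig_normal t : F t = c 0 * expR (- (s ^+ 2 * t ^+ 2 / 2)).
Proof.
pose H t := F t * expR (s ^+ 2 / 2 * t ^+ 2).
have dH x : is_derive x (1:R) H 0.
  have d1 := trig_normal_derive x.
  by apply: is_derive_eq; rewrite /GRing.scale /=; field.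
have := @is_derive_0_is_cst R H t 0 dH.
rewrite /H expr0n mulr0 expR0 mulr1 => h.
have F0 : F 0 = c 0.
  rewrite /F; under eq_Rintegral do rewrite mul0r.
  rewrite RintegralZl//; last exact: integrable_normal_pdf.
  by rewrite /Rintegral integral_normal_pdf/= mulr1.
rewrite -F0 -h -[RHS]mulrA -expRD [X in expR X](_ : _ = 0) ?expR0 ?mulr1//.
by field.
Qed.

End trig_normal.

Lemma normal_cos (s t : R) : s != 0 ->
  \int[mu]_x (cos (t * x) * normal_pdf 0 s x) = expR (- (s ^+ 2 * t ^+ 2 / 2)).
Proof.
move=> s0; have dsin (x : R) : is_derive x (1:R) (fun x => - sin x) (- cos x).
  by apply: is_derive_eq.
have sin1 (x : R) : `|- sin x| <= 1 by rewrite normrN; exact: sin_max.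
have := trig_normal s0 (@is_derive_cos R) dsin (@cos_max R) sin1 t.
by rewrite cos0 mul1r.
Qed.

Lemma normal_sin (s t : R) : s != 0 ->
  \int[mu]_x (sin (t * x) * normal_pdf 0 s x) = 0.
Proof.
move=> s0.
have := trig_normal s0 (@is_derive_sin R) (@is_derive_cos R) (@sin_max R) (@cos_max R) t.
by rewrite sin0 mul0r.
Qed.

Lemma normal_mean (s : R) : s != 0 -> \int[mu]_x (x * normal_pdf 0 s x) = 0.
Proof.
move=> s0.
have ST : \int[mu]_x (1 * x * normal_pdf 0 s x) =
    s ^+ 2 * \int[mu]_x (0 * normal_pdf 0 s x).
  apply: (@normal_stein s 1 (fun=> 1) (fun=> 0)) => //.
  - by move=> x; exact: cvg_cst.
  - by move=> x; rewrite normr1 mul1r lerDl.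
  - by move=> x; rewrite normr0 mul1r addr_ge0 ?sqr_ge0.
move: ST; under eq_Rintegral do rewrite mul1r.
move=> ->; under eq_Rintegral do rewrite mul0r.
by rewrite (_ : (fun=> 0) = cst 0)// Rintegral_cst// mul0r mulr0.
Qed.

Lemma normal_second_moment (s : R) : s != 0 ->
  \int[mu]_x (x ^+ 2 * normal_pdf 0 s x) = s ^+ 2.
Proof.
move=> s0.
have ST : \int[mu]_x (x * x * normal_pdf 0 s x) =
    s ^+ 2 * \int[mu]_x (1 * normal_pdf 0 s x).
  apply: (@normal_stein s 1 id (fun=> 1)) => //.
  - by move=> x; exact: cvg_cst.
  - by move=> x; rewrite mul1r lerDr.
  - by move=> x; rewrite normr1 mul1r lerDl sqr_ge0.
move: ST; under eq_Rintegral do rewrite -expr2.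
move=> ->; under eq_Rintegral do rewrite mul1r.
by rewrite /Rintegral integral_normal_pdf/= mulr1.
Qed.

End normal_transform.

(** * Invariance of Lebesgue measure and exchange of integrals *)

Section lebesgue_isometry.
Context {R : realType}.
Notation mu := (@lebesgue_measure R).
Local Open Scope ereal_scope.

(** Lebesgue measure is determined by its values on half-open intervals, so it coincides with its
    image under [phi]. *)
Lemma ge0_integral_comp_isometry (phi : R -> R) (f : R -> \bar R) :
  measurable_fun setT phi ->
  (forall a b, mu (phi @^-1` `]a, b]) = mu `]a, b]) ->
  measurable_fun setT f -> (forall x, 0 <= f x) ->
  \int[mu]_x f x = \int[mu]_x f (phi x).
Proof.
move=> mphi0 pab mf f0.
have mphi : @measurable_fun _ _ (measurableTypeR R) (measurableTypeR R) setT phi := mphi0.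
rewrite -[RHS](@ge0_integral_pushforward _ _ (measurableTypeR R) (measurableTypeR R) R phi mphi mu setT)//.
apply: eq_measure_integral => A mA _.
apply: (@lebesgue_measure_unique R (measure_function_pushforward__canonical__measure_function_Measure mu mphi)) => //= X [[a b] _ <-].
by rewrite -pab.
Qed.

Lemma ge0_integral_shift (c : R) (f : R -> \bar R) :
  measurable_fun setT f -> (forall x, 0 <= f x) ->
  \int[mu]_x f x = \int[mu]_x f (c + x)%R.
Proof.
move=> mf f0; apply: ge0_integral_comp_isometry => //.
  exact: measurable_funD.
move=> a b; rewrite (_ : _ @^-1` _ = `](a - c)%R, (b - c)%R]%classic).
  rewrite !lebesgue_measure_itv/= !lte_fin ltrD2r; case: ifPn => // _.
  by rewrite -!EFinD; congr EFin; ring.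
by apply/seteqP; split=> x /=; rewrite !in_itv/= ltrBlDl lerBrDl.
Qed.

Lemma ge0_integral_opp (f : R -> \bar R) :
  measurable_fun setT f -> (forall x, 0 <= f x) ->
  \int[mu]_x f x = \int[mu]_x f (- x)%R.
Proof.
move=> mf f0; apply: ge0_integral_comp_isometry => //.
move=> a b; rewrite (_ : _ @^-1` _ = `[(- b)%R, (- a)%R[%classic).
  rewrite !lebesgue_measure_itv/= !lte_fin ltrN2; case: ifPn => // _.
  by rewrite -!EFinD; congr EFin; ring.
by apply/seteqP; split=> x /=; rewrite !in_itv/= andbC lerNl ltrNr.
Qed.

End lebesgue_isometry.

Section lebesgue_tonelli.
Context d (T : measurableType d) (R : realType).
Notation mu := (@lebesgue_measure R).
Local Open Scope ereal_scope.

Lemma measurable_lebesgue_integral (f : T * R -> \bar R) :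
  measurable_fun setT f -> (forall z, 0 <= f z) ->
  measurable_fun setT (fun x => \int[mu]_y f (x, y)).
Proof.
by move=> mf f0; exact: (@measurable_fun_fubini_tonelli_F _ _ T (measurableTypeR R) R mu f mf f0).
Qed.

Lemma lebesgue_tonelli (m : {sigma_finite_measure set T -> \bar R}) (f : T * R -> \bar R) :
  measurable_fun setT f -> (forall z, 0 <= f z) ->
  \int[m]_x \int[mu]_y f (x, y) = \int[mu]_y \int[m]_x f (x, y).
Proof.
by move=> mf f0; exact: (@fubini_tonelli _ _ T (measurableTypeR R) R m mu f mf f0).
Qed.

End lebesgue_tonelli.

Section integral_functional_closure.
Context d (T : measurableType d) (R : realType).
Variable m : {sigma_finite_measure set T -> \bar R}.
Notation mu := (@lebesgue_measure R).
Variables U G : T -> R.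
Hypothesis mU : measurable_fun setT U.
Hypothesis iG : m.-integrable setT (EFin \o G).

Lemma integrable_bounded_mul (h : R -> R) (C : R) : measurable_fun setT h ->
  (forall x, `|h x| <= C) -> m.-integrable setT (fun x => (h (U x) * G x)%:E).
Proof.
move=> mh hC.
apply: (@le_integrable _ _ _ m setT measurableT _ (fun x => C%:E * (EFin \o G) x)%E).
- apply/measurable_EFinP; apply: measurable_funM; first exact: measurableT_comp.
  exact/measurable_EFinP/(measurable_int _ iG).
- move=> x _; rewrite /= lee_fin !normrM; apply: ler_pM => //.
  by rewrite (le_trans (hC _))// ler_norm.
- exact: integrableZl.
Qed.

(** The bound [C] majorizes the double integral of the absolute value by [C] times that of |G|,
    whence Fubini; the uniform bound [B] makes the integral over [m] finite for each u. *)
Lemma integral_bounded_kernel (h : R * R -> R) (C B : R) : measurable_fun setT h ->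
  (forall z, `|h z| <= B) ->
  (forall x, (\int[mu]_u `|h (x, u)|%:E <= C%:E)%E) ->
  \int[m]_x ((\int[mu]_u h (U x, u)) * G x) =
  \int[mu]_u (\int[m]_x (h (U x, u) * G x)).
Proof.
move=> mh hB hC.
pose f (z : T * R) := (h (U z.1, z.2) * G z.1)%:E.
have mf : measurable_fun setT f.
  apply/measurable_EFinP; apply: measurable_funM.
    apply: (measurableT_comp mh); apply: measurable_fun_pair => //.
    by apply: measurableT_comp => //; exact: measurable_fst.
  apply: (measurableT_comp _ measurable_fst).
  exact/measurable_EFinP/(measurable_int _ iG).
have hi x : mu.-integrable setT (fun u => (h (x, u))%:E).
  apply/integrableP; split.
    by apply/measurable_EFinP; apply: (measurableT_comp mh); exact: pair1_measurable.
  by apply: le_lt_trans (hC x) _; rewrite ltry.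
have C0 : 0 <= C.
  by rewrite -lee_fin; apply: le_trans (hC 0); apply: integral_ge0 => u _; rewrite lee_fin.
have if_ : (m \x mu)%E.-integrable setT f.
  apply/(@integrable12ltyP _ _ T (measurableTypeR R) R m mu f mf).
  apply: (@le_lt_trans _ _ (\int[m]_x (C%:E * `|(G x)%:E|))%E).
    apply: ge0_le_integral => //.
    - by move=> x _; apply: integral_ge0.
    - apply: (@measurable_lebesgue_integral _ _ _ (abse \o f)) => //=.
      exact: measurableT_comp.
    - apply: emeasurable_funM => //; apply: measurableT_comp => //.
      exact: (measurable_int _ iG).
    - move=> x _; rewrite /f /=.
      under eq_integral do rewrite normrM EFinM.
      rewrite ge0_integralZr//; last first.
        apply/measurable_EFinP; apply: measurableT_comp => //.
        by apply: (measurableT_comp mh); exact: pair1_measurable.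
      by rewrite lee_wpmul2r ?lee_fin.
  rewrite ge0_integralZl//.
    by rewrite lte_mul_pinfty//; move/integrableP: iG => [].
  by apply: measurableT_comp => //; exact: (measurable_int _ iG).
have /= F := Fubini if_.
have e x : (((\int[mu]_u h (U x, u)) * G x)%:E = \int[mu]_u f (x, u))%E.
  rewrite /f/=; under eq_integral do rewrite EFinM.
  rewrite integralZr//.
  by rewrite EFinM /Rintegral fineK//; apply: integrable_fin_num => //; exact: hi.
rewrite {1}/Rintegral; under eq_integral do rewrite e.
rewrite F; congr fine; apply: eq_integral => u _; rewrite /Rintegral fineK//.
apply: integrable_fin_num => //.
apply: (@integrable_bounded_mul (fun x => h (x, u)) B) => //.
by apply: (measurableT_comp mh); exact: pair2_measurable.
Qed.

End integral_functional_closure.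

(** * Uniqueness of the Fourier transform on the line *)

Section normal_halfline.
Context {R : realType}.
Notation mu := (@lebesgue_measure R).

Lemma measurable_normal_pdf2 (s : R) :
  measurable_fun setT (fun z : R * R => normal_pdf z.1 s z.2).
Proof.
have -> : (fun z : R * R => normal_pdf z.1 s z.2) =
    (fun z => if s == 0 then \1_`[0, 1] z.2 else normal_pdf 0 s (z.2 - z.1)).
  apply/funext => -[x y] /=; rewrite /normal_pdf; case: ifP => // s0.
  by rewrite /normal_fun subr0.
have [s0|s0] := boolP (s == 0).
  by apply: measurableT_comp => //; exact: measurable_indic.
apply: (measurableT_comp (measurable_normal_pdf 0 s)).
apply: measurable_funB; [exact: measurable_snd|exact: measurable_fst].
Qed.

Lemma normal_pdf_center (m s x : R) : s != 0 -> normal_pdf m s x = normal_pdf 0 s (x - m).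
Proof. by move=> s0; rewrite !normal_pdfE// /normal_fun subr0. Qed.

(** Gaussian Fourier inversion: up to the factor [normal_peak s], the transform of the normal
    density of deviation 1/s is that of deviation s. *)
Lemma normal_pdf_fourier (s x y : R) : s != 0 ->
  normal_pdf x s y =
  normal_peak s * \int[mu]_u (cos ((x - y) * u) * normal_pdf 0 (s^-1) u).
Proof.
move=> s0; have si0 : s^-1 != 0 by rewrite invr_eq0.
rewrite normal_cos// normal_pdfE// /normal_fun; congr (_ * expR _).
by field; rewrite s0.
Qed.

Lemma normal_chebyshev (m s e : R) : s != 0 -> 0 < e ->
  (\int[mu]_(u in [set u | e <= `|u - m|]%R) (normal_pdf m s u)%:E <= (s ^+ 2 / e ^+ 2)%:E)%E.
Proof.
move=> s0 e0.
have mpdf x := @measurable_normal_pdf R x s.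
have m2 : measurable_fun setT (fun u : R => (u - m) ^+ 2).
  by apply: measurable_funX; exact: measurable_funB.
have mA : measurable [set u | e <= `|u - m|]%R.
  rewrite (_ : [set _ | _] = (fun u : R => `|u - m|) @^-1` `[e, +oo[).
    rewrite -[X in measurable X]setTI.
    have : measurable_fun setT (fun u : R => `|u - m|).
      by apply: measurableT_comp => //; exact: measurable_funB.
    by apply.
  by apply/seteqP; split=> u /=; rewrite in_itv/= andbT.
have f0 u : 0 <= e ^- 2 * ((u - m) ^+ 2 * normal_pdf m s u).
  by rewrite mulr_ge0 ?invr_ge0 ?sqr_ge0// mulr_ge0 ?sqr_ge0 ?normal_pdf_ge0.
have pw u : (((fun u => (normal_pdf m s u)%:E) \_ [set u | (e <= `|u - m|)%R]) u <=
    (e ^- 2 * ((u - m) ^+ 2 * normal_pdf m s u))%:E)%E.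
  rewrite patchE; case: ifPn => [|_]; last by rewrite lee_fin f0.
  rewrite inE/= => eu; rewrite lee_fin mulrA ler_peMl ?normal_pdf_ge0//.
  rewrite mulrC ler_pdivlMr ?exprn_gt0// mul1r -[(u - m) ^+ 2]real_normK ?num_real//.
  by rewrite ler_sqr// nnegrE ltW.
apply: (@le_trans _ _ (\int[mu]_u (e ^- 2 * ((u - m) ^+ 2 * normal_pdf m s u))%:E)%E).
  rewrite integral_mkcond; apply: ge0_le_integral => //.
  - by move=> u _; rewrite patchE; case: ifP => // _; rewrite lee_fin normal_pdf_ge0.
  - apply/(measurable_restrictT _ _).1 => //.
    by apply/measurable_funTS/measurable_EFinP; exact: mpdf.
  - apply/measurable_EFinP; apply: measurable_funM => //; apply: measurable_funM => //; exact: mpdf.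
rewrite [leLHS](_ : _ = \int[mu]_u (e ^- 2 * (u ^+ 2 * normal_pdf 0 s u))%:E)%E; last first.
  transitivity (\int[mu]_u (e ^- 2 * ((m + u - m) ^+ 2 * normal_pdf m s (m + u)))%:E)%E.
    apply: (@ge0_integral_shift R m (fun u : R => (e ^- 2 * ((u - m) ^+ 2 * normal_pdf m s u))%:E)).
      apply/measurable_EFinP; apply: measurable_funM => //.
      by apply: measurable_funM => //; exact: mpdf.
    by move=> x; rewrite lee_fin f0.
  by apply: eq_integral => u _; rewrite normal_pdf_center// (addrC m) addrK.
under eq_integral do rewrite EFinM.
rewrite ge0_integralZl//=.
- rewrite (_ : (\int[mu]_x _)%E = (s ^+ 2)%:E); first by rewrite -EFinM mulrC.
  rewrite -(normal_second_moment s0) /Rintegral fineK//.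
  apply: integrable_fin_num => //.
  apply: (@integrable_normal_mul R s 1) => //.
  by move=> x; rewrite mul1r ger0_norm ?sqr_ge0// lerDr.
- by apply/measurable_EFinP; apply: measurable_funM; [by apply: measurable_funX; exact: measurable_id|exact: measurable_normal_pdf].
- by move=> x _; rewrite lee_fin mulr_ge0 ?sqr_ge0 ?normal_pdf_ge0.
- by rewrite lee_fin invr_ge0 exprn_ge0 ?ltW.
Qed.

End normal_halfline.

Section smoothed_halfline.
Context {R : realType}.
Notation mu := (@lebesgue_measure R).

(** Gaussian smoothing of a half-line: unlike the indicator, the smoothing kernel is an absolutely
    convergent superposition of cosines, so its integrals are functions of Fourier transforms. *)
Definition smooth_halfline (a s x : R) : R :=
  \int[mu]_u (\1_(`]-oo, a] : set R) u * normal_pdf x s u).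

Lemma smooth_halflineE (a s x : R) :
  (smooth_halfline a s x)%:E = (\int[mu]_(u in `]-oo, a]) (normal_pdf x s u)%:E)%E.
Proof.
rewrite /smooth_halfline /Rintegral fineK; last first.
  apply: integrable_fin_num => //.
  apply: le_integrable (integrable_normal_pdf x s) => //.
    by apply/measurable_EFinP; apply: measurable_funM => //; exact: measurable_normal_pdf.
  move=> u _; rewrite /= lee_fin normrM ler_piMl//.
  by rewrite ger0_norm// indicE; case: (_ \in _).
rewrite [RHS]integral_mkcond; apply: eq_integral => u _.
by rewrite patchE indicE; case: ifP => _; rewrite ?mul1r ?mul0r.
Qed.

Lemma smooth_halfline_ge0 a s x : 0 <= smooth_halfline a s x.
Proof.
by apply: Rintegral_ge0 => u _; rewrite mulr_ge0 ?normal_pdf_ge0// indicE; case: (_ \in _).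
Qed.

Lemma smooth_halfline_le1 a s x : smooth_halfline a s x <= 1.
Proof.
rewrite -lee_fin smooth_halflineE -(integral_normal_pdf x s).
apply: ge0_subset_integral => //.
  by apply/measurable_EFinP; exact: measurable_normal_pdf.
by move=> u _; rewrite lee_fin normal_pdf_ge0.
Qed.

Lemma smooth_halfline_in (a s x e : R) : s != 0 -> 0 < e -> x <= a ->
  1 - s ^+ 2 / e ^+ 2 <= smooth_halfline (a + e) s x.
Proof.
move=> s0 e0 xa; rewrite lerBlDr -lee_fin EFinD smooth_halflineE.
have := normal_chebyshev x s0 e0; set A := [set u | _] => h.
have mA : measurable A.
  rewrite (_ : A = (fun u : R => `|u - x|) @^-1` `[e, +oo[).
    rewrite -[X in measurable X]setTI.
    have : measurable_fun setT (fun u : R => `|u - x|).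
      by apply: measurableT_comp => //; exact: measurable_funB.
    by apply.
  by apply/seteqP; split=> u /=; rewrite in_itv/= andbT.
apply: le_trans (leeD2l _ h); rewrite -(integral_normal_pdf x s).
have mp : measurable_fun setT (fun u => (normal_pdf x s u)%:E).
  by apply/measurable_EFinP; exact: measurable_normal_pdf.
have p0 u : (0 <= (normal_pdf x s u)%:E)%E by rewrite lee_fin normal_pdf_ge0.
rewrite [X in (X + _)%E]integral_mkcond [X in (_ + X)%E]integral_mkcond.
rewrite -ge0_integralD//; last 4 first.
- by move=> u _; rewrite patchE; case: ifP.
- by apply/(measurable_restrictT _ _).1 => //; exact: measurable_funTS.
- by move=> u _; rewrite patchE; case: ifP.
- by apply/(measurable_restrictT _ _).1 => //; exact: measurable_funTS.
apply: ge0_le_integral => //.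
- apply: emeasurable_funD.
    by apply/(measurable_restrictT _ _).1 => //; exact: measurable_funTS.
  by apply/(measurable_restrictT _ _).1 => //; exact: measurable_funTS.
- move=> u _; rewrite !patchE.
  have [ua|ua] := leP u (a + e).
    by rewrite [u \in `]-oo, _]%classic]mem_set ?in_itv//= leeDl//; case: ifP.
  rewrite [u \in A]mem_set/=; first by rewrite leeDr//; case: ifP.
  by rewrite /A /= ger0_norm; lra.
Qed.

Lemma smooth_halfline_out (a s x e : R) : s != 0 -> 0 < e -> a + e <= x ->
  smooth_halfline a s x <= s ^+ 2 / e ^+ 2.
Proof.
move=> s0 e0 xa; rewrite -lee_fin smooth_halflineE.
apply: le_trans (normal_chebyshev x s0 e0).
apply: ge0_subset_integral => //.
- rewrite (_ : [set _ | _] = (fun u : R => `|u - x|) @^-1` `[e, +oo[).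
    rewrite -[X in measurable X]setTI.
    have : measurable_fun setT (fun u : R => `|u - x|).
      by apply: measurableT_comp => //; exact: measurable_funB.
    by apply.
  by apply/seteqP; split=> u /=; rewrite in_itv/= andbT.
- by apply/measurable_EFinP; apply: measurable_funTS; exact: measurable_normal_pdf.
- by move=> u _; rewrite lee_fin normal_pdf_ge0.
- move=> u /=; rewrite in_itv/= => ua; rewrite ler0_norm; lra.
Qed.

(** The half-line is enlarged by e = 1/(n+1) so that the endpoint x = a gets the limit 1, and the
    deviation s = 1/(n+1)^2 is of smaller order, so that the Chebyshev error s^2 / e^2 tends to
    0. *)
Lemma smooth_halfline_cvg (a x : R) :
  smooth_halfline (a + n.+1%:R^-1) (n.+1%:R ^- 2) x @[n --> \oo] -->
  (\1_(`]-oo, a] : set R) x : R).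
Proof.
have h0 : (n.+1%:R^-1 : R) @[n --> \oo] --> (0 : R) by exact: cvg_harmonic.
have h2 : ((n.+1%:R^-1 : R) ^+ 2) @[n --> \oo] --> (0 : R).
  rewrite -[X in _ --> X](mulr0 (0:R)) (_ : (fun n => _) = (fun n => n.+1%:R^-1 * n.+1%:R^-1 : R)).
    exact: cvgM.
  by apply/funext => n; rewrite expr2.
have n0 n : (n.+1%:R : R) != 0 by rewrite pnatr_eq0.
have s0 n : (n.+1%:R : R) ^- 2 != 0 by rewrite invr_eq0 expf_neq0.
rewrite indicE; have [xa|xa] := leP x a.
  rewrite mem_set/= ?in_itv//=.
  apply: (@squeeze_cvgr _ _ _ _ (fun n => 1 - (n.+1%:R^-1 : R) ^+ 2) (cst 1)).
  - apply: nearW => n; rewrite smooth_halfline_le1 andbT.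
    have e0 : 0 < (n.+1%:R : R)^-1 by rewrite invr_gt0.
    apply: le_trans (smooth_halfline_in (s0 n) e0 xa).
    rewrite lerD2l lerN2 (_ : _ / _ = n.+1%:R^-1 ^+ 2)//.
    by field.
  - rewrite -[X in _ --> X](subr0 (1:R)); apply: cvgB => //; exact: cvg_cst.
  - exact: cvg_cst.
rewrite memNset/=; last by rewrite in_itv/= leNgt xa.
apply: (@squeeze_cvgr _ _ _ _ (cst 0) (fun n => (4 / (x - a) ^+ 2) * ((n.+1%:R^-1 : R) ^+ 2))).
- have e0 : 0 < (x - a) / 2 by lra.
  near=> n; rewrite smooth_halfline_ge0/=.
  have h : n.+1%:R^-1 <= (x - a) / 2.
    near: n; move/cvgr0_norm_le: h0 => /(_ _ e0).
    by apply: filterS => n /=; rewrite ger0_norm.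
  have ae : a + n.+1%:R^-1 + (x - a) / 2 <= x.
    by rewrite -lerBrDr [leRHS](_ : _ = a + (x - a) / 2) ?lerD2l//; field.
  apply: le_trans (smooth_halfline_out (s0 n) e0 ae) _.
  rewrite [leLHS](_ : _ = 4 / (x - a) ^+ 2 * (n.+1%:R^-1 ^+ 2) * (n.+1%:R^-1 ^+ 2)).
    rewrite ler_piMr// ?mulr_ge0 ?invr_ge0 ?sqr_ge0//.
    by rewrite exprn_ile1 ?invr_ge0// invf_le1 ?ler1n// ltr0n.
  by move: (n0 n) xa; move: (n.+1%:R : R) => q q0 xa; field; rewrite q0 subr_eq0 gt_eqF.
- exact: cvg_cst.
- rewrite -[X in _ --> X](mulr0 (4 / (x - a) ^+ 2)); apply: cvgMr => //.
Unshelve. all: by end_near.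
Qed.

Lemma measurable_smooth_halfline (a s : R) : measurable_fun setT (smooth_halfline a s).
Proof.
have -> : smooth_halfline a s = fun x => fine (\int[mu]_u (\1_(`]-oo, a] : set R) u * normal_pdf x s u)%:E)%E by [].
apply: measurableT_comp => //.
apply: (@measurable_lebesgue_integral _ _ R (fun z : R * R => (\1_(`]-oo, a] : set R) z.2 * normal_pdf z.1 s z.2)%:E)).
  apply/measurable_EFinP; apply: measurable_funM; last exact: measurable_normal_pdf2.
  by apply: measurableT_comp => //; exact: measurable_indic.
move=> z; rewrite lee_fin mulr_ge0 ?normal_pdf_ge0// indicE; by case: (_ \in _).
Qed.

End smoothed_halfline.

Lemma Rdominated_convergence d (T : measurableType d) (R : realType)
    (m : {measure set T -> \bar R}) (f_ : nat -> T -> R) (f g : T -> R) :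
  (forall n, measurable_fun setT (f_ n)) ->
  (forall x, f_ n x @[n --> \oo] --> f x) ->
  m.-integrable setT (EFin \o g) ->
  (forall n x, `|f_ n x| <= g x) ->
  m.-integrable setT (EFin \o f) /\
  \int[m]_x f_ n x @[n --> \oo] --> \int[m]_x f x.
Proof.
move=> mf_ ff ig fg.
have mf : measurable_fun setT f by apply: measurable_fun_cvg => // x _; exact: ff.
have cv : {ae m, forall x, setT x -> (f_ ^~ x n)%:E @[n --> \oo] --> (f x)%:E}.
  by apply: aeW => x _; apply: cvg_EFin; [exact: nearW|exact: ff].
have bd : {ae m, forall x n, setT x -> (`|(f_ n x)%:E| <= (EFin \o g) x)%E}.
  by apply: aeW => x n _; rewrite /= lee_fin.
have [i1 _ i2] := @dominated_convergence _ T R m setT measurableT (fun n x => (f_ n x)%:E)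
  (fun x => (f x)%:E) (EFin \o g)
  (fun n => (measurable_EFinP _ _).2 (mf_ n)) ((measurable_EFinP _ _).2 mf) cv ig bd.
split=> //; apply: fine_cvg; rewrite fineK//.
exact: integrable_fin_num.
Qed.

Lemma pi_lambda d (T : measurableType d) (G H : set (set T)) :
  @measurable _ T = <<s G >> -> setI_closed G -> G `<=` H -> H setT ->
  (forall A B, measurable A -> measurable B -> B `<=` A -> H A -> H B -> H (A `\` B)) ->
  (forall F : nat -> set T, nondecreasing_seq F -> (forall n, measurable (F n)) ->
     (forall n, H (F n)) -> H (\bigcup_n F n)) ->
  forall A, measurable A -> H A.
Proof.
move=> mG GI GH HT HD HU.
suff : <<s G >> `<=` [set A | measurable A /\ H A].
  by move=> sub A; rewrite mG => /sub[].
apply: lambda_system_subset => //.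
- split; [by move=> A _|by split| |].
  + by move=> A B BA [mA hA] [mB hB]; split; [exact: measurableD|exact: HD].
  + move=> F ndF hF; split; first by apply: bigcupT_measurable => n; case: (hF n).
    by apply: HU => // n; case: (hF n).
- by move=> A GA; split; [rewrite mG; exact: sub_sigma_algebra|exact: GH].
Qed.

Section real_integrable.
Context d (T : measurableType d) (R : realType) (m : {measure set T -> \bar R}).
Implicit Types f g : T -> R.

Lemma integrable_addR f g : m.-integrable setT (EFin \o f) ->
  m.-integrable setT (EFin \o g) -> m.-integrable setT (EFin \o (fun x => f x + g x)).
Proof.
move=> i1 i2; rewrite (_ : _ \o _ = ((EFin \o f) \+ (EFin \o g))%E); first exact: integrableD.
by apply/funext => x; rewrite /= EFinD.
Qed.

Lemma integrable_scaleR (c : R) f : m.-integrable setT (EFin \o f) ->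
  m.-integrable setT (EFin \o (fun x => c * f x)).
Proof. by move=> i1; rewrite /comp; under eq_fun do rewrite EFinM; exact: integrableZl. Qed.

Lemma integrable_subR f g : m.-integrable setT (EFin \o f) ->
  m.-integrable setT (EFin \o g) -> m.-integrable setT (EFin \o (fun x => f x - g x)).
Proof.
move=> i1 i2; rewrite (_ : _ \o _ = ((EFin \o f) \- (EFin \o g))%E); first exact: integrableB.
by apply/funext => x; rewrite /= EFinB.
Qed.

End real_integrable.

Section halfline_determined.
Context (R : realType).
Notation mu := (@lebesgue_measure R).

(** Expanding the normal kernel by [normal_pdf_fourier], splitting cos ((U - u) v) and exchanging
    integrals twice leaves [U] and [G] only inside their cosine and sine transforms. *)
Lemma smooth_halfline_determined d (T : measurableType d)
    (m : {sigma_finite_measure set T -> \bar R}) (U G : T -> R) (a s : R) :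
  measurable_fun setT U -> m.-integrable setT (EFin \o G) -> s != 0 ->
  \int[m]_x (smooth_halfline a s (U x) * G x) =
  \int[mu]_u (\1_(`]-oo, a] : set R) u * (normal_peak s *
    \int[mu]_v (normal_pdf 0 s^-1 v * (cos (u * v) * \int[m]_x (cos (v * U x) * G x) +
       sin (u * v) * \int[m]_x (sin (v * U x) * G x))))).
Proof.
move=> mU iG s0; have si0 : s^-1 != 0 by rewrite invr_eq0.
have ind1 (u : R) : `|\1_(`]-oo, a] : set R) u| <= 1 :> R.
  by rewrite ger0_norm ?indicE; case: (_ \in _).
rewrite (@integral_bounded_kernel _ T R m U G mU iG
  (fun z => \1_(`]-oo, a] : set R) z.2 * normal_pdf z.1 s z.2) 1 (normal_peak s)); last 3 first.
- apply: measurable_funM; last exact: measurable_normal_pdf2.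
  by apply: measurableT_comp => //; exact: measurable_indic.
- move=> z; rewrite normrM -[leRHS]mul1r ler_pM//.
  by rewrite ger0_norm ?normal_pdf_ge0// normal_pdf_ub.
- move=> x; rewrite -(integral_normal_pdf x s); apply: ge0_le_integral => //=.
  + apply/measurable_EFinP; apply: measurableT_comp => //.
    by apply: measurable_funM => //; exact: measurable_normal_pdf.
  + by apply/measurable_EFinP; exact: measurable_normal_pdf.
  + move=> u _; rewrite lee_fin normrM -[leRHS]mul1r ler_pM//.
    by rewrite ger0_norm ?normal_pdf_ge0.
apply: eq_Rintegral => u _ /=.
under eq_Rintegral do rewrite normal_pdf_fourier// -[_ * _ * G _]mulrA -[normal_peak s * _ * _]mulrA mulrA.
have ck z : `|cos (z.1 - u * z.2)| <= 1 :> R by exact: cos_max.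
have hz : measurable_fun setT (fun z : R * R => cos ((z.1 - u) * z.2) * normal_pdf 0 s^-1 z.2).
  apply: measurable_funM.
    apply: (measurableT_comp (continuous_measurable_fun (@continuous_cos R))).
    by apply: measurable_funM => //; apply: measurable_funB.
  by apply: (measurableT_comp (measurable_normal_pdf 0 s^-1)).
have hB z : `|cos ((z.1 - u) * z.2) * normal_pdf 0 s^-1 z.2| <= normal_peak s^-1 :> R.
  rewrite normrM -[leRHS]mul1r ler_pM//; first exact: cos_max.
  by rewrite ger0_norm ?normal_pdf_ge0// normal_pdf_ub.
have hC (x : R) : (\int[mu]_v `|cos ((x - u) * v) * normal_pdf 0 s^-1 v|%:E <= 1%:E)%E.
  rewrite -(integral_normal_pdf 0 s^-1); apply: ge0_le_integral => //=.
  + apply/measurable_EFinP; apply: measurableT_comp => //.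
    exact: (measurableT_comp hz (pair1_measurable x)).
  + by apply/measurable_EFinP; exact: measurable_normal_pdf.
  + move=> v _; rewrite lee_fin normrM -[leRHS]mul1r ler_pM//; first exact: cos_max.
    by rewrite ger0_norm ?normal_pdf_ge0.
have K := @integral_bounded_kernel _ T R m U G mU iG _ _ _ hz hB hC.
have iK : m.-integrable setT (EFin \o (fun x => (\int[mu]_v (cos ((U x - u) * v) * normal_pdf 0 s^-1 v)) * G x)).
  apply: (@integrable_bounded_mul _ T R m U G mU iG
    (fun y => \int[mu]_v (cos ((y - u) * v) * normal_pdf 0 s^-1 v)) 1).
    have -> : (fun y => \int[mu]_v (cos ((y - u) * v) * normal_pdf 0 s^-1 v)) =
        (fun y => expR (- (s^-1 ^+ 2 * (y - u) ^+ 2 / 2))).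
      by apply/funext => y; rewrite normal_cos.
    apply: (measurableT_comp (continuous_measurable_fun (@continuous_expR R))).
    apply: measurableT_comp => //; apply: measurable_funM => //; apply: measurable_funM => //.
    by apply: measurable_funX; apply: measurable_funB.
  move=> y; rewrite normal_cos// ger0_norm ?expR_ge0// -[leRHS]expR0 ler_expR.
  by rewrite oppr_le0 divr_ge0// mulr_ge0 ?sqr_ge0.
transitivity (\1_(`]-oo, a] : set R) u * normal_peak s * \int[m]_x ((\int[mu]_v (cos ((U x - u) * v) * normal_pdf 0 s^-1 v)) * G x)).
  by rewrite -RintegralZl//; apply: eq_Rintegral => x _; ring.
rewrite -mulrA; congr (_ * (_ * _)); rewrite K /=.
have ic v : m.-integrable setT (fun x => (cos (v * U x) * G x)%:E).
  apply: (@integrable_bounded_mul _ T R m U G mU iG (fun y => cos (v * y)) 1).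
    apply: (measurableT_comp (continuous_measurable_fun (@continuous_cos R))).
    exact: measurable_funM.
  by move=> y; exact: cos_max.
have is_ v : m.-integrable setT (fun x => (sin (v * U x) * G x)%:E).
  apply: (@integrable_bounded_mul _ T R m U G mU iG (fun y => sin (v * y)) 1).
    apply: (measurableT_comp (continuous_measurable_fun (@continuous_sin R))).
    exact: measurable_funM.
  by move=> y; exact: sin_max.
apply: eq_Rintegral => v _.
have ic' : m.-integrable setT (EFin \o (fun x => cos (u * v) * (cos (v * U x) * G x))).
  rewrite /comp; under eq_fun do rewrite EFinM; exact: integrableZl.
have is' : m.-integrable setT (EFin \o (fun x => sin (u * v) * (sin (v * U x) * G x))).
  rewrite /comp; under eq_fun do rewrite EFinM; exact: integrableZl.
have isum : m.-integrable setT (EFin \o (fun x => cos (u * v) * (cos (v * U x) * G x) + sin (u * v) * (sin (v * U x) * G x))).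
  exact: integrable_addR.
transitivity (normal_pdf 0 s^-1 v * \int[m]_x (cos (u * v) * (cos (v * U x) * G x) + sin (u * v) * (sin (v * U x) * G x))).
  rewrite -RintegralZl//; apply: eq_Rintegral => x _.
  by rewrite mulrBl cosB (mulrC v (U x)); ring.
congr (_ * _); rewrite RintegralD//.
by congr (_ + _); [apply: RintegralZl => //; exact: ic|apply: RintegralZl => //; exact: is_].
Qed.

End halfline_determined.

Section trig_unique.
Context (R : realType).

(** Uniqueness of the Fourier transform for the finite signed images on the line of G1 m1 and G2 m2.
    Smoothed half-lines agree by [smooth_halfline_determined], half-lines by dominated convergence,
    Borel sets by Dynkin's argument; t = 0 gives equality of the total masses. *)
Lemma trig_unique d1 d2 (T1 : measurableType d1) (T2 : measurableType d2)
    (m1 : {sigma_finite_measure set T1 -> \bar R})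
    (m2 : {sigma_finite_measure set T2 -> \bar R})
    (U1 G1 : T1 -> R) (U2 G2 : T2 -> R) :
  measurable_fun setT U1 -> m1.-integrable setT (EFin \o G1) ->
  measurable_fun setT U2 -> m2.-integrable setT (EFin \o G2) ->
  (forall t, \int[m1]_x (cos (t * U1 x) * G1 x) = \int[m2]_x (cos (t * U2 x) * G2 x)) ->
  (forall t, \int[m1]_x (sin (t * U1 x) * G1 x) = \int[m2]_x (sin (t * U2 x) * G2 x)) ->
  forall A : set R, measurable A ->
  \int[m1]_x (\1_A (U1 x) * G1 x) = \int[m2]_x (\1_A (U2 x) * G2 x).
Proof.
move=> mU1 iG1 mU2 iG2 hc hs.
have ind1 (A : set R) (u : R) : `|\1_A u| <= 1 :> R.
  by rewrite ger0_norm ?indicE; case: (_ \in _).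
have step1 a s : s != 0 -> \int[m1]_x (smooth_halfline a s (U1 x) * G1 x) =
    \int[m2]_x (smooth_halfline a s (U2 x) * G2 x).
  move=> s0; rewrite (smooth_halfline_determined a mU1 iG1 s0) (smooth_halfline_determined a mU2 iG2 s0).
  apply: eq_Rintegral => u _; congr (_ * (_ * _)).
  by apply: eq_Rintegral => v _; rewrite hc hs.
have lim d (T : measurableType d) (m : {sigma_finite_measure set T -> \bar R}) (U G : T -> R) a :
    measurable_fun setT U -> m.-integrable setT (EFin \o G) ->
    \int[m]_x (smooth_halfline (a + n.+1%:R^-1) (n.+1%:R ^- 2) (U x) * G x) @[n --> \oo]
      --> \int[m]_x (\1_(`]-oo, a] : set R) (U x) * G x).
  move=> mU iG.
  have mG : measurable_fun setT G by apply/measurable_EFinP; exact: measurable_int iG.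
  have [] // := @Rdominated_convergence _ T R m
    (fun n x => smooth_halfline (a + n.+1%:R^-1) (n.+1%:R ^- 2) (U x) * G x)
    (fun x => \1_(`]-oo, a] : set R) (U x) * G x) (fun x => `|G x|).
  - move=> n; apply: measurable_funM => //; apply: measurableT_comp => //.
    exact: measurable_smooth_halfline.
  - by move=> x; apply: cvgMl; exact: smooth_halfline_cvg.
  - exact: (integrable_norm iG).
  - move=> n x; rewrite normrM ler_piMl// ger0_norm ?smooth_halfline_ge0//.
    exact: smooth_halfline_le1.
have half a : \int[m1]_x (\1_(`]-oo, a] : set R) (U1 x) * G1 x) =
    \int[m2]_x (\1_(`]-oo, a] : set R) (U2 x) * G2 x).
  apply: (cvg_unique _ (lim _ _ m1 U1 G1 a mU1 iG1)) => //.
  rewrite (_ : (fun n => _) = (fun n => \int[m2]_x (smooth_halfline (a + n.+1%:R^-1) (n.+1%:R ^- 2) (U2 x) * G2 x))).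
    exact: lim.
  by apply/funext => n; rewrite step1// invr_eq0 expf_neq0// pnatr_eq0.
pose K d (T : measurableType d) (m : {sigma_finite_measure set T -> \bar R}) (U G : T -> R) (A : set R) :=
  \int[m]_x (\1_A (U x) * G x).
have iK d (T : measurableType d) (m : {sigma_finite_measure set T -> \bar R}) (U G : T -> R) (A : set R) :
    measurable_fun setT U -> m.-integrable setT (EFin \o G) -> measurable A ->
    m.-integrable setT (EFin \o (fun x => \1_A (U x) * G x)).
  move=> mU iG mA; apply: (@integrable_bounded_mul _ T R m U G mU iG _ 1) => //.
have KT d (T : measurableType d) (m : {sigma_finite_measure set T -> \bar R}) (U G : T -> R) :
    K _ _ m U G setT = \int[m]_x (cos (0 * U x) * G x).
  by apply: eq_Rintegral => x _; rewrite indicT mul0r cos0.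
have KD d (T : measurableType d) (m : {sigma_finite_measure set T -> \bar R}) (U G : T -> R) (A B : set R) :
    measurable_fun setT U -> m.-integrable setT (EFin \o G) -> measurable A -> measurable B -> B `<=` A ->
    K _ _ m U G (A `\` B) = K _ _ m U G A - K _ _ m U G B.
  move=> mU iG mA mB BA; rewrite /K -RintegralB//; try exact: iK.
  apply: eq_Rintegral => x _; rewrite -mulrBl; congr (_ * _); rewrite !indicE in_setD.
  have [xB|xB] := boolP (U x \in B); last by rewrite andbT subr0.
  by rewrite andbF mem_set ?subrr//; apply: BA; rewrite -inE.
have KU d (T : measurableType d) (m : {sigma_finite_measure set T -> \bar R}) (U G : T -> R) (F : nat -> set R) :
    measurable_fun setT U -> m.-integrable setT (EFin \o G) -> nondecreasing_seq F ->
    (forall n, measurable (F n)) ->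
    K _ _ m U G (F n) @[n --> \oo] --> K _ _ m U G (\bigcup_n F n).
  move=> mU iG ndF mF.
  have mG : measurable_fun setT G by apply/measurable_EFinP; exact: measurable_int iG.
  have [] // := @Rdominated_convergence _ T R m
    (fun n x => \1_(F n) (U x) * G x)
    (fun x => \1_(\bigcup_n F n) (U x) * G x) (fun x => `|G x|).
  - by move=> n; apply: measurable_funM => //; apply: measurableT_comp => //; exact: measurable_indic.
  - move=> x; apply: cvgMl; apply: cvg_near_cst.
    have [[k _ Fk]|nF] := pselect ((\bigcup_n F n) (U x)).
      exists k => // n /= kn; have Fn : F n (U x) by move/subsetPset: (ndF _ _ kn); apply.
      by rewrite !indicE (mem_set Fn) mem_set//; exists n.
    exists 0%N => // n _; rewrite !indicE !memNset//.
    by move=> Fn; apply: nF; exists n.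
  - exact: (integrable_norm iG).
  - by move=> n x; rewrite normrM ler_piMl.
move=> A mA; apply: (@pi_lambda _ _ (@RGenOInfty.G R)
  (fun A => K _ _ m1 U1 G1 A = K _ _ m2 U2 G2 A)) mA.
- exact: RGenOInfty.measurableE.
- move=> _ _ [a ->] [b ->]; exists (Num.max a b); apply/seteqP; split=> x /=.
    by rewrite !in_itv/= !andbT gt_max => -[-> ->].
  by rewrite !in_itv/= !andbT gt_max => /andP[].
- move=> _ [a ->]; have -> : `]a, +oo[%classic = setT `\` `]-oo, a] by rewrite setTD setCitvl.
  rewrite !KD//; try exact: measurableT.
  by rewrite !KT hc; congr (_ - _); exact: half.
- by rewrite !KT hc.
- by move=> X Y mX mY YX; rewrite !KD// => -> ->.
- move=> F ndF mF e; apply: (cvg_unique _ (KU _ _ m1 U1 G1 F mU1 iG1 ndF mF)) => //.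
  rewrite (_ : (fun n => _) = (fun n => K _ _ m2 U2 G2 (F n))); first exact: KU.
  by apply/funext => n; rewrite e.
Qed.

End trig_unique.

(** * Fatou bounds and measures with a density *)

Section fatou_bound.
Context d (T : measurableType d) (R : realType) (P : {measure set T -> \bar R}).

(** This is what turns estimates between members of a sequence, valid from some index on, into
    estimates for its pointwise limit. *)
Lemma fatou_bound (f_ : nat -> T -> R) f (C : R) (M : nat) :
  (forall n, measurable_fun setT (f_ n)) -> (forall n x, 0 <= f_ n x) ->
  (forall x, f_ n x @[n --> \oo] --> f x) ->
  (forall n, (M <= n)%N -> (\int[P]_x (f_ n x)%:E <= C%:E)%E) ->
  (\int[P]_x (f x)%:E <= C%:E)%E.
Proof.
move=> mf f0 ff fC.
pose g n := f_ (n + M)%N.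
have gf x : (g n x)%:E @[n --> \oo] --> (f x)%:E.
  apply: cvg_EFin; first exact: nearW.
  by rewrite /g; rewrite (cvg_shiftn M (f_^~ x)); exact: ff.
have := @fatou _ _ _ P setT measurableT (fun n x => (g n x)%:E).
have e : (fun x => limn_einf (fun n => (g n x)%:E)) = (fun x => (f x)%:E).
  by apply/funext => x; rewrite (cvg_limn_einf_sup (gf x)).1.
rewrite e => h; apply: le_trans (h _ _) _.
- by move=> n; apply/measurable_EFinP; exact: mf.
- by move=> n x _; rewrite lee_fin; exact: f0.
rewrite limn_einf_lim; apply: lime_le; first exact: is_cvg_einfs.
apply: nearW => n; apply: ge_ereal_inf; exists (\int[P]_x (g n x)%:E)%E.
  by exists n => //=.
by apply: fC; rewrite leq_addl.
Qed.

End fatou_bound.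

Section density_measure.
Context d (T : measurableType d) (R : realType) (m : {measure set T -> \bar R}) (g : T -> R).
Import HBNNSimple.
Local Open Scope ereal_scope.

(** The two proofs are arguments of the term so that it can carry a measure structure, which is
    false for arbitrary [g]. *)
Definition mdens of measurable_fun setT g & (forall x, (0 <= g x)%R) :=
  fun A : set T => \int[m]_(x in A) (g x)%:E.

Hypotheses (mg : measurable_fun setT g) (g0 : forall x, (0 <= g x)%R).

Let mdens0 : mdens mg g0 set0 = 0.
Proof. exact: integral_set0. Qed.

Let mdens_ge0 A : 0 <= mdens mg g0 A.
Proof. by apply: integral_ge0 => x _; rewrite lee_fin. Qed.

Let mEg : measurable_fun setT (EFin \o g).
Proof. exact/measurable_EFinP. Qed.

Let mdens_sigma_additive : semi_sigma_additive (mdens mg g0).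
Proof.
move=> F mF tF mUF; rewrite /mdens ge0_integral_bigcup//.
- by apply: is_cvg_nneseries => n _ _; apply: integral_ge0 => x _; rewrite lee_fin.
- exact: measurable_funTS.
- by move=> x _; rewrite lee_fin.
Qed.

HB.instance Definition _ := isMeasure.Build _ _ _ (mdens mg g0)
  mdens0 mdens_ge0 mdens_sigma_additive.

Let indic_case E : measurable E ->
  \int[mdens mg g0]_x (\1_E x)%:E = \int[m]_x ((\1_E x)%:E * (g x)%:E).
Proof.
move=> mE; rewrite integral_indic//= setIT /mdens integral_mkcond.
by apply: eq_integral => x _; rewrite patchE indicE; case: ifP => _; rewrite ?mul1e ?mul0e.
Qed.

Let nnsfun_case (f : {nnsfun T >-> R}) :
  \int[mdens mg g0]_x (f x)%:E = \int[m]_x ((f x)%:E * (g x)%:E).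
Proof.
under [LHS]eq_integral do rewrite fimfunE -fsumEFin//.
rewrite [LHS]ge0_integral_fsum//; last 2 first.
  - by move=> r; exact/measurable_EFinP/measurableT_comp.
  - by move=> n x _; rewrite EFinM nnfun_muleindic_ge0.
under [RHS]eq_integral.
  move=> x xD; rewrite fimfunE -fsumEFin// ge0_mule_fsuml; last first.
    by move=> r; rewrite EFinM nnfun_muleindic_ge0.
  over.
rewrite [RHS]ge0_integral_fsum//; last 2 first.
  - move=> r; apply: emeasurable_funM => //; apply/measurable_EFinP.
    by apply/measurable_funM => //; exact: measurable_indic.
  - by move=> n x _; rewrite EFinM mule_ge0// ?nnfun_muleindic_ge0// lee_fin.
apply: eq_fsbigr => r _.
under [RHS]eq_integral do rewrite EFinM -muleA.
have [r0|r0] := leP 0%R r; last first.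
  have f0 x : \1_(f @^-1` [set r]) x = 0%R :> R.
    rewrite indicE memNset//= => fx; move: r0; rewrite -fx ltNge.
    by move/negP; apply; exact: fun_ge0.
  under eq_integral do rewrite EFinM f0 mule0.
  by under [RHS]eq_integral do rewrite f0 mul0e mule0; rewrite !integral0.
under [LHS]eq_integral do rewrite EFinM.
have mi : measurable_fun setT (fun x => (\1_(f @^-1` [set r]) x)%:E : \bar R).
  by apply/measurable_EFinP; exact: measurable_indic.
rewrite ge0_integralZl//.
rewrite indic_case// ge0_integralZl//; first exact: emeasurable_funM.
by move=> x _; rewrite mule_ge0// lee_fin.
Qed.

Lemma ge0_integral_mdens (f : T -> \bar R) :
  measurable_fun setT f -> (forall x, 0 <= f x) ->
  \int[mdens mg g0]_x f x = \int[m]_x (f x * (g x)%:E).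
Proof.
move=> mf f0.
pose f_ := nnsfun_approx measurableT mf.
transitivity (lim (\int[mdens mg g0]_x (f_ n x)%:E @[n --> \oo])).
  rewrite -monotone_convergence//=.
  - apply: eq_integral => ? /[!inE] xD; apply/esym/cvg_lim => //=.
    exact: cvg_nnsfun_approx.
  - by move=> n; exact/measurable_EFinP/measurable_funTS.
  - by move=> n ? _; rewrite lee_fin.
  - by move=> ? _ ? ? mn; rewrite lee_fin; exact/lefP/nd_nnsfun_approx.
transitivity (lim (\int[m]_x ((f_ n x)%:E * (g x)%:E) @[n --> \oo])).
  by congr (lim (_ @ \oo)); apply/funext => n; exact: nnsfun_case.
rewrite -monotone_convergence//=.
- apply: eq_integral => x _; apply/cvg_lim => //=.
  by apply: cvgeZr => //; exact: cvg_nnsfun_approx.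
- by move=> n; apply: emeasurable_funM => //; exact/measurable_EFinP/measurable_funTS.
- by move=> n x _; rewrite mule_ge0// lee_fin.
- move=> x _ p n mn; rewrite lee_wpmul2r// ?lee_fin//; exact/lefP/nd_nnsfun_approx.
Qed.

End density_measure.

(** * The measurable space of twice continuously differentiable paths *)

Section C2_theory.
Context (R : realType).
Implicit Types (f g w : R -> R).

Lemma C2I f f1 f2 : (forall t : R, is_derive t (1:R) f (f1 t)) ->
  (forall t : R, is_derive t (1:R) f1 (f2 t)) -> continuous f2 ->
  [/\ C2 f, f^`()%classic = f1 & derive1n 2 f = f2].
Proof.
move=> d1 d2 c2.
have e1 : f^`()%classic = f1 by apply/funext => t; rewrite derive1E; case: (d1 t).
have e2 : derive1n 2 f = f2.
  by apply/funext => t; rewrite /derive1n /= e1 derive1E; case: (d2 t).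
split => //; split; first by move=> t; case: (d1 t).
  by move=> t; rewrite e1; case: (d2 t).
by rewrite e2.
Qed.

Lemma C2_derive w : C2 w -> [/\ forall t : R, is_derive t (1:R) w (w^`()%classic t),
  forall t : R, is_derive t (1:R) (w^`()%classic) (derive1n 2 w t) &
  continuous (derive1n 2 w)].
Proof.
case=> d1 d2 c2; split; last exact: c2.
- by move=> t; apply: DeriveDef; [exact: d1|rewrite derive1E].
- by move=> t; apply: DeriveDef; [exact: d2|rewrite /= [RHS]derive1E].
Qed.

Lemma C2_cst (c : R) : [/\ C2 (fun=> c), (fun=> c : R)^`()%classic = (fun=> 0) &
  derive1n 2 (fun=> c : R) = (fun=> 0)].
Proof. by apply: (@C2I _ (fun=> 0)) => // t; exact: cvg_cst. Qed.

Lemma C2_lin f g (a : R) : C2 f -> C2 g ->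
  [/\ C2 (fun t => f t + a * g t),
      (fun t => f t + a * g t)^`()%classic = (fun t => f^`()%classic t + a * g^`()%classic t) &
      derive1n 2 (fun t => f t + a * g t) = (fun t => derive1n 2 f t + a * derive1n 2 g t)].
Proof.
move=> /C2_derive[f1 f2 cf] /C2_derive[g1 g2 cg]; apply: C2I.
by move=> t; apply: cvgD; [exact: cf|apply: cvgMr; exact: cg].
Qed.

Lemma C2_continuous w : C2 w -> [/\ continuous w, continuous (w^`()%classic) & continuous (derive1n 2 w)].
Proof.
by move=> [d1 d2 c]; split=> // t; apply/differentiable_continuous/derivable1_diffP.
Qed.

Lemma C2_shift w (h : R) : C2 w -> [/\ C2 (fun t => w (t + h)),
  (fun t => w (t + h))^`()%classic = (fun t => w^`()%classic (t + h)) &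
  derive1n 2 (fun t => w (t + h)) = (fun t => derive1n 2 w (t + h))].
Proof.
move=> /C2_derive[w1 w2 cw].
have sh (f f' : R -> R) (t : R) : (forall t : R, is_derive t (1:R) f (f' t)) ->
    is_derive t (1:R) (fun t => f (t + h)) (f' (t + h)).
  move=> d; have d1 : is_derive t (1:R) (fun t : R => t + h) 1.
    by apply: is_derive_eq; rewrite addr0.
  have := @is_derive1_comp R f (fun t : R => t + h) t _ _ (d _) d1.
  by rewrite /comp mulr1.
have s1 t := sh _ _ t w1; have s2 t := sh _ _ t w2.
apply: (C2I s1 s2) => t.
apply: (@continuous_comp _ _ _ (fun t => t + h)); last exact: cw.
by apply: cvgD; [exact: cvg_id|exact: cvg_cst].
Qed.

End C2_theory.

(** Restriction to C2 functions makes both derivatives limits of difference quotients, hence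
    measurable for the sigma-algebra generated by point evaluations. *)
Record path (R : realType) := Path { path_fun :> R -> R ; path_C2 : C2 path_fun }.

Section path_space.
Context (R : realType).

Definition path0 : path R := Path (let: And3 c _ _ := C2_cst (0:R) in c).

Lemma path_eqP (p q : path R) : path_fun p = path_fun q -> p = q.
Proof. by case: p q => [f hf] [g hg] /= e; subst g; congr Path; exact: Prop_irrelevance. Qed.

HB.instance Definition _ := gen_eqMixin (path R).
HB.instance Definition _ := gen_choiceMixin (path R).
HB.instance Definition _ := isPointed.Build (path R) path0.

Fixpoint cyl (l : seq (R * set R)) : set (path R) :=
  if l is p :: l' then [set w | p.2 (path_fun w p.1)] `&` cyl l' else setT.

Fixpoint cyl_base (l : seq (R * set R)) : Prop :=
  if l is p :: l' then measurable p.2 /\ cyl_base l' else True.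

Definition cylinders : set (set (path R)) := [set A | exists2 l, cyl_base l & A = cyl l].

Lemma cylinders_setI : setI_closed cylinders.
Proof.
move=> _ _ [l1 m1 ->] [l2 m2 ->]; exists (l1 ++ l2).
  by elim: l1 m1 => //= p l IH [mp /IH].
by elim: l1 {m1} => /= [|p l IH]; [rewrite setTI|rewrite -IH setIA].
Qed.

HB.instance Definition _ := @isMeasurable.Build (sigma_display cylinders) (path R)
  <<s cylinders >> (@sigma_algebra0 _ setT cylinders) (@sigma_algebraC (path R) cylinders)
  (@sigma_algebra_bigcup _ setT cylinders).

(* Sealing the construction keeps unification from unfolding paths. *)
Lemma mkpath_subproof (f : R -> R) : {p : path R | C2 f -> p = f :> (R -> R)}.
Proof.
have [h|nh] := pselect (C2 f); first by exists (Path h).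
by exists path0 => /nh.
Qed.

Definition mkpath (f : R -> R) : path R := sval (mkpath_subproof f).

Lemma mkpathE f : C2 f -> mkpath f = f :> (R -> R).
Proof. exact: (svalP (mkpath_subproof f)). Qed.

Lemma measurable_pathP d (T : measurableType d) (X : T -> path R) :
  measurable_fun setT X <-> (forall t, measurable_fun setT (fun x => X x t)).
Proof.
split=> [mX t _ A mA|mX].
  have -> : [set: T] `&` (fun x => X x t) @^-1` A = [set: T] `&` X @^-1` (cyl [:: (t, A)]).
    by rewrite /= setIT.
  by apply: mX => //; apply: sub_sigma_algebra; exists [:: (t, A)].
apply: (@measurability _ _ _ _ _ _ cylinders) => //.
move=> _ [_ [l ml ->] <-]; rewrite setTI.
elim: l ml => /= [_|p l IH [mp /IH ml]]; first by rewrite preimage_setT.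
rewrite preimage_setI; apply: measurableI => //.
by have := mX p.1 measurableT _ mp; rewrite setTI.
Qed.

Lemma measurable_path_eval t : measurable_fun setT (fun w : path R => w t).
Proof. by move: t; apply/measurable_pathP; exact: measurable_id. Qed.

End path_space.

(** * Laws of random paths and trigonometric transforms *)

Section law_uniqueness.
Context (R : realType) (d1 d2 : measure_display)
  (T1 : measurableType d1) (T2 : measurableType d2)
  (X1 : T1 -> path R) (X2 : T2 -> path R).
Hypotheses (mX1 : measurable_fun setT X1) (mX2 : measurable_fun setT X2).

Lemma law_eq_cylinders (P1 : {measure set T1 -> \bar R}) (P2 : {measure set T2 -> \bar R}) :
  (P1 setT < +oo)%E -> (P2 setT < +oo)%E ->
  (forall l, cyl_base l -> P1 (X1 @^-1` cyl l) = P2 (X2 @^-1` cyl l)) ->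
  forall Phi : path R -> \bar R, measurable_fun setT Phi -> (forall w, 0 <= Phi w)%E ->
  (\int[P1]_x Phi (X1 x) = \int[P2]_x Phi (X2 x))%E.
Proof.
move=> f1 f2 h Phi mPhi Phi0.
have fin d (T : measurableType d) (P : {measure set T -> \bar R}) (X : T -> path R) A :
    measurable_fun setT X -> measurable A -> (P setT < +oo -> P (X @^-1` A) < +oo)%E.
  move=> mX mA; apply: le_lt_trans; apply: le_measure => //; rewrite inE//.
  by rewrite -[X in measurable X]setTI; exact: mX.
pose m1 := measure_function_pushforward__canonical__measure_function_Measure P1 mX1.
pose m2 := measure_function_pushforward__canonical__measure_function_Measure P2 mX2.
transitivity (\int[m1]_w Phi w)%E; first by rewrite [RHS]ge0_integral_pushforward.
transitivity (\int[m2]_w Phi w)%E; last by rewrite [LHS]ge0_integral_pushforward.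
apply: eq_measure_integral => A mA _; move: A mA.
apply: (@pi_lambda _ _ (@cylinders R)) => //.
- exact: cylinders_setI.
- by move=> _ [l ml ->]; exact: h.
- by have := h [::] I; rewrite /m1 /m2 /= /pushforward !preimage_setT.
- move=> A B mA mB BA hA hB; rewrite !measureD//.
  + by rewrite (setIidr BA); congr (_ - _)%E; [exact: hA|exact: hB].
  + exact: fin.
  + exact: fin.
- move=> F ndF mF hF.
  have c1 := @nondecreasing_cvg_mu _ _ R m1 F mF (bigcupT_measurable F mF) ndF.
  have c2 := @nondecreasing_cvg_mu _ _ R m2 F mF (bigcupT_measurable F mF) ndF.
  apply: (cvg_unique _ c1) => //; rewrite (_ : m1 \o F = m2 \o F)//.
  by apply/funext => n; exact: hF.
Qed.

Definition comb (w : R -> R) (l : seq (R * R)) : R := \sum_(p <- l) p.1 * w p.2.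

Lemma measurable_comb d (T : measurableType d) (X : T -> path R) l :
  measurable_fun setT X -> measurable_fun setT (fun x => comb (X x) l).
Proof.
move=> /measurable_pathP mX; apply: measurable_sum => p.
exact: measurable_funM.
Qed.

Variables (P1 : probability T1 R) (P2 : probability T2 R).

Let same (G1 : T1 -> R) (G2 : T2 -> R) := forall l,
  \int[P1]_x (cos (comb (X1 x) l) * G1 x) = \int[P2]_x (cos (comb (X2 x) l) * G2 x) /\
  \int[P1]_x (sin (comb (X1 x) l) * G1 x) = \int[P2]_x (sin (comb (X2 x) l) * G2 x).

Let bounded_weight d (T : measurableType d) (G : T -> R) :=
  measurable_fun setT G /\ forall x, `|G x| <= 1.

Let iG d (T : measurableType d) (P : probability T R) (G : T -> R) :
  bounded_weight G -> P.-integrable setT (EFin \o G).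
Proof.
move=> [mG G1]; apply: (@le_integrable _ _ _ P setT measurableT _ (EFin \o cst 1)).
- exact/measurable_EFinP.
- by move=> x _; rewrite /= lee_fin normr1.
- exact: finite_measure_integrable_cst.
Qed.

Let mcos : measurable_fun setT (@cos R).
Proof. exact: continuous_measurable_fun (@continuous_cos R). Qed.
Let msin : measurable_fun setT (@sin R).
Proof. exact: continuous_measurable_fun (@continuous_sin R). Qed.

Let iw d (T : measurableType d) (P : probability T R) (G S : T -> R) (c : R -> R) :
  bounded_weight G -> measurable_fun setT S -> measurable_fun setT c ->
  (forall x, `|c x| <= 1) -> P.-integrable setT (EFin \o (fun x => c (S x) * G x)).
Proof.
move=> [mG G1] mS mc c1; apply: iG; split.
  by apply: measurable_funM => //; exact: measurableT_comp.
by move=> x; rewrite normrM mulr_ile1.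
Qed.

Let comb_cons (w : R -> R) (p : R * R) l : comb w (p :: l) = p.1 * w p.2 + comb w l.
Proof. by rewrite /comb big_cons. Qed.

(** [trig_unique] is applied to the variable X t with the trigonometric factor moved into the
    weight. Product-to-sum formulas express the transforms in X t by those of the combinations [l]
    extended by (u, t) and (- u, t), where the hypothesis applies. *)
Let same_indic G1 G2 (t : R) (A : set R) : measurable A -> bounded_weight G1 -> bounded_weight G2 ->
  same G1 G2 -> same (fun x => \1_A (X1 x t) * G1 x) (fun x => \1_A (X2 x t) * G2 x).
Proof.
move=> mA b1 b2 sG l.
have exp_sum d (T : measurableType d) (P : probability T R) (G : T -> R) (X : T -> path R)
    (c : R -> R) (r s : R) (q e : R -> R) :
  bounded_weight G -> measurable_fun setT X -> measurable_fun setT c -> (forall x, `|c x| <= 1) ->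
  measurable_fun setT q -> measurable_fun setT e ->
  (forall a b, q a * e b = r * (c (a + b) + s * c (- a + b))) ->
  forall u, \int[P]_x (q (u * X x t) * (e (comb (X x) l) * G x)) =
    r * (\int[P]_x (c (comb (X x) ((u, t) :: l)) * G x) +
            s * \int[P]_x (c (comb (X x) ((- u, t) :: l)) * G x)).
  move=> bG mX mc c1 mq me qe u.
  have i1 l' := iw P bG (measurable_comb l' mX) mc c1.
  have i2 := integrable_scaleR s (i1 ((- u, t) :: l)).
  rewrite -(RintegralZl s measurableT (i1 ((- u, t) :: l))) -RintegralD// -RintegralZl//; last exact: integrable_addR.
  apply: eq_Rintegral => x _; rewrite mulrA qe !comb_cons /= mulNr; ring.
have mX1t := (measurable_pathP X1).1 mX1 t; have mX2t := (measurable_pathP X2).1 mX2 t.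
have U (e c1 c2 : R -> R) (r1 r2 s1 s2 : R) : measurable_fun setT e -> (forall x, `|e x| <= 1) ->
    (c1 = cos \/ c1 = sin) -> (c2 = cos \/ c2 = sin) ->
    (forall a b, cos a * e b = r1 * (c1 (a + b) + s1 * c1 (- a + b))) ->
    (forall a b, sin a * e b = r2 * (c2 (a + b) + s2 * c2 (- a + b))) ->
    \int[P1]_x (e (comb (X1 x) l) * (\1_A (X1 x t) * G1 x)) =
    \int[P2]_x (e (comb (X2 x) l) * (\1_A (X2 x t) * G2 x)).
  move=> me e1 hc1 hc2 qc qs.
  have h (c : R -> R) : c = cos \/ c = sin -> [/\ measurable_fun setT c, forall x, `|c x| <= 1 &
      forall l', \int[P1]_x (c (comb (X1 x) l') * G1 x) = \int[P2]_x (c (comb (X2 x) l') * G2 x)].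
    by case=> ->; split => //; [exact: cos_max|move=> l'; case: (sG l')|exact: sin_max|move=> l'; case: (sG l')].
  have [m1 n1 q1] := h _ hc1; have [m2 n2 q2] := h _ hc2.
  transitivity (\int[P1]_x (\1_A (X1 x t) * (e (comb (X1 x) l) * G1 x))).
    by apply: eq_Rintegral => x _; ring.
  transitivity (\int[P2]_x (\1_A (X2 x t) * (e (comb (X2 x) l) * G2 x))); last first.
    by apply: eq_Rintegral => x _; ring.
  apply: trig_unique => //.
  - by apply: iw => //; exact: measurable_comb.
  - by apply: iw => //; exact: measurable_comb.
  - move=> u; rewrite (exp_sum _ _ _ _ _ c1 r1 s1 cos e)// (exp_sum _ _ _ _ _ c1 r1 s1 cos e)//.
    by rewrite !q1.
  - move=> u; rewrite (exp_sum _ _ _ _ _ c2 r2 s2 sin e)// (exp_sum _ _ _ _ _ c2 r2 s2 sin e)//.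
    by rewrite !q2.
split.
- apply: (U cos cos sin 2^-1 2^-1 1 (-1)); [exact: mcos|exact: cos_max|by left|by right| |].
  + by move=> a b; rewrite !cosD cosN sinN; field.
  + by move=> a b; rewrite !sinD cosN sinN; field.
- apply: (U sin sin cos 2^-1 (- 2^-1) 1 (-1)); [exact: msin|exact: sin_max|by right|by left| |].
  + by move=> a b; rewrite !sinD cosN sinN; field.
  + by move=> a b; rewrite !cosD cosN sinN; field.
Qed.

(** [same_indic] brings in the events of a cylinder one coordinate at a time, so the measures of
    densities G1 and G2 have images that agree on cylinders. Weights are carried along because the
    change of slide direction compares two laws with different densities. *)
Lemma law_eq_weighted (G1 : T1 -> R) (G2 : T2 -> R) :
  measurable_fun setT G1 -> (forall x, 0 <= G1 x <= 1) ->
  measurable_fun setT G2 -> (forall x, 0 <= G2 x <= 1) ->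
  (forall l, \int[P1]_x (cos (comb (X1 x) l) * G1 x) = \int[P2]_x (cos (comb (X2 x) l) * G2 x)) ->
  (forall l, \int[P1]_x (sin (comb (X1 x) l) * G1 x) = \int[P2]_x (sin (comb (X2 x) l) * G2 x)) ->
  forall Phi : path R -> \bar R, measurable_fun setT Phi -> (forall w, 0 <= Phi w)%E ->
  (\int[P1]_x (Phi (X1 x) * (G1 x)%:E) = \int[P2]_x (Phi (X2 x) * (G2 x)%:E))%E.
Proof.
move=> mG1 b1 mG2 b2 hc hs Phi mPhi Phi0.
have p1 x : 0 <= G1 x by case/andP: (b1 x).
have p2 x : 0 <= G2 x by case/andP: (b2 x).
have B d (T : measurableType d) (G : T -> R) : measurable_fun setT G -> (forall x, 0 <= G x <= 1) -> bounded_weight G.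
  by move=> mG bG; split=> // x; have /andP[a b] := bG x; rewrite ger0_norm.
have mc d (T : measurableType d) (X : T -> path R) l : measurable_fun setT X -> cyl_base l ->
    measurable (X @^-1` cyl l).
  move=> mX ml; rewrite -[X in measurable X]setTI; apply: mX => //.
  by apply: sub_sigma_algebra; exists l.
have bi d (T : measurableType d) (X : T -> path R) G l' : measurable_fun setT X -> cyl_base l' ->
    bounded_weight G -> bounded_weight (fun x => \1_(X @^-1` cyl l') x * G x).
  move=> mX ml' [mG bG]; split; last first.
    by move=> x; rewrite normrM mulr_ile1// ger0_norm ?indicE//; case: (_ \in _).
  by apply: measurable_funM => //; apply: measurable_indic; exact: mc.
have main l : cyl_base l -> same (fun x => \1_(X1 @^-1` cyl l) x * G1 x) (fun x => \1_(X2 @^-1` cyl l) x * G2 x).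
  elim: l => [_|p l IH /= [mp ml]].
    have e d (T : measurableType d) (X : T -> path R) (G : T -> R) :
        (fun x => \1_(X @^-1` cyl [::]) x * G x) = G.
      by apply/funext => x; rewrite indicE preimage_setT in_setT mul1r.
    by rewrite !e => l; split.
  have := same_indic p.1 mp (bi _ _ X1 G1 l mX1 ml (B _ _ _ mG1 b1)) (bi _ _ X2 G2 l mX2 ml (B _ _ _ mG2 b2)) (IH ml).
  have e d (T : measurableType d) (X : T -> path R) (G : T -> R) :
      (fun x => \1_(X @^-1` ([set w | p.2 (path_fun w p.1)] `&` cyl l)) x * G x) =
      (fun x => \1_(p.2) (X x p.1) * (\1_(X @^-1` cyl l) x * G x)).
    by apply/funext => x; rewrite preimage_setI indicI /= mulrA !indicE.
  by rewrite !e.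
have ri d (T : measurableType d) (P : probability T R) (X : T -> path R) (G : T -> R) l
    (mG : measurable_fun setT G) (p : forall x, 0 <= G x) : (forall x, 0 <= G x <= 1) ->
    measurable_fun setT X -> cyl_base l ->
    (\int[P]_x (\1_(X @^-1` cyl l) x * G x))%:E = mdens P mG p (X @^-1` cyl l).
  move=> bG mX ml; have iG' := iG P (bi _ _ _ _ _ mX ml (B _ _ _ mG bG)).
  rewrite /Rintegral fineK; last exact: (integrable_fin_num measurableT iG').
  rewrite /mdens [RHS]integral_mkcond; apply: eq_integral => x _ /=.
  by rewrite patchE indicE; case: ifP => _; rewrite ?mul1r ?mul0r.
have fin d (T : measurableType d) (P : probability T R) (G : T -> R) (mG : measurable_fun setT G) (p : forall x, 0 <= G x) :
    (forall x, 0 <= G x <= 1) -> (mdens P mG p setT < +oo)%E.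
  move=> bG; have iG' := iG P (B _ _ _ mG bG).
  by have := integrable_fin_num measurableT iG'; rewrite fin_numE -ltey => /andP[].
transitivity (\int[mdens P1 mG1 p1]_x Phi (X1 x))%E.
  by rewrite ge0_integral_mdens//; exact: measurableT_comp.
transitivity (\int[mdens P2 mG2 p2]_x Phi (X2 x))%E; last first.
  by rewrite ge0_integral_mdens//; exact: measurableT_comp.
apply: law_eq_cylinders => //; [exact: fin|exact: fin|move=> l ml].
apply: etrans (esym (ri _ _ P1 X1 G1 l mG1 p1 b1 mX1 ml)) _.
apply: etrans _ (ri _ _ P2 X2 G2 l mG2 p2 b2 mX2 ml).
have [+ _] := main l ml [::].
have c0 (w : path R) : cos (comb w [::]) = 1 by rewrite /comb big_nil cos0.
under eq_Rintegral do rewrite c0 mul1r.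
by under [in X in _ = X -> _]eq_Rintegral do rewrite c0 mul1r; move=> ->.
Qed.

Lemma law_eq :
  (forall l, \int[P1]_x (cos (comb (X1 x) l)) = \int[P2]_x (cos (comb (X2 x) l))) ->
  (forall l, \int[P1]_x (sin (comb (X1 x) l)) = \int[P2]_x (sin (comb (X2 x) l))) ->
  forall Phi : path R -> \bar R, measurable_fun setT Phi -> (forall w, 0 <= Phi w)%E ->
  (\int[P1]_x Phi (X1 x) = \int[P2]_x Phi (X2 x))%E.
Proof.
move=> hc hs Phi mPhi Phi0.
have := @law_eq_weighted (cst 1) (cst 1).
do 4 (move=> /(_ _)/wrap[]; first by [exact: measurable_cst|move=> x; rewrite ler01 lexx]).
have e (c : R -> R) d (T : measurableType d) (P : probability T R) (X : T -> path R) l :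
    \int[P]_x (c (comb (X x) l) * cst 1 x) = \int[P]_x (c (comb (X x) l)).
  by apply: eq_Rintegral => x _; rewrite mulr1.
move=> /(_ _)/wrap[]; first by move=> l; rewrite !e.
move=> /(_ _)/wrap[]; first by move=> l; rewrite !e.
move=> /(_ Phi mPhi Phi0).
by under eq_integral do rewrite mule1; under [in X in _ = X -> _]eq_integral do rewrite mule1.
Qed.

End law_uniqueness.

(** * Mean-square pairing and Gaussian spaces *)

Section square_integrable.
Context d (T : measurableType d) (R : realType) (P : probability T R).
Implicit Types f g h : T -> R.

Definition sqint f := measurable_fun setT f /\ P.-integrable setT (EFin \o (fun x => f x ^+ 2)).

(** On centred variables this is the covariance. *)
Definition ip f g : R := \int[P]_x (f x * g x).

Lemma sqint_mul f g : sqint f -> sqint g -> P.-integrable setT (EFin \o (fun x => f x * g x)).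
Proof.
move=> [mf if_] [mg ig].
apply: le_integrable (integrable_addR if_ ig) => //.
  by apply/measurable_EFinP; exact: measurable_funM.
move=> x _; rewrite /= lee_fin [leRHS]ger0_norm ?addr_ge0 ?sqr_ge0//.
rewrite ler_norml; have := sqr_ge0 (f x - g x); have := sqr_ge0 (f x + g x).
have := sqr_ge0 (f x); have := sqr_ge0 (g x); rewrite !expr2; lra.
Qed.

Lemma sqint_lin (a b : R) f g : sqint f -> sqint g -> sqint (fun x => a * f x + b * g x).
Proof.
move=> sf sg; have ifg := sqint_mul sf sg; case: sf sg => mf if_ [mg ig].
split; first by apply: measurable_funD; exact: measurable_funM.
have -> : (fun x => (a * f x + b * g x) ^+ 2) =
  (fun x => (a ^+ 2 * f x ^+ 2 + 2 * a * b * (f x * g x)) + b ^+ 2 * g x ^+ 2).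
  by apply/funext => x; ring.
by apply: integrable_addR; [apply: integrable_addR|]; exact: integrable_scaleR.
Qed.

Lemma sqint_cst (c : R) : sqint (fun=> c).
Proof. by split => //; exact: finite_measure_integrable_cst. Qed.

Lemma sqint_scale (a : R) f : sqint f -> sqint (fun x => a * f x).
Proof.
move=> sf; have := sqint_lin a 0 sf sf.
by congr sqint; apply/funext => x; rewrite mul0r addr0.
Qed.

Lemma sqint_integrable f : sqint f -> P.-integrable setT (EFin \o f).
Proof.
move=> sf; have := sqint_mul sf (sqint_cst 1).
by congr (P.-integrable _ _); apply/funext => x /=; rewrite mulr1.
Qed.

Lemma ipC f g : ip f g = ip g f.
Proof. by apply: eq_Rintegral => x _; rewrite mulrC. Qed.

Lemma ip_linl (a b : R) f g h : sqint f -> sqint g -> sqint h ->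
  ip (fun x => a * f x + b * g x) h = a * ip f h + b * ip g h.
Proof.
move=> sf sg sh; have i1 := sqint_mul sf sh; have i2 := sqint_mul sg sh.
rewrite /ip -!RintegralZl// -RintegralD//; try exact: integrable_scaleR.
by apply: eq_Rintegral => x _; ring.
Qed.

Lemma ip_linr (a b : R) f g h : sqint f -> sqint g -> sqint h ->
  ip h (fun x => a * f x + b * g x) = a * ip h f + b * ip h g.
Proof. by move=> sf sg sh; rewrite ipC ip_linl// ipC (ipC g). Qed.

Lemma ip_scalel (a : R) f h : sqint f -> sqint h -> ip (fun x => a * f x) h = a * ip f h.
Proof.
move=> sf sh; rewrite -[RHS]addr0 -[X in _ = _ + X](mul0r (ip f h)) -ip_linl//.
by congr ip; apply/funext => x; rewrite mul0r addr0.
Qed.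

Lemma ip_scaler (a : R) f h : sqint f -> sqint h -> ip h (fun x => a * f x) = a * ip h f.
Proof. by move=> sf sh; rewrite ipC ip_scalel// ipC. Qed.

Lemma ip_sub f g h : sqint f -> sqint g -> sqint h ->
  ip (fun x => f x - g x) h = ip f h - ip g h.
Proof.
move=> sf sg sh; rewrite -[RHS](_ : 1 * ip f h + (-1) * ip g h = _); last by ring.
by rewrite -ip_linl//; congr ip; apply/funext => x; ring.
Qed.

Lemma sqint_sub f g : sqint f -> sqint g -> sqint (fun x => f x - g x).
Proof.
move=> sf sg; have := sqint_lin 1 (-1) sf sg.
by congr sqint; apply/funext => x; ring.
Qed.

Lemma ip_ge0 f : 0 <= ip f f.
Proof. by apply: Rintegral_ge0 => x _; rewrite -expr2 sqr_ge0. Qed.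

Lemma ip_quad (a b : R) f g : sqint f -> sqint g ->
  ip (fun x => a * f x + b * g x) (fun x => a * f x + b * g x) =
  a ^+ 2 * ip f f + 2 * a * b * ip f g + b ^+ 2 * ip g g.
Proof.
move=> sf sg; have sl := sqint_lin a b sf sg.
by rewrite ip_linl// !ip_linr// (ipC g f); ring.
Qed.

(** The squares of f + e g and f - e g have nonnegative integral. This parametrized Cauchy-Schwarz
    inequality avoids square roots and suffices for limits. *)
Lemma ip_le f g (e : R) : sqint f -> sqint g -> 0 < e ->
  `|ip f g| <= e * ip g g + e^-1 * ip f f.
Proof.
move=> sf sg e0; have := ip_ge0 (fun x => 1 * f x + e * g x).
have := ip_ge0 (fun x => 1 * f x + (- e) * g x); rewrite !ip_quad//.
have := ip_ge0 f; have := ip_ge0 g.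
move: (ip f f) (ip f g) (ip g g) => a b c c0 a0 h1 h2.
have a1 : 0 <= a / e by rewrite divr_ge0// ltW.
have c1 : 0 <= e * c by rewrite mulr_ge0// ltW.
rewrite (mulrC e^-1) ler_norml.
have {}h1 : 0 <= a / e - 2 * b + e * c.
  rewrite -(pmulr_rge0 _ e0) [leRHS](_ : _ = 1 ^+ 2 * a + 2 * 1 * (- e) * b + (- e) ^+ 2 * c)//.
  by field; rewrite gt_eqF.
have {}h2 : 0 <= a / e + 2 * b + e * c.
  rewrite -(pmulr_rge0 _ e0) [leRHS](_ : _ = 1 ^+ 2 * a + 2 * 1 * e * b + e ^+ 2 * c)//.
  by field; rewrite gt_eqF.
move: (a / e) (e * c) a1 c1 h1 h2 => x y *; lra.
Qed.

Lemma ip_cvg0 (s : nat -> T -> R) g : (forall n, sqint (s n)) -> sqint g ->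
  ip (s n) (s n) @[n --> \oo] --> 0 -> ip (s n) g @[n --> \oo] --> 0.
Proof.
move=> ss sg h; apply/cvgrPdist_le => /= e e0.
pose c := ip g g + 1; have c0 : 0 < c by rewrite ltr_wpDl// ip_ge0.
have e1 : 0 < e / (2 * c) by rewrite divr_gt0// mulr_gt0.
have e2 : 0 < e / 2 * (e / (2 * c)) by rewrite mulr_gt0// divr_gt0.
move/cvgr0_norm_le: h => /(_ _ e2); apply: filterS => n.
rewrite ger0_norm ?ip_ge0// sub0r normrN => h.
apply: le_trans (ip_le (ss n) sg e1) _.
rewrite [leRHS](_ : _ = e / 2 + e / 2); last by field.
apply: lerD; last by rewrite ler_pdivrMl// mulrC.
rewrite -ler_pdivlMl// [leRHS](_ : _ = c) ?lerDl//.
by field; rewrite !gt_eqF.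
Qed.

Lemma sqint_cvg (s : nat -> T -> R) f g : (forall n, sqint (s n)) -> sqint f -> sqint g ->
  ip (fun x => s n x - f x) (fun x => s n x - f x) @[n --> \oo] --> 0 ->
  ip (s n) g @[n --> \oo] --> ip f g.
Proof.
move=> ss sf sg h; apply/subr_cvg0.
have := ip_cvg0 (fun n => sqint_sub (ss n) sf) sg h.
by under eq_fun do rewrite ip_sub//.
Qed.

Lemma sqint_cvg2 (s : nat -> T -> R) f : (forall n, sqint (s n)) -> sqint f ->
  ip (fun x => s n x - f x) (fun x => s n x - f x) @[n --> \oo] --> 0 ->
  ip (s n) (s n) @[n --> \oo] --> ip f f.
Proof.
move=> ss sf h.
have e n : ip (s n) (s n) = ip (fun x => s n x - f x) (fun x => s n x - f x) + (2 * ip (s n) f - ip f f).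
  have := ip_quad 1 (-1) (ss n) sf.
  rewrite (_ : (fun x => _) = (fun x => s n x - f x)); last by apply/funext => x; ring.
  by move=> ->; ring.
rewrite (funext e : (fun n => ip (s n) (s n)) = _).
have {2}-> : ip f f = 0 + (2 * ip f f - ip f f) by ring.
apply: cvgD => //; apply: cvgB; last exact: cvg_cst.
by apply: cvgMr; exact: sqint_cvg.
Qed.

End square_integrable.

Lemma cvg_sqrR (R : realType) (u : nat -> R) (l : R) :
  u n @[n --> \oo] --> l -> u n ^+ 2 @[n --> \oo] --> l ^+ 2.
Proof.
move=> h; rewrite expr2 (_ : (fun n => _) = (fun n => u n * u n)); first exact: cvgM.
by apply/funext => n; rewrite expr2.
Qed.

Section gaussian_space.
Context d (T : measurableType d) (R : realType) (P : probability T R).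
Implicit Types (f g : T -> R) (G : set (T -> R)).

(** A linear space of centred Gaussian variables, given by real and imaginary parts of their
    characteristic functions at 1. Scaling recovers the whole function, and linearity makes the
    variables jointly Gaussian. *)
Record cgauss G : Prop := CGauss {
  cg_0 : G (fun=> 0) ;
  cg_lin : forall a f g, G f -> G g -> G (fun x => a * f x + g x) ;
  cg_sqint : forall f, G f -> sqint P f ;
  cg_mean : forall f, G f -> \int[P]_x f x = 0 ;
  cg_cos : forall f, G f -> \int[P]_x cos (f x) = expR (- (ip P f f / 2)) ;
  cg_sin : forall f, G f -> \int[P]_x sin (f x) = 0 }.

(** Pointwise limits, because derivatives of paths arise as such; [cgauss_sqint_cvg] upgrades them
    to mean-square limits. *)
Definition pw_closure G : set (T -> R) :=
  [set f | exists2 s : nat -> T -> R, forall n, G (s n) &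
     forall x, s n x @[n --> \oo] --> f x].

Lemma Rintegral_prob_cst (c : R) : \int[P]_x c = c.
Proof.
rewrite /Rintegral integral_cst// -[RHS](congr1 fine (mule1 c%:E)).
by congr (fine (_ * _)); exact: probability_setT.
Qed.

Let bdd_int (c : R -> R) f : measurable_fun setT c -> (forall x, `|c x| <= 1) -> measurable_fun setT f ->
  P.-integrable setT (EFin \o (fun x => c (f x))).
Proof.
move=> mc c1 mf; apply: (@le_integrable _ _ _ P setT measurableT _ (EFin \o cst 1)).
- by apply/measurable_EFinP; exact: measurableT_comp.
- by move=> x _; rewrite /= lee_fin normr1.
- exact: finite_measure_integrable_cst.
Qed.

Let mcos : measurable_fun setT (@cos R).
Proof. exact: continuous_measurable_fun (@continuous_cos R). Qed.
Let msin : measurable_fun setT (@sin R).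
Proof. exact: continuous_measurable_fun (@continuous_sin R). Qed.

(** A triangle inequality, up to a constant, for the bounded distance 1 - cos: it expands the
    nonnegative sum of (cos x + cos y - 2)^2 and (sin x + sin y)^2. *)
Let cos_dist (x y : R) : 1 - cos (x - y) <= 2 * (1 - cos x) + 2 * (1 - cos y).
Proof.
have := cos2Dsin2 x; have := cos2Dsin2 y; rewrite cosB.
have := sqr_ge0 (cos x + cos y - 2); have := sqr_ge0 (sin x + sin y).
rewrite !expr2; lra.
Qed.

Let expR_small (v e : R) : 0 <= v -> 0 <= e -> e <= 2^-1 -> 1 - expR (- (v / 2)) <= e -> v <= 4 * e.
Proof.
move=> v0 e0 e1 h.
have h1 : 1 - e <= expR (- (v / 2)) by lra.
have h2 : 1 + v / 2 <= expR (v / 2) by exact: expR_ge1Dx.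
have h3 : expR (v / 2) * expR (- (v / 2)) = 1 by rewrite -expRD subrr expR0.
have h4 : (1 + v / 2) * (1 - e) <= 1.
  by rewrite -[leRHS]h3; apply: ler_pM => //; lra.
have h5 : v * e <= v / 2 by rewrite ler_wpM2l.
nra.
Qed.

(** For a centred Gaussian variable of variance v the mean of the cosine is exp (- v / 2). Bounded
    convergence of cosines thus forces the variances of s n - s m to 0, and Fatou's lemma in m gives
    mean-square convergence to [f], with no integrability assumed of [f]. *)
Lemma cgauss_sqint_cvg G (s : nat -> T -> R) f : cgauss G -> (forall n, G (s n)) ->
  (forall x, s n x @[n --> \oo] --> f x) ->
  sqint P f /\ ip P (fun x => s n x - f x) (fun x => s n x - f x) @[n --> \oo] --> 0.
Proof.
move=> cG Gs sf.
have ms n : measurable_fun setT (s n) by case: (cg_sqint cG (Gs n)).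
have mf : measurable_fun setT f by apply: measurable_fun_cvg => // x _; exact: sf.
pose c n := \int[P]_x (1 - cos (s n x - f x)).
have msf n : measurable_fun setT (fun x => s n x - f x) by exact: measurable_funB.
have c_cvg : c n @[n --> \oo] --> 0.
  have := @Rdominated_convergence _ _ _ P (fun n x => 1 - cos (s n x - f x)) (fun=> 0) (fun=> 2).
  case=> [n||||_].
  - by apply: measurable_funB => //; exact: measurableT_comp.
  - move=> x; rewrite -[X in _ --> X](subrr (1:R)); apply: cvgB; first exact: cvg_cst.
    rewrite -[X in _ --> X](@cos0 R); apply: (continuous_cvg _ (@continuous_cos R 0)).
    by rewrite -[X in _ --> X](subrr (f x)); apply: cvgB => //; exact: cvg_cst.
  - exact: finite_measure_integrable_cst.
  - by move=> n x; rewrite ler_norml; have := cos_max (s n x - f x); rewrite ler_norml; lra.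
  - by rewrite Rintegral_prob_cst.
have Gd n m : G (fun x => s n x - s m x).
  have := cg_lin cG (-1) (Gs m) (Gs n).
  by congr G; apply/funext => x; ring.
pose v n m := ip P (fun x => s n x - s m x) (fun x => s n x - s m x).
have vc n m : 1 - expR (- (v n m / 2)) <= 2 * (c n + c m).
  rewrite -(cg_cos cG (Gd n m)) /c.
  have i1 k : P.-integrable setT (EFin \o (fun x => 1 - cos (s k x - f x))).
    apply: integrable_subR; first exact: finite_measure_integrable_cst.
    exact: bdd_int (@cos_max R) (msf k).
  have i2 : P.-integrable setT (EFin \o (fun x => cos (s n x - s m x))).
    by apply: bdd_int (@cos_max R) _ => //; exact: measurable_funB.
  have -> : 1 - \int[P]_x cos (s n x - s m x) = \int[P]_x (1 - cos (s n x - s m x)).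
    rewrite RintegralB// ?Rintegral_prob_cst//; exact: finite_measure_integrable_cst.
  rewrite -RintegralD// -RintegralZl//; last exact: integrable_addR.
  apply: le_Rintegral => //.
  - by apply: integrable_subR => //; exact: finite_measure_integrable_cst.
  - by apply: integrable_scaleR; exact: integrable_addR.
  - move=> x _; have := cos_dist (s n x - f x) (s m x - f x).
    by rewrite (_ : s n x - f x - (s m x - f x) = s n x - s m x); [lra|ring].
have key e : 0 < e -> \forall n \near \oo, (\int[P]_x (((s n x - f x) ^+ 2)%:E) <= e%:E)%E.
  (* [expR_small] asks for a bound at most 1/2 and loses a factor 4. *)
  move=> e0; pose e' := Num.min (2^-1) (e / 4).
  have e'0 : 0 < e' by rewrite lt_min invr_gt0 ltr0n divr_gt0.
  have e'4 : 0 < e' / 4 by rewrite divr_gt0.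
  move/cvgr0_norm_le: c_cvg => /(_ _ e'4)[N _ hN].
  exists N => // n /= Nn.
  apply: (@fatou_bound _ T R P (fun m x => (s n x - s m x) ^+ 2) _ e N).
  - by move=> m; apply: measurable_funX; exact: measurable_funB.
  - by move=> m x; exact: sqr_ge0.
  - move=> x; have h : s n x - s m x @[m --> \oo] --> s n x - f x by apply: cvgB => //; exact: cvg_cst.
    exact: cvg_sqrR.
  - move=> m Nm.
    have -> : (\int[P]_x ((s n x - s m x) ^+ 2)%:E = (v n m)%:E)%E.
      rewrite /v /ip /Rintegral fineK.
        by apply: eq_integral => x _; rewrite expr2.
      by apply: integrable_fin_num => //; apply: sqint_mul; exact: (cg_sqint cG (Gd n m)).
    rewrite lee_fin.
    have h : 1 - expR (- (v n m / 2)) <= e'.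
      apply: le_trans (vc n m) _.
      have := le_trans (ler_norm _) (hN _ Nn); have := le_trans (ler_norm _) (hN _ Nm).
      move: (c n) (c m) => x y; lra.
    apply: le_trans (expR_small (ip_ge0 _ _) (ltW e'0) _ h) _; first by rewrite ge_min lexx.
    have : e' <= e / 4 by rewrite ge_min lexx orbT.
    move: e' {e'0 e'4 hN h} => e'; lra.
have sd n : (\int[P]_x (((s n x - f x) ^+ 2)%:E) < +oo)%E -> sqint P (fun x => s n x - f x).
  move=> h; split => //; apply/integrableP; split.
    by apply/measurable_EFinP; exact: measurable_funX.
  by rewrite /=; under eq_integral do rewrite ger0_norm ?sqr_ge0//.
have [N _ hN] := key 1 ltr01.
have sf' : sqint P f.
  have := sqint_sub (cg_sqint cG (Gs N)) (sd N (le_lt_trans (hN N (leqnn N)) (ltry _))).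
  by congr sqint; apply/funext => x; ring.
split => //; apply/cvgrPdist_le => /= e e0; have := key e e0; apply: filterS => n h.
rewrite sub0r normrN ger0_norm ?ip_ge0// -lee_fin /ip /Rintegral fineK.
  by under eq_integral do rewrite -expr2.
have sn := sqint_sub (cg_sqint cG (Gs n)) sf'.
by apply: integrable_fin_num => //; exact: sqint_mul.
Qed.

Lemma cgauss_pw_closure G : cgauss G -> cgauss (pw_closure G).
Proof.
move=> cG; split.
- by exists (fun=> fun=> 0); [move=> _; exact: cg_0|move=> x; exact: cvg_cst].
- move=> a f g [s Gs sf] [r Gr rg]; exists (fun n x => a * s n x + r n x).
    by move=> n; exact: cg_lin.
  by move=> x; apply: cvgD => //; exact: cvgMr.
- by move=> f [s Gs sf]; case: (cgauss_sqint_cvg cG Gs sf).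
- move=> f [s Gs sf]; have [sqf h] := cgauss_sqint_cvg cG Gs sf.
  have ss n := cg_sqint cG (Gs n).
  have e g : \int[P]_x g x = ip P g (fun=> 1) by apply: eq_Rintegral => x _; rewrite mulr1.
  have := sqint_cvg ss sqf (sqint_cst P 1) h; rewrite -e.
  under eq_fun do rewrite -e (cg_mean cG (Gs _)).
  by move=> hc; apply: (cvg_unique _ hc) => //; exact: cvg_cst.
- move=> f [s Gs sf]; have [sqf h] := cgauss_sqint_cvg cG Gs sf.
  have ss n := cg_sqint cG (Gs n).
  have [_ h1] := @Rdominated_convergence _ _ _ P (fun n x => cos (s n x)) (fun x => cos (f x)) (fun=> 1)
    (fun n => measurableT_comp mcos (ss n).1)
    (fun x => continuous_cvg _ (@continuous_cos R _) (sf x))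
    (finite_measure_integrable_cst _ _ measurableT) (fun n x => cos_max _).
  apply: (cvg_unique _ h1) => //.
  rewrite (_ : (fun n => _) = (fun n => expR (- (ip P (s n) (s n) / 2)))); last first.
    by apply/funext => n; exact: (cg_cos cG).
  apply: (continuous_cvg _ (@continuous_expR R _)); apply: cvgN; apply: cvgMl.
  exact: sqint_cvg2.
- move=> f [s Gs sf]; have [sqf h] := cgauss_sqint_cvg cG Gs sf.
  have ss n := cg_sqint cG (Gs n).
  have [_ h1] := @Rdominated_convergence _ _ _ P (fun n x => sin (s n x)) (fun x => sin (f x)) (fun=> 1)
    (fun n => measurableT_comp msin (ss n).1)
    (fun x => continuous_cvg _ (@continuous_sin R _) (sf x))
    (finite_measure_integrable_cst _ _ measurableT) (fun n x => sin_max _).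
  apply: (cvg_unique _ h1) => //.
  rewrite (_ : (fun n => _) = (fun n => 0)); last first.
    by apply/funext => n; exact: (cg_sin cG).
  exact: cvg_cst.
Qed.

Lemma sub_pw_closure G : G `<=` pw_closure G.
Proof. by move=> f Gf; exists (fun=> f) => // x; exact: cvg_cst. Qed.

End gaussian_space.

(** Rounding the first argument down to the grid of mesh 1/(n+1) gives functions whose preimages are
    countable unions of rectangles; by continuity they converge to g. *)
Lemma measurable_caratheodory (R : realType) d (S : measurableType d) (g : R -> S -> R) :
  (forall s, continuous (g^~ s)) -> (forall x, measurable_fun setT (g x)) ->
  measurable_fun setT (fun z : R * S => g z.1 z.2).
Proof.
move=> cg mg.
pose h (n : nat) (k : int) : R := k%:~R / n.+1%:R.
pose fl (n : nat) (x : R) : int := Num.floor (x * n.+1%:R).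
apply: (@measurable_fun_cvg _ _ _ _ (fun n (z : R * S) => g (h n (fl n z.1)) z.2)) => //.
- move=> n _ B mB; rewrite setTI.
  have -> : (fun z : R * S => g (h n (fl n z.1)) z.2) @^-1` B =
      \bigcup_(k : int) ([set x | fl n x = k] `*` (g (h n k) @^-1` B)).
    apply/seteqP; split=> [[x s] /= H|[x s] [k _ [/= <-]]] //.
    by exists (fl n x).
  apply: countable_bigcupT_measurable => // k; apply: measurableX.
  + have -> : [set x | fl n x = k] = (fun x : R => x * n.+1%:R) @^-1` `[k%:~R, (k + 1)%:~R[.
      apply/seteqP; split=> x /=; rewrite in_itv/= /fl.
        by move=> <-; exact: floor_itv.
      by move/floor_def.
    rewrite -[X in measurable X]setTI.
    have : measurable_fun setT (fun x : R => x * n.+1%:R) by exact: measurable_funM.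
    by apply.
  + by rewrite -[X in measurable X]setTI; exact: mg.
- move=> [x s] _ /=.
  have hx : h n (fl n x) @[n --> \oo] --> x.
    apply: (@squeeze_cvgr _ _ _ _ (fun n => x - n.+1%:R^-1) (cst x)).
    - apply: nearW => n; rewrite /h /fl /=.
      have n0 : 0 < n.+1%:R :> R by rewrite ltr0n.
      have /andP[h1 h2] := floor_itv (x * n.+1%:R).
      rewrite ler_pdivrMr// h1 andbT ler_pdivlMr// mulrBl mulVf ?gt_eqF//.
      by rewrite lerBlDr; move: h2; rewrite intrD => /ltW.
    - rewrite -[X in _ --> X](subr0 x); apply: cvgB; first exact: cvg_cst.
      exact: cvg_harmonic.
    - exact: cvg_cst.
  exact: (cvg_comp _ _ hx (cg s x)).
Qed.

(** * Measurable functionals of a path *)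

Section path_functionals_measurable.
Context (R : realType).

Lemma derive_seq (f : R -> R) (t l : R) (u : nat -> R) : is_derive t (1:R) f l ->
  (forall n, u n != 0) -> u n @[n --> \oo] --> 0 ->
  (u n)^-1 * (f (t + u n) - f t) @[n --> \oo] --> l.
Proof.
move=> [df <-] u0 uc.
have h : (fun h : R => h^-1 *: (f (h + t) - f t)) x @[x --> 0^'] --> 'D_1 f t.
  have : (fun h : R => h^-1 *: ((f \o shift t) (h *: 1) - f t)) x @[x --> 0^'] --> 'D_1 f t by exact: df.
  by under eq_fun do rewrite /GRing.scale /= mulr1.
have /cvgr_dnbhsP /(_ u (conj u0 uc)) := h.
rewrite (_ : (fun n => _) = (fun n => (u n)^-1 *: (f (u n + t) - f t)))//.
by apply/funext => n; rewrite (addrC t).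
Qed.

Lemma measurable_path_derive t : measurable_fun setT (fun w : path R => (w : R -> R)^`()%classic t).
Proof.
apply: (@measurable_fun_cvg _ _ _ _ (fun n (w : path R) => (n.+1%:R^-1)^-1 * (w (t + n.+1%:R^-1) - w t))) => //.
  by move=> n; apply: measurable_funM => //; apply: measurable_funB; exact: measurable_path_eval.
move=> w _; have [d1 _ _] := C2_derive (path_C2 w).
by apply: (derive_seq (d1 t)) => //; exact: cvg_harmonic.
Qed.

Lemma measurable_path_derive2 t : measurable_fun setT (fun w : path R => derive1n 2 w t).
Proof.
apply: (@measurable_fun_cvg _ _ _ _ (fun n (w : path R) => (n.+1%:R^-1)^-1 *
    ((w : R -> R)^`()%classic (t + n.+1%:R^-1) - (w : R -> R)^`()%classic t))) => //.
  by move=> n; apply: measurable_funM => //; apply: measurable_funB; exact: measurable_path_derive.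
move=> w _; have [_ d2 _] := C2_derive (path_C2 w).
by apply: (derive_seq (d2 t)) => //; exact: cvg_harmonic.
Qed.

(** One family of observables for all three zeros: e = (1, 0) is the value, (0, 1) the slope, (0,
    -1) the opposite slope, so that downcrossings, maxima and minima are all downcrossings of some
    [Lf e w], with derivative [Lf' e w]. *)
Definition Lf (e : R * R) (w : R -> R) (t : R) : R := e.1 * w t + e.2 * w^`()%classic t.
Definition Lf' (e : R * R) (w : R -> R) (t : R) : R := e.1 * w^`()%classic t + e.2 * derive1n 2 w t.

Lemma Lf_derive e (w : R -> R) (t : R) : C2 w -> is_derive t (1:R) (Lf e w) (Lf' e w t).
Proof.
move=> /C2_derive[d1 d2 _]; have h1 := d1 t; have h2 := d2 t.
exact: (is_deriveD (is_deriveZ e.1 h1) (is_deriveZ e.2 h2)).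
Qed.

Lemma Lf_continuous e (w : R -> R) : C2 w -> continuous (Lf e w).
Proof.
move=> /C2_continuous[c0 c1 c2] t.
by apply: cvgD; apply: cvgMr; [exact: c0|exact: c1].
Qed.

Lemma Lf'_continuous e (w : R -> R) : C2 w -> continuous (Lf' e w).
Proof.
move=> /C2_continuous[c0 c1 c2] t.
by apply: cvgD; apply: cvgMr; [exact: c1|exact: c2].
Qed.

Lemma measurable_Lf2 e : measurable_fun setT (fun z : R * path R => Lf e z.2 z.1).
Proof.
apply: (@measurable_caratheodory _ _ _ (fun t (w : path R) => Lf e w t)).
  by move=> w; exact: Lf_continuous (path_C2 w).
move=> t; apply: measurable_funD; apply: measurable_funM => //.
  exact: measurable_path_eval.
exact: measurable_path_derive.
Qed.

Lemma measurable_Lf'2 e : measurable_fun setT (fun z : R * path R => Lf' e z.2 z.1).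
Proof.
apply: (@measurable_caratheodory _ _ _ (fun t (w : path R) => Lf' e w t)).
  by move=> w; exact: Lf'_continuous (path_C2 w).
move=> t; apply: measurable_funD; apply: measurable_funM => //.
  exact: measurable_path_derive.
exact: measurable_path_derive2.
Qed.

Lemma measurable_Lf d (S : measurableType d) e (t : S -> R) (w : S -> path R) :
  measurable_fun setT t -> measurable_fun setT w -> measurable_fun setT (fun s => Lf e (w s) (t s)).
Proof.
move=> mt mw; have mp : measurable_fun setT (fun s => (t s, w s)) by exact: measurable_fun_pair.
exact: (measurableT_comp (measurable_Lf2 e) mp).
Qed.

Lemma measurable_Lf' d (S : measurableType d) e (t : S -> R) (w : S -> path R) :
  measurable_fun setT t -> measurable_fun setT w -> measurable_fun setT (fun s => Lf' e (w s) (t s)).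
Proof.
move=> mt mw; have mp : measurable_fun setT (fun s => (t s, w s)) by exact: measurable_fun_pair.
exact: (measurableT_comp (measurable_Lf'2 e) mp).
Qed.

Definition padd (w : R -> R) (a : R) (k : R -> R) : path R := mkpath (fun t => w t + a * k t).

Lemma paddE w a k : C2 w -> C2 k -> padd w a k = (fun t => w t + a * k t) :> (R -> R).
Proof. by move=> cw ck; apply: mkpathE; case: (C2_lin a cw ck). Qed.

Lemma padd_derive w a k t : C2 w -> C2 k ->
  (padd w a k : R -> R)^`()%classic t = w^`()%classic t + a * k^`()%classic t.
Proof. by move=> cw ck; rewrite paddE//; case: (C2_lin a cw ck) => _ ->. Qed.

Lemma padd_derive2 w a k t : C2 w -> C2 k ->
  derive1n 2 (padd w a k) t = derive1n 2 w t + a * derive1n 2 k t.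
Proof. by move=> cw ck; rewrite paddE//; case: (C2_lin a cw ck) => _ _ ->. Qed.

Lemma Lf_padd e w a k t : C2 w -> C2 k -> Lf e (padd w a k) t = Lf e w t + a * Lf e k t.
Proof. by move=> cw ck; rewrite /Lf padd_derive// paddE//; ring. Qed.

Lemma Lf'_padd e w a k t : C2 w -> C2 k -> Lf' e (padd w a k) t = Lf' e w t + a * Lf' e k t.
Proof.
move=> cw ck; rewrite /Lf' padd_derive// padd_derive2//.
by move: (derive1n 2 w t) (derive1n 2 k t) (w^`()%classic t) (k^`()%classic t) => *; ring.
Qed.

Lemma measurable_padd d (S : measurableType d) (w k : S -> path R) (a : S -> R) :
  measurable_fun setT w -> measurable_fun setT a -> measurable_fun setT k ->
  measurable_fun setT (fun s => padd (w s) (a s) (k s)).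
Proof.
move=> /measurable_pathP mw ma /measurable_pathP mk; apply/measurable_pathP => t.
under eq_fun do rewrite (paddE _ (path_C2 _) (path_C2 _)).
by apply: measurable_funD => //; exact: measurable_funM.
Qed.

End path_functionals_measurable.

Lemma ge0_integral_normal_prob (R : realType) (s : R) (f : R -> \bar R) :
  measurable_fun setT f -> (forall x, 0 <= f x)%E ->
  (\int[normal_prob 0 s]_x f x = \int[lebesgue_measure]_x (f x * (normal_pdf 0 s x)%:E))%E.
Proof.
move=> mf0 f0.
have mf : @measurable_fun _ _ (measurableTypeR R) _ setT f := mf0.
have mp : @measurable_fun _ _ (measurableTypeR R) _ setT (normal_pdf 0 s) := measurable_normal_pdf 0 s.
by rewrite -(ge0_integral_mdens _ mp (normal_pdf_ge0 0 s)).
Qed.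

(** * Regression of a Gaussian path on a Gaussian variable *)

Section gaussian_process_theory.
Context d (T : measurableType d) (R : realType) (P : probability T R).
Notation mu := (@lebesgue_measure R).
Variable G : set (T -> R).
Hypothesis cG : cgauss P G.

Lemma cg_scale a f : G f -> G (fun x => a * f x).
Proof.
by move=> Gf; have := cg_lin cG a Gf (cg_0 cG); congr G; apply/funext => x; rewrite addr0.
Qed.

Lemma cg_add a b f g : G f -> G g -> G (fun x => a * f x + b * g x).
Proof. by move=> Gf Gg; apply: (cg_lin cG) => //; exact: cg_scale. Qed.

Lemma cg_sub a f g : G f -> G g -> G (fun x => f x - a * g x).
Proof. by move=> Gf Gg; have := cg_add 1 (- a) Gf Gg; congr G; apply/funext => x; ring. Qed.

(** Since [G] contains only centred variables, [m] is the mean path. The derivatives are listed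
    because [G] is not assumed closed under limits. *)
Record gproc (X : T -> path R) (m : path R) : Prop := GProc {
  gp_meas : measurable_fun setT X ;
  gp_eval : forall t, G (fun x => X x t - m t) ;
  gp_derive : forall t, G (fun x => (X x : R -> R)^`()%classic t - (m : R -> R)^`()%classic t) ;
  gp_derive2 : forall t, G (fun x => derive1n 2 (X x) t - derive1n 2 m t) }.

Section regression.
Variables (X : T -> path R) (m : path R).
Hypothesis gX : gproc X m.

Definition cL (e : R * R) (t : R) (x : T) : R := Lf e (X x) t - Lf e m t.

Lemma cL_G e t : G (cL e t).
Proof.
have := cg_add e.1 e.2 (gp_eval gX t) (gp_derive gX t).
by congr G; apply/funext => x; rewrite /cL /Lf; ring.
Qed.

(** The regression function of the process on [U], equal to 0 if [U] has variance 0. *)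
Definition kfun (U : T -> R) (t : R) : R := ip P (fun x => X x t - m t) U / ip P U U.

(** Difference quotients of Z are elements of [G] that converge pointwise, hence in mean square, so
    the derivative passes inside the pairing. *)
Let ipc (U : T -> R) (Z Z' : R -> T -> R) : sqint P U -> (forall t, G (Z t)) -> (forall t, G (Z' t)) ->
  (forall x (t : R), is_derive t (1:R) (Z^~ x) (Z' t x)) ->
  forall t : R, is_derive t (1:R) (fun t => ip P (Z t) U) (ip P (Z' t) U).
Proof.
move=> sU GZ GZ' dZ t.
have cv : (fun h => h^-1 *: (ip P (Z (h + t)) U - ip P (Z t) U)) h @[h --> 0^'] --> ip P (Z' t) U.
  apply/cvgr_dnbhsP => u [u0 uc].
  pose q n x := (u n)^-1 * (Z (t + u n) x - Z t x).
  have Gq n : G (q n).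
    apply: cg_scale; have := cg_sub 1 (GZ (t + u n)) (GZ t).
    by congr G; apply/funext => x; rewrite mul1r.
  have qc x : q n x @[n --> \oo] --> Z' t x by exact: (derive_seq (dZ x t)).
  have [sZ h] := cgauss_sqint_cvg cG Gq qc.
  have := sqint_cvg (fun n => cg_sqint cG (Gq n)) sZ sU h.
  rewrite (_ : (fun n => ip P (q n) U) = (fun n => (u n)^-1 *: (ip P (Z (u n + t)) U - ip P (Z t) U)))//.
  apply/funext => n; rewrite /q ip_scalel//; last first.
    by apply: sqint_sub; exact: (cg_sqint cG).
  by rewrite ip_sub//; try exact: (cg_sqint cG); rewrite (addrC t).
apply: DeriveDef.
  apply/cvg_ex; exists (ip P (Z' t) U).
  by under eq_fun do rewrite /= [_ *: 1]mulr1.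
apply/cvg_lim => //.
by under eq_fun do rewrite /= [_ *: 1]mulr1.
Qed.

Let ipcont (U : T -> R) (Z : R -> T -> R) : sqint P U -> (forall t, G (Z t)) ->
  (forall x, continuous (Z^~ x)) -> continuous (fun t => ip P (Z t) U).
Proof.
move=> sU GZ cZ t; apply/(@cvg_nbhsP R R^o) => u ut.
have qc x : Z (u n) x @[n --> \oo] --> Z t x by exact: (cvg_comp _ _ ut (cZ x t)).
have [sZ h] := cgauss_sqint_cvg cG (fun n => GZ (u n)) qc.
exact: (sqint_cvg (fun n => cg_sqint cG (GZ (u n))) sZ sU h).
Qed.

Lemma kfun_C2 U : sqint P U ->
  [/\ C2 (kfun U),
    (kfun U)^`()%classic = (fun t => ip P (fun x => (X x : R -> R)^`()%classic t - (m : R -> R)^`()%classic t) U / ip P U U) &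
    derive1n 2 (kfun U) = (fun t => ip P (fun x => derive1n 2 (X x) t - derive1n 2 m t) U / ip P U U)].
Proof.
move=> sU.
have dp (w : path R) := C2_derive (path_C2 w).
have d0 x (t : R) : is_derive t (1:R) (fun t => X x t - m t)
    ((X x : R -> R)^`()%classic t - (m : R -> R)^`()%classic t).
  have [a1 _ _] := dp (X x); have [b1 _ _] := dp m.
  exact: (is_deriveB (a1 t) (b1 t)).
have d1 x (t : R) : is_derive t (1:R) (fun t => (X x : R -> R)^`()%classic t - (m : R -> R)^`()%classic t)
    (derive1n 2 (X x) t - derive1n 2 m t).
  have [_ a1 _] := dp (X x); have [_ b1 _] := dp m.
  exact: (is_deriveB (a1 t) (b1 t)).
have c2 x : continuous (fun t => derive1n 2 (X x) t - derive1n 2 m t).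
  have [_ _ a1] := dp (X x); have [_ _ b1] := dp m.
  by move=> t; apply: cvgB; [exact: a1|exact: b1].
have h1 := ipc sU (gp_eval gX) (gp_derive gX) d0.
have h2 := ipc sU (gp_derive gX) (gp_derive2 gX) d1.
have h3 := ipcont sU (gp_derive2 gX) c2.
have sc (f f' : R -> R) : (forall t : R, is_derive t (1:R) f (f' t)) ->
    forall t : R, is_derive t (1:R) (fun t => f t / ip P U U) (f' t / ip P U U).
  move=> df t; have := is_deriveZ (ip P U U)^-1 (df t).
  rewrite [_ *: _]mulrC (_ : _ \*: f = (fun t => f t / ip P U U))//.
  by apply/funext => y /=; rewrite [_ *: _]mulrC.
apply: (C2I (sc _ _ h1) (sc _ _ h2)).
by move=> t; apply: cvgMl; exact: h3.
Qed.

Definition kpath U : path R := mkpath (kfun U).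

Lemma kpathE U : sqint P U -> kpath U = kfun U :> (R -> R).
Proof. by move=> sU; apply: mkpathE; case: (kfun_C2 sU). Qed.

Lemma Lf_kpath e U t : sqint P U -> Lf e (kpath U) t = ip P (cL e t) U / ip P U U.
Proof.
move=> sU; have [_ d1 _] := kfun_C2 sU; rewrite /Lf kpathE// d1 /kfun.
rewrite !mulrA -mulrDl; congr (_ / _).
have s1 := cg_sqint cG (gp_eval gX t); have s2 := cg_sqint cG (gp_derive gX t).
rewrite -ip_linl//; congr ip; apply/funext => x; rewrite /cL /Lf; ring.
Qed.

End regression.

End gaussian_process_theory.

Section regression_formula.
Context d (T : measurableType d) (R : realType) (P : probability T R).
Notation mu := (@lebesgue_measure R).
Variable G : set (T -> R).
Hypothesis cG : cgauss P G.

Let mcos : measurable_fun setT (@cos R).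
Proof. exact: continuous_measurable_fun (@continuous_cos R). Qed.
Let msin : measurable_fun setT (@sin R).
Proof. exact: continuous_measurable_fun (@continuous_sin R). Qed.

Lemma bounded_integrable d' (T' : measurableType d') (P' : probability T' R) (f : T' -> R) (C : R) :
  measurable_fun setT f -> (forall x, `|f x| <= C) -> P'.-integrable setT (EFin \o f).
Proof.
move=> mf fC; apply: (@le_integrable _ _ _ P' setT measurableT _ (EFin \o cst C)).
- exact/measurable_EFinP.
- by move=> x _; rewrite /= lee_fin (le_trans (fC x))// ler_norm.
- exact: finite_measure_integrable_cst.
Qed.

Lemma cgauss_trig_shift (a : R) f : G f ->
  \int[P]_x cos (a + f x) = cos a * expR (- (ip P f f / 2)) /\
  \int[P]_x sin (a + f x) = sin a * expR (- (ip P f f / 2)).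
Proof.
move=> Gf; have [mf _] := cg_sqint cG Gf.
have ic : P.-integrable setT (EFin \o (fun x => cos (f x))).
  by apply: (@bounded_integrable _ _ _ _ 1) => [|x]; [exact: measurableT_comp|exact: cos_max].
have is_ : P.-integrable setT (EFin \o (fun x => sin (f x))).
  by apply: (@bounded_integrable _ _ _ _ 1) => [|x]; [exact: measurableT_comp|exact: sin_max].
have ec := cg_cos cG Gf; have es := cg_sin cG Gf.
split.
  under eq_Rintegral do rewrite cosD.
  rewrite RintegralB//; [|exact: integrable_scaleR|exact: integrable_scaleR].
  by rewrite !RintegralZl// ec es mulr0 subr0.
under eq_Rintegral do rewrite sinD.
rewrite RintegralD//; [|exact: integrable_scaleR|exact: integrable_scaleR].
by rewrite !RintegralZl// ec es mulr0 addr0.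
Qed.

Lemma normal_trig_shift (s a c : R) : s != 0 ->
  \int[mu]_u (cos (a + c * u) * normal_pdf 0 s u) = cos a * expR (- (c ^+ 2 * s ^+ 2 / 2)) /\
  \int[mu]_u (sin (a + c * u) * normal_pdf 0 s u) = sin a * expR (- (c ^+ 2 * s ^+ 2 / 2)).
Proof.
move=> s0.
have mac : measurable_fun setT (fun u : R => a + c * u).
  by apply: measurable_funD => //; exact: measurable_funM.
have ic : mu.-integrable setT (EFin \o (fun u => cos (c * u) * normal_pdf 0 s u)).
  apply: (@integrable_normal_mul R s 1) => // [|x].
    by apply: measurableT_comp => //; exact: measurable_funM.
  by rewrite mul1r (le_trans (cos_max _))// lerDl sqr_ge0.
have is_ : mu.-integrable setT (EFin \o (fun u => sin (c * u) * normal_pdf 0 s u)).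
  apply: (@integrable_normal_mul R s 1) => // [|x].
    by apply: measurableT_comp => //; exact: measurable_funM.
  by rewrite mul1r (le_trans (sin_max _))// lerDl sqr_ge0.
rewrite (mulrC (c ^+ 2)).
split.
  under eq_Rintegral do rewrite cosD mulrBl -!mulrA.
  rewrite RintegralB//; [|exact: integrable_scaleR|exact: integrable_scaleR].
  by rewrite !RintegralZl// normal_cos// normal_sin// mulr0 subr0.
under eq_Rintegral do rewrite sinD mulrDl -!mulrA.
rewrite RintegralD//; [|exact: integrable_scaleR|exact: integrable_scaleR].
by rewrite !RintegralZl// normal_cos// normal_sin// mulr0 addr0.
Qed.

Lemma normal_prob_trig (s a c : R) : s != 0 ->
  \int[normal_prob 0 s]_u cos (a + c * u) = cos a * expR (- (c ^+ 2 * s ^+ 2 / 2)) /\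
  \int[normal_prob 0 s]_u sin (a + c * u) = sin a * expR (- (c ^+ 2 * s ^+ 2 / 2)).
Proof.
move=> s0.
have bd (f : R -> R) : measurable_fun setT f -> (forall x, `|f x| <= 1) ->
    \int[normal_prob 0 s]_u f u = \int[mu]_u (f u * normal_pdf 0 s u).
  move=> mf f1.
  have i1 : (normal_prob 0 s).-integrable setT (EFin \o f).
    exact: (@bounded_integrable _ _ (normal_prob 0 s) f 1).
  have i2 : (normal_prob 0 s).-integrable setT (EFin \o (fun=> 1 : R)).
    exact: finite_measure_integrable_cst.
  have i3 := integrable_normal_pdf 0 s.
  have i4 : mu.-integrable setT (EFin \o (fun u => f u * normal_pdf 0 s u)).
    apply: (@integrable_normal_mul R s 1) => // x.
    by rewrite mul1r (le_trans (f1 x))// lerDl sqr_ge0.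
  (* Adding 1 makes the integrand nonnegative, where the density formula holds; the constant cancels
     afterwards. *)
  have e : \int[normal_prob 0 s]_u (1 + f u) = \int[mu]_u (normal_pdf 0 s u + f u * normal_pdf 0 s u).
    rewrite /Rintegral (ge0_integral_normal_prob s (f := fun u => (1 + f u)%:E)).
    - by congr fine; apply: eq_integral => u _; rewrite -EFinM mulrDl mul1r.
    - by apply/measurable_EFinP; exact: measurable_funD.
    - by move=> u; rewrite lee_fin; have := f1 u; rewrite ler_norml; lra.
  move: e; rewrite RintegralD// RintegralD//.
  rewrite (Rintegral_prob_cst (normal_prob 0 s)) [X in _ = X + _ -> _](_ : _ = 1).
    by move/addrI.
  by rewrite /Rintegral integral_normal_pdf.
have mac : measurable_fun setT (fun u : R => a + c * u).
  by apply: measurable_funD => //; exact: measurable_funM.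
have [hc hs] := normal_trig_shift a c s0.
split; rewrite bd//; try exact: measurableT_comp.
  by move=> x; exact: cos_max.
by move=> x; exact: sin_max.
Qed.

Lemma Rintegral_prod_bounded d1 d2 (T1 : measurableType d1) (T2 : measurableType d2)
    (P1 : probability T1 R) (P2 : probability T2 R) (f : T1 * T2 -> R) (C : R) :
  measurable_fun setT f -> (forall z, `|f z| <= C) ->
  \int[(P1 \x P2)%E]_z f z = \int[P1]_x \int[P2]_y f (x, y).
Proof.
move=> mf fC.
have if_ : (P1 \x P2)%E.-integrable setT (EFin \o f) by exact: bounded_integrable fC.
rewrite /Rintegral -(integral12_prod_meas1 if_); congr fine; apply: eq_integral => x _.
rewrite /fubini_F /= fineK//; apply: integrable_fin_num => //.
apply: (@bounded_integrable _ _ P2 (fun y => f (x, y)) C) => //.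
by apply: (measurableT_comp mf); exact: pair1_measurable.
Qed.

Variables (X : T -> path R) (m : path R).
Hypothesis gX : gproc G X m.

Lemma comb_lin (w k : R -> R) (a : R) l : comb (fun t => w t + a * k t) l = comb w l + a * comb k l.
Proof.
rewrite /comb mulr_sumr -big_split/=; apply: eq_bigr => p _; ring.
Qed.

Lemma comb_G l : G (fun x => comb (X x) l - comb m l).
Proof.
elim: l => [|p l IH].
  have := cg_0 cG; congr G; apply/funext => x.
  by rewrite /comb !big_nil subrr.
have := cg_add cG p.1 1 (gp_eval gX p.2) IH.
by congr G; apply/funext => x; rewrite /comb !big_cons; ring.
Qed.

Lemma comb_kfun U l : sqint P U ->
  comb (kfun P X m U) l = ip P (fun x => comb (X x) l - comb m l) U / ip P U U.
Proof.
move=> sU; elim: l => [|p l IH].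
  rewrite /comb !big_nil.
  rewrite (_ : (fun=> _) = (fun=> 0)); last by apply/funext => x; rewrite big_nil subrr.
  by have := ip_scalel 0 sU sU; under eq_fun do rewrite mul0r; rewrite /ip => ->; rewrite !mul0r.
rewrite {1}/comb big_cons -/(comb _ l) IH /kfun mulrA -mulrDl; congr (_ / _).
rewrite -[X in _ + X]mul1r -ip_linl//; [|exact: (cg_sqint cG (gp_eval gX p.2))|exact: (cg_sqint cG (comb_G l))].
by congr ip; apply/funext => x; rewrite /comb !big_cons; ring.
Qed.

(** The residual of the regression on [U] is independent of [U], so replacing [U] by an independent
    normal variable u of the same variance preserves the law of the path. On transforms this says
    that the variance of a combination is that of its residual plus (comb k l)^2 s^2. *)
Lemma regression_formula (U : T -> R) (s : R) (Phi : path R -> \bar R) :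
  G U -> 0 < s -> ip P U U = s ^+ 2 ->
  measurable_fun setT Phi -> (forall w, 0 <= Phi w)%E ->
  (\int[P]_x Phi (X x) =
   \int[mu]_u ((normal_pdf 0 s u)%:E * \int[P]_x Phi (padd (X x) (u - U x) (kpath P X m U))))%E.
Proof.
move=> GU s0 Us mPhi Phi0.
have sn0 : s != 0 by rewrite gt_eqF.
have sU := cg_sqint cG GU; have [mU _] := sU.
have mX := gp_meas gX.
set k := kpath P X m U.
have ck := path_C2 k; have cX x := path_C2 (X x).
pose X2 (z : T * R) : path R := padd (X z.1) (z.2 - U z.1) k.
have mX2 : measurable_fun setT X2.
  apply: measurable_padd => //.
  - by apply: measurableT_comp => //; exact: measurable_fst.
  - apply: measurable_funB; first exact: measurable_snd.
    by apply: measurableT_comp => //; exact: measurable_fst.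
have mcb l := measurable_comb l mX2.
have cX2 l z : comb (X2 z) l = comb m l + ((comb (X z.1) l - comb m l) - comb k l * U z.1) + comb k l * z.2.
  have e : X2 z = (fun t => X z.1 t + (z.2 - U z.1) * k t) :> (R -> R) by exact: (paddE _ (cX z.1) ck).
  apply: (etrans (congr1 (fun f : R -> R => comb f l) e)).
  apply: (etrans (comb_lin (X z.1) k (z.2 - U z.1) l)).
  by move: (comb (X z.1) l) (comb m l) (comb k l) => *; ring.
have Gl l : G (fun x => (comb (X x) l - comb m l) - comb k l * U x).
  by apply: (cg_sub cG) => //; exact: comb_G.
have kE l : comb k l = ip P (fun x => comb (X x) l - comb m l) U / s ^+ 2.
  by rewrite /k (kpathE cG gX sU) comb_kfun// Us.
have ipE l : ip P (fun x => (comb (X x) l - comb m l) - comb k l * U x) (fun x => (comb (X x) l - comb m l) - comb k l * U x)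
   = ip P (fun x => comb (X x) l - comb m l) (fun x => comb (X x) l - comb m l) - comb k l ^+ 2 * s ^+ 2.
  have := ip_quad 1 (- comb k l) (cg_sqint cG (comb_G l)) sU.
  rewrite (_ : (fun x => _) = (fun x => comb (X x) l - comb m l - comb k l * U x)); last by apply/funext => x; ring.
  move=> ->; rewrite Us; have := kE l.
  set b := ip P _ U; set a := ip P _ _; move: (comb k l) b a => c b a ->.
  by field.
pose Q := (P \x normal_prob 0 s)%E.
have T2E (c : R -> R) (q : R -> R) l : measurable_fun setT c -> (forall x, `|c x| <= 1) ->
    (forall a b, \int[normal_prob 0 s]_u c (a + b * u) = c a * expR (- (b ^+ 2 * s ^+ 2 / 2))) ->
    (forall a f, G f -> \int[P]_x c (a + f x) = c a * expR (- (ip P f f / 2))) ->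
    \int[P]_x c (comb (X x) l) = \int[Q]_z c (comb (X2 z) l).
  move=> mc c1 hN hG.
  have mcX : measurable_fun setT (fun z => c (comb (X2 z) l)) by exact: measurableT_comp.
  rewrite /Q (@Rintegral_prod_bounded _ _ T (measurableTypeR R) P (normal_prob 0 s) _ 1 mcX (fun z => c1 _)).
  under [RHS]eq_Rintegral do (under eq_Rintegral do rewrite cX2); rewrite /=.
  under [RHS]eq_Rintegral do rewrite hN mulrC.
  rewrite RintegralZl//; last first.
    apply: (@bounded_integrable _ _ P _ 1) => // ; apply: measurableT_comp => //.
    by apply: measurable_funD => //; case: (cg_sqint cG (Gl l)).
  rewrite hG// ipE [RHS]mulrC -[RHS]mulrA -expRD.
  transitivity (\int[P]_x c (comb m l + (comb (X x) l - comb m l))).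
    by apply: eq_Rintegral => x _; congr c; ring.
  by rewrite hG//; [congr (_ * expR _); ring|exact: comb_G].
transitivity (\int[Q]_z Phi (X2 z))%E.
  apply: (@law_eq R _ _ T (T * measurableTypeR R)%type X X2 mX mX2 P (P \x normal_prob 0 s)%E) => //.
  - by move=> l; apply: T2E => // [x|a b|a f Gf]; [exact: cos_max|case: (normal_prob_trig a b sn0)|case: (cgauss_trig_shift a Gf)].
  - by move=> l; apply: T2E => // [x|a b|a f Gf]; [exact: sin_max|case: (normal_prob_trig a b sn0)|case: (cgauss_trig_shift a Gf)].
have mPX : measurable_fun setT (fun z => Phi (X2 z)) by exact: measurableT_comp.
apply: (etrans (@fubini_tonelli2 _ _ T (measurableTypeR R) R P (normal_prob 0 s) (fun z => Phi (X2 z)) mPX (fun z => Phi0 _))).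
rewrite ge0_integral_normal_prob//=.
- by apply: eq_integral => u _; rewrite muleC.
- exact: (@measurable_fun_fubini_tonelli_G _ _ T (measurableTypeR R) R P (fun z => Phi (X2 z))).
- by move=> u; apply: integral_ge0.
Qed.

End regression_formula.

(** * Changing the direction of a slide *)

Section gaussian_tilt.
Context d (T : measurableType d) (R : realType) (P : probability T R).
Notation mu := (@lebesgue_measure R).

Let Rintegral_shift (c : R) (f : R -> R) : measurable_fun setT f ->
  \int[mu]_x f x = \int[mu]_x f (c + x).
Proof.
move=> mf; have e : (\int[mu]_x (f x)%:E = \int[mu]_x (f (c + x))%:E)%E.
  have mE : measurable_fun setT (EFin \o f) by exact/measurable_EFinP.
  have e1 : (\int[mu]_x (fun x => (f x)%:E)^\+ x = \int[mu]_x (fun x => (f (c + x))%:E)^\+ x)%E.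
    have p x : (0 <= (EFin \o f)^\+ x)%E by exact: funepos_ge0.
    rewrite (_ : (\int[mu]_x (fun x => (f (c + x))%:E)^\+ x = \int[mu]_x (EFin \o f)^\+ (c + x)%R)%E); last first.
      by apply: eq_integral => x _; rewrite !funeposE.
    exact: (@ge0_integral_shift R c (EFin \o f)^\+%E (measurable_funepos mE) p).
  have e2 : (\int[mu]_x (fun x => (f x)%:E)^\- x = \int[mu]_x (fun x => (f (c + x))%:E)^\- x)%E.
    have p x : (0 <= (EFin \o f)^\- x)%E by exact: funeneg_ge0.
    rewrite (_ : (\int[mu]_x (fun x => (f (c + x))%:E)^\- x = \int[mu]_x (EFin \o f)^\- (c + x)%R)%E); last first.
      by apply: eq_integral => x _; rewrite !funenegE.
    exact: (@ge0_integral_shift R c (EFin \o f)^\-%E (measurable_funeneg mE) p).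
  by rewrite integralE [RHS]integralE e1 e2.
by rewrite /Rintegral e.
Qed.

Let trig_measurable (q : R -> R) : q = cos \/ q = sin ->
  [/\ measurable_fun setT q, forall x, `|q x| <= 1 &
    forall x y, q x * cos y = 2^-1 * (q (x + y) + q (x - y))].
Proof.
case=> ->; split.
- exact: continuous_measurable_fun (@continuous_cos R).
- exact: cos_max.
- by move=> x y; rewrite !cosD cosN sinN; field.
- exact: continuous_measurable_fun (@continuous_sin R).
- exact: sin_max.
- by move=> x y; rewrite !sinD cosN sinN; field.
Qed.

Let normal_peakV (s r : R) : 0 < s -> 0 < r ->
  normal_peak s^-1 = normal_peak r^-1 * (s / r).
Proof.
move=> s0 r0; have e (a : R) : 0 < a -> normal_peak a^-1 = a * (Num.sqrt (pi *+ 2))^-1.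
  move=> a0; rewrite /normal_peak -mulrnAr sqrtrM ?sqr_ge0// sqrtr_sqr ger0_norm ?invr_ge0 ?ltW//.
  by rewrite invfM invrK.
by rewrite !e//; field; rewrite (gt_eqF r0) gt_eqF// sqrtr_gt0 pmulrn_lgt0// pi_gt0.
Qed.

(** Completing the square: the exponential factor times the density of deviation 1/s is a constant
    times the normal density of deviation 1/r centred at - c / r^2, whose transform is known. *)
Lemma normal_tilt (q : R -> R) (a b c v s r : R) : q = cos \/ q = sin ->
  0 < s -> 0 < r -> r ^+ 2 = s ^+ 2 + v ->
  let F u := q (a + b * u) * expR (- ((2 * u * c + u ^+ 2 * v) / 2)) * normal_pdf 0 s^-1 u in
  mu.-integrable setT (EFin \o F) /\
  \int[mu]_u F u =
  q (a - b * c / r ^+ 2) * expR ((c ^+ 2 - b ^+ 2) / (2 * r ^+ 2)) * (s / r).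
Proof.
move=> hq s0 r0 rE F; have [mq q1 _] := trig_measurable hq.
have sn : s != 0 by rewrite gt_eqF. have rn : r != 0 by rewrite gt_eqF.
have si : s^-1 != 0 by rewrite invr_eq0. have ri : r^-1 != 0 by rewrite invr_eq0.
have mab (a' : R) : measurable_fun setT (fun u : R => a' + b * u).
  by apply: measurable_funD => //; exact: measurable_funM.
pose m := - (c / r ^+ 2).
pose K := expR (c ^+ 2 / (2 * r ^+ 2)) * (s / r).
have FE : F = fun u => K * (q (a + b * u) * normal_pdf m r^-1 u).
  apply/funext => u; rewrite /F !normal_pdfE// /normal_fun !subr0 (normal_peakV s0 r0) /K /m.
  have e : expR (- ((2 * u * c + u ^+ 2 * v) / 2)) * expR (- u ^+ 2 / ((s^-1) ^+ 2 *+ 2)) =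
      expR (c ^+ 2 / (2 * r ^+ 2)) * expR (- (u - - (c / r ^+ 2)) ^+ 2 / ((r^-1) ^+ 2 *+ 2)).
    rewrite -!expRD; congr expR.
    have -> : v = r ^+ 2 - s ^+ 2 by rewrite rE; ring.
    by field; rewrite sn rn.
  move: e; set E1 := expR _; set E2 := expR _; set E3 := expR _; set E4 := expR _ => e.
  rewrite [LHS](_ : _ = q (a + b * u) * normal_peak r^-1 * (s / r) * (E1 * E2)); last by ring.
  by rewrite e; ring.
have mqu a' : measurable_fun setT (fun u => q (a' + b * u)) by exact: measurableT_comp.
have iF : mu.-integrable setT (EFin \o (fun u => q (a + b * u) * normal_pdf m r^-1 u)).
  apply: (@integrable_bounded_mul _ _ R mu id (normal_pdf m r^-1) (@measurable_id _ _ setT) (integrable_normal_pdf m r^-1)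
    (fun u => q (a + b * u)) 1) => //.
rewrite FE; split; first exact: integrable_scaleR.
rewrite RintegralZl// (Rintegral_shift m); last first.
  by apply: measurable_funM => //; exact: measurable_normal_pdf.
rewrite (_ : \int[mu]_x _ = q (a - b * c / r ^+ 2) * expR (- (b ^+ 2 * r^-1 ^+ 2 / 2))).
  rewrite /K; set x := q _; transitivity (x * (expR (c ^+ 2 / (2 * r ^+ 2)) * expR (- (b ^+ 2 * r^-1 ^+ 2 / 2))) * (s / r)).
    by move: (expR _) (expR _) => *; ring.
  by rewrite -expRD; congr (_ * expR _ * _); field.
transitivity (\int[mu]_u (q ((a - b * c / r ^+ 2) + b * u) * normal_pdf 0 r^-1 u)).
  apply: eq_Rintegral => u _; rewrite normal_pdf_center//; congr (q _ * normal_pdf _ _ _); rewrite /m; by field.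
by case: hq => ->; case: (normal_trig_shift (a - b * c / r ^+ 2) b ri).
Qed.

Variable G : set (T -> R).
Hypothesis cG : cgauss P G.

(* The weight is written as the Fourier transform of a normal density; the
   Gaussian integral in the Fourier variable then has complex shift. *)
Lemma cgauss_weighted_trig (q : R -> R) (a h s r : R) f g : q = cos \/ q = sin ->
  G f -> G g -> 0 < s -> 0 < r -> r ^+ 2 = s ^+ 2 + ip P g g ->
  \int[P]_x (q (a + f x) * normal_pdf 0 s (g x - h)) =
  q (a + ip P f g * h / r ^+ 2) * expR (- ((ip P f f - ip P f g ^+ 2 / r ^+ 2) / 2)) *
    normal_pdf 0 r h.
Proof.
move=> hq Gf Gg s0 r0 rE; have [mq q1 qp] := trig_measurable hq.
have sn : s != 0 by rewrite gt_eqF. have rn : r != 0 by rewrite gt_eqF.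
have si : s^-1 != 0 by rewrite invr_eq0.
have sf := cg_sqint cG Gf; have sg := cg_sqint cG Gg.
have [mf _] := sf; have [mg _] := sg.
have maf : measurable_fun setT (fun x => a + f x) by exact: measurable_funD.
have mqf : measurable_fun setT (fun x => q (a + f x)) by exact: measurableT_comp.
have mcos : measurable_fun setT (@cos R) by exact: continuous_measurable_fun (@continuous_cos R).
pose k (z : R * R) := cos ((z.1 - h) * z.2) * normal_pdf 0 s^-1 z.2.
have mk : measurable_fun setT k.
  apply: measurable_funM; last by apply: measurableT_comp => //; exact: measurable_normal_pdf.
  by apply: measurableT_comp => //; apply: measurable_funM => //; exact: measurable_funB.
have kb z : `|k z| <= normal_pdf 0 s^-1 z.2.
  rewrite /k normrM [X in _ * X]ger0_norm ?normal_pdf_ge0//.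
  by rewrite ler_piMl ?normal_pdf_ge0// cos_max.
have ps : normal_peak s != 0 by rewrite gt_eqF// normal_peak_gt0.
have kE x : \int[mu]_u k (g x, u) = normal_pdf 0 s (g x - h) / normal_peak s.
  rewrite -normal_pdf_center// normal_pdf_fourier// mulrAC divff// mul1r.
  by apply: eq_Rintegral => u _; rewrite /k /= -cosN; congr (cos _ * _); ring.
have iq : P.-integrable setT (EFin \o (fun x => q (a + f x))).
  by apply: (@bounded_integrable _ _ _ P _ 1).
transitivity (normal_peak s * \int[P]_x ((\int[mu]_u k (g x, u)) * q (a + f x))).
  under [in RHS]eq_Rintegral do rewrite kE.
  rewrite -RintegralZl//; last first.
    apply: (@bounded_integrable _ _ _ P _ 1).
      apply: measurable_funM => //; apply: measurable_funM => //.
      by apply: measurableT_comp; [exact: measurable_normal_pdf|exact: measurable_funB].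
    move=> x; rewrite normrM -[leRHS]mulr1 ler_pM// ger0_norm ?mulr_ge0 ?normal_pdf_ge0 ?invr_ge0 ?normal_peak_ge0//.
    by rewrite ler_pdivrMr ?normal_peak_gt0// mul1r normal_pdf_ub.
  by apply: eq_Rintegral => x _; field.
have kb1 z : `|k z| <= normal_peak s^-1 by rewrite (le_trans (kb z))// normal_pdf_ub.
have kC x : (\int[mu]_u `|k (x, u)|%:E <= 1%:E)%E.
  rewrite -(integral_normal_pdf 0 s^-1); apply: ge0_le_integral => //.
  - by apply/measurable_EFinP; apply: measurableT_comp => //; apply: (measurableT_comp mk); exact: measurable_fun_pair.
  - by apply/measurable_EFinP; exact: measurable_normal_pdf.
  - by move=> u _; rewrite lee_fin; exact: kb.
rewrite (@integral_bounded_kernel _ _ _ _ _ _ mg iq k 1 (normal_peak s^-1) mk kb1 kC).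
set c := ip P f g; set v := ip P g g.
have E (b : R) u : \int[P]_x q (a + b + (f x + u * g x)) =
    q (a + b) * expR (- (ip P f f / 2)) * expR (- ((2 * u * c + u ^+ 2 * v) / 2)).
  have Gu : G (fun x => f x + u * g x).
    by have := cg_add cG 1 u Gf Gg; congr G; apply/funext => x; rewrite mul1r.
  have -> : \int[P]_x q (a + b + (f x + u * g x)) = q (a + b) * expR (- (ip P (fun x => f x + u * g x) (fun x => f x + u * g x) / 2)).
    by case: hq => ->; case: (cgauss_trig_shift cG (a + b) Gu).
  have := ip_quad 1 u sf sg.
  rewrite (_ : (fun x => 1 * f x + u * g x) = (fun x => f x + u * g x)); last by apply/funext => x; rewrite mul1r.
  move=> ->; rewrite -[RHS]mulrA -expRD; congr (_ * expR _); rewrite -/c -/v; by field.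
pose F b c' u := q (a + b * u) * expR (- ((2 * u * c' + u ^+ 2 * v) / 2)) * normal_pdf 0 s^-1 u.
have [i1 v1] := @normal_tilt q a (- h) c v s r hq s0 r0 rE.
have [i2 v2] := @normal_tilt q a h (- c) v s r hq s0 r0 rE.
have inner t0 : \int[P]_x (k (g x, t0) * q (a + f x)) =
    expR (- (ip P f f / 2)) / 2 * (F (- h) c t0 + F h (- c) t0).
  have iqu b0 t' : P.-integrable setT (EFin \o (fun x => q (a + b0 + (f x + t' * g x)))).
    apply: (@bounded_integrable _ _ _ P _ 1) => //; apply: measurableT_comp => //.
    by apply: measurable_funD => //; apply: measurable_funD => //; exact: measurable_funM.
  transitivity (\int[P]_x (normal_pdf 0 s^-1 t0 / 2 *
      (q (a + - h * t0 + (f x + t0 * g x)) + q (a + h * t0 + (f x + (- t0) * g x))))).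
    apply: eq_Rintegral => x _; rewrite /k /=.
    have := qp (a + f x) ((g x - h) * t0).
    rewrite (_ : a + f x + _ = a + - h * t0 + (f x + t0 * g x)); last by ring.
    rewrite (_ : a + f x - _ = a + h * t0 + (f x + - t0 * g x)); last by ring.
    move: (q _) (q _) (q _) (cos _) (normal_pdf _ _ _) => q1' q2' q3' c1' n1' e'.
    by rewrite mulrAC [c1' * _]mulrC e'; field.
  rewrite RintegralZl//; last by have := integrable_addR (iqu (- h * t0) t0) (iqu (h * t0) (- t0)).
  rewrite RintegralD// !E /F.
  rewrite (_ : 2 * - t0 * c + (- t0) ^+ 2 * v = 2 * t0 * - c + t0 ^+ 2 * v); last by ring.
  by move: (expR _) (expR _) (expR _) (normal_pdf _ _ _) (q _) (q _) => *; field.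
under eq_Rintegral do rewrite inner.
rewrite RintegralZl//; last by have := integrable_addR i1 i2.
rewrite RintegralD// v1 v2.
rewrite (_ : a - - h * c / r ^+ 2 = a + c * h / r ^+ 2); last by ring.
rewrite (_ : a - h * - c / r ^+ 2 = a + c * h / r ^+ 2); last by ring.
rewrite !sqrrN normal_pdfE// /normal_fun subr0.
have pk : normal_peak s * (s / r) = normal_peak r.
  have := @normal_peakV s^-1 r^-1; rewrite !invr_gt0 !invrK => ->//.
  by field; rewrite sn rn.
rewrite -pk; set x := q _.
have -> : expR (- ((ip P f f - c ^+ 2 / r ^+ 2) / 2)) =
    expR (- (ip P f f / 2)) * expR (c ^+ 2 / (2 * r ^+ 2)).
  by rewrite -expRD; congr expR; field.
have -> : expR ((c ^+ 2 - h ^+ 2) / (2 * r ^+ 2)) = expR (c ^+ 2 / (2 * r ^+ 2)) * expR (- h ^+ 2 / (r ^+ 2 *+ 2)).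
  by rewrite -expRD; congr expR; field.
by move: (expR _) (expR _) (expR _) (normal_peak _) x => *; field.
Qed.

End gaussian_tilt.

Section change_of_direction.
Context d (T : measurableType d) (R : realType) (P : probability T R).
Notation mu := (@lebesgue_measure R).
Variable G : set (T -> R).
Hypothesis cG : cgauss P G.
Variables (X : T -> path R) (m : path R).
Hypothesis gX : gproc G X m.

Lemma measurable_padd_Lf e t (c : R) (k : path R) : measurable_fun setT (fun x => padd (X x) (- (Lf e (X x) t / c)) k).
Proof.
have mX := gp_meas gX; apply: measurable_padd => //.
by apply: measurableT_comp => //; apply: measurable_funM => //; exact: measurable_Lf.
Qed.

Lemma comb_padd (w k : path R) (a : R) l : comb (padd w a k) l = comb w l + a * comb k l.
Proof.
have e : padd w a k = (fun t => w t + a * k t) :> (R -> R) by exact: paddE (path_C2 w) (path_C2 k).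
exact: (etrans (congr1 (fun f : R -> R => comb f l) e) (comb_lin w k a l)).
Qed.

Let normal_peakE (s : R) : 0 < s -> normal_peak s = s^-1 * (Num.sqrt (pi *+ 2))^-1.
Proof.
move=> s0; rewrite /normal_peak -mulrnAr sqrtrM ?sqr_ge0// sqrtr_sqr ger0_norm ?ltW//.
by rewrite invfM.
Qed.

(* Both sides are the value at 0 of the density of [Lf e X t] weighted by [F]
   of the path slid to [Lf e X t = 0], on the left along [kpath P X m U]. *)
Lemma slide_direction_change e t (U : T -> R) (sU sY : R) (F : path R -> \bar R) :
  G U -> 0 < sU -> ip P U U = sU ^+ 2 ->
  0 < sY -> ip P (cL X m e t) (cL X m e t) = sY ^+ 2 ->
  let k := Lf e (kpath P X m U) t in 0 < k ->
  measurable_fun setT F -> (forall w, 0 <= F w)%E ->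
  (\int[P]_x (F (padd (X x) (- (Lf e (X x) t / k)) (kpath P X m U)) *
       (normal_pdf 0 sU (U x - Lf e (X x) t / k))%:E) =
   \int[P]_x (F (padd (X x) (- Lf e (X x) t) (kpath P X m (cL X m e t)))) *
       (k * normal_pdf 0 sY (Lf e m t))%:E)%E.
Proof.
move=> GU sU0 UU sY0 YY k k0 mF F0.
have sUn : sU != 0 by rewrite gt_eqF. have sYn : sY != 0 by rewrite gt_eqF.
have kn : k != 0 by rewrite gt_eqF.
have sqU := cg_sqint cG GU; have [mU _] := sqU.
have GY := cL_G cG gX e t; have sqY := cg_sqint cG GY; have mX := gp_meas gX.
set Y := cL X m e t in YY GY sqY *; set y0 := Lf e m t.
have YE x : Lf e (X x) t = y0 + Y x by rewrite /Y /cL /y0; ring.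
have mY : measurable_fun setT (fun x => Lf e (X x) t) by exact: measurable_Lf.
have kYU : ip P Y U = k * sU ^+ 2.
  by rewrite /k (Lf_kpath cG gX)// UU mulfVK// expf_neq0.
(* A normalization that brings both weights into [0, 1], as [law_eq_weighted] requires; it cancels
   at the end. *)
set c := (normal_peak sU + k * normal_peak sY)^-1.
have pU := normal_peak_gt0 sUn; have pY := normal_peak_gt0 sYn.
have c0 : 0 < c by rewrite invr_gt0 addr_gt0// mulr_gt0.
pose G1 x := c * normal_pdf 0 sU (U x - Lf e (X x) t / k).
pose G2 (x : T) := c * (k * normal_pdf 0 sY y0).
have mp : measurable_fun setT (fun x => normal_pdf 0 sU (U x - Lf e (X x) t / k)).
  apply: measurableT_comp; first exact: measurable_normal_pdf.
  by apply: measurable_funB => //; exact: measurable_funM.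
have mG1 : measurable_fun setT G1 by exact: measurable_funM.
have b1 x : 0 <= G1 x <= 1.
  rewrite /G1 mulr_ge0 ?normal_pdf_ge0 ?(ltW c0)//= /c mulrC ler_pdivrMr ?addr_gt0 ?mulr_gt0// mul1r.
  by rewrite (le_trans (normal_pdf_ub _ _ sUn))// lerDl mulr_ge0// ltW.
have b2 x : 0 <= G2 x <= 1.
  rewrite /G2 mulr_ge0 ?mulr_ge0 ?normal_pdf_ge0 ?(ltW c0) ?(ltW k0)//= /c mulrC ler_pdivrMr ?addr_gt0 ?mulr_gt0// mul1r.
  by rewrite (le_trans (ler_wpM2l (ltW k0) (normal_pdf_ub _ _ sYn)))// lerDr ltW.
pose X1 x := padd (X x) (- (Lf e (X x) t / k)) (kpath P X m U).
pose X2 x := padd (X x) (- Lf e (X x) t) (kpath P X m Y).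
have mX1 : measurable_fun setT X1 by exact: measurable_padd_Lf.
have mX2 : measurable_fun setT X2.
  by have := measurable_padd_Lf e t 1 (kpath P X m Y); under eq_fun do rewrite divr1.
have main q l : q = cos \/ q = sin -> \int[P]_x (q (comb (X1 x) l) * G1 x) = \int[P]_x (q (comb (X2 x) l) * G2 x).
  move=> hq; have GC := comb_G cG gX l; have sqC := cg_sqint cG GC.
  set C := (fun x => comb (X x) l - comb m l) in GC sqC.
  pose K := comb (kpath P X m U) l; pose p := ip P C Y.
  have KE : ip P C U = K * sU ^+ 2.
    by rewrite /K (kpathE cG gX)// (comb_kfun cG gX)// UU mulfVK// expf_neq0.
  have K2 : comb (kpath P X m Y) l = p / sY ^+ 2.
    by rewrite (kpathE cG gX)// (comb_kfun cG gX)// YY.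
  pose f x := C x - (K / k) * Y x; pose g x := U x - k^-1 * Y x.
  have Gf : G f by exact: (cg_sub cG). have Gg : G g by exact: (cg_sub cG).
  pose f2 x := C x - (p / sY ^+ 2) * Y x.
  have Gf2 : G f2 by exact: (cg_sub cG).
  have lin (A B : T -> R) (r : R) : (fun x => A x - r * B x) = (fun x => 1 * A x + (- r) * B x).
    by apply/funext => x; ring.
  have gg : ip P g g = sY ^+ 2 / k ^+ 2 - sU ^+ 2.
    by rewrite /g lin ip_quad// UU YY (ipC P U Y) kYU; field.
  have fg : ip P f g = K * sY ^+ 2 / k ^+ 2 - p / k.
    by rewrite /f /g !lin ip_linl ?ip_linr//; [rewrite KE kYU YY -/p; field|exact: (cg_sqint cG (cg_add cG _ _ _ _))].
  have ff : ip P f f = ip P C C - 2 * K * p / k + K ^+ 2 * sY ^+ 2 / k ^+ 2.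
    by rewrite /f lin ip_quad// YY -/p; field.
  have ff2 : ip P f2 f2 = ip P C C - p ^+ 2 / sY ^+ 2.
    by rewrite /f2 lin ip_quad// YY -/p; field.
  have rk0 : 0 < sY / k by exact: divr_gt0.
  have rE : (sY / k) ^+ 2 = sU ^+ 2 + ip P g g by rewrite gg; field.
  have hL := cgauss_weighted_trig cG (comb m l - (y0 / k) * K) (y0 / k) hq Gf Gg sU0 rk0 rE.
  have hR : \int[P]_x q (comb m l - y0 * (p / sY ^+ 2) + f2 x) =
      q (comb m l - y0 * (p / sY ^+ 2)) * expR (- (ip P f2 f2 / 2)).
    by case: hq => ->; case: (cgauss_trig_shift cG (comb m l - y0 * (p / sY ^+ 2)) Gf2).
  have [mq q1] : measurable_fun setT q /\ forall x, `|q x| <= 1.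
    by case: hq => ->; split; try exact: cos_max; try exact: sin_max;
      apply: continuous_measurable_fun; [exact: continuous_cos|exact: continuous_sin].
  have [mf _] := cg_sqint cG Gf. have [mf2 _] := cg_sqint cG Gf2. have [mg _] := cg_sqint cG Gg.
  transitivity (c * \int[P]_x (q (comb m l - (y0 / k) * K + f x) * normal_pdf 0 sU (g x - y0 / k))).
    have iI : P.-integrable setT (EFin \o (fun x => q (comb m l - (y0 / k) * K + f x) * normal_pdf 0 sU (g x - y0 / k))).
      apply: (@bounded_integrable _ _ _ P _ (normal_peak sU)).
        apply: measurable_funM; first by apply: measurableT_comp => //; exact: measurable_funD.
        by apply: measurableT_comp; [exact: measurable_normal_pdf|exact: measurable_funB].
      move=> x; rewrite normrM -[leRHS]mul1r ler_pM// ger0_norm ?normal_pdf_ge0//.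
      exact: normal_pdf_ub.
    rewrite -(RintegralZl c measurableT iI).
    apply: eq_Rintegral => x _; rewrite /G1 /X1 comb_padd -/K YE /f /g /C.
    rewrite mulrCA; congr (_ * (q _ * normal_pdf _ _ _)); by field.
  rewrite hL ff fg.
  transitivity ((\int[P]_x q (comb m l - y0 * (p / sY ^+ 2) + f2 x)) * (c * (k * normal_pdf 0 sY y0))).
    rewrite hR ff2.
    have -> : normal_pdf 0 (sY / k) (y0 / k) = k * normal_pdf 0 sY y0.
      have skn : sY / k != 0 by rewrite gt_eqF.
      rewrite !normal_pdfE// /normal_fun !subr0 [RHS]mulrA; congr (_ * expR _); last by field; rewrite ?kn ?sYn.
      rewrite !normal_peakE// invfM invrK [_^-1 * k]mulrC mulrA; ring.
    rewrite mulrC -!mulrA; congr (q _ * (expR _ * _)); last by ring.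
    - by field; rewrite ?kn ?sYn.
    - by field; rewrite ?kn ?sYn.
  have iI : P.-integrable setT (EFin \o (fun x => q (comb m l - y0 * (p / sY ^+ 2) + f2 x))).
    by apply: (@bounded_integrable _ _ _ P _ 1) => //; apply: measurableT_comp => //; exact: measurable_funD.
  rewrite mulrC -(RintegralZl _ measurableT iI).
  apply: eq_Rintegral => x _; rewrite /X2 comb_padd K2 YE /f2 /C /G2 mulrC; congr (q _ * _); ring.
have H := @law_eq_weighted _ _ _ _ _ X1 X2 mX1 mX2 P P G1 G2 mG1 b1 (measurable_cst _) b2
   (fun l => main cos l (or_introl erefl)) (fun l => main sin l (or_intror erefl)) F mF F0.
have c0E : (c%:E != 0)%E by rewrite eqe gt_eqF.
have mF1 : measurable_fun setT (fun x => F (X1 x) * (normal_pdf 0 sU (U x - Lf e (X x) t / k))%:E)%E.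
  have mFX1 : measurable_fun setT (fun x => F (X1 x)) by exact: (measurableT_comp mF mX1).
  have mE : measurable_fun setT (fun x => (normal_pdf 0 sU (U x - Lf e (X x) t / k))%:E) by exact/measurable_EFinP.
  exact: (emeasurable_funM mFX1 mE).
have mF2 : measurable_fun setT (fun x => F (X2 x)) by exact: (measurableT_comp mF mX2).
have e1 : (\int[P]_x (F (X1 x) * (G1 x)%:E) = c%:E * \int[P]_x (F (X1 x) * (normal_pdf 0 sU (U x - Lf e (X x) t / k))%:E))%E.
  rewrite -ge0_integralZl ?lee_fin ?(ltW c0)//; last by move=> x _; rewrite mule_ge0// lee_fin normal_pdf_ge0.
  by apply: eq_integral => x _; rewrite /G1 EFinM muleCA.
have kp0 : 0 <= k * normal_pdf 0 sY y0 by rewrite mulr_ge0 ?normal_pdf_ge0// ltW.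
have e2 : (\int[P]_x (F (X2 x) * (G2 x)%:E) = c%:E * (\int[P]_x (F (X2 x)) * (k * normal_pdf 0 sY y0)%:E))%E.
  rewrite -ge0_integralZr ?lee_fin//.
  rewrite -ge0_integralZl ?lee_fin ?(ltW c0)//; last 2 first.
  - by apply: emeasurable_funM.
  - by move=> x _; rewrite mule_ge0// lee_fin.
  by apply: eq_integral => x _; rewrite /G2 EFinM muleCA.
move: H; rewrite e1 e2 => H.
have := congr1 (fun z => (c^-1)%:E * z)%E H.
by rewrite !muleA -!EFinM mulVf ?gt_eqF// !mul1e.
Qed.

End change_of_direction.

(** * Change of variables and induction on intervals *)

Section area_formula.
Context (R : realType).
Notation mu := (@lebesgue_measure R).

Lemma FTC2_in (F f : R -> R) (s e : R) : s <= e ->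
  (forall t, s <= t <= e -> is_derive t (1:R) F (f t)) ->
  (forall t, s <= t <= e -> {for t, continuous f}) ->
  (\int[mu]_(t in `[s, e]) (f t)%:E = (F e - F s)%:E)%E.
Proof.
rewrite le_eqVlt => /predU1P[<- _ _|se dF cf].
  by rewrite set_itv1 integral_set1 subrr.
have cF t : s <= t <= e -> {for t, continuous F}.
  move=> h; have [dt _] := dF t h; apply: differentiable_continuous.
  exact/derivable1_diffP.
rewrite (@continuous_FTC2 _ f F)//.
- apply: continuous_in_subspaceT => t; rewrite inE/= in_itv/= => h; exact: cf.
- split.
  + by move=> t; rewrite in_itv/= => /andP[h1 h2]; case: (dF t); rewrite ?(ltW h1) ?(ltW h2).
  + by apply: cvg_at_right_filter; apply: cF; rewrite lexx ltW.
  + by apply: cvg_at_left_filter; apply: cF; rewrite lexx ltW.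
- move=> t; rewrite in_itv/= => /andP[h1 h2].
  by have := dF t; rewrite (ltW h1) (ltW h2) => /(_ isT) [_ <-]; rewrite derive1E.
Qed.

Variables (psi psi' : R -> R) (s e : R).
Hypothesis se : s <= e.
Hypothesis mpsi : measurable_fun setT psi.
Hypothesis mpsi' : measurable_fun setT psi'.
Hypothesis dpsi : forall t, s <= t <= e -> is_derive t (1:R) psi (psi' t).
Hypothesis cpsi' : forall t, s <= t <= e -> {for t, continuous psi'}.

Let J : set R := `[s, e]%classic.

Let mJ : measurable J. Proof. exact: measurable_itv. Qed.

Let cpsi t : s <= t <= e -> {for t, continuous psi}.
Proof.
move=> h; have [dt _] := dpsi h; apply: differentiable_continuous.
exact/derivable1_diffP.
Qed.

Let subst (q H : R -> R) : continuous q -> (forall u : R, is_derive u (1:R) H (q u)) -> psi s <= psi e ->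
  \int[mu]_t (q (psi t) * (psi' t * \1_J t)) = \int[mu]_u (q u * \1_(`[psi s, psi e]%classic) u).
Proof.
move=> cq dH se'; rewrite /Rintegral; congr fine.
transitivity (\int[mu]_(t in J) (psi' t * q (psi t))%:E)%E.
  rewrite [RHS]integral_mkcond; apply: eq_integral => t _; rewrite patchE indicE.
  by case: ifP => _; rewrite ?mulr1 ?mulr0// mulrC.
have dHp t : s <= t <= e -> is_derive t (1:R) (H \o psi) (psi' t * q (psi t)).
  move=> h; have d1 := dpsi h; have d2 := dH (psi t).
  by apply: (@is_derive_eq _ _ _ _ _ _ _ _ (@is_derive1_comp R H psi _ _ _ d2 d1)); rewrite mulrC.
apply: (etrans (@FTC2_in (H \o psi) (fun t => psi' t * q (psi t)) s e se dHp _)).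
  move=> t h; apply: cvgM; first exact: cpsi'.
  by apply: (@continuous_comp _ _ _ psi q); [exact: cpsi|exact: cq].
rewrite -(@FTC2_in H q _ _ se') //; last by move=> *; exact: cq.
rewrite [LHS]integral_mkcond; apply: eq_integral => t _; rewrite patchE indicE.
by case: ifP => _; rewrite ?mulr1 ?mulr0.
Qed.

Let sub_indic (B : set R) : psi s <= psi e -> measurable B ->
  (\int[mu]_t (\1_B (psi t) * (psi' t * \1_J t))%:E =
   \int[mu]_u (\1_B u * \1_(`[psi s, psi e]%classic) u)%:E)%E.
Proof.
move=> se' mB.
have trig (q H : R -> R) : continuous q -> (forall u : R, is_derive u (1:R) H (q u)) ->
    forall th, th != 0 -> \int[mu]_t (q (th * psi t) * (psi' t * \1_J t)) =
    \int[mu]_u (q (th * u) * \1_(`[psi s, psi e]%classic) u).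
  move=> cq dH th th0; apply: (@subst (fun u => q (th * u)) (fun u => th^-1 * H (th * u))) => //.
    move=> u; apply: (@continuous_comp _ _ _ ( *%R th) q); [exact: mulrl_continuous|exact: cq].
  move=> u; have d1 : is_derive u (1:R) ( *%R th) th.
    by have := is_deriveZ th (@is_derive_id R _ u 1); rewrite /GRing.scale /= mulr1.
  have d2 := dH (th * u); have d3 := @is_derive1_comp R H ( *%R th) _ _ _ d2 d1.
  by apply: (@is_derive_eq _ _ _ _ _ _ _ _ (is_deriveZ th^-1 d3)); rewrite /GRing.scale /=; field.
have cst1 : \int[mu]_t (1 * (psi' t * \1_J t)) = \int[mu]_u (1 * \1_(`[psi s, psi e]%classic) u).
  apply: (@subst (fun=> 1) id) => // u; exact: cvg_cst.
have i1 : mu.-integrable setT (EFin \o (fun t => psi' t * \1_J t)).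
  have : mu.-integrable J (EFin \o psi').
    apply: continuous_compact_integrable; first exact: segment_compact.
    by apply: continuous_in_subspaceT => t /set_mem; rewrite /J /= in_itv/= => h; exact: cpsi'.
  move=> h0; have : mu.-integrable setT ((EFin \o psi') \_ J) by have := @integrable_mkcond _ (measurableTypeR R) R mu J; first [move=> /(_ (EFin \o psi') mJ) [+ _]|move=> /(_ mJ (EFin \o psi')) [+ _]]; apply.
  apply: eq_integrable => // t _.
  by rewrite patchE /= indicE; case: ifP => _; rewrite ?mulr1 ?mulr0.
have i2 : mu.-integrable setT (EFin \o (fun t => \1_(`[psi s, psi e]%classic) t)).
  apply: (@integrable_indic_itv R (psi s) (psi e) true false).
have b1 (x : R) : `|\1_B x| <= 1 :> R by rewrite indicE; case: (_ \in _); rewrite /= ?normr1 ?normr0.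
have m1B : measurable_fun setT (\1_B : R -> R) by exact: measurable_indic.
have j1 := @integrable_bounded_mul _ _ R mu psi _ mpsi i1 _ _ m1B b1.
have j2 := @integrable_bounded_mul _ _ R mu id _ (@measurable_id _ _ setT) i2 _ _ m1B b1.
suff : \int[mu]_t (\1_B (psi t) * (psi' t * \1_J t)) = \int[mu]_u (\1_B u * \1_(`[psi s, psi e]%classic) u).
  have f1 := integrable_fin_num measurableT j1; have f2 := integrable_fin_num measurableT j2.
  by move=> h; rewrite -(fineK f1) -(fineK f2); exact: (congr1 EFin h).
apply: (@trig_unique _ _ _ _ _ mu mu psi (fun t => psi' t * \1_J t) id (fun t => \1_(`[psi s, psi e]%classic) t)) => //.
- move=> th; have [->|th0] := eqVneq th 0.
    transitivity (\int[mu]_t (1 * (psi' t * \1_J t))).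
      by apply: eq_Rintegral => t _; rewrite mul0r cos0.
    by rewrite cst1; apply: eq_Rintegral => t _; rewrite mul0r cos0.
  apply: (trig cos sin) => //; exact: continuous_cos.
- move=> th; have [->|th0] := eqVneq th 0.
    by under eq_Rintegral do rewrite mul0r sin0 mul0r; under [RHS]eq_Rintegral do rewrite mul0r sin0 mul0r.
  apply: (trig sin (fun u => - cos u)) => //; first exact: continuous_sin.
  by move=> u; apply: is_derive_eq; rewrite opprK.
Qed.

(** Over the preimage of [O] the derivative is nonnegative, so the signed measure of [sub_indic]
    agrees there with its positive part and every u in [O] is covered with multiplicity one. If psi
    e < psi s, then [O] is empty. *)
Lemma area_formula (O : set R) (f : R -> \bar R) : measurable O ->
  (forall u, O u -> psi s <= u <= psi e) ->
  (forall t, s <= t <= e -> O (psi t) -> 0 <= psi' t) ->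
  measurable_fun setT f -> (forall u, 0 <= f u)%E ->
  (\int[mu]_t (f (psi t) * (\1_O (psi t) * Num.max (psi' t) 0 * \1_J t)%:E) =
   \int[mu]_u (f u * (\1_O u)%:E))%E.
Proof.
move=> mO Ose Opos mf0 f0.
have mf : @measurable_fun _ _ (measurableTypeR R) _ setT f := mf0.
pose g1 (t : measurableTypeR R) : R := \1_O (psi t) * Num.max (psi' t) 0 * \1_J t.
pose g2 (u : measurableTypeR R) : R := \1_O u.
have mg1 : measurable_fun setT g1.
  apply: measurable_funM; last exact: measurable_indic.
  apply: measurable_funM; last exact: measurable_maxr.
  by apply: measurableT_comp => //; exact: measurable_indic.
have mg2 : measurable_fun setT g2 by exact: measurable_indic.
have g10 t : 0 <= g1 t by rewrite /g1 !mulr_ge0 ?indicE ?le_max ?lexx ?orbT.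
have g20 t : 0 <= g2 t by rewrite /g2 indicE.
have mpsi0 : @measurable_fun _ _ (measurableTypeR R) (measurableTypeR R) setT psi := mpsi.
pose m1 := measure_function_pushforward__canonical__measure_function_Measure (mdens mu mg1 g10) mpsi0.
transitivity (\int[m1]_u f u)%E.
  rewrite [RHS]ge0_integral_pushforward//. rewrite preimage_setT ge0_integral_mdens//.
    exact: measurableT_comp.
  by move=> u; exact: f0.
transitivity (\int[mdens mu mg2 g20]_u f u)%E; last by rewrite ge0_integral_mdens.
apply: eq_measure_integral => B mB _.
rewrite /m1 /= /pushforward /mdens integral_mkcond [RHS]integral_mkcond.
pose C := B `&` O.
have mC : measurable C by exact: measurableI.
have [lt|se'] := ltP (psi e) (psi s).
  have O0 u : ~ O u by move=> /Ose/andP[h1 h2]; have := le_lt_trans (le_trans h1 h2) lt; rewrite ltxx.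
  rewrite !integral0_eq// => u _; rewrite patchE; case: ifP => // _.
    by rewrite /g2 indicE memNset.
  by rewrite /g1 indicE memNset// !mul0r.
have H := sub_indic se' mC.
have e1 t : (((fun t => (g1 t)%:E) \_ (psi @^-1` B)) t = (\1_C (psi t) * (psi' t * \1_J t))%:E)%E.
  rewrite patchE (_ : (t \in psi @^-1` B) = (psi t \in B)); last by apply/idP/idP; rewrite !inE.
  rewrite /g1 !indicE in_setI; have [Jt|Jt] := boolP (t \in J); last by rewrite /= !mulr0 if_same.
  have h : s <= t <= e by move: Jt; rewrite inE /J/= in_itv.
  case: (psi t \in B); rewrite ?mul0r//= !mulr1.
  have [/set_mem Ot|] := boolP (psi t \in O); rewrite /= ?mul0r// !mul1r.
  by rewrite max_l// Opos.
have e2 u : (((fun t => (g2 t)%:E) \_ B) u = (\1_C u * \1_(`[psi s, psi e]%classic) u)%:E)%E.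
  rewrite patchE /g2 !indicE in_setI; have [Ou|Ou] := boolP (u \in O).
    have h := Ose _ (set_mem Ou).
    have -> : (u \in `[psi s, psi e]%classic) = true by apply/mem_set; rewrite /= in_itv.
    by case: (u \in B); rewrite /= ?mulr1 ?mul0r.
  by case: (u \in B); rewrite /= ?mul0r.
transitivity (\int[mu]_t (\1_C (psi t) * (psi' t * \1_J t))%:E)%E.
  by apply: eq_integral => t _; exact: e1.
by rewrite H; apply: eq_integral => u _; exact/esym/e2.
Qed.

End area_formula.

(** Around the supremum of the t with [C p t], the local hypothesis and additivity extend the
    property beyond it, unless the supremum is q. *)
Lemma interval_induction (R : realType) (C : R -> R -> Prop) (p q : R) : p <= q ->
  (forall a b c, p <= a -> a <= b -> b <= c -> c <= q -> C a b -> C b c -> C a c) ->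
  (forall t, p <= t <= q -> exists2 e, 0 < e &
    forall a b, p <= a -> a <= b -> b <= q -> t - e < a -> b < t + e -> C a b) ->
  C p q.
Proof.
move=> pq add loc; pose S := [set t | p <= t <= q /\ C p t].
have Sp : S p.
  have [|e e0 h] := loc p; first by rewrite lexx.
  by split; [rewrite lexx|apply: h; rewrite // ?ltrBlDr ltrDl].
have ubS : ubound S q by move=> t [/andP[]].
have hu : has_ubound S by exists q.
have hS : has_sup S by split; [exists p|exists q].
have pc : p <= sup S by exact: (ub_le_sup hu).
have cq : sup S <= q by apply: ge_sup => //; exists p.
have [|e e0 h] := loc (sup S); first by rewrite pc.
have [t [/andP[pt tq] Ct] ht] := sup_adherent e0 hS.
have tc : t <= sup S by apply: (ub_le_sup hu); split; first by rewrite pt.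
pose b := Num.min q (sup S + e / 2).
have tb : t <= b by rewrite le_min tq /=; lra.
have bq : b <= q by rewrite ge_min lexx.
have bc : b < sup S + e by rewrite (@le_lt_trans _ _ (sup S + e / 2)) ?ge_min ?lexx ?orbT//; lra.
have Cb : C p b by apply: (add p t b) => //; apply: h.
have : b <= sup S by apply: (ub_le_sup hu); split => //; rewrite bq (le_trans pt tb).
rewrite /b /Num.min; case: ifPn => [_ cc|_]; last by move: e0; lra.
by have := Cb; rewrite /b /Num.min ifT//; move: e0 cc; lra.
Qed.

(** * Conditioning a Gaussian path on one observable *)

Section gauss_density.
Context (R : realType).

(** The continuous functions x / (x^2 + 1/(n+1)) converge to the inverse everywhere, with limit 0 at
    x = 0, the conventional value of 0^-1. *)
Lemma measurable_invr : measurable_fun setT (@GRing.inv R).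
Proof.
have pos n (x : R) : 0 < x ^+ 2 + n.+1%:R^-1 by rewrite ltr_wpDl ?sqr_ge0// invr_gt0 ltr0n.
apply: (@measurable_fun_cvg _ _ _ _ (fun n (x : R) => x * (x ^+ 2 + n.+1%:R^-1)^-1)) => //.
- move=> n; apply: continuous_measurable_fun => x.
  apply: cvgM => //; apply: cvgV; first by rewrite gt_eqF// pos.
  by apply: cvgD; [exact: exprn_continuous|exact: cvg_cst].
- move=> x _; have [->|x0] := eqVneq x 0.
    by under eq_fun do rewrite mul0r; rewrite invr0; exact: cvg_cst.
  rewrite -[X in _ --> X](_ : x * (x ^+ 2 + 0)^-1 = _); last by rewrite addr0; field.
  apply: cvgMr; apply: cvgV; first by rewrite addr0 expf_neq0.
  by apply: cvgD; [exact: cvg_cst|exact: cvg_harmonic].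
Qed.

(* [normal_pdf 0 s y] without the special case [s = 0]. *)
Definition gauss_pdf (s y : R) : R := normal_peak s * normal_fun 0 s y.

Lemma gauss_pdfE s y : s != 0 -> gauss_pdf s y = normal_pdf 0 s y.
Proof. by move=> s0; rewrite normal_pdfE. Qed.

Lemma gauss_pdf_ge0 s y : 0 <= gauss_pdf s y.
Proof. by rewrite mulr_ge0 ?normal_peak_ge0// expR_ge0. Qed.

Lemma measurable_gauss_pdf d (T : measurableType d) (s y : T -> R) :
  measurable_fun setT s -> measurable_fun setT y -> measurable_fun setT (fun t => gauss_pdf (s t) (y t)).
Proof.
move=> ms my; rewrite /gauss_pdf /normal_peak /normal_fun; apply: measurable_funM.
  apply: measurableT_comp; first exact: measurable_invr.
  apply: measurableT_comp; first exact: (continuous_measurable_fun (@sqrt_continuous R)).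
  under eq_fun do rewrite -mulrnAr.
  by apply: measurable_funM => //; exact: measurable_funX.
apply: measurableT_comp; first exact: measurable_expR.
apply: measurable_funM.
  by apply: measurableT_comp => //; apply: measurable_funX; exact: measurable_funB.
apply: measurableT_comp; first exact: measurable_invr.
under eq_fun do rewrite -mulr_natr.
by apply: measurable_funM => //; exact: measurable_funX.
Qed.

End gauss_density.

Section measurable_covariance.
Context d (T : measurableType d) (R : realType) (P : probability T R) d' (A : measurableType d').

Lemma measurable_ip (f g : A * T -> R) : measurable_fun setT f -> measurable_fun setT g ->
  measurable_fun setT (fun a => ip P (fun x => f (a, x)) (fun x => g (a, x))).
Proof.
move=> mf mg; have mfg : measurable_fun setT (fun z => (f z * g z)%:E).
  by apply/measurable_EFinP; exact: measurable_funM.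
apply: (measurableT_comp (@fine_measurable R setT measurableT)).
have p0 z : (0 <= (fun z => (f z * g z)%:E)^\+ z)%E by exact: funepos_ge0.
have n0 z : (0 <= (fun z => (f z * g z)%:E)^\- z)%E by exact: funeneg_ge0.
have mp := @measurable_fun_fubini_tonelli_F _ _ A T R P _ (measurable_funepos mfg) p0.
have mn := @measurable_fun_fubini_tonelli_F _ _ A T R P _ (measurable_funeneg mfg) n0.
rewrite (_ : (fun _ => _) = (fun a => \int[P]_y ((fun z => (f z * g z)%:E)^\+)%E (a, y) -
    \int[P]_y ((fun z => (f z * g z)%:E)^\-)%E (a, y))%E); last first.
  apply/funext => a; rewrite integralE; congr (_ - _)%E; apply: eq_integral => x _.
    by rewrite !funeposE.
  by rewrite !funenegE.
exact: emeasurable_funB.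
Qed.

End measurable_covariance.

Section conditioning.
Context d (T : measurableType d) (R : realType) (P : probability T R).

Definition sd (X : T -> path R) (m : path R) (e : R * R) (t : R) : R :=
  Num.sqrt (ip P (cL X m e t) (cL X m e t)).
(* The process [X] and its mean conditioned on [Lf e X t = v]. *)
Definition cpath (X : T -> path R) (m : path R) (e : R * R) (t v : R) (x : T) : path R :=
  padd (X x) (v - Lf e (X x) t) (kpath P X m (cL X m e t)).
Definition cmean (X : T -> path R) (m : path R) (e : R * R) (t v : R) : path R :=
  padd m (v - Lf e m t) (kpath P X m (cL X m e t)).

Section measurability.
Variables (G : set (T -> R)) (cG : cgauss P G).
Context d' (S : measurableType d').
Variables (X : S -> T -> path R) (m : S -> path R) (e : R * R) (t v : S -> R).
Hypotheses (mX : measurable_fun setT (fun z : S * T => X z.1 z.2))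
  (mm : measurable_fun setT m) (mt : measurable_fun setT t) (mv : measurable_fun setT v).
Hypothesis gX : forall s, gproc G (X s) (m s).

Let m1 d'' (S' : measurableType d'') (f : S -> S') : measurable_fun setT f ->
  measurable_fun setT (fun z : S * T => f z.1).
Proof. by move=> mf; exact: (measurableT_comp mf (@measurable_fst _ _ _ _)). Qed.

Let mcL : measurable_fun setT (fun z : S * T => cL (X z.1) (m z.1) e (t z.1) z.2).
Proof. by apply: measurable_funB; [exact: (measurable_Lf e (m1 mt) mX)|exact: (measurable_Lf e (m1 mt) (m1 mm))]. Qed.

Lemma measurable_sd : measurable_fun setT (fun s => sd (X s) (m s) e (t s)).
Proof.
apply: (measurableT_comp (continuous_measurable_fun (@sqrt_continuous R))).
exact: (measurable_ip P mcL mcL).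
Qed.

Let mkp : measurable_fun setT (fun s => kpath P (X s) (m s) (cL (X s) (m s) e (t s))).
Proof.
apply/measurable_pathP => u.
have e1 : (fun s => kpath P (X s) (m s) (cL (X s) (m s) e (t s)) u) =
   (fun s => ip P (fun x => X s x u - m s u) (cL (X s) (m s) e (t s)) *
             (ip P (cL (X s) (m s) e (t s)) (cL (X s) (m s) e (t s)))^-1).
  by apply/funext => s; rewrite (kpathE cG (gX s))//; exact: (cg_sqint cG (cL_G cG (gX s) e (t s))).
have mf : measurable_fun setT (fun z : S * T => X z.1 z.2 u - m z.1 u).
  by apply: measurable_funB; [exact: ((measurable_pathP _).1 mX u)|exact: ((measurable_pathP _).1 (m1 mm) u)].
rewrite e1; apply: measurable_funM; first exact: (measurable_ip P mf mcL).
by apply: (measurableT_comp (@measurable_invr R)); exact: (measurable_ip P mcL mcL).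
Qed.

Lemma measurable_cpath : measurable_fun setT (fun z : S * T => cpath (X z.1) (m z.1) e (t z.1) (v z.1) z.2).
Proof.
have md : measurable_fun setT (fun z : S * T => v z.1 - Lf e (X z.1 z.2) (t z.1)).
  by apply: measurable_funB; [exact: m1|exact: (measurable_Lf e (m1 mt) mX)].
exact: (measurable_padd mX md (m1 mkp)).
Qed.

Lemma measurable_cmean : measurable_fun setT (fun s => cmean (X s) (m s) e (t s) (v s)).
Proof.
have md : measurable_fun setT (fun s => v s - Lf e (m s) (t s)).
  by apply: measurable_funB => //; exact: (measurable_Lf e mt mm).
exact: (measurable_padd mm md mkp).
Qed.

End measurability.

Variables (G : set (T -> R)) (cG : cgauss P G) (X : T -> path R) (m : path R).
Hypothesis gX : gproc G X m.

Lemma Lf_cpath e t v e' t' x : Lf e' (cpath X m e t v x) t' =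
  Lf e' (X x) t' + (v - Lf e (X x) t) * Lf e' (kpath P X m (cL X m e t)) t'.
Proof. exact: Lf_padd (path_C2 _) (path_C2 _). Qed.

Lemma Lf_cmean e t v e' t' : Lf e' (cmean X m e t v) t' =
  Lf e' m t' + (v - Lf e m t) * Lf e' (kpath P X m (cL X m e t)) t'.
Proof. exact: Lf_padd (path_C2 _) (path_C2 _). Qed.

(** The value [v] cancels: centred observables of the conditioned path are regression residuals, the
    same whatever value is prescribed. *)
Lemma cL_cond e t v e' t' : cL (cpath X m e t v) (cmean X m e t v) e' t' =
  (fun x => cL X m e' t' x - Lf e' (kpath P X m (cL X m e t)) t' * cL X m e t x).
Proof.
apply/funext => x.
apply: (etrans (congr2 (fun a b : R => a - b) (Lf_cpath e t v e' t' x) (Lf_cmean e t v e' t'))); rewrite /cL.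
by move: (Lf e' (X x) t') (Lf e (X x) t) (Lf e m t) (Lf e' m t') (Lf e' _ t') => *; ring.
Qed.

Lemma gproc_cond e t v : gproc G (cpath X m e t v) (cmean X m e t v).
Proof.
have mX := gp_meas gX; have ck := path_C2 (kpath P X m (cL X m e t)).
have GY := cL_G cG gX e t.
have YE x : cL X m e t x = Lf e (X x) t - Lf e m t by [].
have sub (f g : T -> R) c : G f -> (forall x, g x = f x - c * cL X m e t x) -> G g.
  by move=> Gf E; have := cg_sub cG c Gf GY; congr G; apply/funext.
split.
- apply: measurable_padd => //; apply: measurable_funB => //; exact: measurable_Lf.
- move=> u; apply: (sub _ _ (kpath P X m (cL X m e t) u) (gp_eval gX u)) => x.
  rewrite /cpath /cmean; have e1 := paddE (v - Lf e (X x) t) (path_C2 (X x)) ck.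
  have e2 := paddE (v - Lf e m t) (path_C2 m) ck.
  apply: (etrans (congr2 (fun f g : R -> R => f u - g u) e1 e2)); rewrite /= YE.
  by move: (X x u) (m u) (kpath P X m (cL X m e t) u) (Lf e (X x) t) (Lf e m t) => *; ring.
- move=> u; apply: (sub _ _ ((kpath P X m (cL X m e t) : R -> R)^`()%classic u) (gp_derive gX u)) => x.
  apply: (etrans (congr2 (fun a b : R => a - b) (padd_derive (v - Lf e (X x) t) u (path_C2 (X x)) ck)
    (padd_derive (v - Lf e m t) u (path_C2 m) ck))); rewrite YE.
  by move: ((X x : R -> R)^`()%classic u) ((m : R -> R)^`()%classic u) ((kpath P X m (cL X m e t) : R -> R)^`()%classic u) (Lf e (X x) t) (Lf e m t) => *; ring.
- move=> u; apply: (sub _ _ (derive1n 2 (kpath P X m (cL X m e t)) u) (gp_derive2 gX u)) => x.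
  apply: (etrans (congr2 (fun a b : R => a - b) (padd_derive2 (v - Lf e (X x) t) u (path_C2 (X x)) ck)
    (padd_derive2 (v - Lf e m t) u (path_C2 m) ck))); rewrite YE.
  by move: (derive1n 2 (X x) u) (derive1n 2 m u) (derive1n 2 (kpath P X m (cL X m e t)) u) (Lf e (X x) t) (Lf e m t) => *; ring.
Qed.

Lemma sd_gt0 e t : 0 < ip P (cL X m e t) (cL X m e t) ->
  0 < sd X m e t /\ ip P (cL X m e t) (cL X m e t) = sd X m e t ^+ 2.
Proof. by move=> v0; rewrite /sd sqrtr_gt0 sqr_sqrtr// ltW. Qed.

Lemma Lf_kpath_diag e t : 0 < ip P (cL X m e t) (cL X m e t) ->
  Lf e (kpath P X m (cL X m e t)) t = 1.
Proof.
move=> v0; rewrite (Lf_kpath cG gX) ?divff ?gt_eqF//.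
exact: (cg_sqint cG (cL_G cG gX e t)).
Qed.

(** Disintegration of the law of the path over the value of one observable: [regression_formula] for
    its centred version, with the substitution u = v - Lf e m t. *)
Lemma conditioning_formula e t (Phi : path R -> \bar R) :
  0 < ip P (cL X m e t) (cL X m e t) ->
  measurable_fun setT Phi -> (forall w, 0 <= Phi w)%E ->
  (\int[P]_x Phi (X x) = \int[lebesgue_measure]_v
     (\int[P]_x Phi (cpath X m e t v x) * (gauss_pdf (sd X m e t) (v - Lf e m t))%:E))%E.
Proof.
move=> v0 mPhi Phi0; have [s0 sE] := sd_gt0 v0; have GY := cL_G cG gX e t.
rewrite (regression_formula cG gX GY s0 sE mPhi Phi0).
have mX := gp_meas gX.
have mX2 : measurable_fun setT (fun z : R * T => X z.2) by exact: (measurableT_comp mX (@measurable_snd _ _ _ _)).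
pose H v := (\int[P]_x Phi (cpath X m e t v x) * (gauss_pdf (sd X m e t) (v - Lf e m t))%:E)%E.
have mH : measurable_fun setT H.
  apply: emeasurable_funM.
    have mc := @measurable_cpath G cG _ R (fun=> X) (fun=> m) e (fun=> t) id mX2 (measurable_cst m) (measurable_cst t) (@measurable_id _ _ setT) (fun=> gX).
    have := @measurable_fun_fubini_tonelli_F _ _ R T R P _ (measurableT_comp mPhi mc).
    by apply=> z; exact: Phi0.
  apply/measurable_EFinP; apply: measurable_gauss_pdf => //.
  by apply: measurable_funB.
have H0 v : (0 <= H v)%E.
  by rewrite mule_ge0// ?lee_fin ?gauss_pdf_ge0//; apply: integral_ge0.
rewrite [RHS](ge0_integral_shift (Lf e m t) mH H0); apply: eq_integral => u _.
rewrite /H (_ : Lf e m t + u - Lf e m t = u); last by ring.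
have E x : u - cL X m e t x = Lf e m t + u - Lf e (X x) t.
  by rewrite /cL; move: (Lf e (X x) t) (Lf e m t) => *; ring.
rewrite gauss_pdfE ?gt_eqF// muleC.
apply: (congr1 (fun z => (z * _)%E)); apply: eq_integral => x _.
exact: (congr1 (fun a => Phi (padd (X x) a (kpath P X m (cL X m e t)))) (E x)).
Qed.

End conditioning.

(** * Rice's formula for the unique zero in a strip *)

Section strip_formula.
Context d (T : measurableType d) (R : realType) (P : probability T R).
Notation mu := (@lebesgue_measure R).
Variable G : set (T -> R).
Hypothesis cG : cgauss P G.
Variables (X : T -> path R) (m : path R).
Hypothesis gX : gproc G X m.
Variables (e : R * R) (p q : R).

Definition descending (e : R * R) (p q : R) (w : R -> R) := forall t, p <= t <= q -> Lf' e w t < 0.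
(** Strict at the left end and weak at the right one: for a descending path the zero lies in the
    half-open interval from s (excluded) to t, and adjacent strips do not count it twice. *)
Definition crosses (e : R * R) (s t : R) (w : R -> R) := 0 < Lf e w s /\ Lf e w t <= 0.

Lemma descending_lt (w : path R) s t : descending e p q w -> p <= s -> s < t -> t <= q ->
  Lf e w t < Lf e w s.
Proof.
move=> dw ps st tq; have dL u : is_derive u (1:R) (Lf e w) (Lf' e w u) := Lf_derive e u (path_C2 w).
have [|c cst E] := @MVT R (Lf e w) (Lf' e w) s t st (fun u _ => dL u).
  by apply: continuous_subspaceT => u; exact: Lf_continuous (path_C2 w) u.
rewrite -subr_lt0 E pmulr_llt0 ?subr_gt0//; apply: dw.
by move: cst; rewrite in_itv/= => /andP[h1 h2]; rewrite (le_trans ps (ltW h1)) (le_trans (ltW h2)).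
Qed.

Lemma measurable_crosses s t : measurable [set w : path R | crosses e s t w].
Proof.
have mL u : measurable_fun setT (fun w : path R => Lf e w u) by exact: measurable_Lf.
have -> : [set w : path R | crosses e s t w] =
    (fun w : path R => Lf e w s) @^-1` `]0, +oo[ `&` (fun w : path R => Lf e w t) @^-1` `]-oo, 0].
  by apply/seteqP; split => w /=; rewrite !in_itv/= ?andbT.
by apply: measurableI; rewrite -[X in measurable X]setTI; apply: mL => //; exact: measurable_itv.
Qed.

Notation slide := (fun t => cpath P X m e t 0).

Let mX2 : measurable_fun setT (fun z : R * T => X z.2).
Proof. exact: (measurableT_comp (gp_meas gX) (@measurable_snd _ _ _ _)). Qed.

Let measurable_slide : measurable_fun setT (fun z : R * T => slide z.1 z.2).
Proof.
exact: (@measurable_cpath _ _ _ P G cG _ R (fun=> X) (fun=> m) e id (fun=> 0) mX2 (measurable_cst m)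
  (@measurable_id _ _ setT) (measurable_cst (0 : R)) (fun=> gX)).
Qed.

Variable F : path R -> \bar R.
Hypotheses (mF : measurable_fun setT F) (F0 : forall w, (0 <= F w)%E).
Hypothesis Fdesc : forall w, F w != 0%E -> descending e p q w.

(** The integrand of Rice's formula: the mean of F times the downward slope along the path
    conditioned on a zero at t, times the density at 0 of the observable, which by symmetry of the
    centred density is evaluated at the mean. *)
Definition slid_density (t : R) : \bar R :=
  ((\int[P]_x (F (slide t x) * (Num.max (- Lf' e (slide t x) t) 0)%:E)) *
   (gauss_pdf (sd P X m e t) (Lf e m t))%:E)%E.

Lemma slid_density_ge0 t : (0 <= slid_density t)%E.
Proof.
rewrite mule_ge0// ?lee_fin ?gauss_pdf_ge0//; apply: integral_ge0 => x _.
by rewrite mule_ge0// lee_fin le_max lexx orbT.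
Qed.

Let mFmax : measurable_fun setT (fun z : R * path R => F z.2 * (Num.max (- Lf' e z.2 z.1) 0)%:E)%E.
Proof.
apply: emeasurable_funM; first exact: (measurableT_comp mF (@measurable_snd _ _ _ _)).
apply/measurable_EFinP; apply: measurable_maxr => //; apply: measurableT_comp => //.
exact: measurable_Lf'2.
Qed.

Lemma measurable_slid_density : measurable_fun setT slid_density.
Proof.
apply: emeasurable_funM.
  have mz : measurable_fun setT (fun z : R * T => (z.1, slide z.1 z.2)).
    by apply: measurable_fun_pair; [exact: measurable_fst|exact: measurable_slide].
  have := @measurable_fun_fubini_tonelli_F _ _ R T R P _ (measurableT_comp mFmax mz).
  by apply=> z; rewrite mule_ge0// lee_fin le_max lexx orbT.
apply/measurable_EFinP.
have mz : measurable_fun setT (fun t => Lf e m t) by exact: (measurable_Lf e (@measurable_id _ _ _) (measurable_cst m)).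
have ms : measurable_fun setT (fun t => sd P X m e t).
  exact: (@measurable_sd _ _ _ P _ R (fun=> X) (fun=> m) e id mX2 (measurable_cst m) (@measurable_id _ _ setT)).
exact: (measurable_gauss_pdf ms mz).
Qed.

Definition strip_rice (s t : R) :=
  (\int[P]_x (F (X x) * (\1_[set w : path R | crosses e s t w] (X x))%:E) =
   \int[mu]_(u in `]s, t]) slid_density u)%E.

(** With [U] fixed, [regression_formula] replaces each path by a line of paths X + (u - U) ka. Since
    the observable of ka stays positive on [s, t], exactly one parameter puts a zero at a given
    location, and [area_formula] changes the variable from parameter to location. The direction is
    exchanged for that of the observable only after this, location by location. *)
Lemma strip_rice_local (U : T -> R) (sU s t : R) : G U -> 0 < sU -> ip P U U = sU ^+ 2 ->
  p <= s -> s <= t -> t <= q ->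
  (forall u, s <= u <= t -> 0 < Lf e (kpath P X m U) u) ->
  (forall u, p <= u <= q -> 0 < ip P (cL X m e u) (cL X m e u)) ->
  strip_rice s t.
Proof.
move=> GU sU0 UU ps st tq k0 v0; have sUn : sU != 0 by rewrite gt_eqF.
have mX := gp_meas gX; have [mU _] := cg_sqint cG GU.
set ka := kpath P X m U in k0 *.
pose k u := Lf e ka u; pose k' u := Lf' e ka u.
pose A : set (path R) := [set w : path R | crosses e s t w].
have mA : measurable A by exact: measurable_crosses.
pose FA w := (F w * (\1_A w)%:E)%E.
have mFA : measurable_fun setT FA.
  by apply: emeasurable_funM => //; apply/measurable_EFinP; exact: measurable_indic.
have FA0 w : (0 <= FA w)%E by rewrite mule_ge0// lee_fin indicE.
rewrite /strip_rice -/A -[LHS]/(\int[P]_x FA (X x))%E.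
rewrite (regression_formula cG gX GU sU0 UU mFA FA0) -/ka.
pose line x u := padd (X x) (u - U x) ka.
have mline : measurable_fun setT (fun z : T * R => line z.1 z.2).
  apply: measurable_padd => //.
  - exact: (measurableT_comp mX (@measurable_fst _ _ _ _)).
  - apply: measurable_funB; first exact: measurable_snd.
    exact: (measurableT_comp mU (@measurable_fst _ _ _ _)).
have pdf0 u : (0 <= (normal_pdf 0 sU u)%:E)%E by rewrite lee_fin normal_pdf_ge0.
pose h (z : T * R) := ((normal_pdf 0 sU z.2)%:E * FA (line z.1 z.2))%E.
have mh : measurable_fun setT h.
  apply: emeasurable_funM; last exact: (measurableT_comp mFA mline).
  apply/measurable_EFinP; exact: (measurableT_comp (measurable_normal_pdf 0 sU) (@measurable_snd _ _ _ _)).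
have h0 z : (0 <= h z)%E by rewrite mule_ge0.
transitivity (\int[P]_x \int[mu]_u h (x, u))%E.
  rewrite (lebesgue_tonelli P mh h0); apply: eq_integral => u _.
  rewrite -ge0_integralZl//.
  have mu1 : measurable_fun setT (fun x : T => (x, u)) by apply: measurable_fun_pair.
  exact: (measurableT_comp mFA (measurableT_comp mline mu1)).
pose S u x := padd (X x) (- (Lf e (X x) u / k u)) ka.
pose wt u x := (normal_pdf 0 sU (U x - Lf e (X x) u / k u))%:E.
pose Fm u w := (F w * (Num.max (- Lf' e w u) 0)%:E)%E.
pose j (z : T * R) := (Fm z.2 (S z.2 z.1) * wt z.2 z.1 * ((k z.2)^-1 * \1_(`]s, t]%classic) z.2)%:E)%E.
have inner x : (\int[mu]_u h (x, u) = \int[mu]_u j (x, u))%E.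
  pose a u := Lf e (X x) u; pose a' u := Lf' e (X x) u.
  (* The parameter at which the line of paths vanishes at location u. *)
  pose psi u := U x - a u / k u.
  pose psi' u := - ((a' u * k u - a u * k' u) / k u ^+ 2).
  (* Restricting to paths seen by F makes them descending, which yields the sign of the derivative
     that [area_formula] asks for. *)
  pose O : set R := [set u | A (line x u) /\ F (line x u) != 0%E].
  have mx (w : path R) : measurable_fun setT (Lf e w).
    exact: (measurable_Lf e (@measurable_id _ _ _) (measurable_cst w)).
  have mx' (w : path R) : measurable_fun setT (Lf' e w).
    exact: (measurable_Lf' e (@measurable_id _ _ _) (measurable_cst w)).
  have mki : measurable_fun setT (fun u => (k u)^-1).
    by apply: measurableT_comp; [exact: measurable_invr|exact: mx].
  have mpsi : measurable_fun setT psi.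
    apply: measurable_funB => //; apply: measurable_funM; [exact: mx|exact: mki].
  have mpsi' : measurable_fun setT psi'.
    apply: measurableT_comp => //; apply: measurable_funM.
      by apply: measurable_funB; apply: measurable_funM; try exact: mx; exact: mx'.
    under eq_fun do rewrite -exprVn; exact: measurable_funX.
  have kn u : s <= u <= t -> k u != 0 by move=> /k0 h1; rewrite gt_eqF.
  have da (w : path R) u : is_derive u (1:R) (Lf e w) (Lf' e w u) := Lf_derive e u (path_C2 w).
  have dpsi u : s <= u <= t -> is_derive u (1:R) psi (psi' u).
    move=> /kn ku; have d1 := da (X x) u; have d2 := da ka u.
    have d3 := is_deriveV ku d2.
    have d4 := is_deriveB (is_derive_cst (U x) u (1:R)) (is_deriveM d1 d3).
    apply: (@is_derive_eq _ _ _ _ _ _ _ _ d4); rewrite /psi' /a /a' /k' /GRing.scale /= -/(k u) -/(k u).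
    by move: ku; move: (Lf e (X x) u) (Lf' e (X x) u) (Lf' e ka u) (k u) => *; field.
  have cpsi' u : s <= u <= t -> {for u, continuous psi'}.
    move=> /kn ku; have c1 (w : path R) := @Lf_continuous R e w (path_C2 w).
    have c2 (w : path R) := @Lf'_continuous R e w (path_C2 w).
    apply: cvgN; apply: cvgM.
      by apply: cvgB; apply: cvgM; try exact: c1; exact: c2.
    apply: cvgV; first by rewrite expf_neq0.
    by rewrite expr2; under eq_fun do rewrite expr2; apply: cvgM; exact: c1.
  have mlx : measurable_fun setT (line x).
    have mu1 : measurable_fun setT (fun u : R => (x, u)) by apply: measurable_fun_pair.
    exact: (measurableT_comp mline mu1).
  have mO : measurable O.
    have -> : O = line x @^-1` (A `&` F @^-1` (~` [set 0%E])).
      by apply/seteqP; split => u /= [h1 /eqP h2].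
    rewrite -[X in measurable X]setTI; apply: mlx => //; apply: measurableI => //.
    by rewrite -[X in measurable X]setTI; apply: mF => //; exact: measurableC.
  have Lline u v : Lf e (line x v) u = a u + (v - U x) * k u.
    exact: Lf_padd (path_C2 _) (path_C2 _).
  have Ose u : O u -> psi s <= u <= psi t.
    move=> [[]]; rewrite !Lline => h1 h2 _.
    have ks := k0 s; have kt := k0 t; rewrite lexx st in ks kt.
    rewrite /psi; apply/andP; split.
      by rewrite lerBlDr -lerBlDl ler_pdivlMr ?ks// ltW//; move: h1; rewrite -/(k s); lra.
    by rewrite -[leLHS](subrK (U x)) addrC lerD2l lerNr ler_pdivrMr ?kt//; move: h2; lra.
  have lineS u : line x (psi u) = S u x.
    have e0 : psi u - U x = - (a u / k u) by rewrite /psi; move: (U x) (a u / k u) => *; ring.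
    by rewrite /line e0.
  have L'S u : Lf' e (S u x) u = a' u - a u / k u * k' u.
    by rewrite /S Lf'_padd; [rewrite mulNr|exact: path_C2|exact: path_C2].
  have psi'E u : s <= u <= t -> psi' u = (k u)^-1 * - Lf' e (S u x) u.
    by move=> /kn ku; rewrite L'S /psi'; field.
  have desc u : s <= u <= t -> F (S u x) != 0%E -> Lf' e (S u x) u < 0.
    move=> /andP[h1 h2] /Fdesc; apply; by rewrite (le_trans ps h1) (le_trans h2 tq).
  have Opos u : s <= u <= t -> O (psi u) -> 0 <= psi' u.
    move=> hu [_]; rewrite lineS psi'E// => /(desc u hu) h1.
    by rewrite mulr_ge0 ?oppr_ge0 ?(ltW h1)// invr_ge0 ltW// k0.
  pose f u := ((normal_pdf 0 sU u)%:E * F (line x u))%E.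
  have mf : measurable_fun setT f.
    apply: emeasurable_funM; last exact: (measurableT_comp mF mlx).
    by apply/measurable_EFinP; exact: measurable_normal_pdf.
  have f0 u : (0 <= f u)%E by rewrite mule_ge0.
  transitivity (\int[mu]_u (f u * (\1_O u)%:E))%E.
    apply: eq_integral => u _; rewrite /h /f /FA /= -muleA.
    have [->|Fn] := eqVneq (F (line x u)) 0%E; first by rewrite !mul0e.
    congr (_ * (_ * _%:E))%E; rewrite !indicE (_ : (u \in O) = (line x u \in A))//.
    by apply/idP/idP => [/set_mem [h1 _]|/set_mem h1]; apply/mem_set.
  rewrite -(@area_formula R psi psi' s t st mpsi mpsi' dpsi cpsi' O f mO Ose Opos mf f0).
  apply: eq_integral => u _; rewrite /f lineS /j /Fm /wt /=.
  have -> : U x - Lf e (X x) u / k u = psi u by [].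
  have [Ju|Ju] := boolP (s <= u <= t); last first.
    have -> : \1_(`[s, t]%classic) u = 0 :> R.
      by rewrite indicE memNset//= in_itv/=; exact/negP.
    have -> : \1_(`]s, t]%classic) u = 0 :> R.
      rewrite indicE memNset//= in_itv/= => /andP[h1 h2].
      by move: Ju; rewrite (ltW h1) h2.
    by rewrite !mulr0 !mule0.
  have [->|Fn] := eqVneq (F (S u x)) 0%E; first by rewrite mule0 !mul0e.
  have hd := desc u Ju Fn; have dS := Fdesc Fn; have /andP[h1 h2] := Ju.
  have LS : Lf e (S u x) u = 0.
    by rewrite -lineS Lline /psi /a; have := kn u Ju; move: (k u) (Lf e (X x) u) => *; field.
  have -> : \1_(`[s, t]%classic) u = 1 :> R by rewrite indicE mem_set//= in_itv/=.
  (* A zero at s itself contradicts the strict inequality in [crosses]; every other location in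
     [s, t] is accepted because the path descends. *)
  have -> : \1_O (psi u) = \1_(`]s, t]%classic) u :> R.
    rewrite !indicE (_ : (psi u \in O) = (u \in `]s, t]%classic))//; apply/idP/idP => [/set_mem [+ _]|].
      rewrite lineS => -[h3 _]; apply/mem_set; rewrite /= in_itv/= h2 andbT lt_neqAle h1 andbT.
      by apply/eqP => su; move: h3; rewrite su LS ltxx.
    rewrite inE/= in_itv/= => /andP[h3 _]; apply/mem_set; rewrite /O /= lineS; split => //.
    split; first by have := descending_lt dS ps h3 (le_trans h2 tq); rewrite LS.
    move: h2; rewrite le_eqVlt => /predU1P[<-|h2]; first by rewrite LS.
    by have := descending_lt dS (le_trans ps h1) h2 tq; rewrite LS => /ltW.
  have -> : Num.max (psi' u) 0 = (k u)^-1 * Num.max (- Lf' e (S u x) u) 0.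
    rewrite psi'E// !max_l ?oppr_ge0 ?(ltW hd)//.
    by rewrite mulr_ge0 ?oppr_ge0 ?(ltW hd)// invr_ge0 ltW// k0.
  rewrite mulr1 [((normal_pdf _ _ _)%:E * _)%E]muleC -!muleA -!EFinM; congr (_ * _%:E)%E.
  by move: (normal_pdf _ _ _) (Num.max _ _) (\1__ _) (k u)^-1 => *; ring.
have mk : measurable_fun setT (fun z : T * R => (k z.2)^-1).
  apply: measurableT_comp; first exact: measurable_invr.
  exact: (measurable_Lf e (@measurable_snd _ _ _ _) (measurable_cst ka)).
have mX1 : measurable_fun setT (fun z : T * R => X z.1) by exact: (measurableT_comp mX (@measurable_fst _ _ _ _)).
have ma : measurable_fun setT (fun z : T * R => Lf e (X z.1) z.2 / k z.2).
  by apply: measurable_funM => //; exact: (measurable_Lf e (@measurable_snd _ _ _ _) mX1).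
have mS : measurable_fun setT (fun z : T * R => S z.2 z.1).
  have mna : measurable_fun setT (fun z : T * R => - (Lf e (X z.1) z.2 / k z.2)).
    exact: (measurableT_comp (@oppr_measurable R setT) ma).
  exact: (measurable_padd mX1 mna (measurable_cst ka)).
have mj : measurable_fun setT j.
  apply: emeasurable_funM; first apply: emeasurable_funM.
  - have mz : measurable_fun setT (fun z : T * R => (z.2, S z.2 z.1)).
      by apply: measurable_fun_pair; [exact: measurable_snd|exact: mS].
    exact: (measurableT_comp mFmax mz).
  - apply/measurable_EFinP; apply: measurableT_comp; first exact: measurable_normal_pdf.
    by apply: measurable_funB => //; exact: (measurableT_comp mU (@measurable_fst _ _ _ _)).
  - apply/measurable_EFinP; apply: measurable_funM => //.
    apply: measurableT_comp; last exact: measurable_snd.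
    by apply: measurable_indic; exact: measurable_itv.
have Fm0 u w : (0 <= Fm u w)%E by rewrite mule_ge0// lee_fin le_max lexx orbT.
have wt0 u x : (0 <= wt u x)%E by rewrite lee_fin normal_pdf_ge0.
have j0 z : (0 <= j z)%E.
  have hk : 0 <= (k z.2)^-1 * \1_(`]s, t]%classic) z.2.
    rewrite indicE; have [h1|h1] := boolP (z.2 \in `]s, t]%classic); last by rewrite mulr0.
    rewrite mulr1 invr_ge0 ltW// k0//.
    by move: h1; rewrite inE/= in_itv/= => /andP[/ltW -> ->].
  by apply: mule_ge0; [exact: (mule_ge0 (Fm0 _ _) (wt0 _ _))|rewrite lee_fin].
rewrite (eq_integral _ _ (fun x _ => inner x)) (lebesgue_tonelli P mj j0).
rewrite [RHS]integral_mkcond; apply: eq_integral => u _; rewrite patchE /j /=.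
case: ifPn => hu; last first.
  by rewrite integral0_eq// => x _; rewrite indicE (negbTE hu) mulr0 mule0.
have hst : s <= u <= t by move: hu; rewrite inE/= in_itv/= => /andP[/ltW -> ->].
have ku := k0 u hst; have kn : k u != 0 by rewrite gt_eqF.
have pu : p <= u <= q by case/andP: hst => h1 h2; rewrite (le_trans ps h1) (le_trans h2 tq).
have sd0 : 0 < sd P X m e u by rewrite sqrtr_gt0 v0.
have sdE : ip P (cL X m e u) (cL X m e u) = sd P X m e u ^+ 2 by rewrite sqr_sqrtr// ltW// v0.
have mFm : measurable_fun setT (Fm u).
  apply: emeasurable_funM => //; apply/measurable_EFinP; apply: measurable_maxr => //.
  by apply: measurableT_comp => //; exact: measurable_Lf'.
have mx1 : measurable_fun setT (fun x : T => (x, u)) by apply: measurable_fun_pair.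
(* The factor k created here cancels the inverse of k produced by the derivative of [psi]. *)
have H := slide_direction_change cG gX GU sU0 UU sd0 sdE ku mFm (Fm0 u).
rewrite indicE hu mulr1 ge0_integralZr//; last 3 first.
- apply: emeasurable_funM; first exact: (measurableT_comp mFm (measurableT_comp mS mx1)).
  apply/measurable_EFinP; apply: measurableT_comp; first exact: measurable_normal_pdf.
  by apply: measurable_funB => //; exact: (measurableT_comp ma mx1).
- by move=> x _; rewrite mule_ge0.
- by rewrite lee_fin invr_ge0 ltW.
rewrite H /slid_density gauss_pdfE ?gt_eqF// -muleA -EFinM.
under [in RHS]eq_integral do rewrite /cpath sub0r.
by congr (_ * _%:E)%E; rewrite -/(k u) mulrAC divff// mul1r.
Qed.

(** The sign at b decides which of the two subintervals a descending path crosses. *)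
Lemma strip_rice_additive a b c : p <= a -> a <= b -> b <= c -> c <= q ->
  strip_rice a b -> strip_rice b c -> strip_rice a c.
Proof.
move=> pa ab bc cq hab hbc; have mX := gp_meas gX.
have mFA u v : measurable_fun setT (fun x => F (X x) * (\1_[set w : path R | crosses e u v w] (X x))%:E)%E.
  apply: emeasurable_funM; first exact: (measurableT_comp mF mX).
  apply/measurable_EFinP; apply: (measurableT_comp _ mX).
  by apply: measurable_indic; exact: measurable_crosses.
have FA0 u v x : (0 <= F (X x) * (\1_[set w : path R | crosses e u v w] (X x))%:E)%E.
  by rewrite mule_ge0// lee_fin indicE.
rewrite /strip_rice.
transitivity (\int[P]_x (F (X x) * (\1_[set w : path R | crosses e a b w] (X x))%:E +
    F (X x) * (\1_[set w : path R | crosses e b c w] (X x))%:E))%E.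
  apply: eq_integral => x _; have [->|Fn] := eqVneq (F (X x)) 0%E; first by rewrite !mul0e adde0.
  have dX := Fdesc Fn.
  have mono u v : p <= u -> u <= v -> v <= q -> Lf e (X x) v <= Lf e (X x) u.
    move=> h1; rewrite le_eqVlt => /predU1P[->//|h2] h3; apply/ltW; exact: (descending_lt dX).
  have h1 := mono a b pa ab (le_trans bc cq); have h2 := mono b c (le_trans pa ab) bc cq.
  rewrite -ge0_muleDr ?lee_fin ?indicE//.
  congr (_ * _)%E; rewrite -EFinD; congr (_%:E); rewrite ?indicE.
  have [Lb|Lb] := ltP 0 (Lf e (X x) b).
    rewrite (_ : (X x \in [set w : path R | crosses e a b w]) = false) /= ?add0r; last first.
      by apply/negbTE/negP => /set_mem [_]; rewrite leNgt Lb.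
    rewrite (_ : (X x \in _) = (X x \in [set w : path R | crosses e b c w]))//.
    by apply/idP/idP => /set_mem [h3 h4]; apply/mem_set; split => //; exact: lt_le_trans h1.
  rewrite (_ : (X x \in [set w : path R | crosses e b c w]) = false) /= ?addr0; last first.
    by apply/negbTE/negP => /set_mem [+ _]; rewrite ltNge Lb.
  rewrite (_ : (X x \in _) = (X x \in [set w : path R | crosses e a b w]))//.
  by apply/idP/idP => /set_mem [h3 h4]; apply/mem_set; split => //; exact: le_trans Lb.
rewrite ge0_integralD// hab hbc.
have -> : `]a, c]%classic = `]a, b]%classic `|` `]b, c]%classic :> set R.
  apply/seteqP; split => u /=; rewrite !in_itv/=.
    move=> /andP[h1 h2]; have [h3|h3] := leP u b; [left|right]; by rewrite ?h1 ?h2 ?h3.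
  move=> [|] /andP[h1 h2]; first by rewrite h1 (le_trans h2).
  by rewrite (le_lt_trans ab h1).
rewrite ge0_integral_setU//=.
- exact: measurable_funTS measurable_slid_density.
- by move=> u _; exact: slid_density_ge0.
- apply/disj_setPS => u /=; rewrite !in_itv/= => -[/andP[_ h1] /andP[h2 _]].
  by have := le_lt_trans h1 h2; rewrite ltxx.
Qed.

(** Near t the direction is the regression on the observable at t itself: its own observable equals
    1 at t, hence is positive on a neighbourhood, where the local formula applies. *)
Theorem strip_rice_formula : p <= q ->
  (forall u, p <= u <= q -> 0 < ip P (cL X m e u) (cL X m e u)) ->
  strip_rice p q.
Proof.
move=> pq v0; apply: (interval_induction pq).
  by move=> a b c; exact: strip_rice_additive.
move=> t /v0 vt; have GU := cL_G cG gX e t; have sU := cg_sqint cG GU.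
set U := cL X m e t in vt GU sU *.
have sd0 : 0 < sd P X m e t by rewrite sqrtr_gt0.
have sdE : ip P U U = sd P X m e t ^+ 2 by rewrite sqr_sqrtr// ltW.
have k1 : Lf e (kpath P X m U) t = 1 by rewrite (Lf_kpath cG gX)// divff// gt_eqF.
have ck := @Lf_continuous R e _ (path_C2 (kpath P X m U)) t.
have : \forall u \near t, 0 < Lf e (kpath P X m U) u.
  by apply: (cvgr_gt _ ck); rewrite k1.
move=> /nbhs_ballP[r /= r0 h]; exists r => // a b pa ab bq ta bt.
apply: (strip_rice_local GU sd0 sdE) => // u /andP[au ub].
by apply: h; rewrite /ball/= ltr_distlC; apply/andP; split; move: ta bt au ub; lra.
Qed.

End strip_formula.

(** * Conditioning on several observables, one after the other *)

Section conditioning_chain.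
Context d (T : measurableType d) (R : realType) (P : probability T R).
Variables (G : set (T -> R)) (cG : cgauss P G).
Implicit Types (l : seq ((R * R) * R)) (u v : seq R) (X : T -> path R) (m : path R).

(** Returns the conditioned process together with its mean, since the next regression needs both. A
    list of values that is too short is completed by 0. *)
Fixpoint chain l v X m : (T -> path R) * path R :=
  if l is c :: l' then
    chain l' (behead v) (cpath P X m c.1 c.2 (head 0 v)) (cmean P X m c.1 c.2 (head 0 v))
  else (X, m).

(** The chain rule for densities: each factor is the density of one observable given the preceding
    values. *)
Fixpoint chain_pdf l v X m : R :=
  if l is c :: l' then
    gauss_pdf (sd P X m c.1 c.2) (head 0 v - Lf c.1 m c.2) *
    chain_pdf l' (behead v) (cpath P X m c.1 c.2 (head 0 v)) (cmean P X m c.1 c.2 (head 0 v))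
  else 1.

Fixpoint lcomb l u X m (x : T) : R :=
  if l is c :: l' then head 0 u * cL X m c.1 c.2 x + lcomb l' (behead u) X m x else 0.

Fixpoint nonzero_coef l u : bool :=
  if l is c :: l' then (head 0 u != 0) || nonzero_coef l' (behead u) else false.

(** Positive definiteness of the covariance matrix of the observables, in a form that can be
    followed along the recursion of [chain]. *)
Definition nondeg l X m := forall u, nonzero_coef l u -> 0 < ip P (lcomb l u X m) (lcomb l u X m).

Fixpoint lvals l u (w : R -> R) : R :=
  if l is c :: l' then head 0 u * Lf c.1 w c.2 + lvals l' (behead u) w else 0.

Fixpoint lresid l u v (w : R -> R) : R :=
  if l is c :: l' then head 0 u * (head 0 v - Lf c.1 w c.2) + lresid l' (behead u) (behead v) w else 0.

Lemma lcomb_nil l X m : lcomb l [::] X m = (fun=> 0).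
Proof. by elim: l => //= c l IH; apply/funext => x; rewrite mul0r IH addr0. Qed.

Lemma lcomb_G l u X m : gproc G X m -> G (lcomb l u X m).
Proof.
move=> gX; elim: l u => [|c l IH] u; first exact: (cg_0 cG).
exact: (cg_lin cG) (cL_G cG gX _ _) (IH _).
Qed.

Lemma lcomb_cond l u X m e t (v0 : R) :
  lcomb l u (cpath P X m e t v0) (cmean P X m e t v0) =
  (fun x => lcomb l u X m x - lvals l u (kpath P X m (cL X m e t)) * cL X m e t x).
Proof.
elim: l u => [|c l IH] u; apply/funext => x /=; first by rewrite mul0r subr0.
rewrite (IH (behead u)) cL_cond.
by move: (cL X m c.1 c.2 x) (lcomb _ _ _ _ x) (lvals _ _ _) (cL X m e t x) (Lf _ _ _) => *; ring.
Qed.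

(** A combination of residuals is a combination of the whole list in which only the coefficient of
    [c] has been adjusted, so it keeps its nonzero coefficients. *)
Lemma nondeg_cons c l X m (v0 : R) : nondeg (c :: l) X m ->
  0 < ip P (cL X m c.1 c.2) (cL X m c.1 c.2) /\
  nondeg l (cpath P X m c.1 c.2 v0) (cmean P X m c.1 c.2 v0).
Proof.
move=> nd; split.
  have := nd [:: 1]; rewrite /= oner_eq0 /= => /(_ isT).
  rewrite lcomb_nil (_ : (fun x => _) = cL X m c.1 c.2)//.
  by apply/funext => x; rewrite mul1r addr0.
move=> u nu; rewrite lcomb_cond.
have := nd (- lvals l u (kpath P X m (cL X m c.1 c.2)) :: u); rewrite /= nu orbT => /(_ isT).
rewrite (_ : (fun x => _) = (fun x => lcomb l u X m x - lvals l u (kpath P X m (cL X m c.1 c.2)) * cL X m c.1 c.2 x))//.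
by apply/funext => x; rewrite addrC mulNr.
Qed.

(** The processes may differ by their means only, as happens when the same observable is given two
    different values. *)
Definition same_residual X m X2 m2 := forall e t, cL X m e t = cL X2 m2 e t.

Let eval_cL X m t : (fun x => X x t - m t) = cL X m (1, 0) t.
Proof. by apply/funext => x; rewrite /cL /Lf /= !mul1r !mul0r !addr0. Qed.

Let ipD (f g h : T -> R) : sqint P f -> sqint P g -> sqint P h ->
  ip P (fun x => f x + g x) h = ip P f h + ip P g h.
Proof.
move=> sf sg sh; have := ip_linl 1 1 sf sg sh; rewrite !mul1r => <-.
by congr ip; apply/funext => x; rewrite !mul1r.
Qed.

Lemma same_residual_kpath X m X2 m2 U : same_residual X m X2 m2 -> kpath P X m U = kpath P X2 m2 U.
Proof.
move=> h; rewrite /kpath; congr mkpath; apply/funext => t.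
by rewrite /kfun !eval_cL h.
Qed.

Lemma same_residual_cond X m X2 m2 e t (v v2 : R) : same_residual X m X2 m2 ->
  same_residual (cpath P X m e t v) (cmean P X m e t v) (cpath P X2 m2 e t v2) (cmean P X2 m2 e t v2).
Proof.
move=> h e' t'; apply: (etrans (@cL_cond _ T R P X m e t v e' t')).
apply: etrans (esym (@cL_cond _ T R P X2 m2 e t v2 e' t')).
by rewrite (h e' t') (h e t) (same_residual_kpath (cL X2 m2 e t) h).
Qed.

Lemma same_residual_sd X m X2 m2 e t : same_residual X m X2 m2 -> sd P X m e t = sd P X2 m2 e t.
Proof. by move=> h; rewrite /sd h. Qed.

Lemma lresid_padd l u v (w k : path R) a :
  lresid l u v (padd w a k) = lresid l u v w - a * lvals l u k.
Proof.
elim: l u v => [|c l IH] u v /=; first by rewrite mulr0 subr0.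
rewrite IH; have := Lf_padd c.1 a c.2 (path_C2 w) (path_C2 k).
move: (Lf c.1 (padd w a k) c.2) => z ->.
by move: (lresid _ _ _ _) (lvals _ _ _) (Lf _ _ _) (Lf _ _ _) => *; ring.
Qed.

(** Successive scalar regressions amount to one joint regression: [q t] holds the coefficients of X
    t on the whole list, and the second clause is the normal equations. Quantifying over all [X2]
    with the same residual is forced by the recursion, where each prescribed value changes the
    mean. *)
Lemma chain_residual l X m : gproc G X m -> nondeg l X m ->
  exists q : R -> seq R,
    (forall X2 m2, same_residual X m X2 m2 -> forall v x t,
       (chain l v X2 m2).1 x t = X2 x t + lresid l (q t) v (X2 x)) /\
    (forall t c, c \in l ->
       ip P (fun x => cL X m (1, 0) t x - lcomb l (q t) X m x) (cL X m c.1 c.2) = 0).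
Proof.
elim: l X m => [|c l IH] X m gX nd.
  by exists (fun=> [::]); split => //= X2 m2 _ v x t; rewrite addr0.
have [v0 nd'] := nondeg_cons 0 nd.
have gX' := gproc_cond cG gX c.1 c.2 0.
have [q' [h1 h2]] := IH _ _ gX' nd'.
set Y := cL X m c.1 c.2 in v0 *; set ka := kpath P X m Y.
have GY : G Y := cL_G cG gX c.1 c.2; have sY := cg_sqint cG GY.
(* Sliding along [ka] also moves the later observables, by [lvals l (q' t) ka] in total; the first
   coefficient compensates for this. *)
exists (fun t => (ka t - lvals l (q' t) ka) :: q' t); split.
  move=> X2 m2 h v x t /=.
  have hs := same_residual_cond c.1 c.2 0 (head 0 v) h.
  rewrite (h1 _ _ hs (behead v) x t) /cpath -(h _ _) -/Y -(same_residual_kpath _ h) -/ka.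
  rewrite lresid_padd; have e1 := paddE (head 0 v - Lf c.1 (X2 x) c.2) (path_C2 (X2 x)) (path_C2 ka).
  apply: (etrans (congr1 (fun z => z + _) (congr1 (fun f : R -> R => f t) e1))).
  by move: (X2 x t) (Lf c.1 (X2 x) c.2) (ka t) (lvals _ _ _) (lresid _ _ _ _) => *; ring.
pose D t x := cL X m (1, 0) t x - lcomb (c :: l) ((ka t - lvals l (q' t) ka) :: q' t) X m x.
have kaE t : Lf (1, 0) ka t = ka t by rewrite /Lf /= mul1r mul0r addr0.
have DE t : D t = (fun x => cL (cpath P X m c.1 c.2 0) (cmean P X m c.1 c.2 0) (1, 0) t x -
    lcomb l (q' t) (cpath P X m c.1 c.2 0) (cmean P X m c.1 c.2 0) x).
  apply/funext => x; rewrite /D /= cL_cond lcomb_cond -/Y -/ka kaE.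
  by move: (cL X m (1,0) t x) (ka t) (lvals _ _ _) (Y x) (lcomb _ _ _ _ _) => *; ring.
have GD t : G (D t).
  rewrite DE; have := cg_sub cG 1 (cL_G cG gX' (1, 0) t) (lcomb_G l (q' t) gX').
  by congr G; apply/funext => x; rewrite mul1r.
have orthL e' t' : ip P (cL (cpath P X m c.1 c.2 0) (cmean P X m c.1 c.2 0) e' t') Y = 0.
  have sL := cg_sqint cG (cL_G cG gX e' t').
  rewrite cL_cond -/Y -/ka ip_sub//; last exact: sqint_scale.
  by rewrite ip_scalel// /ka (Lf_kpath cG gX)// -/Y mulfVK ?subrr// gt_eqF.
have orthC u : ip P (lcomb l u (cpath P X m c.1 c.2 0) (cmean P X m c.1 c.2 0)) Y = 0.
  elim: {h1 h2 IH nd nd' D DE GD} l u => [|c' l IHl] u /=.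
    by have := ip_scalel 0 sY sY; rewrite mul0r (_ : (fun x => 0 * Y x) = (fun=> 0))//; apply/funext => x; rewrite mul0r.
  have s1 := cg_sqint cG (cL_G cG gX' c'.1 c'.2); have s2 := cg_sqint cG (lcomb_G l (behead u) gX').
  rewrite (ipD (sqint_scale (head 0 u) s1) s2 sY) (ip_scalel _ s1 sY) orthL mulr0 add0r.
  exact: IHl.
have orthD t : ip P (D t) Y = 0.
  rewrite DE ip_sub; [by rewrite orthL orthC subr0|exact: (cg_sqint cG (cL_G cG gX' _ _))| |exact: sY].
  exact: (cg_sqint cG (lcomb_G _ _ gX')).
move=> t c'; rewrite inE => /predU1P[->|c'l]; first exact: orthD.
have := h2 t c' c'l; rewrite -DE cL_cond -/Y -/ka.
have sD := cg_sqint cG (GD t); have sc := cg_sqint cG (cL_G cG gX c'.1 c'.2).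
rewrite ipC ip_sub//; last exact: sqint_scale.
by rewrite ip_scalel// (ipC P Y) orthD mulr0 subr0 ipC.
Qed.

Definition below l (a : seq R) : set (path R) :=
  [set w : path R | forall i, (i < size l)%N -> Lf (nth (0, 0, 0) l i).1 w (nth (0, 0, 0) l i).2 <= a`_i].

Lemma measurable_below l a : measurable (below l a).
Proof.
have -> : below l a = \bigcap_i [set w : path R | (i < size l)%N ->
    Lf (nth (0, 0, 0) l i).1 w (nth (0, 0, 0) l i).2 <= a`_i].
  by apply/seteqP; split => w h i; [move=> _; exact: h|exact: h].
apply: bigcapT_measurable => i; case: (ltnP i (size l)) => hi; last first.
  by rewrite (_ : [set w | _] = setT)//; apply/seteqP; split.
rewrite (_ : [set w | _] =
    (fun w : path R => Lf (nth (0, 0, 0) l i).1 w (nth (0, 0, 0) l i).2) @^-1` `]-oo, a`_i]); last first.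
  by apply/seteqP; split => w /=; rewrite in_itv/=; [apply|].
by rewrite -[X in measurable X]setTI; apply: measurable_Lf => //; exact: measurable_itv.
Qed.

(** Each use of [conditioning_formula] fixes one observable and extracts one density factor; [r]
    carries the factors already extracted through the induction. *)
Lemma chain_orthant l X m a (r : R) : gproc G X m -> nondeg l X m -> size a = size l -> 0 <= r ->
  (\int[P]_x (r * \1_(below l a) (X x))%:E =
   orthant_integral a (fun s => (r * chain_pdf l s X m)%:E))%E.
Proof.
elim: l X m a r => [|c l IH] X m [|a0 a]//= r gX nd.
  move=> _ r0; rewrite mulr1.
  have -> : (fun x => (r * \1_(below [::] [::]) (X x))%:E) = (fun=> r%:E).
    by apply/funext => x; rewrite indicE mem_set// mulr1.
  by rewrite integral_cst// [X in (_ * X)%E](@probability_setT _ _ _ P) mule1.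
move=> [sa] r0; have [v0 _] := nondeg_cons 0 nd.
have mPhi : measurable_fun setT (fun w : path R => (r * \1_(below (c :: l) (a0 :: a)) w)%:E).
  apply/measurable_EFinP; apply: measurable_funM => //; apply: measurable_indic.
  exact: measurable_below.
rewrite (conditioning_formula cG gX v0 mPhi); last by move=> w; rewrite lee_fin mulr_ge0// indicE.
rewrite [RHS]integral_mkcond; apply: eq_integral => y _; rewrite patchE.
have e1 x : Lf c.1 (cpath P X m c.1 c.2 y x) c.2 = y.
  by rewrite Lf_cpath (Lf_kpath_diag cG gX v0) mulr1; ring.
have hb x : below (c :: l) (a0 :: a) (cpath P X m c.1 c.2 y x) <->
    y <= a0 /\ below l a (cpath P X m c.1 c.2 y x).
  split=> [h|[h1 h2]].
    by split; [have := h 0%N erefl; rewrite /= e1|move=> i hi; exact: (h i.+1)].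
  by move=> [|i] /= hi; [rewrite e1|exact: h2].
have [ya|ya] := boolP (y \in `]-oo, a0]%classic); last first.
  have {}ya : ~ (y <= a0) by move=> h; move/negP: ya; apply; rewrite inE /= in_itv.
  rewrite integral0_eq ?mul0e// => x _.
  by rewrite indicE memNset ?mulr0// => /hb[].
have {}ya : y <= a0 by move: ya; rewrite inE /= in_itv.
have [_ nd'] := nondeg_cons y nd; have gX' := gproc_cond cG gX c.1 c.2 y.
set g := gauss_pdf _ _; have g0 : 0 <= g by exact: gauss_pdf_ge0.
rewrite -ge0_integralZr ?lee_fin//; last 2 first.
- exact: (measurableT_comp mPhi (gp_meas gX')).
- by move=> x _; rewrite lee_fin mulr_ge0// indicE.
have := IH _ _ a (r * g) gX' nd' sa (mulr_ge0 r0 g0).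
under [in X in _ = X -> _]eq_fun do rewrite -mulrA.
move=> <-; apply: eq_integral => x _; rewrite -EFinM; congr (_%:E).
rewrite mulrAC !indicE; congr (_ * (nat_of_bool _)%:R).
by apply/idP/idP => /set_mem; [move/hb => [_ h]|move=> h]; apply/mem_set => //; apply/hb.
Qed.

End conditioning_chain.

(** * Uniqueness of a continuous density *)

Section iterated_integrals.
Context (R : realType).
Notation mu := (@lebesgue_measure R).
Implicit Types (f : seq R -> R) (s : seq R) (A : seq (set R)).

(** Continuity in the sup norm of the first n entries; it also forces [f] to depend on these entries
    alone. *)
Definition seq_continuous (n : nat) f := forall v (d : R), 0 < d -> exists2 e : R, 0 < e &
  forall w, (forall i, (i < n)%N -> `|w`_i - v`_i| <= e) -> `|f w - f v| < d.

Lemma seq_continuous_row n (F : 'rV[R]_n -> R) : continuous F ->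
  seq_continuous n (fun s => F (row_of_seq n s)).
Proof.
move=> cF v d d0; have /cvgrPdist_lt /(_ d d0) := cF (row_of_seq n v).
move=> /nbhs_ballP[e /= e0 h]; exists (e / 2); first by rewrite divr_gt0.
move=> w hw; rewrite distrC; apply: h; split => // i j.
rewrite !mxE /ball/= distrC (le_lt_trans (hw j (ltn_ord j)))//.
by rewrite ltr_pdivrMr// mulr_natr mulr2n ltrDl.
Qed.

Lemma seq_continuous_sep n f s1 s2 : seq_continuous n f -> continuous (fun x => f (s1 ++ x :: s2)).
Proof.
move=> cf x; apply/cvgrPdist_lt => d d0; have [e e0 h] := cf (s1 ++ x :: s2) d d0.
apply/nbhs_ballP; exists e => //= y; rewrite /ball/= => xy; rewrite distrC; apply: h => i _.
rewrite !nth_cat; case: ltnP => [_|]; first by rewrite subrr normr0 ltW.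
rewrite leq_eqVlt => /predU1P[<-|si]; first by rewrite subnn /= distrC ltW.
by rewrite -(subnK si) addnS -addSn addnK /= subrr normr0 ltW.
Qed.

Definition sep_continuous f := forall s1 s2, continuous (fun x => f (s1 ++ x :: s2)).

(** Measurability of a sequence-valued map, tested on separately continuous functions instead of
    through a sigma-algebra on sequences. *)
Definition prefix_measurable d (S : measurableType d) (p : S -> seq R) :=
  forall f, sep_continuous f -> forall s, measurable_fun setT (fun z => f (p z ++ s)).

Lemma prefix_measurable_rcons d (S : measurableType d) (p : S -> seq R) :
  prefix_measurable p -> prefix_measurable (fun z : S * R => rcons (p z.1) z.2).
Proof.
move=> hp f cf s.
have h := @measurable_caratheodory R _ S (fun x z => f (p z ++ x :: s)) (fun z => cf (p z) s) (fun x => hp f cf (x :: s)).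
have ms : measurable_fun setT (fun z : S * R => (z.2, z.1)).
  by apply: measurable_fun_pair; [exact: measurable_snd|exact: measurable_fst].
by under eq_fun do rewrite cat_rcons; exact: (measurableT_comp h ms).
Qed.

Fixpoint iter_integral A (f : seq R -> \bar R) : \bar R :=
  if A is B :: A' then (\int[mu]_(x in B) iter_integral A' (fun s => f (x :: s)))%E else f [::].

Lemma orthant_iter_integral a (f : seq R -> \bar R) : orthant_integral a f =
  iter_integral [seq `]-oo, b]%classic | b <- a] f.
Proof. by elim: a f => //= a0 a IH f; apply: eq_integral => x _; exact: IH. Qed.

Lemma iter_integral_ge0 A f : (forall s, 0 <= f s) -> (0 <= iter_integral A (fun s => (f s)%:E))%E.
Proof.
elim: A f => [|B A IH] f f0 /=; first by rewrite lee_fin.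
by apply: integral_ge0 => x _; apply: IH.
Qed.

Lemma measurable_iter_integral A d (S : measurableType d) (p : S -> seq R) f :
  (forall B, B \in A -> measurable B) -> prefix_measurable p -> sep_continuous f ->
  (forall s, 0 <= f s) ->
  measurable_fun setT (fun z => iter_integral A (fun s => (f (p z ++ s))%:E)).
Proof.
elim: A d S p => [|B A IH] d S p mA hp cf f0 /=.
  by apply/measurable_EFinP; exact: hp.
have mB : measurable B by apply: mA; rewrite inE eqxx.
have mA' C : C \in A -> measurable C by move=> h; apply: mA; rewrite inE h orbT.
have h := IH _ _ _ mA' (prefix_measurable_rcons hp) cf f0.
pose g (z : S * R) := (iter_integral A (fun s => (f (rcons (p z.1) z.2 ++ s))%:E) * (\1_B z.2)%:E)%E.
have mg : measurable_fun setT g.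
  apply: emeasurable_funM; first exact: h.
  apply/measurable_EFinP; apply: measurableT_comp; last exact: measurable_snd.
  exact: measurable_indic.
have g0 z : (0 <= g z)%E.
  rewrite mule_ge0// ?lee_fin ?indicE//.
  by apply: (@iter_integral_ge0 A (fun s => f (rcons (p z.1) z.2 ++ s))).
have := measurable_lebesgue_integral mg g0; congr measurable_fun.
apply/funext => z; rewrite [RHS]integral_mkcond; apply: eq_integral => x _.
rewrite patchE /g /= indicE; case: ifP => _; rewrite ?mule0 ?mule1//.
by congr iter_integral; apply/funext => s; rewrite cat_rcons.
Qed.

Lemma sep_continuous_cons f x : sep_continuous f -> sep_continuous (fun s => f (x :: s)).
Proof. by move=> cf s1 s2; exact: (cf (x :: s1) s2). Qed.

Let measurable_slice A f : (forall B, B \in A -> measurable B) -> sep_continuous f ->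
  (forall s, 0 <= f s) -> measurable_fun setT (fun x : R => iter_integral A (fun s => (f (x :: s))%:E)).
Proof.
move=> mA cf f0; have hp : prefix_measurable (fun x : R => [:: x]).
  by move=> g cg s; apply: continuous_measurable_fun; exact: (cg [::] s).
exact: (measurable_iter_integral mA hp cf f0).
Qed.

Lemma iter_integralU A1 B C A2 f : (forall D, D \in A1 -> measurable D) ->
  (forall D, D \in A2 -> measurable D) -> measurable B -> measurable C -> [disjoint B & C]%classic ->
  sep_continuous f -> (forall s, 0 <= f s) ->
  (iter_integral (A1 ++ (B `|` C) :: A2) (fun s => (f s)%:E) =
   iter_integral (A1 ++ B :: A2) (fun s => (f s)%:E) + iter_integral (A1 ++ C :: A2) (fun s => (f s)%:E))%E.
Proof.
move=> + mA2 mB mC BC; elim: A1 f => [|D A1 IH] f mA1 cf f0 /=.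
  rewrite ge0_integral_setU//.
  - by apply: measurable_funTS; exact: measurable_slice.
  - by move=> x _; exact: (@iter_integral_ge0 A2 (fun s => f (x :: s))).
have mD : measurable D by apply: mA1; rewrite inE eqxx.
have mA1' E : E \in A1 -> measurable E by move=> h; apply: mA1; rewrite inE h orbT.
have mcat E B' : measurable B' -> E \in A1 ++ B' :: A2 -> measurable E.
  by move=> mB'; rewrite mem_cat inE => /orP[/mA1'//|/predU1P[->//|/mA2]].
have E x := IH (fun s => f (x :: s)) mA1' (@sep_continuous_cons f x cf) (fun s => f0 (x :: s)).
under eq_integral do rewrite E.
rewrite ge0_integralD//.
- by move=> x _; exact: (@iter_integral_ge0 _ (fun s => f (x :: s))).
- apply: measurable_funTS; apply: measurable_slice => // C'; exact: mcat.
- by move=> x _; exact: (@iter_integral_ge0 _ (fun s => f (x :: s))).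
- apply: measurable_funTS; apply: measurable_slice => // C'; exact: mcat.
Qed.

Let box (b : R * R) : set R := `]b.1, b.2]%classic.
Let low (a : R) : set R := `]-oo, a]%classic.

(** Half-lines are turned into bounded intervals one coordinate at a time, the integral below b.1
    being subtracted from that below b.2; finiteness is propagated to permit the subtraction. *)
Lemma iter_integral_boxes f1 f2 n : sep_continuous f1 -> sep_continuous f2 ->
  (forall s, 0 <= f1 s) -> (forall s, 0 <= f2 s) ->
  (forall a, size a = n -> orthant_integral a (fun s => (f1 s)%:E) = orthant_integral a (fun s => (f2 s)%:E) /\
      (orthant_integral a (fun s => (f2 s)%:E) < +oo)%E) ->
  forall bs a, all (fun b => b.1 < b.2) bs -> (size bs + size a)%N = n ->
  iter_integral ([seq box b | b <- bs] ++ [seq low b | b <- a]) (fun s => (f1 s)%:E) =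
  iter_integral ([seq box b | b <- bs] ++ [seq low b | b <- a]) (fun s => (f2 s)%:E) /\
  (iter_integral ([seq box b | b <- bs] ++ [seq low b | b <- a]) (fun s => (f2 s)%:E) < +oo)%E.
Proof.
move=> c1 c2 p1 p2 h; elim/last_ind => [|bs b IH] a; first by move=> _ sz; have [] := h a sz; rewrite !orthant_iter_integral.
rewrite all_rcons size_rcons map_rcons cat_rcons => /andP[bb hbs] sz.
have [E1 F1] := IH (b.1 :: a) hbs (etrans (addnS _ _) sz).
have [E2 F2] := IH (b.2 :: a) hbs (etrans (addnS _ _) sz).
have mb : forall D, D \in [seq box b | b <- bs] -> measurable D by move=> _ /mapP[c _ ->]; exact: measurable_itv.
have ml : forall D, D \in [seq low b | b <- a] -> measurable D by move=> _ /mapP[c _ ->]; exact: measurable_itv.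
have dj : [disjoint box b & low b.1]%classic.
  apply/disj_setPS => x; rewrite /box /low /= !in_itv/= => -[/andP[h1 _] h2].
  by have := lt_le_trans h1 h2; rewrite ltxx.
have lU : low b.2 = box b `|` low b.1.
  apply/seteqP; split=> x; rewrite /low /box /= !in_itv/=.
    by move=> ->; case: (ltP b.1 x) => h1; [left|right].
  by move=> [/andP[]//|h1]; rewrite (le_trans h1)// ltW.
have U f (cf : sep_continuous f) (p : forall s, 0 <= f s) :=
  iter_integralU mb ml (measurable_itv _ : measurable (box b)) (measurable_itv _ : measurable (low b.1)) dj cf p.
move: E1 F1 E2 F2; rewrite /= lU !U//.
set x1 := iter_integral _ _; set x2 := iter_integral _ _; set x3 := iter_integral _ _; set x4 := iter_integral _ _.
have n2 : (0 <= x2)%E by exact: iter_integral_ge0.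
have n4 : (0 <= x4)%E by exact: iter_integral_ge0.
move=> E1 F1 E2 F2; have fx : x2 \is a fin_num by rewrite ge0_fin_numE.
rewrite E1 in E2; have := congr1 (fun z => z - x2)%E E2; rewrite !addeK// => ->.
by split => //; apply: le_lt_trans F2; rewrite leeDl.
Qed.

Lemma iter_integral_bounds f (c C : R) bs : 0 <= c -> 0 <= C -> all (fun b => b.1 < b.2) bs -> sep_continuous f ->
  (forall s, 0 <= f s) ->
  (forall s, size s = size bs -> (forall i, (i < size bs)%N -> box (nth (0,0) bs i) s`_i) -> c <= f s <= C) ->
  ((c * \prod_(b <- bs) (b.2 - b.1))%:E <= iter_integral [seq box b | b <- bs] (fun s => (f s)%:E))%E /\
  (iter_integral [seq box b | b <- bs] (fun s => (f s)%:E) <= (C * \prod_(b <- bs) (b.2 - b.1))%:E)%E.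
Proof.
move=> c0 C0; elim: bs f => [|b bs IH] f /= => [_ cf f0 h|/andP[bb hbs] cf f0 h].
  by rewrite big_nil !mulr1 !lee_fin; have /andP[] := h [::] erefl (fun i hi => False_ind _ (notF hi)).
have IHx x : box b x -> _ := fun bx => IH (fun s => f (x :: s)) hbs (@sep_continuous_cons f x cf) (fun s => f0 _)
   (fun s sz hs => h (x :: s) (congr1 S sz) (fun i => match i with 0 => fun _ => bx | i'.+1 => hs i' end)).
have mb D : D \in [seq box b | b <- bs] -> measurable D by move=> /mapP[e _ ->]; exact: measurable_itv.
have mI : measurable_fun (box b) (fun x => iter_integral [seq box b | b <- bs] (fun s => (f (x :: s))%:E)).
  by apply: measurable_funTS; exact: measurable_slice.
have I0 x : (0 <= iter_integral [seq box b | b <- bs] (fun s => (f (x :: s))%:E))%E.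
  exact: (@iter_integral_ge0 _ (fun s => f (x :: s))).
have pr0 : 0 <= \prod_(b <- bs) (b.2 - b.1).
  by rewrite big_seq; apply: prodr_ge0 => u hu; rewrite subr_ge0 ltW//; exact: (allP hbs).
have cstI r : (\int[mu]_(x in box b) (r * \prod_(b <- bs) (b.2 - b.1))%:E = (r * \prod_(b <- (b :: bs)) (b.2 - b.1))%:E)%E.
  rewrite integral_cst; last exact: measurable_itv.
  have lE : mu (box b) = (b.2 - b.1)%:E by rewrite /box lebesgue_measure_itv/= lte_fin bb -EFinB.
  apply: (etrans (congr1 (fun z => (r * \prod_(b <- bs) (b.2 - b.1))%:E * z)%E lE)).
  by rewrite -EFinM big_cons; congr (_%:E); ring.
rewrite -!cstI; split; apply: ge0_le_integral => //; try exact: measurable_itv;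
  by move=> x bx; first [exact: I0|by rewrite lee_fin mulr_ge0|by case: (IHx x bx)].
Qed.

(** If one function exceeded the other at v, then on a small box with upper corner v each would stay
    within a third of the gap from its value at v, and the integrals over this box would differ. *)
Lemma continuous_density_unique n f1 f2 : seq_continuous n f1 -> seq_continuous n f2 ->
  (forall s, 0 <= f1 s) -> (forall s, 0 <= f2 s) ->
  (forall a, size a = n -> orthant_integral a (fun s => (f1 s)%:E) = orthant_integral a (fun s => (f2 s)%:E) /\
      (orthant_integral a (fun s => (f2 s)%:E) < +oo)%E) ->
  forall v, size v = n -> f1 v = f2 v.
Proof.
move=> c1 c2 p1 p2 h v sv.
have s1 : sep_continuous f1 by move=> a b; exact: (@seq_continuous_sep n f1 a b c1).
have s2 : sep_continuous f2 by move=> a b; exact: (@seq_continuous_sep n f2 a b c2).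
have B : forall bs, all (fun b => b.1 < b.2) bs -> size bs = n ->
    iter_integral [seq box b | b <- bs] (fun s => (f1 s)%:E) = iter_integral [seq box b | b <- bs] (fun s => (f2 s)%:E).
  move=> bs hb sb; have [+ _] := iter_integral_boxes s1 s2 p1 p2 h (a := [::]) hb (etrans (addn0 _) sb).
  by rewrite /= cats0.
suff main g1 g2 : seq_continuous n g1 -> seq_continuous n g2 -> (forall s, 0 <= g1 s) -> (forall s, 0 <= g2 s) ->
    (forall bs, all (fun b => b.1 < b.2) bs -> size bs = n ->
      iter_integral [seq box b | b <- bs] (fun s => (g1 s)%:E) = iter_integral [seq box b | b <- bs] (fun s => (g2 s)%:E)) ->
    g1 v <= g2 v.
  apply/eqP; rewrite eq_le (main f1 f2)// (main f2 f1)// => bs hb sb; exact/esym/B.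
move=> {h B s1 s2} d1 d2 q1 q2 B; rewrite leNgt; apply/negP => lt.
pose r := (g1 v - g2 v) / 3; have r0 : 0 < r by rewrite divr_gt0// subr_gt0.
have [e1 e10 h1] := d1 v r r0; have [e2 e20 h2] := d2 v r r0.
pose e := Num.min e1 e2; have e0 : 0 < e by rewrite lt_min e10.
pose bs := [seq (x - e, x) | x <- v].
have hb : all (fun b => b.1 < b.2) bs by apply/allP => _ /mapP[x _ ->] /=; rewrite ltrBlDr ltrDl.
have sb : size bs = n by rewrite size_map.
have close s : (forall i, (i < size bs)%N -> box (nth (0,0) bs i) s`_i) ->
    forall i, (i < n)%N -> `|s`_i - v`_i| <= e.
  move=> hs i hi; have := hs i; rewrite sb => /(_ hi).
  rewrite /bs (nth_map 0) ?sv// /box /= in_itv/= => /andP[a1 a2].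
  by rewrite ler_distl; apply/andP; split; move: e0 a1 a2; lra.
have le1 : e <= e1 by rewrite ge_min lexx. have le2 : e <= e2 by rewrite ge_min lexx orbT.
have hg2 s : size s = size bs -> (forall i, (i < size bs)%N -> box (nth (0,0) bs i) s`_i) -> 0 <= g2 s <= g2 v + r.
  move=> _ /close hs; rewrite q2/=; have := h2 s (fun i hi => le_trans (hs i hi) le2).
  by rewrite ltr_distl => /andP[_ /ltW].
have hg1 s : size s = size bs -> (forall i, (i < size bs)%N -> box (nth (0,0) bs i) s`_i) -> g1 v - r <= g1 s <= g1 v + r.
  move=> _ /close hs; have := h1 s (fun i hi => le_trans (hs i hi) le1).
  by rewrite ltr_distl => /andP[/ltW -> /ltW].
have cmp : g2 v + r < g1 v - r by move: lt; rewrite /r; lra.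
have g2r : 0 <= g2 v + r by rewrite addr_ge0// ltW.
have [_ up] := iter_integral_bounds (lexx 0) g2r hb (fun a b => @seq_continuous_sep n g2 a b d2) q2 hg2.
have [lo _] := iter_integral_bounds (le_trans g2r (ltW cmp)) (addr_ge0 (q1 v) (ltW r0)) hb (fun a b => @seq_continuous_sep n g1 a b d1) q1 hg1.
have := le_trans lo; rewrite (B bs hb sb) => /(_ _ up).
rewrite lee_fin ler_pM2r; first by rewrite leNgt cmp.
by rewrite big_seq; apply: prodr_gt0 => u hu; rewrite subr_gt0; exact: (allP hb).
Qed.

End iterated_integrals.

(** * Matrix form of the regression and of the density *)

Section null_modifications.
Context d (T : measurableType d) (R : realType) (P : {measure set T -> \bar R}).
Local Open Scope ereal_scope.

(* No measurability is needed since the integral of a nonnegative function is a supremum. *)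
Lemma ge0_le_lower_integral (f g : T -> \bar R) : (forall x, 0 <= f x) -> (forall x, f x <= g x) ->
  \int[P]_x f x <= \int[P]_x g x.
Proof.
move=> f0 fg; have g0 x : 0 <= g x by exact: le_trans (fg x).
rewrite !ge0_integralE//; apply: le_ereal_sup => _ [h hf <-]; exists h => // x.
by rewrite (le_trans (hf x))// !patch_setT.
Qed.

Variables (N : set T) (mN : measurable N) (N0 : P N = 0).

(** No measurability of [f] is assumed: it lies between the two measurable functions obtained from
    [g] by the values 0 and +oo on [N], whose integrals agree with that of [g]. *)
Let ge0_integral_null (f g : T -> \bar R) : measurable_fun setT g ->
  (forall x, 0 <= f x) -> (forall x, 0 <= g x) -> (forall x, ~ N x -> f x = g x) ->
  \int[P]_x f x = \int[P]_x g x.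
Proof.
move=> mg f0 g0 fg; apply/eqP; rewrite eq_le; apply/andP.
have aeN (h : T -> \bar R) : measurable_fun setT h -> (forall x, ~ N x -> g x = h x) ->
    \int[P]_x g x = \int[P]_x h x.
  move=> mh gh; apply: ae_eq_integral => //; exists N; split => // x /= hx.
  by apply: contrapT => Nx; apply: hx => _; exact: gh.
split.
  pose h x := if x \in N then +oo else g x.
  rewrite (aeN h); last by move=> x Nx; rewrite /h memNset.
    apply: ge0_le_lower_integral => // x; rewrite /h; case: ifPn => [_|]; first exact: leey.
    by rewrite notin_setE => /fg ->.
  apply: measurable_fun_ifT => //; apply: (measurable_fun_bool true).
  by rewrite setTI preimage_mem_true.
pose h x := if x \in N then 0 else g x.
rewrite (aeN h); last by move=> x Nx; rewrite /h memNset.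
  apply: ge0_le_lower_integral => x; rewrite /h; case: ifPn => //.
  by rewrite notin_setE => /fg ->.
apply: measurable_fun_ifT => //; apply: (measurable_fun_bool true).
by rewrite setTI preimage_mem_true.
Qed.

Lemma integral_null_modification (f g : T -> \bar R) : measurable_fun setT g ->
  (forall x, ~ N x -> f x = g x) -> \int[P]_x f x = \int[P]_x g x.
Proof.
move=> mg fg; rewrite integralE [RHS]integralE; congr (_ - _).
  apply: ge0_integral_null => //; first exact: measurable_funepos.
  by move=> x Nx; rewrite !funeposE fg.
apply: ge0_integral_null => //; first exact: measurable_funeneg.
by move=> x Nx; rewrite !funenegE fg.
Qed.

End null_modifications.

Section gaussian_regression_chain.
Context d (T : measurableType d) (R : realType) (P : probability T R).
Variables (G : set (T -> R)) (cG : cgauss P G) (N : set T).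
Hypotheses (mN : measurable N) (N0 : P N = 0%E).
Variables (X : T -> path R) (m : path R) (gX : gproc G X m).
Variables (n : nat) (l : seq ((R * R) * R)) (szl : size l = n).
Hypothesis nd : nondeg P l X m.
Variable V : T -> 'rV[R]_n.
Let c_ i := nth (0, 0, 0) l i.
Hypothesis VE : forall x, ~ N x -> forall i : 'I_n, V x 0 i = Lf (c_ i).1 (X x) (c_ i).2.

Let Y i := cL X m (c_ i).1 (c_ i).2.

Lemma Rintegral_cgauss_shift (a : R) f : G f -> (\int[P]_x (a + f x)%:E = a%:E)%E.
Proof.
move=> Gf; have i1 := sqint_integrable (cg_sqint cG Gf).
have i0 : P.-integrable setT (EFin \o (fun=> a)) by exact: finite_measure_integrable_cst.
under eq_integral do rewrite EFinD.
rewrite integralD//.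
have := cg_mean cG Gf; rewrite /Rintegral => h.
rewrite -[X in (_ + X)%E](fineK (integrable_fin_num measurableT i1)) h adde0.
by rewrite integral_cst// [X in (_ * X)%E](@probability_setT _ _ _ P) mule1.
Qed.

Lemma covariance_null_modification (f h f0 h0 : T -> R) (a b : R) : G f0 -> G h0 ->
  (forall x, ~ N x -> f x = a + f0 x) -> (forall x, ~ N x -> h x = b + h0 x) ->
  fine (covariance P f h) = ip P f0 h0.
Proof.
move=> Gf Gh fE hE; have [mf _] := cg_sqint cG Gf; have [mh _] := cg_sqint cG Gh.
have ex (g g0 : T -> R) (c : R) : G g0 -> measurable_fun setT g0 -> (forall x, ~ N x -> g x = c + g0 x) ->
    fine 'E_P[g]%E = c.
  move=> Gg mg gE; rewrite expectation.unlock (integral_null_modification mN N0 (g := fun x => (c + g0 x)%:E)).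
  - by rewrite Rintegral_cgauss_shift.
  - by apply/measurable_EFinP; exact: measurable_funD.
  - by move=> x Nx; rewrite gE.
rewrite covariance.unlock (ex _ _ _ Gf mf fE) (ex _ _ _ Gh mh hE) expectation.unlock.
rewrite (integral_null_modification mN N0 (g := fun x => (f0 x * h0 x)%:E))//.
  by apply/measurable_EFinP; exact: measurable_funM.
move=> x Nx; congr (_%:E); rewrite /= fctE /= fE// hE//; ring.
Qed.

Let lcombE (l' : seq ((R * R) * R)) u x : lcomb l' u X m x =
  \sum_(i < size l') u`_i * cL X m (nth (0,0,0) l' i).1 (nth (0,0,0) l' i).2 x.
Proof.
elim: l' u => [|c l' IH] u /=; first by rewrite big_ord0.
rewrite big_ord_recl /= nth0 IH; congr (_ + _); apply: eq_bigr => i _.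
by rewrite nth_behead.
Qed.

Let lresidE (l' : seq ((R * R) * R)) u v w : lresid l' u v w =
  \sum_(i < size l') u`_i * (v`_i - Lf (nth (0,0,0) l' i).1 w (nth (0,0,0) l' i).2).
Proof.
elim: l' u v => [|c l' IH] u v /=; first by rewrite big_ord0.
rewrite big_ord_recl /= !nth0 IH; congr (_ + _); apply: eq_bigr => i _.
by rewrite !nth_behead.
Qed.

Let nonzeroE (l' : seq ((R * R) * R)) u : nonzero_coef l' u = [exists i : 'I_(size l'), u`_i != 0].
Proof.
elim: l' u => [|c l' IH] u /=; first by apply/esym/existsP => -[[]].
rewrite IH; apply/orP/existsP => [[h|/existsP[i h]]|[[[|i] hi] h]].
- by exists ord0; rewrite /= nth0.
- by exists (lift ord0 i); move: h; rewrite nth_behead.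
- by left; move: h; rewrite /= nth0.
- by right; apply/existsP; exists (Ordinal (hi : (i < size l')%N)); rewrite /= nth_behead.
Qed.

Let YG i : G (Y i). Proof. exact: (cL_G cG gX). Qed.

Let ip_sum (I : finType) (u : I -> R) (f : I -> T -> R) g : (forall i, G (f i)) -> G g ->
  G (fun x => \sum_i u i * f i x) /\ ip P (fun x => \sum_i u i * f i x) g = \sum_i u i * ip P (f i) g.
Proof.
move=> Gf Gg; elim: (index_enum I) => [|i s [IH1 IH2]].
  rewrite big_nil (_ : (fun x => _) = (fun=> 0)); last by apply/funext => x; rewrite big_nil.
  split; first exact: (cg_0 cG).
  have := ip_scalel 0 (cg_sqint cG Gg) (cg_sqint cG Gg); rewrite mul0r.
  by rewrite (_ : (fun x => 0 * g x) = (fun=> 0))//; apply/funext => x; rewrite mul0r.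
have e : (fun x => \sum_(j <- i :: s) u j * f j x) = (fun x => u i * f i x + 1 * \sum_(j <- s) u j * f j x).
  by apply/funext => x; rewrite big_cons mul1r.
rewrite e; split; first exact: (cg_add cG).
by rewrite ip_linl ?IH2 ?big_cons ?mul1r//; exact: (cg_sqint cG).
Qed.

Let Sigma : 'M[R]_n := \matrix_(i, j) ip P (Y i) (Y j).

Lemma cov_matrix_chain : cov_matrix P V = Sigma.
Proof.
apply/matrixP => i j; rewrite !mxE.
have h (k : 'I_n) x : ~ N x -> V x 0 k = Lf (c_ k).1 m (c_ k).2 + Y k x.
  by move=> Nx; rewrite VE// /Y /cL; ring.
exact: (covariance_null_modification (YG i) (YG j) (h i) (h j)).
Qed.

(** A kernel vector would be a nontrivial combination of the observables with variance 0, against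
    [nd]. *)
Lemma Sigma_unit : Sigma \in unitmx.
Proof.
rewrite unitmxE unitfE; apply/negP => /det0P[u un0 uS].
have q0 : ip P (lcomb l [seq u 0 i | i <- enum 'I_n] X m) (lcomb l [seq u 0 i | i <- enum 'I_n] X m) = 0.
  have e : lcomb l [seq u 0 i | i <- enum 'I_n] X m = (fun x => \sum_(i < n) u 0 i * Y i x).
    apply/funext => x; rewrite lcombE; case: _ / szl u {un0 uS} => u.
    apply: eq_bigr => i _; rewrite (nth_map i) ?size_enum_ord// nth_ord_enum//.
  rewrite e; have Gs := (ip_sum (u 0) YG (YG 0)).1.
  rewrite (ip_sum (u 0) YG Gs).2 big1// => i _; rewrite ipC (ip_sum (u 0) YG (YG i)).2.
  have e2 : \sum_j u 0 j * ip P (Y j) (Y i) = 0.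
    have /matrixP /(_ 0 i) := uS; rewrite mxE [in RHS]mxE; apply: etrans.
    by apply: eq_bigr => j _; rewrite mxE.
  by rewrite e2 mulr0.
have : nonzero_coef l [seq u 0 i | i <- enum 'I_n].
  rewrite nonzeroE; apply: contra_notT (negP un0) => h.
  apply/eqP/rowP => i; rewrite mxE; apply/eqP; apply: contraNT h => h.
  apply/existsP; rewrite szl; exists i; rewrite (nth_map i) ?size_enum_ord// nth_ord_enum//.
by move=> /nd; rewrite q0 ltxx.
Qed.

Variable W : R -> {RV P >-> R}.
Hypothesis WE : forall x, ~ N x -> forall t, W t x = X x t.

(** The normal equations of [chain_residual] say that the row of covariances of W t with V is the
    coefficient row times [Sigma]; multiplying by the inverse matrix recovers the coefficients of
    the chain. *)
Lemma conditioned_path_chain (v : 'rV[R]_n) x : ~ N x ->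
  conditioned_path W V v x = (chain P l [seq v 0 i | i <- enum 'I_n] X m).1 x.
Proof.
move=> Nx; apply/funext => t; have [q [h1 h2]] := chain_residual cG gX nd.
rewrite (h1 X m (fun _ _ => erefl)) /conditioned_path WE//; congr (_ + _).
pose qr : 'rV[R]_n := \row_i (q t)`_i.
have cw : cov_with W V t = qr *m Sigma.
  apply/rowP => j; rewrite !mxE.
  have Wt : forall x, ~ N x -> W t x = m t + cL X m (1, 0) t x.
    by move=> y Ny; rewrite WE// /cL /Lf /=; ring.
  have h (k : 'I_n) y : ~ N y -> V y 0 k = Lf (c_ k).1 m (c_ k).2 + Y k y.
    by move=> Ny; rewrite VE// /Y /cL; ring.
  rewrite (covariance_null_modification (cL_G cG gX (1, 0) t) (YG j) Wt (h j)).
  have jl : c_ j \in l by rewrite mem_nth// szl.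
  have := h2 t _ jl.
  have e : lcomb l (q t) X m = (fun x => \sum_(i < n) (q t)`_i * Y i x).
    by apply/funext => y; rewrite lcombE szl.
  rewrite ip_sub; [|exact: (cg_sqint cG (cL_G cG gX _ _))|exact: (cg_sqint cG (lcomb_G cG _ _ gX))|exact: (cg_sqint cG (YG j))].
  rewrite e (ip_sum (fun i : 'I_n => (q t)`_i) (fun i : 'I_n => YG i) (YG j)).2 => /eqP; rewrite subr_eq0 => /eqP ->.
  by apply: eq_bigr => i _; rewrite !mxE.
rewrite cov_matrix_chain cw mulmxK ?Sigma_unit// mxE lresidE szl.
apply: eq_bigr => i _; rewrite !mxE VE//; congr (_ * (_ - _)).
by rewrite (nth_map i) ?size_enum_ord// nth_ord_enum.
Qed.

End gaussian_regression_chain.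

Section chain_density.
Context d (T : measurableType d) (R : realType) (P : probability T R).
Variables (G : set (T -> R)) (cG : cgauss P G).

Lemma gauss_pdf_continuous (s : R) : continuous (gauss_pdf s).
Proof.
have c1 : continuous (fun y : R => - (y - 0) ^+ 2 / (s ^+ 2 *+ 2)).
  move=> y; apply: cvgMl; apply: cvgN; rewrite expr2; under eq_fun do rewrite expr2.
  by apply: cvgM; apply: cvgB => //; exact: cvg_cst.
move=> y; apply: cvgMr.
exact: (@continuous_comp _ _ _ (fun y : R => - (y - 0) ^+ 2 / (s ^+ 2 *+ 2)) (@expR R) y (c1 y) (@continuous_expR R _)).
Qed.

(** Residuals, hence deviations and regression functions, do not vary with the parameter; only
    prescribed values and means do, and each conditioning step changes the means affinely. Process
    and mean depend on the parameter because conditioning makes them depend on earlier values. *)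
Lemma chain_pdf_continuous (S : topologicalType) (l : seq ((R * R) * R)) (X : S -> T -> path R)
    (m : S -> path R) (v : S -> seq R) :
  (forall s s', same_residual (X s) (m s) (X s') (m s')) ->
  (forall e t, continuous (fun s => Lf e (m s) t)) -> (forall i, continuous (fun s => (v s)`_i)) ->
  continuous (fun s => chain_pdf P l (v s) (X s) (m s)).
Proof.
elim: l X m v => [|c l IH] X m v hX hm hv s0 /=; first exact: cvg_cst.
apply: cvgM.
  have -> : (fun s => gauss_pdf (sd P (X s) (m s) c.1 c.2) (head 0 (v s) - Lf c.1 (m s) c.2)) =
      (gauss_pdf (sd P (X s0) (m s0) c.1 c.2) \o (fun s => (v s)`_0 - Lf c.1 (m s) c.2)).
    by apply/funext => s /=; rewrite (same_residual_sd P c.1 c.2 (hX s s0)) nth0.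
  have -> : head 0 (v s0) - Lf c.1 (m s0) c.2 = (v s0)`_0 - Lf c.1 (m s0) c.2 by rewrite nth0.
  apply: (@continuous_comp _ _ _ (fun s => (v s)`_0 - Lf c.1 (m s) c.2)).
    by apply: cvgB; [exact: hv|exact: hm].
  exact: gauss_pdf_continuous.
apply: (IH (fun s => cpath P (X s) (m s) c.1 c.2 (head 0 (v s))) (fun s => cmean P (X s) (m s) c.1 c.2 (head 0 (v s)))
   (fun s => behead (v s))).
- by move=> s s'; exact: same_residual_cond.
- move=> e t.
  have -> : (fun s => Lf e (cmean P (X s) (m s) c.1 c.2 (head 0 (v s))) t) =
     (fun s => Lf e (m s) t + ((v s)`_0 - Lf c.1 (m s) c.2) *
        Lf e (kpath P (X s0) (m s0) (cL (X s0) (m s0) c.1 c.2)) t).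
    apply/funext => s; apply: (etrans (@Lf_cmean _ T R P (X s) (m s) c.1 c.2 (head 0 (v s)) e t)).
    have E := same_residual_kpath P (cL (X s0) (m s0) c.1 c.2) (hX s s0).
    by rewrite (hX s s0 c.1 c.2) E -nth0.
  by move=> s; apply: cvgD; [exact: hm|apply: cvgMl; apply: cvgB; [exact: hv|exact: hm]].
- by move=> i; under eq_fun do rewrite nth_behead; exact: hv.
Qed.

Lemma chain_pdf_ge0 l v (X : T -> path R) m : 0 <= chain_pdf P l v X m.
Proof. by elim: l v X m => //= c l IH v X m; rewrite mulr_ge0 ?gauss_pdf_ge0. Qed.

Lemma chain_pdf_ext l v v' (X : T -> path R) m : (forall i, (i < size l)%N -> v`_i = v'`_i) ->
  chain_pdf P l v X m = chain_pdf P l v' X m.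
Proof.
elim: l v v' X m => [|c l IH] v v' X m h; first by [].
have step u : chain_pdf P (c :: l) u X m = gauss_pdf (sd P X m c.1 c.2) (head 0 u - Lf c.1 m c.2) *
    chain_pdf P l (behead u) (cpath P X m c.1 c.2 (head 0 u)) (cmean P X m c.1 c.2 (head 0 u)) by [].
rewrite !step.
have -> : head 0 v = head 0 v' by rewrite -!nth0; exact: h.
apply: (congr1 (fun z => _ * z)); apply: IH => i hi; rewrite !nth_behead; exact: h.
Qed.

Variable N : set T.
Hypotheses (mN : measurable N) (N0 : P N = 0%E).
Variables (X : T -> path R) (m : path R) (gX : gproc G X m).
Variables (n : nat) (l : seq ((R * R) * R)) (szl : size l = n).
Hypothesis nd : nondeg P l X m.
Variable V : T -> 'rV[R]_n.
Let c_ i := nth (0, 0, 0) l i.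
Hypothesis VE : forall x, ~ N x -> forall i : 'I_n, V x 0 i = Lf (c_ i).1 (X x) (c_ i).2.

Let rowseq (v : 'rV[R]_n) : seq R := [seq v 0 i | i <- enum 'I_n].
Let rowseqE (v : 'rV[R]_n) (i : 'I_n) : (rowseq v)`_i = v 0 i.
Proof. by rewrite (nth_map i) ?size_enum_ord// nth_ord_enum. Qed.

Let f (v : 'rV[R]_n) := chain_pdf P l (rowseq v) X m.

Let fE s : f (row_of_seq n s) = chain_pdf P l s X m.
Proof.
apply: chain_pdf_ext => i; rewrite szl => hi.
by rewrite (rowseqE _ (Ordinal hi)) mxE.
Qed.

Let cf : continuous f.
Proof.
have h1 (s s' : 'rV[R]_n) : same_residual X m X m by move=> e t.
have h2 e t : continuous (fun _ : 'rV[R]_n => Lf e m t) by exact: cst_continuous.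
apply: (@chain_pdf_continuous _ l (fun=> X) (fun=> m) rowseq h1 h2).
move=> i v; case: (ltnP i n) => hi.
  rewrite (_ : (fun s => _) = (fun s : 'rV[R]_n => s 0 (Ordinal hi))); first exact: coord_continuous.
  by apply/funext => s; rewrite -rowseqE.
rewrite (_ : (fun s => _) = (fun=> 0)); first exact: (@cst_continuous _ _ 0 v).
by apply/funext => s; rewrite nth_default// size_map size_enum_ord.
Qed.

Let orthantE (a : seq R) : size a = n ->
  orthant_integral a (fun s => (f (row_of_seq n s))%:E) =
  ('E_P[\1_[set x | forall i : 'I_n, (V x ord0 i <= a`_i)%R]])%E.
Proof.
move=> sa; rewrite expectation.unlock.
rewrite (integral_null_modification mN N0 (g := fun x => (1 * \1_(below l a) (X x))%:E)); last first.
- move=> x Nx; rewrite mul1r !indicE; congr ((nat_of_bool _)%:R%:E).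
  apply/idP/idP => /set_mem h; apply/mem_set.
    by move=> i hi; rewrite szl in hi; have := h (Ordinal hi); rewrite VE.
  by move=> i; rewrite VE//; apply: h; rewrite szl.
- apply/measurable_EFinP; apply: measurable_funM => //; apply: (measurableT_comp _ (gp_meas gX)).
  by apply: measurable_indic; exact: measurable_below.
rewrite (chain_orthant cG gX nd (etrans sa (esym szl)) ler01).
by congr orthant_integral; apply/funext => s; rewrite fE mul1r.
Qed.

(** [chain_pdf] is a continuous density by [chain_orthant], and any other one agrees with it
    pointwise by [continuous_density_unique], so [xget] can only select this value. *)
Lemma density_chain v : density P V v = chain_pdf P l (rowseq v) X m.
Proof.
rewrite -/(f v); apply: xget_unique.
  exists f => //; split; [exact: cf|by move=> w; exact: chain_pdf_ge0|move=> a].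
  rewrite orthantE ?size_tuple//; congr expectation; congr indic; apply/seteqP.
  by split => x h i; have := h i; rewrite (tnth_nth 0).
move=> y [g [cg g0 gE] <-].
have rowK w : row_of_seq n (rowseq w) = w by apply/rowP => i; rewrite mxE rowseqE.
rewrite -(rowK v).
apply: (@continuous_density_unique R n (fun s => g (row_of_seq n s)) (fun s => f (row_of_seq n s))) => //.
- exact: (seq_continuous_row cg).
- exact: (seq_continuous_row cf).
- by move=> s; exact: chain_pdf_ge0.
- move=> a sa; have sa' : size a == n by rewrite sa.
  have := gE (Tuple sa'); rewrite /= => <-; rewrite orthantE//; split.
    congr expectation; congr indic; apply/seteqP.
    by split => x h i; have := h i; rewrite (tnth_nth 0).
  rewrite expectation.unlock (@le_lt_trans _ _ (\int[P]_x 1)%E)//.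
    apply: ge0_le_lower_integral => x; first by rewrite lee_fin.
    by rewrite lee_fin indicE; case: (_ \in _).
  by rewrite integral_cst// mul1e [X in (X < _)%E](@probability_setT _ _ _ P) ltry.
- by rewrite size_map size_enum_ord.
Qed.

End chain_density.

Section chain_measurable.
Context d (T : measurableType d) (R : realType) (P : probability T R).
Variables (G : set (T -> R)) (cG : cgauss P G).
Context d' (S : measurableType d').

Lemma measurable_chain (l : seq ((R * R) * (S -> R))) (v : seq (S -> R)) (X : S -> T -> path R) (m : S -> path R) :
  (forall c, List.In c l -> measurable_fun setT c.2) -> (forall c, List.In c v -> measurable_fun setT c) ->
  measurable_fun setT (fun z : S * T => X z.1 z.2) -> measurable_fun setT m ->
  (forall s, gproc G (X s) (m s)) ->
  let l' s := [seq (c.1, c.2 s) | c <- l] in let v' s := [seq c s | c <- v] in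
  measurable_fun setT (fun z : S * T => (chain P (l' z.1) (v' z.1) (X z.1) (m z.1)).1 z.2) /\
  measurable_fun setT (fun s => chain_pdf P (l' s) (v' s) (X s) (m s)).
Proof.
elim: l v X m => [|c l IH] v X m ml mv mX mm gX /=; first by split.
have mt : measurable_fun setT c.2 by apply: ml; left.
have mv0 : measurable_fun setT (fun s => head 0 [seq c s | c <- v]).
  by case: v mv => [|a v] mv /=; [exact: measurable_cst|apply: mv; left].
pose v0 s := head 0 [seq c s | c <- v].
have bE s : behead [seq c s | c <- v] = [seq c s | c <- behead v] by case: v {mv mv0 v0}.
have [h1 h2] := IH (behead v) (fun s => cpath P (X s) (m s) c.1 (c.2 s) (v0 s)) (fun s => cmean P (X s) (m s) c.1 (c.2 s) (v0 s))
  (fun a ha => ml a (or_intror ha)) (fun a ha => mv a (match v return List.In a (behead v) -> List.In a v with [::] => id | _ :: _ => fun h => or_intror h end ha))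
  (measurable_cpath cG c.1 mX mm mt mv0 gX) (measurable_cmean cG c.1 mX mm mt mv0 gX)
  (fun s => gproc_cond cG (gX s) c.1 (c.2 s) (v0 s)).
split; first by under eq_fun do rewrite bE; exact: h1.
apply: measurable_funM; last by under eq_fun do rewrite bE; exact: h2.
apply: measurable_gauss_pdf; first exact: (measurable_sd P c.1 mX mm mt).
by apply: measurable_funB; [exact: mv0|exact: (measurable_Lf c.1 mt mm)].
Qed.

End chain_measurable.

(** * From the process W to a Gaussian random path *)

Section gaussian_variables.
Context d (T : measurableType d) (R : realType) (P : probability T R).
Notation mu := (@lebesgue_measure R).

Lemma ge0_integral_law d1 d2 (T1 : measurableType d1) (T2 : measurableType d2)
    (P1 : {measure set T1 -> \bar R}) (P2 : {measure set T2 -> \bar R}) (S1 : T1 -> R) (S2 : T2 -> R) (g : R -> \bar R) :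
  measurable_fun setT S1 -> measurable_fun setT S2 ->
  (forall A : set R, measurable A -> P1 (S1 @^-1` A) = P2 (S2 @^-1` A)) ->
  measurable_fun setT g -> (forall x, 0 <= g x)%E ->
  (\int[P1]_x g (S1 x) = \int[P2]_x g (S2 x))%E.
Proof.
move=> mS1 mS2 h mg g0.
pose m1 := measure_function_pushforward__canonical__measure_function_Measure P1 mS1.
pose m2 := measure_function_pushforward__canonical__measure_function_Measure P2 mS2.
transitivity (\int[m1]_w g w)%E; first by rewrite [RHS]ge0_integral_pushforward.
transitivity (\int[m2]_w g w)%E; last by rewrite [LHS]ge0_integral_pushforward.
by apply: eq_measure_integral => A mA _; exact: h.
Qed.

Lemma integral_law d1 d2 (T1 : measurableType d1) (T2 : measurableType d2)
    (P1 : {measure set T1 -> \bar R}) (P2 : {measure set T2 -> \bar R}) (S1 : T1 -> R) (S2 : T2 -> R) (g : R -> R) :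
  measurable_fun setT S1 -> measurable_fun setT S2 ->
  (forall A : set R, measurable A -> P1 (S1 @^-1` A) = P2 (S2 @^-1` A)) ->
  measurable_fun setT g ->
  \int[P1]_x g (S1 x) = \int[P2]_x g (S2 x).
Proof.
move=> mS1 mS2 h mg; rewrite /Rintegral; congr fine; rewrite integralE [RHS]integralE.
have mE : measurable_fun setT (EFin \o g) by exact/measurable_EFinP.
have pE d' (T' : measurableType d') (P' : {measure set T' -> \bar R}) (S : T' -> R) :
   (\int[P']_x (fun x => (g (S x))%:E)^\+ x = \int[P']_x (EFin \o g)^\+ (S x))%E.
  by apply: eq_integral => x _; rewrite !funeposE.
have nE d' (T' : measurableType d') (P' : {measure set T' -> \bar R}) (S : T' -> R) :
   (\int[P']_x (fun x => (g (S x))%:E)^\- x = \int[P']_x (EFin \o g)^\- (S x))%E.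
  by apply: eq_integral => x _; rewrite !funenegE.
have p0 x : (0 <= (EFin \o g)^\+ x)%E by exact: funepos_ge0.
have n0 x : (0 <= (EFin \o g)^\- x)%E by exact: funeneg_ge0.
rewrite !pE !nE; congr (_ - _)%E.
  exact: (ge0_integral_law mS1 mS2 h (measurable_funepos mE) p0).
exact: (ge0_integral_law mS1 mS2 h (measurable_funeneg mE) n0).
Qed.

(* The law of [S] is that of [M + s Z] with [Z] standard normal. *)
Lemma gaussian_rv_moments (S : T -> R) : measurable_fun setT S -> gaussian_rv P S ->
  exists M : R, [/\ sqint P (fun x => S x - M), \int[P]_x (S x - M) = 0,
   \int[P]_x cos (S x - M) = expR (- (ip P (fun x => S x - M) (fun x => S x - M) / 2)) &
   \int[P]_x sin (S x - M) = 0].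
Proof.
move=> mS [M [s h]]; exists M.
have mSM : measurable_fun setT (fun x => S x - M) by exact: measurable_funB.
have [s0|s0] := eqVneq s 0.
  pose N := S @^-1` (~` [set M]).
  have mN : measurable N by rewrite -[X in measurable X]setTI; apply: mS => //; exact: measurableC.
  have N0 : P N = 0%E.
    rewrite h; last exact: measurableC.
    by rewrite s0 eqxx diracE memNset//=; apply.
  have null_cst (g : R -> R) c : g 0 = c -> (\int[P]_x (g (S x - M))%:E = c%:E)%E.
    move=> gc; rewrite (integral_null_modification mN N0 (g := cst c%:E)) //.
      by rewrite integral_cst// [X in (_ * X)%E](@probability_setT _ _ _ P) mule1.
    by move=> x /contrapT; rewrite /= => ->; rewrite subrr gc.
  have e2 : (\int[P]_x ((S x - M) ^+ 2)%:E = 0)%E by apply: (null_cst (fun z => z ^+ 2)); rewrite expr0n.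
  have i2 : ip P (fun x => S x - M) (fun x => S x - M) = 0.
    by rewrite /ip /Rintegral (eq_integral (fun x => ((S x - M) ^+ 2)%:E)) ?e2.
  split.
  - split=> //; apply/integrableP; split; first by apply/measurable_EFinP; exact: measurable_funX.
    by under eq_integral do rewrite /= ger0_norm ?sqr_ge0//; rewrite e2 ltry.
  - by rewrite /Rintegral (null_cst id 0).
  - by rewrite /Rintegral (null_cst cos 1) ?cos0// i2 mul0r oppr0 expR0.
  - by rewrite /Rintegral (null_cst sin 0) ?sin0.
have mp : @measurable_fun _ _ (measurableTypeR R) _ setT (normal_pdf M s) := measurable_normal_pdf M s.
have law (A : set R) : measurable A -> P (S @^-1` A) = mdens mu mp (normal_pdf_ge0 M s) (id @^-1` A).
  by move=> mA; rewrite h// (negbTE s0).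
have mid : @measurable_fun _ _ (measurableTypeR R) _ setT (@id R) := @measurable_id _ _ setT.
have nn (g : R -> R) : measurable_fun setT g -> (forall x, 0 <= g x) ->
    (\int[P]_x (g (S x - M))%:E = \int[mu]_u (g u * normal_pdf 0 s u)%:E)%E.
  move=> mg g0; have mgM : measurable_fun setT (fun x : R => (g (x - M))%:E).
    by apply/measurable_EFinP; apply: measurableT_comp => //; exact: measurable_funB.
  have g0M x : (0 <= (g (x - M))%:E)%E by rewrite lee_fin.
  rewrite (ge0_integral_law mS mid law mgM g0M) ge0_integral_mdens//.
  have mgp : measurable_fun setT (fun x : R => ((g (x - M))%:E * (normal_pdf M s x)%:E)%E).
    by apply: emeasurable_funM => //; apply/measurable_EFinP; exact: measurable_normal_pdf.
  rewrite (ge0_integral_shift M mgp); last by move=> x; rewrite mule_ge0// lee_fin normal_pdf_ge0.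
  apply: eq_integral => u _; rewrite -EFinM normal_pdf_center//.
  by rewrite (_ : M + u - M = u)//; ring.
have sg (g g1 g2 : R -> R) : measurable_fun setT g1 -> measurable_fun setT g2 ->
    (forall x, 0 <= g1 x) -> (forall x, 0 <= g2 x) -> (forall x, g x = g1 x - g2 x) ->
    mu.-integrable setT (fun x => (g1 x * normal_pdf 0 s x)%:E) -> mu.-integrable setT (fun x => (g2 x * normal_pdf 0 s x)%:E) ->
    \int[P]_x g (S x - M) = \int[mu]_u (g u * normal_pdf 0 s u).
  move=> mg1 mg2 p1 p2 gE i1 i2; rewrite /Rintegral.
  have iP (k : R -> R) : measurable_fun setT k -> (forall x, 0 <= k x) -> mu.-integrable setT (fun x => (k x * normal_pdf 0 s x)%:E) ->
      P.-integrable setT (fun x => (k (S x - M))%:E).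
    move=> mk k0 ik; apply/integrableP; split; first by apply/measurable_EFinP; exact: measurableT_comp.
    under eq_integral do rewrite /= ger0_norm//.
    rewrite nn//; have := integrable_fin_num measurableT ik.
    by rewrite ge0_fin_numE//; apply: integral_ge0 => x _; rewrite lee_fin mulr_ge0 ?normal_pdf_ge0.
  under eq_integral do rewrite gE EFinB.
  rewrite integralB//; [|exact: iP|exact: iP].
  under [in RHS]eq_integral do rewrite gE mulrBl EFinB.
  by rewrite integralB// !nn.
have inm (k : R -> R) C : measurable_fun setT k -> (forall x, `|k x| <= C * (1 + x ^+ 2)) ->
   mu.-integrable setT (fun x => (k x * normal_pdf 0 s x)%:E) := @integrable_normal_mul R s C k s0.
have bd (g : R -> R) : measurable_fun setT g -> (forall x, `|g x| <= 1) ->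
    \int[P]_x g (S x - M) = \int[mu]_u (g u * normal_pdf 0 s u).
  move=> mg g1; apply: (sg g (fun x => g x + 1) (fun=> 1)) => //.
  - exact: measurable_funD.
  - by move=> x; have := g1 x; rewrite ler_norml => /andP[]; lra.
  - by move=> x; ring.
  - apply: (inm _ 2); first exact: measurable_funD.
    move=> x; rewrite (le_trans (ler_normD _ _))// normr1.
    by have := g1 x; have := sqr_ge0 x; lra.
  - by apply: (inm _ 1) => // x; rewrite normr1 mul1r lerDl sqr_ge0.
have mcos : measurable_fun setT (@cos R) by exact: continuous_measurable_fun (@continuous_cos R).
have msin : measurable_fun setT (@sin R) by exact: continuous_measurable_fun (@continuous_sin R).
have sq : (\int[P]_x ((S x - M) ^+ 2)%:E = (s ^+ 2)%:E)%E.
  rewrite (nn (fun z => z ^+ 2)); [|exact: measurable_funX|by move=> x; exact: sqr_ge0].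
  rewrite -(normal_second_moment s0) /Rintegral fineK//.
  apply: (integrable_fin_num measurableT); apply: (inm _ 1); first exact: measurable_funX.
  by move=> x; rewrite ger0_norm ?sqr_ge0// mul1r lerDr.
have i2 : ip P (fun x => S x - M) (fun x => S x - M) = s ^+ 2.
  by rewrite /ip /Rintegral (eq_integral (fun x => ((S x - M) ^+ 2)%:E)) ?sq.
split.
- split=> //; apply/integrableP; split; first by apply/measurable_EFinP; exact: measurable_funX.
  by under eq_integral do rewrite /= ger0_norm ?sqr_ge0//; rewrite sq ltry.
- rewrite (sg id (fun x => Num.max x 0) (fun x => Num.max (- x) 0)) ?normal_mean//.
  + exact: measurable_maxr.
  + by apply: measurable_maxr => //; exact: measurableT_comp.
  + by move=> x; rewrite le_max lexx orbT.
  + by move=> x; rewrite le_max lexx orbT.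
  + by move=> x; rewrite /Num.max; case: ifPn; case: ifPn; rewrite -?leNgt; lra.
  + apply: (inm _ 1); first exact: measurable_maxr.
    by move=> x; rewrite ger0_norm ?le_max ?lexx ?orbT// ge_max; apply/andP; split; nra.
  + apply: (inm _ 1); first by apply: measurable_maxr => //; exact: measurableT_comp.
    by move=> x; rewrite ger0_norm ?le_max ?lexx ?orbT// ge_max; apply/andP; split; nra.
- rewrite (bd cos)//; last exact: cos_max.
  rewrite i2 -[RHS](_ : expR (- (s ^+ 2 * 1 ^+ 2 / 2)) = _); last by rewrite expr1n mulr1.
  by rewrite -(normal_cos 1 s0); apply: eq_Rintegral => x _; rewrite mul1r.
- rewrite (bd sin)//; last exact: sin_max.
  apply: etrans (normal_sin 1 s0); by apply: eq_Rintegral => x _; rewrite mul1r.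
Qed.

End gaussian_variables.

(** The cases s = 1 and s = -1 are the positive and negative parts, so identities for nonnegative
    functionals pass to real ones. *)
Lemma Rintegral_parts d1 d2 (T1 : measurableType d1) (T2 : measurableType d2) (R : realType)
    (P1 : {measure set T1 -> \bar R}) (P2 : {measure set T2 -> \bar R}) (f1 : T1 -> R) (f2 : T2 -> R) :
  (forall s : R, \int[P1]_x (Num.max (s * f1 x) 0)%:E = \int[P2]_x (Num.max (s * f2 x) 0)%:E)%E ->
  \int[P1]_x f1 x = \int[P2]_x f2 x.
Proof.
move=> h; rewrite /Rintegral; congr fine; rewrite integralE [RHS]integralE.
have pE d' (T' : measurableType d') (P' : {measure set T' -> \bar R}) (f : T' -> R) :
   (\int[P']_x (fun x => (f x)%:E)^\+ x = \int[P']_x (Num.max (1 * f x) 0)%:E)%E.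
  by apply: eq_integral => x _; rewrite funeposE mul1r -EFin_max.
have nE d' (T' : measurableType d') (P' : {measure set T' -> \bar R}) (f : T' -> R) :
   (\int[P']_x (fun x => (f x)%:E)^\- x = \int[P']_x (Num.max ((-1) * f x) 0)%:E)%E.
  by apply: eq_integral => x _; rewrite funenegE -EFinN mulN1r -EFin_max.
by rewrite !pE !nE !h.
Qed.

Lemma Rintegral_linear d (T : measurableType d) (R : realType) (P : {measure set T -> \bar R})
    (a : R) (f g : T -> R) : P.-integrable setT (EFin \o f) -> P.-integrable setT (EFin \o g) ->
  \int[P]_x (a * f x + g x) = a * \int[P]_x f x + \int[P]_x g x.
Proof.
by move=> i1 i2; rewrite RintegralD// ?RintegralZl//; exact: integrable_scaleR.
Qed.

Section pshift.
Context (R : realType).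

Definition pshift (h : R) (w : path R) : path R := mkpath (fun t => w (t + h)).

Lemma pshiftE h (w : path R) : pshift h w = (fun t => w (t + h)) :> (R -> R).
Proof. by apply: mkpathE; case: (C2_shift h (path_C2 w)). Qed.

Lemma measurable_pshift h : measurable_fun setT (pshift h).
Proof.
apply/measurable_pathP => t; under eq_fun do rewrite pshiftE.
exact: measurable_path_eval.
Qed.

End pshift.

(** On the exceptional set the path is replaced by 0, so that the version is smooth everywhere and
    still measurable. *)
Lemma path_version d (T : measurableType d) (R : realType) (P : probability T R)
    (W : R -> {RV P >-> R}) (N : set T) : measurable N -> (forall x, ~ N x -> C2 (sample_path W x)) ->
  exists2 X : T -> path R, measurable_fun setT X &
    forall x, ~ N x -> X x = sample_path W x :> (R -> R).
Proof.
move=> mN C2W; exists (fun x => mkpath (fun t => if x \in N then 0 else W t x)).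
  apply/measurable_pathP => t.
  have E x : mkpath (fun t => if x \in N then 0 else W t x) = (fun t => if x \in N then 0 else W t x) :> (R -> R).
    apply: mkpathE; have [Nx|] := boolP (x \in N); first by case: (C2_cst (0 : R)).
    by rewrite notin_setE => /C2W.
  under eq_fun do rewrite E.
  apply: measurable_fun_ifT => //; apply: (measurable_fun_bool true).
  by rewrite setTI preimage_mem_true.
move=> x Nx; rewrite mkpathE; first by apply/funext => t; rewrite memNset.
by rewrite memNset//; exact: C2W.
Qed.

Section path_process.
Context d (T : measurableType d) (R : realType) (P : probability T R).
Variable W : R -> {RV P >-> R}.
Hypothesis hgauss : gaussian_process W.
Hypothesis hstat : stationary_process W.
Variables (N : set T) (mN : measurable N) (N0 : P N = 0%E).
Variables (X : T -> path R) (mX : measurable_fun setT X).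
Hypothesis XW : forall x, ~ N x -> X x = sample_path W x :> (R -> R).

Let cylE l w : cyl l w <-> forall i : 'I_(size l), (nth (0, set0) l i).2 (w (nth (0, set0 : set R) l i).1).
Proof.
elim: l => [|p l IH] /=; first by split => // _ [].
split=> [[h1 /IH h2] [[|i] hi]//=|h]; first exact: (h2 (Ordinal (hi : (i < size l)%N))).
split; first exact: (h ord0).
by apply/IH => i; exact: (h (lift ord0 i)).
Qed.

(** Stationarity is given for finitely many times, that is, on cylinders; these determine the law of
    the path. *)
Lemma stationary_path (h : R) (Phi : path R -> \bar R) : measurable_fun setT Phi ->
  (forall w, 0 <= Phi w)%E -> (\int[P]_x Phi (pshift h (X x)) = \int[P]_x Phi (X x))%E.
Proof.
move=> mPhi Phi0; have mXh : measurable_fun setT (fun x => pshift h (X x)).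
  exact: (measurableT_comp (measurable_pshift h) mX).
have fin : (P setT < +oo)%E by rewrite [X in (X < _)%E](@probability_setT _ _ _ P) ltry.
apply: (@law_eq_cylinders _ _ _ _ _ _ _ mXh mX P P fin fin _ Phi mPhi Phi0) => l ml.
have mA (Z : T -> path R) : measurable_fun setT Z -> measurable (Z @^-1` cyl l).
  move=> mZ; rewrite -[X in measurable X]setTI; apply: mZ => //.
  by apply: sub_sigma_algebra; exists l.
pose A (i : 'I_(size l)) := (nth (0, set0) l i).2; pose t (i : 'I_(size l)) := (nth (0, set0 : set R) l i).1.
have mAi i : measurable (A i).
  rewrite /A; elim: l ml {mA A t} i => [|p l IH] /=; first by move=> _ [].
  move=> [m1 m2] [[|i] hi] /=; [exact: m1|exact: (IH m2 (Ordinal (hi : (i < size l)%N)))].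
have E (Z : T -> path R) (s : R) : measurable_fun setT Z -> (forall x, ~ N x -> forall u, Z x u = W (u + s) x) ->
    P (Z @^-1` cyl l) = P [set x | forall i, A i (W (t i + s) x)].
  move=> mZ ZE; have mB : measurable [set x | forall i, A i (W (t i + s) x)].
    rewrite (_ : mkset _ = \bigcap_(i in [set: 'I_(size l)]) (W (t i + s) @^-1` A i)).
      by apply: fin_bigcap_measurable => // i _; exact: measurable_sfunP.
    by apply/seteqP; split => x h1 i; [move=> _; exact: h1|exact: (h1 i I)].
  have ind (B : set T) : measurable B -> (P B = \int[P]_x (\1_B x)%:E)%E.
    by move=> mB'; rewrite integral_indic// setIT.
  rewrite (ind _ (mA Z mZ)) (ind _ mB); apply: (integral_null_modification mN N0).
    by apply/measurable_EFinP; exact: measurable_indic.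
  move=> x Nx; congr (_%:E); rewrite !indicE; congr ((nat_of_bool _)%:R).
  apply/idP/idP => /set_mem h1; apply/mem_set.
    by move=> i; have /cylE /(_ i) := h1; rewrite ZE.
  by apply/cylE => i; rewrite ZE//; exact: h1.
have e1 := E (fun x => pshift h (X x)) h mXh; have e2 := E X 0 mX.
apply: (etrans (e1 _)); first by move=> x Nx u; rewrite pshiftE (XW Nx).
apply: (etrans _ (esym (e2 _))); last by move=> x Nx u; rewrite (XW Nx) addr0.
rewrite hstat//; congr (P _); apply/seteqP.
by split => x h1 i; have := h1 i; rewrite addr0.
Qed.

Lemma stationary_path_Rintegral (h : R) (Psi : path R -> R) : measurable_fun setT Psi ->
  \int[P]_x Psi (pshift h (X x)) = \int[P]_x Psi (X x).
Proof.
move=> mPsi; have ms (s : R) : measurable_fun setT (fun w => (Num.max (s * Psi w) 0)%:E).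
  by apply/measurable_EFinP; apply: measurable_maxr => //; exact: measurable_funM.
have p0 s w : (0 <= (Num.max (s * Psi w) 0)%:E)%E by rewrite lee_fin le_max lexx orbT.
by apply: Rintegral_parts => s; exact: (stationary_path h (ms s) (p0 s)).
Qed.

Variables (mean0 : R) (m : path R).
Hypotheses (mean0E : \int[P]_x X x 0 = mean0) (path_meanE : m = (fun=> mean0) :> (R -> R)).

Definition gauss_base : set (T -> R) := [set f | exists l, f = fun x => comb (X x) l - comb m l].

Let comb_W l x : ~ N x -> comb (X x) l = \sum_(i < size l) (nth (0, 0) l i).1 * W (nth (0, 0) l i).2 x.
Proof. by move=> Nx; rewrite (XW Nx) /comb (big_nth (0, 0)) big_mkord. Qed.

Let comb_moments l : exists M : R, [/\ sqint P (fun x => comb (X x) l - M), \int[P]_x (comb (X x) l - M) = 0,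
   \int[P]_x cos (comb (X x) l - M) = expR (- (ip P (fun x => comb (X x) l - M) (fun x => comb (X x) l - M) / 2)) &
   \int[P]_x sin (comb (X x) l - M) = 0].
Proof.
apply: gaussian_rv_moments; first exact: measurable_comb.
have [M [s h]] := hgauss (fun i : 'I_(size l) => (nth (0, 0) l i).2) (fun i => (nth (0, 0) l i).1).
exists M, s => A mA; rewrite -h//.
have mS : measurable_fun setT (fun x => \sum_(i < size l) (nth (0, 0) l i).1 * W (nth (0, 0) l i).2 x).
  by apply: measurable_sum => i; exact: measurable_funM.
have mB (f : T -> R) : measurable_fun setT f -> measurable (f @^-1` A).
  by move=> mf; rewrite -[X in measurable X]setTI; exact: mf.
have ind (B : set T) : measurable B -> (P B = \int[P]_x (\1_B x)%:E)%E.
  by move=> mB'; rewrite integral_indic// setIT.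
rewrite (ind _ (mB _ (measurable_comb l mX))) (ind _ (mB _ mS)); apply: (integral_null_modification mN N0).
  by apply/measurable_EFinP; apply: measurable_indic; exact: mB.
move=> x Nx; congr (_%:E); rewrite !indicE; congr ((nat_of_bool _)%:R).
by apply/idP/idP => /set_mem h1; apply/mem_set; move: h1; rewrite /= comb_W.
Qed.

Let integrable_comb l : P.-integrable setT (fun x => (comb (X x) l)%:E).
Proof.
have [M [s1 _ _ _]] := comb_moments l.
have := integrable_addR (sqint_integrable s1) (sqint_integrable (sqint_cst P M)).
by congr (P.-integrable _ _); apply/funext => x /=; congr (_%:E); ring.
Qed.

Let meanE t : \int[P]_x X x t = mean0.
Proof.
rewrite -mean0E; have := stationary_path_Rintegral t (measurable_path_eval 0).
by move=> h; apply: etrans h; apply: eq_Rintegral => x _; rewrite pshiftE add0r.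
Qed.

Let comb_mean l : \int[P]_x comb (X x) l = comb m l.
Proof.
elim: l => [|p l IH].
  transitivity (\int[P]_x (0 : R)); first by apply: eq_Rintegral => x _; rewrite /comb big_nil.
  by rewrite (Rintegral_prob_cst P) /comb big_nil.
have i1 : P.-integrable setT (fun x => (X x p.2)%:E).
  have := integrable_comb [:: (1, p.2)].
  by congr (P.-integrable _ _); apply/funext => x; rewrite /comb big_seq1 mul1r.
have i2 := integrable_comb l.
transitivity (\int[P]_x (p.1 * X x p.2 + comb (X x) l)).
  by apply: eq_Rintegral => x _; rewrite /comb big_cons.
apply: (etrans (Rintegral_linear p.1 i1 i2)); rewrite IH meanE.
have mE : m p.2 = mean0 by rewrite path_meanE.
by rewrite /comb big_cons mE.
Qed.

Lemma cgauss_base : cgauss P gauss_base.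
Proof.
have key l : [/\ sqint P (fun x => comb (X x) l - comb m l), \int[P]_x (comb (X x) l - comb m l) = 0,
   \int[P]_x cos (comb (X x) l - comb m l) = expR (- (ip P (fun x => comb (X x) l - comb m l) (fun x => comb (X x) l - comb m l) / 2)) &
   \int[P]_x sin (comb (X x) l - comb m l) = 0].
  have [M [s1 s2 s3 s4]] := comb_moments l.
  (* [M] is only known to centre the combination; taking means identifies it with the value on the
     mean path. *)
  suff E : M = comb m l by subst M.
  have := Rintegral_linear (-1) (sqint_integrable s1) (integrable_comb l).
  rewrite s2 comb_mean mulr0 add0r => <-.
  apply: etrans (esym (Rintegral_prob_cst P M)) _; apply: eq_Rintegral => x _; ring.
split.
- by exists [::]; apply/funext => x; rewrite /comb !big_nil subrr.
- move=> a _ _ [l1 ->] [l2 ->]; exists ([seq (a * p.1, p.2) | p <- l1] ++ l2).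
  have e w : comb w ([seq (a * p.1, p.2) | p <- l1] ++ l2) = a * comb w l1 + comb w l2.
    by rewrite /comb big_cat big_map mulr_sumr; congr (_ + _); apply: eq_bigr => p _; rewrite /= mulrA.
  by apply/funext => x; rewrite !e; ring.
- by move=> _ [l ->]; case: (key l).
- by move=> _ [l ->]; case: (key l).
- by move=> _ [l ->]; case: (key l).
- by move=> _ [l ->]; case: (key l).
Qed.

(** One closure for each derivative: slopes are limits of difference quotients of values, and second
    derivatives are limits of difference quotients of slopes. *)
Definition gauss_space : set (T -> R) := pw_closure (pw_closure gauss_base).

Lemma cgauss_space : cgauss P gauss_space.
Proof. exact/cgauss_pw_closure/cgauss_pw_closure/cgauss_base. Qed.

Lemma gproc_path : gproc gauss_space X m.
Proof.
have c1 := cgauss_pw_closure cgauss_base.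
have b t : gauss_base (fun x => X x t - m t).
  by exists [:: (1, t)]; apply/funext => x; rewrite /comb !big_seq1 !mul1r.
have dm (w : path R) := C2_derive (path_C2 w).
have b1 t : pw_closure gauss_base (fun x => (X x : R -> R)^`()%classic t - (m : R -> R)^`()%classic t).
  exists (fun k x => (k.+1%:R^-1)^-1 * (X x (t + k.+1%:R^-1) - m (t + k.+1%:R^-1) - (X x t - m t))).
    move=> k; have := cg_scale cgauss_base (k.+1%:R^-1)^-1 (cg_sub cgauss_base 1 (b (t + k.+1%:R^-1)) (b t)).
    by congr gauss_base; apply/funext => x; rewrite mul1r.
  move=> x; have [d1 _ _] := dm (X x); have [d2 _ _] := dm m.
  have d3 := is_deriveB (d1 t) (d2 t).
  by apply: (derive_seq d3) => //; exact: cvg_harmonic.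
split.
- exact: mX.
- by move=> t; do 2 apply: sub_pw_closure; exact: b.
- by move=> t; apply: sub_pw_closure; exact: b1.
- move=> t; exists (fun k x => (k.+1%:R^-1)^-1 * ((X x : R -> R)^`()%classic (t + k.+1%:R^-1) -
      (m : R -> R)^`()%classic (t + k.+1%:R^-1) - ((X x : R -> R)^`()%classic t - (m : R -> R)^`()%classic t))).
    move=> k; have := cg_scale c1 (k.+1%:R^-1)^-1 (cg_sub c1 1 (b1 (t + k.+1%:R^-1)) (b1 t)).
    by congr (pw_closure _); apply/funext => x; rewrite mul1r.
  move=> x; have [_ d1 _] := dm (X x); have [_ d2 _] := dm m.
  have d3 := is_deriveB (d1 t) (d2 t).
  by apply: (derive_seq d3) => //; exact: cvg_harmonic.
Qed.

End path_process.

(** * Linear independence from the continuous part of the spectrum *)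

Section spectral_nondegeneracy.
Context (R : realType).

(** An entry (t, ((a, b), (c, d))) contributes (a + b x) cos (t x) + (c + d x) sin (t x). Affine
    coefficients are needed because a derivative of the process brings a factor x in the frequency
    domain. *)
Definition trig_poly (l : seq (R * (R * R * (R * R)))) (x : R) : R :=
  \sum_(p <- l) ((p.2.1.1 + p.2.1.2 * x) * cos (x * p.1) + (p.2.2.1 + p.2.2.2 * x) * sin (x * p.1)).

Definition trig_deriv (l : seq (R * (R * R * (R * R)))) : seq (R * (R * R * (R * R))) :=
  [seq (p.1, ((p.2.1.2 + p.1 * p.2.2.1, p.1 * p.2.2.2), (p.2.2.2 - p.1 * p.2.1.1, - (p.1 * p.2.1.2)))) | p <- l].

Lemma is_derive_trig_poly l (x : R) : is_derive x (1:R) (trig_poly l) (trig_poly (trig_deriv l) x).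
Proof.
elim: l => [|[t [[a b] [c d]]] l IH].
  rewrite (_ : trig_poly [::] = cst 0); last by apply/funext => y; rewrite /trig_poly big_nil.
  exact: is_derive_cst.
have e : trig_poly ((t, (a, b, (c, d))) :: l) =
    (fun y => ((a + b * y) * cos (y * t) + (c + d * y) * sin (y * t)) + trig_poly l y).
  by apply/funext => y; rewrite /trig_poly big_cons.
have dl (u v : R) : is_derive x (1:R) (fun y : R => u + v * y) v.
  have h := is_deriveD (is_derive_cst u x (1:R)) (is_deriveZ v (@is_derive_id R R x (1:R))).
  by apply: (is_derive_eq h); rewrite add0r /GRing.scale /= mulr1.
have dt : is_derive x (1:R) (fun y : R => y * t) t.
  have := dl 0 t; rewrite (_ : (fun y : R => 0 + t * y) = (fun y => y * t))//.
  by apply/funext => y; rewrite add0r mulrC.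
have dc := @is_derive1_comp R (@cos R) (fun y : R => y * t) x _ _ (is_derive_cos _) dt.
have ds := @is_derive1_comp R (@sin R) (fun y : R => y * t) x _ _ (is_derive_sin _) dt.
have h := is_deriveD (is_deriveD (is_deriveM (dl a b) dc) (is_deriveM (dl c d) ds)) IH.
rewrite e; apply: (is_derive_eq h).
rewrite /trig_poly /trig_deriv /= big_cons /GRing.scale /=; congr (_ + _).
by move: (cos (x * t)) (sin (x * t)) => *; ring.
Qed.

Definition zeros_cluster (f : R -> R) (x0 : R) :=
  forall e : R, 0 < e -> exists x, [/\ x != x0, `|x - x0| < e & f x = 0].

(** Continuity makes the cluster point a zero, and Rolle's theorem between it and nearby zeros gives
    zeros of the derivative. *)
Lemma zeros_cluster_derive f f' x0 : (forall x : R, is_derive x (1:R) f (f' x)) ->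
  zeros_cluster f x0 -> f x0 = 0 /\ zeros_cluster f' x0.
Proof.
move=> df zf; have cf : continuous f.
  move=> x; have [dx _] := df x; apply: differentiable_continuous; exact/derivable1_diffP.
have f0 : f x0 = 0.
  apply/eqP; apply/negPn/negP => fn.
  have n0 : 0 < `|f x0| by rewrite normr_gt0.
  have /cvgrPdist_lt /(_ _ n0) /nbhs_ballP[e /= e0 h] := cf x0.
  have [x [_ xe fx]] := zf e e0.
  by have := h x; rewrite /ball/= distrC fx subr0 ltxx => /(_ xe).
split=> // e e0; have [x [xn xe fx]] := zf e e0.
have rolle (a b : R) : a < b -> f a = 0 -> f b = 0 -> exists2 c, a < c < b & f' c = 0.
  move=> ab fa fb.
  have [c cab E] := @MVT R f f' a b ab (fun u _ => df u) (continuous_subspaceT cf).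
  exists c; first by move: cab; rewrite in_itv.
  by move: E; rewrite fa fb subrr => /esym/eqP; rewrite mulf_eq0 subr_eq0 (gt_eqF ab) orbF => /eqP.
have := xe; rewrite ltr_distl => /andP[h1 h2].
have [lt|lt|E] := ltgtP x x0; last by rewrite E eqxx in xn.
  have [c /andP[c1 c2] fc] := rolle x x0 lt fx f0; exists c; split => //; first by rewrite lt_eqF.
  by rewrite ltr_distl; apply/andP; split; move: h1 h2 c1 c2 e0; lra.
have [c /andP[c1 c2] fc] := rolle x0 x lt f0 fx; exists c; split => //; first by rewrite gt_eqF.
by rewrite ltr_distl; apply/andP; split; move: h1 h2 c1 c2 e0; lra.
Qed.

(** Iterating Rolle's theorem takes the place of analyticity: all derivatives vanish at the cluster
    point. *)
Lemma trig_poly_flat l x0 : zeros_cluster (trig_poly l) x0 ->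
  forall k, trig_poly (iter k trig_deriv l) x0 = 0.
Proof.
move=> z k; have : zeros_cluster (trig_poly (iter k trig_deriv l)) x0.
  by elim: k => //= k IH; case: (zeros_cluster_derive (is_derive_trig_poly _) IH).
by case/(zeros_cluster_derive (is_derive_trig_poly _)).
Qed.

(* The transfer functions, real and imaginary parts, of the functional
   u1 w(b) + u2 w'(a) + u3 w'(c) + u4 w(a) + u5 w(c). *)
Definition transfer_re (a b c u1 u2 u3 u4 u5 : R) :=
  [:: (b, ((u1, 0 : R), (0 : R, 0 : R))); (a, ((u4, 0 : R), (0 : R, - u2))); (c, ((u5, 0 : R), (0 : R, - u3)))].
Definition transfer_im (a b c u1 u2 u3 u4 u5 : R) :=
  [:: (b, ((0 : R, 0 : R), (u1, 0 : R))); (a, ((0 : R, u2), (u4, 0 : R))); (c, ((0 : R, u3), (u5, 0 : R)))].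

Lemma transfer_zero a b c u1 u2 u3 u4 u5 x0 : a != b -> b != c -> a != c ->
  zeros_cluster (trig_poly (transfer_re a b c u1 u2 u3 u4 u5)) x0 ->
  zeros_cluster (trig_poly (transfer_im a b c u1 u2 u3 u4 u5)) x0 ->
  [/\ u1 = 0, u2 = 0, u3 = 0, u4 = 0 & u5 = 0].
Proof.
move=> ab bc ac /trig_poly_flat C /trig_poly_flat S.
have cs (t : R) (u : R) : u * cos (x0 * t) = 0 -> u * sin (x0 * t) = 0 -> u = 0.
  move=> h1 h2; have := cos2Dsin2 (x0 * t) => h3.
  have : u * (cos (x0 * t) ^+ 2 + sin (x0 * t) ^+ 2) = 0.
    by rewrite mulrDr !expr2 !mulrA h1 h2 !mul0r addr0.
  by rewrite h3 mulr1.
move: (C 0%N) (C 1%N) (C 2%N) (C 3%N) (C 4%N) (S 0%N) (S 1%N) (S 2%N) (S 3%N) (S 4%N).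
rewrite /trig_poly /transfer_re /transfer_im /= !big_cons !big_nil /=.
move: (cs a) (cs b) (cs c).
move: (cos (x0 * a)) (cos (x0 * b)) (cos (x0 * c)) (sin (x0 * a)) (sin (x0 * b)) (sin (x0 * c)).
move=> ca cb cc sa sb sc csa csb csc C0 C1 C2 C3 C4 S0 S1 S2 S3 S4.
have nab : b - a != 0 by rewrite subr_eq0 eq_sym.
have nbc : b - c != 0 by rewrite subr_eq0.
have nac : a - c != 0 by rewrite subr_eq0.
have mz (k v : R) : k != 0 -> k * v = 0 -> v = 0.
  by move=> k0 /eqP; rewrite mulf_eq0 (negbTE k0) => /eqP.
have k1 : (b - a) ^+ 2 * (b - c) ^+ 2 != 0 by rewrite mulf_neq0 ?expf_neq0.
have k2 : (a - c) ^+ 2 != 0 by rewrite expf_neq0.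
(* The letters q, r and t denote the coefficients of (z - a)^2 (z - c)^2, of (z - a) (z - c)^2 and
   of (z - c) (z - a)^2. *)
pose q3 := - (2 * (a + c)); pose q2 := a ^+ 2 + 4 * a * c + c ^+ 2.
pose q1 := - (2 * a * c * (a + c)); pose q0 := a ^+ 2 * c ^+ 2.
pose r2 := - (a + 2 * c); pose r1 := c ^+ 2 + 2 * a * c; pose r0 := - (a * c ^+ 2).
pose t2 := - (c + 2 * a); pose t1 := a ^+ 2 + 2 * a * c; pose t0 := - (c * a ^+ 2).
have m (k x : R) : x = 0 -> k * x = 0 by move=> ->; rewrite mulr0.
have E1 : u1 = 0.
  apply: csb; apply: (mz _ _ k1).
    by move: C4 (m q3 _ S3) (m q2 _ C2) (m q1 _ S1) (m q0 _ C0); rewrite /q0 /q1 /q2 /q3; lra.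
  by move: S4 (m q3 _ C3) (m q2 _ S2) (m q1 _ C1) (m q0 _ S0); rewrite /q0 /q1 /q2 /q3; lra.
have E2 : u2 = 0.
  apply: csa; apply: (mz _ _ k2).
    by move: C3 S3 (m r2 _ C2) (m r2 _ S2) (m r1 _ C1) (m r1 _ S1) (m r0 _ C0) (m r0 _ S0); rewrite E1 /r0 /r1 /r2; lra.
  by move: C3 S3 (m r2 _ C2) (m r2 _ S2) (m r1 _ C1) (m r1 _ S1) (m r0 _ C0) (m r0 _ S0); rewrite E1 /r0 /r1 /r2; lra.
have E3 : u3 = 0.
  apply: csc; apply: (mz _ _ k2).
    by move: C3 S3 (m t2 _ C2) (m t2 _ S2) (m t1 _ C1) (m t1 _ S1) (m t0 _ C0) (m t0 _ S0); rewrite E1 E2 /t0 /t1 /t2; lra.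
  by move: C3 S3 (m t2 _ C2) (m t2 _ S2) (m t1 _ C1) (m t1 _ S1) (m t0 _ C0) (m t0 _ S0); rewrite E1 E2 /t0 /t1 /t2; lra.
have E4 : u4 = 0.
  apply: csa; apply: (mz _ _ nac).
    by move: C1 S1 (m c _ C0) (m c _ S0); rewrite E1 E2 E3; lra.
  by move: C1 S1 (m c _ C0) (m c _ S0); rewrite E1 E2 E3; lra.
split => //; apply: csc.
  by move: C0; rewrite E1 E2 E3 E4; lra.
by move: S0; rewrite E1 E2 E3 E4; lra.
Qed.

(** Without an accumulation point, compactness would make the trace of Z on each [- n, n] finite,
    hence Z countable. *)
Lemma infinite_accumulation (Z : set R) : ~ countable Z ->
  exists x0, forall e : R, 0 < e -> exists x, [/\ x != x0, `|x - x0| < e & Z x].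
Proof.
move=> cZ; apply: contrapT => h.
have iso x0 : exists2 e : R, 0 < e & forall x, Z x -> `|x - x0| < e -> x = x0.
  apply: contrapT => h'; apply: h; exists x0 => e e0; apply: contrapT => h2; apply: h'; exists e => // x Zx xe.
  by apply: contrapT => xn; apply: h2; exists x; split=> //; apply/eqP.
have fin (n : nat) : finite_set (Z `&` `[- n%:R, n%:R]%classic).
  have cpt : compact (`[- n%:R, n%:R]%classic : set R) by exact: segment_compact.
  have [e he] := choice (fun x0 => let: ex_intro2 e e0 h := iso x0 in ex_intro (fun e => 0 < e /\ forall x, Z x -> `|x - x0| < e -> x = x0) e (conj e0 h)).
  move: cpt; rewrite compact_cover => /(_ R setT (fun x0 => `](x0 - e x0), (x0 + e x0)[%classic)) [].
  - by move=> x _; exact: interval_open.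
  - move=> x _; exists x => //=; rewrite in_itv/= ltrBlDr ltrDl; have := (he x).1; move: (e x) => y; lra.
  move=> D _ cov; apply: (sub_finite_set _ (finite_fset D)).
  move=> x [Zx /cov[y yD]]; rewrite /= in_itv/= => xy.
  by rewrite ((he y).2 x Zx) // ltr_distl.
apply: cZ; rewrite (_ : Z = \bigcup_n (Z `&` `[- n%:R, n%:R]%classic)).
  by apply: bigcup_countable => // n _; exact: finite_set_countable.
apply/seteqP; split => [x Zx|x [n _ []]//].
have [n hn] : exists n : nat, `|x| < n%:R.
  by exists (Num.truncn `|x|).+1; rewrite truncnS_gt.
by exists n => //; split=> //=; rewrite in_itv/= -ler_norml ltW.
Qed.

Lemma atoms_countable (F : {finite_measure set R -> \bar R}) :
  countable [set x | (F [set x] != 0)%E].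
Proof.
have fin (n : nat) : finite_set [set x | ((n.+1%:R^-1)%:E <= F [set x])%E].
  apply: contrapT => inf.
  have fF : (F setT < +oo)%E by rewrite -ge0_fin_numE// fin_num_measure.
  pose K := (Num.truncn (fine (F setT) * n.+1%:R)).+1.
  have /infiniteP/pcard_leP[f] := inf.
  have fA i : ((n.+1%:R^-1)%:E <= F [set f i])%E by exact: (@funS _ _ _ _ f i I).
  have tf : trivIset setT (fun i => [set f i]).
    by move=> i j _ _ [x [/= -> ]] fij; apply: (@inj _ _ _ f); rewrite ?inE.
  have mf i : measurable ([set f i] : set R) by exact: measurable_set1.
  have h1 : (F (\big[setU/set0]_(i < K) [set f i]) <= F setT)%E.
    by apply: le_measure; rewrite ?inE//; exact: bigsetU_measurable.
  have h2 : (\sum_(i < K) (n.+1%:R^-1)%:E <= F (\big[setU/set0]_(i < K) [set f i]))%E.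
    have e : F (\big[setU/set0]_(i < K) [set f i]) = (\sum_(i < K) F [set f i])%E by first [exact: (@measure_bigsetU _ _ _ F (fun i => [set f i]) mf tf K)|exact: (@measure_bigsetU _ _ _ F (fun i => [set f i]) K mf tf)].
    by rewrite e; apply: lee_sum => i _; exact: fA.
  have := le_trans h2 h1; rewrite sumEFin sumr_const card_ord -(fineK (fin_num_measure F setT measurableT)) lee_fin.
  rewrite -[_ *+ K]mulr_natl ler_pdivrMr ?ltr0n// leNgt => /negP; apply.
  exact: truncnS_gt.
rewrite (_ : mkset _ = \bigcup_n [set x | ((n.+1%:R^-1)%:E <= F [set x])%E]).
  by apply: bigcup_countable => // n _; exact: finite_set_countable.
apply/seteqP; split => x /=; last first.
  by move=> [n _ /= h]; apply/negP => /eqP F0; move: h; rewrite F0 lee_fin leNgt invr_gt0 ltr0n.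
move=> Fx.
have ff : F [set x] \is a fin_num by apply: fin_num_measure; exact: measurable_set1.
have p : 0 < fine (F [set x]) by rewrite lt_neqAle fine_ge0// andbT eq_sym; apply: contra Fx => /eqP h; rewrite -(fineK ff) h.
exists (Num.truncn (fine (F [set x]))^-1) => //=; rewrite -[leRHS](fineK ff) lee_fin.
by rewrite -[leRHS]invrK lef_pV2 ?posrE ?invr_gt0 ?ltr0n// ltW// truncnS_gt.
Qed.

End spectral_nondegeneracy.

Section spectral_variance.
Context d (T : measurableType d) (R : realType) (P : probability T R).
Variables (G : set (T -> R)) (cG : cgauss P G).
Variables (F : {finite_measure set R -> \bar R}) (Z : R -> T -> R).
Hypothesis GZ : forall t, G (Z t).
Hypothesis ipZ : forall s t, ip P (Z s) (Z t) = \int[F]_l cos (l * (t - s)).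

Let iF (f : R -> R) (C : R) : measurable_fun setT f -> (forall x, `|f x| <= C) -> F.-integrable setT (EFin \o f).
Proof.
move=> mf fC; apply: (@le_integrable _ _ _ F setT measurableT _ (EFin \o cst C)).
- exact/measurable_EFinP.
- by move=> x _; rewrite /= lee_fin (le_trans (fC x))// ler_norm.
- exact: finite_measure_integrable_cst.
Qed.

Definition zcomb (l : seq (R * R)) (x : T) : R := \sum_(p <- l) p.1 * Z p.2 x.
Definition cos_sum (l : seq (R * R)) (y : R) : R := \sum_(p <- l) p.1 * cos (y * p.2).
Definition sin_sum (l : seq (R * R)) (y : R) : R := \sum_(p <- l) p.1 * sin (y * p.2).

Definition bounded_meas (f : R -> R) := measurable_fun setT f /\ exists C, forall x, `|f x| <= C.

Let bm_lin (a : R) f g : bounded_meas f -> bounded_meas g -> bounded_meas (fun x => a * f x + g x).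
Proof.
move=> [mf [C fC]] [mg [D gD]]; split; first by apply: measurable_funD => //; exact: measurable_funM.
exists (`|a| * C + D) => x; rewrite (le_trans (ler_normD _ _))// lerD// normrM.
by rewrite ler_wpM2l.
Qed.

Let bm_mul f g : bounded_meas f -> bounded_meas g -> bounded_meas (fun x => f x * g x).
Proof.
move=> [mf [C fC]] [mg [D gD]]; split; first exact: measurable_funM.
by exists (C * D) => x; rewrite normrM ler_pM.
Qed.

Let bm_trig (t : R) : bounded_meas (fun y => cos (y * t)) /\ bounded_meas (fun y => sin (y * t)).
Proof.
split; split.
- apply: measurableT_comp; last exact: measurable_funM.
  exact: continuous_measurable_fun (@continuous_cos R).
- by exists 1 => x; exact: cos_max.
- apply: measurableT_comp; last exact: measurable_funM.
  exact: continuous_measurable_fun (@continuous_sin R).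
- by exists 1 => x; exact: sin_max.
Qed.

Let bm_sum l : bounded_meas (cos_sum l) /\ bounded_meas (sin_sum l).
Proof.
elim: l => [|p l [IH1 IH2]].
  rewrite (_ : cos_sum [::] = (fun=> 0)); last by apply/funext => y; rewrite /cos_sum big_nil.
  rewrite (_ : sin_sum [::] = (fun=> 0)); last by apply/funext => y; rewrite /sin_sum big_nil.
  by split; split => //; exists 0 => x; rewrite normr0.
have e1 : cos_sum (p :: l) = (fun y => p.1 * cos (y * p.2) + cos_sum l y) by apply/funext => y; rewrite /cos_sum big_cons.
have e2 : sin_sum (p :: l) = (fun y => p.1 * sin (y * p.2) + sin_sum l y) by apply/funext => y; rewrite /sin_sum big_cons.
by rewrite e1 e2; split; apply: bm_lin => //; case: (bm_trig p.2).
Qed.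

Let bm_int f : bounded_meas f -> F.-integrable setT (EFin \o f).
Proof. by move=> [mf [C fC]]; exact: iF fC. Qed.

Let zcomb_G l : G (zcomb l).
Proof.
elim: l => [|p l IH].
  by rewrite (_ : zcomb [::] = (fun=> 0)); [exact: (cg_0 cG)|apply/funext => x; rewrite /zcomb big_nil].
have := cg_lin cG p.1 (GZ p.2) IH.
by congr G; apply/funext => x; rewrite /zcomb big_cons.
Qed.

Let pairing (h : T -> R) (c s : R -> R) l : G h -> bounded_meas c -> bounded_meas s ->
  (forall t, ip P (Z t) h = \int[F]_y (cos (y * t) * c y + sin (y * t) * s y)) ->
  ip P (zcomb l) h = \int[F]_y (cos_sum l y * c y + sin_sum l y * s y).
Proof.
move=> Gh bc bs E; have sh := cg_sqint cG Gh.
have bE (f g : R -> R) : bounded_meas f -> bounded_meas g -> bounded_meas (fun y => f y * c y + g y * s y).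
  move=> bf bg; have := bm_lin 1 (bm_mul bf bc) (bm_mul bg bs).
  by congr bounded_meas; apply/funext => y; rewrite mul1r.
elim: l => [|p l IH].
  transitivity (0 : R).
    have := ip_scalel 0 sh sh; rewrite mul0r => <-; congr ip; apply/funext => x.
    by rewrite /zcomb big_nil mul0r.
  transitivity (\int[F]_y (0 : R)); first by rewrite /Rintegral integral0.
  by apply: eq_Rintegral => y _; rewrite /cos_sum /sin_sum !big_nil !mul0r addr0.
have e : zcomb (p :: l) = (fun x => p.1 * Z p.2 x + 1 * zcomb l x).
  by apply/funext => x; rewrite /zcomb big_cons mul1r.
rewrite e ip_linl//; [|exact: (cg_sqint cG (GZ _))|exact: (cg_sqint cG (zcomb_G l))].
have [bc1 bs1] := bm_trig p.2; have [bc2 bs2] := bm_sum l.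
rewrite mul1r IH E -(Rintegral_linear p.1 (bm_int (bE _ _ bc1 bs1)) (bm_int (bE _ _ bc2 bs2))).
apply: eq_Rintegral => y _; rewrite /cos_sum /sin_sum !big_cons.
by move: (\sum_(p <- l) _) (\sum_(p <- l) _) (cos _) (sin _) (c y) (s y) => *; ring.
Qed.

(** The spectral isometry, with the squared modulus of the transfer function split into real and
    imaginary parts; [pairing] is used once for each argument of [ip]. *)
Lemma ip_zcomb l : ip P (zcomb l) (zcomb l) = \int[F]_y (cos_sum l y ^+ 2 + sin_sum l y ^+ 2).
Proof.
have [bc bs] := bm_sum l.
rewrite (pairing l (zcomb_G l) bc bs); first by apply: eq_Rintegral => y _; rewrite !expr2.
move=> t; rewrite ipC; have [bct bst] := bm_trig t.
rewrite (pairing l (GZ t) bct bst).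
  by apply: eq_Rintegral => y _; rewrite mulrC [sin_sum _ _ * _]mulrC.
move=> s; rewrite ipZ; apply: eq_Rintegral => y _; rewrite mulrBr cosB.
by ring.
Qed.

(** Variances of the approximating combinations tend to that of [f], which is 0; by Fatou's lemma
    the limiting squared transfer function has spectral integral 0. *)
Lemma spectral_limit_zero (ls : nat -> seq (R * R)) (f : T -> R) (c s : R -> R) :
  (forall x, zcomb (ls n) x @[n --> \oo] --> f x) -> ip P f f = 0 ->
  (forall y, cos_sum (ls n) y @[n --> \oo] --> c y) ->
  (forall y, sin_sum (ls n) y @[n --> \oo] --> s y) ->
  exists B, [/\ measurable B, F B = 0%E & forall y, ~ B y -> c y = 0 /\ s y = 0].
Proof.
move=> zf f0 hc hs.
have [sf h] := cgauss_sqint_cvg cG (fun n => zcomb_G (ls n)) zf.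
have h2 := sqint_cvg2 (fun n => cg_sqint cG (zcomb_G (ls n))) sf h.
rewrite f0 in h2.
pose q n y := cos_sum (ls n) y ^+ 2 + sin_sum (ls n) y ^+ 2.
have mcs n : measurable_fun setT (cos_sum (ls n)) /\ measurable_fun setT (sin_sum (ls n)).
  by have [[] ? _ [] ? _] := bm_sum (ls n).
have mq n : measurable_fun setT (q n) by case: (mcs n) => *; apply: measurable_funD; exact: measurable_funX.
have q0 n y : 0 <= q n y by rewrite addr_ge0// sqr_ge0.
have iq n : (\int[F]_y (q n y)%:E = (ip P (zcomb (ls n)) (zcomb (ls n)))%:E)%E.
  rewrite ip_zcomb /Rintegral fineK//; apply: (integrable_fin_num measurableT); apply: bm_int.
  have [bc bs] := bm_sum (ls n); have := bm_lin 1 (bm_mul bc bc) (bm_mul bs bs).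
  by congr bounded_meas; apply/funext => y; rewrite mul1r /q !expr2.
have qc y : q n y @[n --> \oo] --> c y ^+ 2 + s y ^+ 2.
  rewrite !expr2; apply: cvgD; (under eq_fun do rewrite expr2); apply: cvgM; try exact: hc; exact: hs.
have mc : measurable_fun setT (fun y => c y ^+ 2 + s y ^+ 2).
  by apply: (@measurable_fun_cvg _ _ _ _ q) => // y _; exact: qc.
have int0 : (\int[F]_y (c y ^+ 2 + s y ^+ 2)%:E = 0)%E.
  apply/eqP; rewrite eq_le integral_ge0 ?andbT; last by move=> y _; rewrite lee_fin addr_ge0 ?sqr_ge0.
  apply/lee_addgt0Pr => e e0; rewrite add0e.
  have /cvgrPdist_le /(_ e e0) [M _ hM] := h2.
  apply: (@fatou_bound _ _ R F q _ e M mq q0 qc) => n Mn; rewrite iq lee_fin.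
  by have := hM n Mn; rewrite sub0r normrN; apply: le_trans; exact: ler_norm.
have abs0 : (\int[F]_y `|(c y ^+ 2 + s y ^+ 2)%:E| = 0)%E.
  rewrite -[RHS]int0; apply: eq_integral => y _; rewrite gee0_abs// lee_fin addr_ge0 ?sqr_ge0//.
have mE : measurable_fun setT (fun y => (c y ^+ 2 + s y ^+ 2)%:E) by exact/measurable_EFinP.
have := (@ae_eq_integral_abs _ _ R F setT measurableT _ mE).1 abs0.
move=> [B [mB B0 hB]]; exists B; split => // y By.
have : c y ^+ 2 + s y ^+ 2 = 0.
  by apply: contrapT => h3; apply: By; apply: hB => /= h4; apply: h3; have [] := h4 I.
move=> /eqP; rewrite paddr_eq0 ?sqr_ge0// !sqrf_eq0 => /andP[/eqP -> /eqP ->]; by [].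
Qed.

End spectral_variance.

Section nondegeneracy.
Context d (T : measurableType d) (R : realType) (P : probability T R).
Variables (G : set (T -> R)) (cG : cgauss P G) (X : T -> path R) (m : path R) (gX : gproc G X m).
Variable F : {finite_measure set R -> \bar R}.
Hypothesis ipF : forall s t, ip P (fun x => X x s - m s) (fun x => X x t - m t) = \int[F]_l cos (l * (t - s)).
Hypothesis Fcont : (0 < F [set l | F [set l] = 0])%E.

(** The order of [xi_heights]: the three observables that vanish come first, so that Rice's formula
    can use them up and the heights remain for plain conditioning. *)
Definition five (a b c : R) : seq ((R * R) * R) :=
  [:: ((1, 0), b); ((0, 1), a); ((0, 1), c); ((1, 0), a); ((1, 0), c)].

Let countable_null (A : set R) : countable A -> (forall x, A x -> F [set x] = 0%E) -> F A = 0%E.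
Proof.
move=> /pfcard_geP[->|[f]] h; first by rewrite measure0.
have mA : measurable (A : set R).
  apply: countable_measurable => //; apply/pfcard_geP; right; exact: (squash f).
have : F.-negligible (\bigcup_k [set f k]).
  apply: negligible_bigcup => k; apply/negligibleP => //; apply: h; exact: (@funS _ _ _ _ f k I).
move=> [B [mB B0 AB]]; apply: (@subset_measure0 _ _ _ F A B) => //.
by move=> x /(@surj _ _ _ _ f)[k _ fk]; apply: AB; exists k.
Qed.

(** A countable set of points that are not atoms has mass 0, while the set of all such points has
    positive mass by [Fcont]. *)
Let off_null (B : set R) : measurable B -> F B = 0%E -> ~ countable [set x | F [set x] = 0%E /\ ~ B x].
Proof.
move=> mB B0 cA; pose A := [set l : R | F [set l] = 0%E].
have mA : measurable A.
  rewrite (_ : A = ~` [set x | (F [set x] != 0)%E]).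
    by apply: measurableC; apply: countable_measurable => //; exact: atoms_countable.
  by apply/seteqP; split => x /=; [move=> ->; rewrite eqxx|move/negP; rewrite negbK => /eqP].
have D0 : F (A `\` B) = 0%E by apply: countable_null => // x [].
have mD : measurable (A `\` B) by exact: measurableD.
have h1 : (F A <= F ((A `\` B) `|` B))%E.
  apply: le_measure; rewrite ?inE//; first exact: measurableU.
  by move=> x Ax; case: (pselect (B x)) => h; [right|left].
have h2 : (F ((A `\` B) `|` B) <= F (A `\` B) + F B)%E by exact: measureU2.
have := le_trans h1 h2; rewrite D0 B0 adde0 => h3.
by have := lt_le_trans Fcont h3; rewrite ltxx.
Qed.

(** The combination of the five observables with slopes replaced by difference quotients of step
    1/(n+1), so that only values of the process occur. *)
Let quotients (a b c u0 u1 u2 u3 u4 : R) (n : nat) : seq (R * R) :=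
  let h := n.+1%:R^-1 in
  [:: (u0, b); (u1 * h^-1, a + h); (- (u1 * h^-1), a); (u2 * h^-1, c + h); (- (u2 * h^-1), c); (u3, a); (u4, c)].

Let quotients_cvg a b c u0 u1 u2 u3 u4 (g : R -> R) (g' : R -> R) :
  (forall t : R, is_derive t (1:R) g (g' t)) ->
  \sum_(p <- quotients a b c u0 u1 u2 u3 u4 n) p.1 * g p.2 @[n --> \oo] -->
  u0 * g b + u1 * g' a + u2 * g' c + u3 * g a + u4 * g c.
Proof.
move=> dg; have q (t : R) : (n.+1%:R^-1)^-1 * (g (t + n.+1%:R^-1) - g t) @[n --> \oo] --> g' t.
  by apply: (derive_seq (dg t)) => //; exact: cvg_harmonic.
rewrite (_ : (fun n => _) = (fun n => u0 * g b + u1 * ((n.+1%:R^-1)^-1 * (g (a + n.+1%:R^-1) - g a)) +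
   u2 * ((n.+1%:R^-1)^-1 * (g (c + n.+1%:R^-1) - g c)) + u3 * g a + u4 * g c)); last first.
  apply/funext => n; rewrite /quotients !big_cons big_nil /=.
  by move: (n.+1%:R^-1 : R) => h; move: (h^-1) (g (a + h)) (g (c + h)) (g a) (g b) (g c) => *; ring.
by apply: cvgD; [apply: cvgD; [apply: cvgD; [apply: cvgD|]|]|]; try exact: cvg_cst; exact: cvgMr.
Qed.

Lemma nondeg_five a b c : a != b -> b != c -> a != c -> nondeg P (five a b c) X m.
Proof.
move=> ab bc ac u nu; rewrite lt_neqAle ip_ge0 andbT eq_sym; apply/negP => /eqP f0.
pose Z t x := X x t - m t.
have GZ t : G (Z t) := gp_eval gX t.
have dm (w : path R) := C2_derive (path_C2 w).
have dZ x (t : R) : is_derive t (1:R) (Z^~ x) ((X x : R -> R)^`()%classic t - (m : R -> R)^`()%classic t).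
  by have [d1 _ _] := dm (X x); have [d2 _ _] := dm m; exact: (is_deriveB (d1 t) (d2 t)).
have dl (y t : R) : is_derive t (1:R) (fun t : R => y * t) y.
  by have := is_deriveZ y (@is_derive_id R R t (1:R)); rewrite /GRing.scale /= mulr1.
have dc (y t : R) : is_derive t (1:R) (fun t : R => cos (y * t)) (- (y * sin (y * t))).
  by apply: (is_derive_eq (@is_derive1_comp R (@cos R) (fun t : R => y * t) t _ _ (is_derive_cos _) (dl y t))); ring.
have ds (y t : R) : is_derive t (1:R) (fun t : R => sin (y * t)) (y * cos (y * t)).
  by apply: (is_derive_eq (@is_derive1_comp R (@sin R) (fun t : R => y * t) t _ _ (is_derive_sin _) (dl y t))); ring.
pose ls := quotients a b c u`_0 u`_1 u`_2 u`_3 u`_4.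
have zf x : zcomb Z (ls n) x @[n --> \oo] --> lcomb (five a b c) u X m x.
  have := @quotients_cvg a b c u`_0 u`_1 u`_2 u`_3 u`_4 _ _ (dZ x).
  rewrite [X in _ --> X -> _](_ : _ = lcomb (five a b c) u X m x)// /lcomb /=.
  rewrite -!nth0 !nth_behead /cL /Lf /= /Z !mul1r !mul0r !add0r !addr0.
  by move: (X x b) (X x a) (X x c) (m a) (m b) (m c) (_^`()%classic _) (_^`()%classic _) (_^`()%classic _) (_^`()%classic _) => *; ring.
have hc y := @quotients_cvg a b c u`_0 u`_1 u`_2 u`_3 u`_4 _ _ (dc y).
have hs y := @quotients_cvg a b c u`_0 u`_1 u`_2 u`_3 u`_4 _ _ (ds y).
have [B [mB B0 hB]] := spectral_limit_zero cG GZ ipF zf f0 hc hs.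
have [x0 acc] := infinite_accumulation (off_null mB B0).
have [||e0 e1 e2 e3 e4] := @transfer_zero R a b c u`_0 u`_1 u`_2 u`_3 u`_4 x0 ab bc ac.
- move=> e /acc[x [xn xe [_ /hB[h1 _]]]]; exists x; split => //; apply: etrans h1.
  rewrite /trig_poly /transfer_re !big_cons big_nil /=.
  by move: (cos (x * b)) (cos (x * a)) (cos (x * c)) (sin (x * a)) (sin (x * b)) (sin (x * c)) => *; ring.
- move=> e /acc[x [xn xe [_ /hB[_ h1]]]]; exists x; split => //; apply: etrans h1.
  rewrite /trig_poly /transfer_im !big_cons big_nil /=.
  by move: (cos (x * b)) (cos (x * a)) (cos (x * c)) (sin (x * a)) (sin (x * b)) (sin (x * c)) => *; ring.
by move: nu; rewrite /= -!nth0 !nth_behead e0 e1 e2 e3 e4 eqxx.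
Qed.

End nondegeneracy.

#[local] Opaque pshift padd mkpath.


(** * Stationarity of the conditioned path *)

Section shifted_chain.
Context d (T : measurableType d) (R : realType) (P : probability T R).
Variables (G : set (T -> R)) (cG : cgauss P G).
Implicit Types (X : T -> path R) (m : path R) (l : seq ((R * R) * R)).

Lemma chain_cons c l (v : seq R) X m : chain P (c :: l) v X m =
  chain P l (behead v) (cpath P X m c.1 c.2 (head 0 v)) (cmean P X m c.1 c.2 (head 0 v)).
Proof. by []. Qed.

Lemma chain_pdf_cons c l (v : seq R) X m : chain_pdf P (c :: l) v X m =
  gauss_pdf (sd P X m c.1 c.2) (head 0 v - Lf c.1 m c.2) *
  chain_pdf P l (behead v) (cpath P X m c.1 c.2 (head 0 v)) (cmean P X m c.1 c.2 (head 0 v)).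
Proof. by []. Qed.

(** Weaker than [same_residual]: a shifted process is a different random path, with the same
    covariances only. *)
Definition same_cov X m X' m' := forall e t e' t',
  ip P (cL X m e t) (cL X m e' t') = ip P (cL X' m' e t) (cL X' m' e' t').

Let ip_comb f g h k (a b : R) : G f -> G g -> G h -> G k ->
  ip P (fun x => f x - a * g x) (fun x => h x - b * k x) =
  ip P f h - b * ip P f k - a * (ip P g h - b * ip P g k).
Proof.
move=> Gf Gg Gh Gk; have sf := cg_sqint cG Gf; have sg := cg_sqint cG Gg.
have sh := cg_sqint cG Gh; have sk := cg_sqint cG Gk.
have e (p q : T -> R) (r : R) : (fun x => p x - r * q x) = (fun x => 1 * p x + (- r) * q x).
  by apply/funext => x; ring.
rewrite !e ip_linl//; last exact: (cg_sqint cG (cg_add cG 1 (- b) Gh Gk)).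
by rewrite !ip_linr//; ring.
Qed.

Lemma same_cov_cond X m X' m' e t v v' : gproc G X m -> gproc G X' m' -> same_cov X m X' m' ->
  kpath P X m (cL X m e t) = kpath P X' m' (cL X' m' e t) /\
  same_cov (cpath P X m e t v) (cmean P X m e t v) (cpath P X' m' e t v') (cmean P X' m' e t v').
Proof.
move=> gX gX' h.
have kE : kpath P X m (cL X m e t) = kpath P X' m' (cL X' m' e t).
  rewrite /kpath; apply: (congr1 (@mkpath R)); apply/funext => u; rewrite /kfun (h e t e t); apply: (congr1 (fun z => z / _)).
  have ev (Z : T -> path R) (n : path R) : (fun x => Z x u - n u) = cL Z n (1, 0) u.
    by apply/funext => x; rewrite /cL /Lf /= !mul1r !mul0r !addr0.
  by rewrite !ev h.
split; first exact: kE.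
move=> e1 t1 e2 t2.
have E1 := @cL_cond _ T R P X m e t v; have E2 := @cL_cond _ T R P X' m' e t v'.
apply: (etrans (congr2 (fun f g => ip P f g) (E1 e1 t1) (E1 e2 t2))).
apply: etrans (esym (congr2 (fun f g => ip P f g) (E2 e1 t1) (E2 e2 t2))).
apply: (etrans (ip_comb _ _ (cL_G cG gX e1 t1) (cL_G cG gX e t) (cL_G cG gX e2 t2) (cL_G cG gX e t))).
apply: etrans (esym (ip_comb _ _ (cL_G cG gX' e1 t1) (cL_G cG gX' e t) (cL_G cG gX' e2 t2) (cL_G cG gX' e t))).
by rewrite kE (h e1 t1 e2 t2) (h e1 t1 e t) (h e t e2 t2) (h e t e t).
Qed.

(** Conditioning acts on a path by a deterministic map that depends only on mean and covariances.
    The equation m = m' is a hypothesis because the recursion meets conditional means that are equal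
    only by proof. *)
Lemma chain_functional l v X X' m : gproc G X m -> gproc G X' m -> same_cov X m X' m ->
  forall m', m = m' ->
  exists Psi : path R -> path R, [/\ measurable_fun setT Psi,
    forall x, (chain P l v X m).1 x = Psi (X x),
    forall x, (chain P l v X' m').1 x = Psi (X' x) &
    chain_pdf P l v X m = chain_pdf P l v X' m'].
Proof.
elim: l v X X' m => [|c l IH] v X X' m gX gX' h _ <-; first by exists id.
have [kE hc] := same_cov_cond c.1 c.2 (head 0 v) (head 0 v) gX gX' h.
have mE : cmean P X m c.1 c.2 (head 0 v) = cmean P X' m c.1 c.2 (head 0 v).
  exact: (congr1 (fun k : path R => padd m (head 0 v - Lf c.1 m c.2) k) kE).
have g1 := gproc_cond cG gX c.1 c.2 (head 0 v); have g2 := gproc_cond cG gX' c.1 c.2 (head 0 v).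
rewrite -mE in g2 hc.
have [Psi [mPsi h1 h2 h3]] := IH (behead v) _ _ _ g1 g2 hc _ mE.
pose psi (w : path R) := padd w (head 0 v - Lf c.1 w c.2) (kpath P X m (cL X m c.1 c.2)).
exists (Psi \o psi); split.
- have md : measurable_fun setT (fun w : path R => head 0 v - Lf c.1 w c.2).
    by apply: measurable_funB; [exact: measurable_cst|exact: (measurable_Lf c.1 (measurable_cst c.2) (@measurable_id _ _ setT))].
  exact: (measurableT_comp mPsi (measurable_padd (@measurable_id _ _ setT) md (measurable_cst _))).
- by move=> x; rewrite /= h1.
- by move=> x; rewrite /= h2 /psi kE.
- apply: (congr2 (fun p q : R => p * q)); last exact: h3.
  exact: (congr1 (fun z => gauss_pdf (Num.sqrt z) _) (h c.1 c.2 c.1 c.2)).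
Qed.

Section shift.
Variable b : R.

Lemma pshift_derive (w : path R) : (pshift b w : R -> R)^`()%classic = (fun t => (w : R -> R)^`()%classic (t + b)) /\
  derive1n 2 (pshift b w) = (fun t => derive1n 2 w (t + b)).
Proof.
move: (pshiftE b w); move: (path_fun (pshift b w)) => f ->.
by have [_ d1 d2] := C2_shift b (path_C2 w); exact: (conj d1 d2).
Qed.

Lemma Lf_pshift e (w : path R) t : Lf e (pshift b w) t = Lf e w (t + b).
Proof. by rewrite /Lf (pshift_derive w).1 pshiftE. Qed.

Lemma cL_pshift X m e t : cL (fun x => pshift b (X x)) (pshift b m) e t = cL X m e (t + b).
Proof. by apply/funext => x; exact: (congr2 (fun p q : R => p - q) (Lf_pshift e (X x) t) (Lf_pshift e m t)). Qed.

Lemma gproc_pshift X m : gproc G X m -> gproc G (fun x => pshift b (X x)) (pshift b m).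
Proof.
move=> gX; split.
- exact: (measurableT_comp (measurable_pshift b) (gp_meas gX)).
- move=> t; have := gp_eval gX (t + b); congr G; apply/funext => x.
  exact: (congr2 (fun p q : R -> R => p t - q t) (esym (pshiftE b (X x))) (esym (pshiftE b m))).
- move=> t; have := gp_derive gX (t + b); congr G; apply/funext => x.
  exact: (congr2 (fun p q : R -> R => p t - q t) (esym (pshift_derive (X x)).1) (esym (pshift_derive m).1)).
- move=> t; have E : (fun x => derive1n 2 (X x) (t + b) - derive1n 2 m (t + b)) =
      (fun x => derive1n 2 (pshift b (X x)) t - derive1n 2 (pshift b m) t).
    apply/funext => x.
    exact: (congr2 (fun p q : R -> R => p t - q t) (esym (pshift_derive (X x)).2) (esym (pshift_derive m).2)).
  exact: (eq_ind _ G (gp_derive2 gX (t + b)) _ E).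
Qed.

Lemma pshift_padd (w k : path R) a : pshift b (padd w a k) = padd (pshift b w) a (pshift b k).
Proof.
apply: path_eqP; apply: (etrans (pshiftE b _)); apply: etrans (esym (paddE a (path_C2 (pshift b w)) (path_C2 (pshift b k)))).
apply/funext => t; apply: (etrans (congr1 (fun f : R -> R => f (t + b)) (paddE a (path_C2 w) (path_C2 k)))).
exact: (congr2 (fun f g : R -> R => f t + a * g t) (esym (pshiftE b w)) (esym (pshiftE b k))).
Qed.

Lemma kpath_pshift X m e t : gproc G X m ->
  kpath P (fun x => pshift b (X x)) (pshift b m) (cL (fun x => pshift b (X x)) (pshift b m) e t) =
  pshift b (kpath P X m (cL X m e (t + b))).
Proof.
move=> gX; have gX' := gproc_pshift gX; apply: path_eqP; rewrite cL_pshift.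
have sY := cg_sqint cG (cL_G cG gX e (t + b)).
apply: (etrans (kpathE cG gX' sY)); apply: etrans (esym (pshiftE b _)).
apply/funext => u; apply: etrans (esym (congr1 (fun f : R -> R => f (u + b)) (kpathE cG gX sY))).
apply: (congr1 (fun f => ip P f _ / _)); apply/funext => x.
exact: (congr2 (fun p q : R -> R => p u - q u) (pshiftE b (X x)) (pshiftE b m)).
Qed.

Lemma chain_pshift l v X m : gproc G X m ->
  (forall x, pshift b ((chain P [seq (c.1, c.2 + b) | c <- l] v X m).1 x) =
    (chain P l v (fun x => pshift b (X x)) (pshift b m)).1 x) /\
  chain_pdf P [seq (c.1, c.2 + b) | c <- l] v X m = chain_pdf P l v (fun x => pshift b (X x)) (pshift b m).
Proof.
elim: l v X m => [|c l IH] v X m gX; first by split.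
have g1 := gproc_cond cG gX c.1 (c.2 + b) (head 0 v).
have [h1 h2] := IH (behead v) _ _ g1.
have e1 : (fun x => pshift b (cpath P X m c.1 (c.2 + b) (head 0 v) x)) =
    cpath P (fun x => pshift b (X x)) (pshift b m) c.1 c.2 (head 0 v).
  by apply/funext => x; rewrite /cpath pshift_padd -(kpath_pshift c.1 c.2 gX) -(Lf_pshift c.1 (X x) c.2).
have e2 : pshift b (cmean P X m c.1 (c.2 + b) (head 0 v)) =
    cmean P (fun x => pshift b (X x)) (pshift b m) c.1 c.2 (head 0 v).
  by rewrite /cmean pshift_padd -(kpath_pshift c.1 c.2 gX) -(Lf_pshift c.1 m c.2).
split.
  move=> x; apply: (etrans (h1 x)); apply: etrans (esym (congr1 (fun z => z.1 x) (chain_cons c l v _ _))).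
  exact: (congr2 (fun Y n => (chain P l (behead v) Y n).1 x) e1 e2).
apply: (etrans (chain_pdf_cons (c.1, c.2 + b) [seq (c.1, c.2 + b) | c <- l] v X m)).
apply: etrans (esym (chain_pdf_cons c l v _ _)).
apply: (congr2 (fun p q : R => p * q)); last first.
  by apply: (etrans h2); exact: (congr2 (fun Y n => chain_pdf P l (behead v) Y n) e1 e2).
by rewrite /sd (cL_pshift X m c.1 c.2) (Lf_pshift c.1 m c.2).
Qed.

End shift.

Variables (X : T -> path R) (m : path R) (c0 : R) (gX : gproc G X m) (mE : m = (fun=> c0) :> (R -> R)).
Hypothesis statR : forall h (Psi : path R -> R), measurable_fun setT Psi ->
  \int[P]_x Psi (pshift h (X x)) = \int[P]_x Psi (X x).
Hypothesis statE : forall h (Phi : path R -> \bar R), measurable_fun setT Phi -> (forall w, 0 <= Phi w)%E ->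
  (\int[P]_x Phi (pshift h (X x)) = \int[P]_x Phi (X x))%E.

(** Conditioning at shifted places and shifting back is conditioning the shifted process, which by
    [chain_functional] applies to it the same map as to the original one; stationarity then acts on
    one fixed functional. *)
Lemma chain_stationary b l v (Phi : path R -> \bar R) : measurable_fun setT Phi -> (forall w, 0 <= Phi w)%E ->
  (\int[P]_x Phi (pshift b ((chain P [seq (c.1, (c.2 + b)%R) | c <- l] v X m).1 x)) =
   \int[P]_x Phi ((chain P l v X m).1 x))%E /\
  chain_pdf P [seq (c.1, c.2 + b) | c <- l] v X m = chain_pdf P l v X m.
Proof.
move=> mPhi Phi0; have [h1 h2] := chain_pshift b l v gX.
have mb : m = pshift b m.
  by apply: path_eqP; apply: etrans (esym (pshiftE b m)); apply/funext => t; rewrite mE.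
have gb := gproc_pshift b gX; rewrite -mb in gb.
have sc : same_cov X m (fun x => pshift b (X x)) m.
  move=> e t e' t'; have mP : measurable_fun setT (fun w : path R => (Lf e w t - Lf e m t) * (Lf e' w t' - Lf e' m t')).
    by apply: measurable_funM; apply: measurable_funB => //; exact: measurable_Lf.
  exact: (esym (statR b mP)).
have [Psi [mPsi p1 p2 p3]] := chain_functional l v gX gb sc mb.
split; last by rewrite h2 p3.
rewrite (eq_integral (fun x => (Phi \o Psi) (pshift b (X x)))); last by move=> x _; rewrite h1 p2.
rewrite (statE b (measurableT_comp mPhi mPsi)); last by move=> w; exact: Phi0.
by apply: eq_integral => x _; rewrite p1.
Qed.

End shifted_chain.


(** * Absence of tangential zeros *)

Section double_zeros.
Context d (T : measurableType d) (R : realType) (P : probability T R).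
Variables (G : set (T -> R)) (cG : cgauss P G) (X : T -> path R) (m : path R) (gX : gproc G X m).
Variable s2 : R.
Hypotheses (s20 : 0 < s2) (varE : forall t, ip P (cL X m (1, 0) t) (cL X m (1, 0) t) = s2).

Let Lf10 (w : path R) t : Lf (1, 0) w t = w t.
Proof. by rewrite /Lf /= mul1r mul0r addr0. Qed.

Let mX := gp_meas gX.

Let K := normal_peak (Num.sqrt s2).

Lemma small_ball t (e : R) : 0 < e -> (P [set x | (`|X x t| <= e)%R] <= (K * (2 * e))%:E)%E.
Proof.
move=> e0; have v0 : 0 < ip P (cL X m (1, 0) t) (cL X m (1, 0) t) by rewrite varE.
pose A : set (path R) := [set w : path R | `|w t| <= e].
have mA : measurable A.
  rewrite (_ : A = (fun w : path R => w t) @^-1` `[- e, e]).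
    by rewrite -[X in measurable X]setTI; apply: measurable_path_eval => //; exact: measurable_itv.
  by apply/seteqP; split => w; rewrite /A /= in_itv/= ler_norml.
have mPhi : measurable_fun setT (fun w : path R => (\1_A w : R)%:E).
  by apply/measurable_EFinP; exact: measurable_indic.
have -> : P [set x | (`|X x t| <= e)%R] = (\int[P]_x (\1_A (X x) : R)%:E)%E.
  have mB : measurable [set x | (`|X x t| <= e)%R].
    by rewrite (_ : mkset _ = X @^-1` A)// -[X in measurable X]setTI; exact: mX.
  transitivity (\int[P]_x (\1_[set x | (`|X x t| <= e)%R] x)%:E)%E; first by rewrite integral_indic// setIT.
  by apply: eq_integral => x _; rewrite !indicE.
rewrite (conditioning_formula cG gX v0 mPhi); last by move=> w; rewrite lee_fin.
apply: (@le_trans _ _ (\int[lebesgue_measure]_v (K * \1_(`[- e, e]%classic) v)%:E)%E).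
  apply: ge0_le_lower_integral => v.
    by rewrite mule_ge0// ?lee_fin ?gauss_pdf_ge0//; apply: integral_ge0 => x _; rewrite lee_fin.
  have E x : \1_A (cpath P X m (1, 0) t v x) = \1_(`[- e, e]%classic) v :> R.
    have h : cpath P X m (1, 0) t v x t = v.
      by rewrite -Lf10 Lf_cpath (Lf_kpath_diag cG gX v0) mulr1; ring.
    rewrite !indicE (_ : (_ \in A) = (v \in `[- e, e]%classic))//.
    by apply/idP/idP; rewrite !inE /A /= in_itv/= h ler_norml.
  under eq_integral do rewrite E.
  rewrite integral_cst// [X in (_ * X * _)%E](@probability_setT _ _ _ P) mule1 -EFinM lee_fin mulrC.
  rewrite ler_wpM2r// /K (_ : Num.sqrt s2 = sd P X m (1, 0) t); last by rewrite /sd varE.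
  have sn : sd P X m (1, 0) t != 0 by rewrite gt_eqF// sqrtr_gt0.
  by rewrite gauss_pdfE// normal_pdf_ub.
under eq_integral do rewrite EFinM.
rewrite ge0_integralZl ?lee_fin ?normal_peak_ge0//; last first.
  by apply/measurable_EFinP; apply: measurable_indic; exact: measurable_itv.
have -> : (\int[lebesgue_measure]_v (\1_(`[- e, e]%classic) v)%:E = (2 * e)%:E)%E.
  have mI : measurable (`[- e, e]%classic : set R) by exact: measurable_itv.
  rewrite integral_indic// setIT.
  apply: (etrans (lebesgue_measure_itv `[- e, e])).
  by rewrite /= lte_fin ifT; [rewrite -EFinB; congr (_%:E); ring|lra].
by rewrite -EFinM.
Qed.

Let taylor (w : path R) (k b t : R) : (forall u, 0 <= u <= 1 -> `|derive1n 2 w u| <= k) ->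
  0 <= b <= 1 -> 0 <= t <= 1 -> w b = 0 -> (w : R -> R)^`()%classic b = 0 -> `|w t| <= k * `|t - b| ^+ 2.
Proof.
move=> hk hb ht wb w'b; have [d1 d2 _] := C2_derive (path_C2 w).
have k0 : 0 <= k by exact: le_trans (normr_ge0 _) (hk b hb).
have mvt (f f' : R -> R) (t' : R) : (forall x : R, is_derive x (1:R) f (f' x)) -> f b = 0 ->
    0 <= t' <= 1 -> exists c, [/\ 0 <= c <= 1, `|c - b| <= `|t' - b| & f t' = f' c * (t' - b)].
  move=> df fb ht'; have cf x : {for x, continuous f}.
    by have [dx _] := df x; apply: differentiable_continuous; exact/derivable1_diffP.
  have [lt|gt|->] := ltgtP t' b.
  - have [c cab E] := @MVT R f f' t' b lt (fun u _ => df u) (continuous_subspaceT cf).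
    move: cab; rewrite in_itv/= => /andP[c1 c2]; exists c; split.
    + by move: ht' hb c1 c2; lra.
    + by rewrite !ler0_norm ?subr_le0 ?ltW//; move: c1; lra.
    + by move: E; rewrite fb sub0r => h; rewrite -[f t']opprK h; ring.
  - have [c cab E] := @MVT R f f' b t' gt (fun u _ => df u) (continuous_subspaceT cf).
    move: cab; rewrite in_itv/= => /andP[c1 c2]; exists c; split.
    + by move: ht' hb c1 c2; lra.
    + by rewrite !ger0_norm ?subr_ge0 ?ltW//; move: c2; lra.
    + by move: E; rewrite fb subr0.
  - by exists b; split => //; rewrite subrr mulr0 fb.
have [c [hc cb ->]] := mvt _ _ t d1 wb ht.
have [c2 [hc2 _ ->]] := mvt _ _ c d2 w'b hc.
rewrite !normrM expr2 mulrA ler_wpM2r// ler_pM// ; exact: hk.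
Qed.

(** If the second derivative is bounded by k+1 on [0, 1], a double zero b forces |X| <=
    (k+1)/(n+1)^2 at the grid point of mesh 1/(n+1) just left of b. There are n+2 such events, each
    of probability of order 1/n^2 because the density of X t is bounded, so their union has
    probability of order 1/n. *)
Lemma no_double_zeros : exists N' : set T, [/\ measurable N', P N' = 0%E &
  forall x, ~ N' x -> forall b, 0 <= b <= 1 -> X x b = 0 -> (X x : R -> R)^`()%classic b <> 0].
Proof.
pose h (n i : nat) : R := i%:R / n.+1%:R.
pose E (k n i : nat) := [set x | `|X x (h n i)| <= k.+1%:R / n.+1%:R ^+ 2].
pose B (k : nat) := \bigcap_n \big[setU/set0]_(i < n.+2) E k n i.
have mE k n i : measurable (E k n i).
  rewrite (_ : E k n i = (fun x => X x (h n i)) @^-1` `[- (k.+1%:R / n.+1%:R ^+ 2), k.+1%:R / n.+1%:R ^+ 2]).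
    by rewrite -[X in measurable X]setTI; apply: ((measurable_pathP _).1 mX) => //; exact: measurable_itv.
  by apply/seteqP; split => x; rewrite /E /= in_itv/= ler_norml.
have mU k n : measurable (\big[setU/set0]_(i < n.+2) E k n i) by exact: bigsetU_measurable.
have mB k : measurable (B k) by exact: bigcapT_measurable.
have PB k : P (B k) = 0%E.
  apply/eqP; rewrite eq_le measure_ge0 andbT; apply/lee_addgt0Pr => r r0; rewrite add0e.
  have bound n : (P (B k) <= (n.+2%:R * (K * (2 * (k.+1%:R / n.+1%:R ^+ 2))))%:E)%E.
    apply: (@le_trans _ _ (P (\big[setU/set0]_(i < n.+2) E k n i))).
      by apply: le_measure; rewrite ?inE// => x /(_ n I).
    apply: (le_trans (Boole_inequality P _)) => //.
    apply: (@le_trans _ _ (\sum_(i < n.+2) (K * (2 * (k.+1%:R / n.+1%:R ^+ 2)))%:E)%E).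
      by apply: lee_sum => i _; apply: small_ball; rewrite divr_gt0// ?exprn_gt0 ltr0n.
    by rewrite sumEFin sumr_const card_ord lee_fin [leRHS]mulr_natl.
  have K0 : 0 <= K by exact: normal_peak_ge0.
  (* Each event has probability at most 2 K (k+1)/(n+1)^2, and n+2 <= 2 (n+1) doubles the
     constant. *)
  pose n := Num.truncn (4 * K * k.+1%:R / r).
  apply: (le_trans (bound n)); rewrite lee_fin.
  have := truncnS_gt (4 * K * k.+1%:R / r); rewrite -/n ltr_pdivrMr// => hn.
  have n0 : 0 < n.+1%:R :> R by rewrite ltr0n.
  have n2 : n.+2%:R <= 2 * n.+1%:R :> R by rewrite -natrM ler_nat mul2n -addnn addSnnS leq_addl.
  rewrite (_ : _ * _ = n.+2%:R * (2 * K * k.+1%:R) / n.+1%:R ^+ 2); last by field; rewrite gt_eqF.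
  rewrite ler_pdivrMr ?exprn_gt0// expr2.
  have kk : 0 <= 2 * K * k.+1%:R by rewrite !mulr_ge0.
  apply: (le_trans (ler_wpM2r kk n2)); move: hn n0; move: (n.+1%:R : R) (k.+1%:R : R) => a b' hn a0.
  by rewrite [leRHS]mulrA [leRHS]mulrC [r * a]mulrC; have := ler_wpM2l (ltW a0) (ltW hn); lra.
exists (\bigcup_k B k); split.
- exact: bigcupT_measurable.
- apply/eqP; rewrite eq_le measure_ge0 andbT.
  apply: (le_trans (measure_sigma_subadditive P _ _ (@subset_refl _ _))) => //; first exact: bigcupT_measurable.
  by rewrite eseries0// => k _ _; exact: PB.
move=> x Nx b hb xb x'b; apply: Nx.
have [_ _ c2] := C2_continuous (path_C2 (X x)).
have [k0 hk0] : exists k : nat, forall u, 0 <= u <= 1 -> `|derive1n 2 (X x) u| <= k.+1%:R.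
  have [c _ hc] := @EVT_max R (fun u => `|derive1n 2 (X x) u|) 0 1 ler01
     (continuous_subspaceT (fun u => continuous_comp (c2 u) (@norm_continuous _ _ _))).
  exists (Num.truncn `|derive1n 2 (X x) c|) => u hu.
  by apply: (le_trans (hc u _)); rewrite ?in_itv//=; exact/ltW/truncnS_gt.
exists k0 => // n _; have n0 : 0 < n.+1%:R :> R by rewrite ltr0n.
pose i := Num.truncn (b * n.+1%:R).
have /andP[b0 b1] := hb.
have /andP[i1 i2] : i%:R <= b * n.+1%:R < i.+1%:R by apply: truncn_itv; rewrite mulr_ge0.
have ilt : (i < n.+2)%N.
  by rewrite ltnS -(ler_nat R) (le_trans i1)// ler_piMl// ltW.
rewrite -bigcup_mkord; exists i => //; rewrite /E /=.
have ih : h n i <= b by rewrite /h ler_pdivrMr.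
have hi : b < h n i + n.+1%:R^-1 by rewrite /h -[X in _ + X]mul1r -mulrDl ltr_pdivlMr// natr1.
have h0 : 0 <= h n i by rewrite divr_ge0.
have := taylor hk0 hb (t := h n i) _ xb x'b.
move=> /(_ _)/wrap[]; first by rewrite h0 (le_trans ih).
move/le_trans; apply; apply: ler_wpM2l => //.
rewrite -exprVn; apply: lerXn2r; rewrite ?nnegrE ?invr_ge0//.
by rewrite ler0_norm ?subr_le0// opprB lerBlDl ltW.
Qed.

End double_zeros.

(** * Rice's formula for three zeros *)

Section triple_rice.
Context d (T : measurableType d) (R : realType) (P : probability T R).
Notation mu := (@lebesgue_measure R).
Variables (G : set (T -> R)) (cG : cgauss P G).

Lemma gauss_pdfN (s y : R) : gauss_pdf s (- y) = gauss_pdf s y.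
Proof. by rewrite /gauss_pdf /normal_fun !subr0 sqrrN. Qed.

Let LfN (w : path R) t : Lf (0, -1) w t = - Lf (0, 1) w t.
Proof. by rewrite /Lf /= !mul0r !add0r mulN1r mul1r. Qed.

Let cLN (X : T -> path R) m t : cL X m (0, -1) t = (fun x => (-1) * cL X m (0, 1) t x).
Proof. by apply/funext => x; rewrite /cL (LfN (X x)) (LfN m); ring. Qed.

Let varN (X : T -> path R) m t : gproc G X m ->
  ip P (cL X m (0, -1) t) (cL X m (0, -1) t) = ip P (cL X m (0, 1) t) (cL X m (0, 1) t).
Proof.
move=> gX; have sY := cg_sqint cG (cL_G cG gX (0, 1) t).
by rewrite cLN ip_scalel ?ip_scaler//; [ring|exact: sqint_scale].
Qed.

(** Changing the sign of the observable changes that of its regression function as well, and the two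
    signs cancel when the prescribed value is 0. *)
Let cpathN (X : T -> path R) m t x : gproc G X m ->
  cpath P X m (0, -1) t 0 x = cpath P X m (0, 1) t 0 x.
Proof.
move=> gX; have sY := cg_sqint cG (cL_G cG gX (0, 1) t).
have sYN := cg_sqint cG (cL_G cG gX (0, -1) t).
apply: path_eqP; apply: (etrans (paddE (0 - Lf (0, -1) (X x) t) (path_C2 (X x)) (path_C2 (kpath P X m (cL X m (0, -1) t))))).
apply: etrans (esym (paddE (0 - Lf (0, 1) (X x) t) (path_C2 (X x)) (path_C2 (kpath P X m (cL X m (0, 1) t))))).
apply/funext => u.
suff h : (0 - Lf (0, -1) (X x) t) * kpath P X m (cL X m (0, -1) t) u = (0 - Lf (0, 1) (X x) t) * kpath P X m (cL X m (0, 1) t) u.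
  by exact: (congr1 (fun z => X x u + z) h).
have e1 := congr1 (fun f : R -> R => f u) (kpathE cG gX sYN).
have e2 := congr1 (fun f : R -> R => f u) (kpathE cG gX sY).
apply: (etrans (congr1 (fun z => (0 - Lf (0, -1) (X x) t) * z) e1)).
apply: (etrans _ (congr1 (fun z => (0 - Lf (0, 1) (X x) t) * z) (esym e2))).
have hv := varN t gX.
have hc : ip P (fun x => X x u - m u) (cL X m (0, -1) t) = -1 * ip P (fun x => X x u - m u) (cL X m (0, 1) t).
  apply: (etrans (congr1 (ip P _) (cLN X m t))).
  by apply: ip_scaler => //; exact: (cg_sqint cG (gp_eval gX u)).
rewrite /kfun hv hc (LfN (X x)).
by move: (ip _ _ _) (ip _ _ _) (Lf _ _ _) => *; ring.
Qed.

(** The support of F makes the indicator of [crosses] redundant, and the density moves under the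
    expectation, so that the integrand is again a functional of a conditioned path and the step can
    be iterated. *)
Lemma rice_step (X : T -> path R) m (e : R * R) (p q : R) (F : path R -> \bar R) : gproc G X m -> p <= q ->
  (forall u, p <= u <= q -> 0 < ip P (cL X m e u) (cL X m e u)) ->
  measurable_fun setT F -> (forall w, 0 <= F w)%E ->
  (forall w, F w != 0%E -> descending e p q w) -> (forall w, F w != 0%E -> crosses e p q w) ->
  (\int[P]_x F (X x) = \int[mu]_(t in `]p, q])
     (\int[P]_x (F (cpath P X m e t 0 x) *
        (Num.max (- Lf' e (cpath P X m e t 0 x) t) 0 * gauss_pdf (sd P X m e t) (0 - Lf e m t))%:E)))%E.
Proof.
move=> gX pq v0 mF F0 dF cF; have := strip_rice_formula cG gX mF F0 dF pq v0; rewrite /strip_rice => h.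
rewrite -[LHS](_ : (\int[P]_x (F (X x) * (\1_[set w : path R | crosses e p q w] (X x))%:E) = _)%E); last first.
  apply: eq_integral => x _; have [->|Fn] := eqVneq (F (X x)) 0%E; first by rewrite mul0e.
  by rewrite indicE mem_set ?mule1//; exact: cF.
rewrite h; apply: eq_integral => t _; rewrite /slid_density.
have mc := gp_meas (gproc_cond cG gX e t 0).
rewrite -ge0_integralZr ?lee_fin ?gauss_pdf_ge0//.
- apply: eq_integral => x _; rewrite [(_ * gauss_pdf _ _)%:E]EFinM [RHS]muleA sub0r gauss_pdfN.
  by [].
- apply: emeasurable_funM; first exact: (measurableT_comp mF mc).
  apply/measurable_EFinP; apply: measurable_maxr => //; apply: measurableT_comp => //.
  exact: (measurable_Lf' e (measurable_cst t) mc).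
- by move=> x _; rewrite mule_ge0// lee_fin le_max lexx orbT.
Qed.

Variables (X : T -> path R) (m : path R) (gX : gproc G X m).
Hypothesis nd : forall a b c, a != b -> b != c -> a != c -> nondeg P (five a b c) X m.

Definition conditioned5 (a b c y1 y2 : R) (x : T) : path R :=
  (chain P (five a b c) [:: 0; 0; 0; y1; y2] X m).1 x.
Definition density5 (a b c y1 y2 : R) : R := chain_pdf P (five a b c) [:: 0; 0; 0; y1; y2] X m.
(** Absolute Jacobian of (w b, w' a, w' c) with respect to (b, a, c), which is diagonal; the
    positive parts keep a downcrossing at b, a maximum at a and a minimum at c, the last being a
    downcrossing of - w'. *)
Definition jacobian (a b c : R) (w : path R) : R :=
  Num.max (- Lf' (1, 0) w b) 0 * Num.max (- Lf' (0, 1) w a) 0 * Num.max (- Lf' (0, -1) w c) 0.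

(** The slope factor of each step enters the functional of the next one, so all three slopes end up
    evaluated along the fully conditioned path. Separation of the strips keeps a, b, c distinct,
    which is what nondegeneracy requires at each step. *)
Lemma triple_rice pa qa pb qb pc qc (F : path R -> \bar R) :
  pa <= qa -> qa < pb -> pb <= qb -> qb < pc -> pc <= qc ->
  measurable_fun setT F -> (forall w, 0 <= F w)%E ->
  (forall w, F w != 0%E -> [/\ descending (1, 0) pb qb w, descending (0, 1) pa qa w & descending (0, -1) pc qc w]) ->
  (forall w, F w != 0%E -> [/\ crosses (1, 0) pb qb w, crosses (0, 1) pa qa w & crosses (0, -1) pc qc w]) ->
  (\int[P]_x F (X x) = \int[mu]_(b in `]pb, qb]) \int[mu]_(a in `]pa, qa]) \int[mu]_(c in `]pc, qc])
    \int[mu]_y1 \int[mu]_y2 (\int[P]_x (F (conditioned5 a b c y1 y2 x) *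
       (jacobian a b c (conditioned5 a b c y1 y2 x))%:E) * (density5 a b c y1 y2)%:E))%E.
Proof.
move=> h1 h2 h3 h4 h5 mF F0 dF cF.
have nz (F' : path R -> \bar R) (k : R) w : (F' w * k%:E != 0)%E -> F' w != 0%E.
  by apply: contra_neq => ->; rewrite mul0e.
have mJ (F' : path R -> \bar R) e t (g : R) : measurable_fun setT F' ->
    measurable_fun setT (fun w : path R => F' w * (Num.max (- Lf' e w t) 0 * g)%:E)%E.
  move=> mF'; apply: emeasurable_funM => //; apply/measurable_EFinP; apply: measurable_funM => //.
  apply: measurable_maxr => //; apply: measurableT_comp => //.
  exact: (measurable_Lf' e (measurable_cst t) (@measurable_id _ _ setT)).
have J0 (F' : path R -> \bar R) e t s y : (forall w, 0 <= F' w)%E ->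
    forall w : path R, (0 <= F' w * (Num.max (- Lf' e w t) 0 * gauss_pdf s y)%:E)%E.
  by move=> F'0 w; rewrite mule_ge0// lee_fin mulr_ge0 ?gauss_pdf_ge0// le_max lexx orbT.
have v1 b : 0 < ip P (cL X m (1, 0) b) (cL X m (1, 0) b).
  have := @nd (b - 1) b (b + 1); rewrite !lt_eqF; try by lra.
  by move=> /(_ isT isT isT) /(nondeg_cons 0)[].
rewrite (rice_step gX h3 (fun u _ => v1 u) mF F0); [|by move=> w /dF[]|by move=> w /cF[]].
apply: eq_integral => b; rewrite inE/= in_itv/= => /andP[b1 b2].
have ne a c : pa <= a <= qa -> pc <= c <= qc -> nondeg P (five a b c) X m.
  move=> /andP[_ a2] /andP[c1 _]; apply: nd; rewrite lt_eqF//.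
  - exact: le_lt_trans a2 (lt_trans h2 b1).
  - exact: le_lt_trans b2 (lt_le_trans h4 c1).
  - exact: lt_trans (le_lt_trans a2 (lt_trans h2 b1)) (le_lt_trans b2 (lt_le_trans h4 c1)).
have g1 := gproc_cond cG gX (1, 0) b 0; set X1 := cpath P X m (1, 0) b 0 in g1 *; set m1 := cmean P X m (1, 0) b 0 in g1 *.
set F1 := fun w : path R => (F w * (Num.max (- Lf' (1, 0) w b) 0 * gauss_pdf (sd P X m (1, 0) b) (0 - Lf (1, 0) m b))%:E)%E.
rewrite -[LHS]/(\int[P]_x F1 (X1 x))%E.
have mF1 : measurable_fun setT F1 := mJ _ _ _ _ mF.
have F10 : forall w, (0 <= F1 w)%E := J0 _ _ _ _ _ F0.
rewrite (rice_step (e := (0, 1)) g1 h1 _ mF1 F10); [|move=> a ha|by move=> w /(nz F _ _)/dF[]|by move=> w /(nz F _ _)/cF[]]; last first.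
  have := ne a pc ha; rewrite lexx h5 => /(_ isT) n0; have [_ n1] := nondeg_cons 0 n0.
  by have [] := nondeg_cons 0 n1.
apply: eq_integral => a; rewrite inE/= in_itv/= => /andP[a1 a2].
have ha : pa <= a <= qa by rewrite (ltW a1).
have g2 := gproc_cond cG g1 (0, 1) a 0; set X2 := cpath P X1 m1 (0, 1) a 0 in g2 *; set m2 := cmean P X1 m1 (0, 1) a 0 in g2 *.
set F2 := fun w : path R => (F1 w * (Num.max (- Lf' (0, 1) w a) 0 * gauss_pdf (sd P X1 m1 (0, 1) a) (0 - Lf (0, 1) m1 a))%:E)%E.
rewrite -[LHS]/(\int[P]_x F2 (X2 x))%E.
have mF2 : measurable_fun setT F2 := mJ _ _ _ _ mF1.
have F20 : forall w, (0 <= F2 w)%E := J0 _ _ _ _ _ F10.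
have nd3 c : pc <= c <= qc -> nondeg P [:: ((0, 1), c); ((1, 0), a); ((1, 0), c)] X2 m2.
  move=> hc; have [_ n1] := nondeg_cons 0 (ne a c ha hc).
  by have [_ n2] := nondeg_cons 0 n1.
rewrite (rice_step (e := (0, -1)) g2 h5 _ mF2 F20); [|move=> c hc|by move=> w /(nz F1 _ _)/(nz F _ _)/dF[]|by move=> w /(nz F1 _ _)/(nz F _ _)/cF[]]; last first.
  by rewrite varN//; have [] := nondeg_cons 0 (nd3 c hc).
apply: eq_integral => c; rewrite inE/= in_itv/= => /andP[c1 c2].
have hc : pc <= c <= qc by rewrite (ltW c1).
(* Rice's formula was applied to - w' at c, whereas the chain of [five] conditions on w'. *)
under eq_integral do rewrite (cpathN _ _ g2).
have g3 := gproc_cond cG g2 (0, 1) c 0; set X3 := cpath P X2 m2 (0, 1) c 0 in g3 *; set m3 := cmean P X2 m2 (0, 1) c 0 in g3 *.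
have sdN : gauss_pdf (sd P X2 m2 (0, -1) c) (0 - Lf (0, -1) m2 c) = gauss_pdf (sd P X2 m2 (0, 1) c) (0 - Lf (0, 1) m2 c).
  by rewrite /sd varN// (LfN m2) sub0r opprK sub0r gauss_pdfN.
rewrite sdN.
set F3 := fun w : path R => (F2 w * (Num.max (- Lf' (0, -1) w c) 0 * gauss_pdf (sd P X2 m2 (0, 1) c) (0 - Lf (0, 1) m2 c))%:E)%E.
rewrite -[LHS]/(\int[P]_x F3 (X3 x))%E.
have mF3 : measurable_fun setT F3 := mJ _ _ _ _ mF2.
have F30 : forall w, (0 <= F3 w)%E := J0 _ _ _ _ _ F20.
have [_ nd4] := nondeg_cons 0 (nd3 c hc); rewrite -/X3 -/m3 in nd4.
have [v4 _] := nondeg_cons 0 nd4.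
rewrite (conditioning_formula cG g3 v4 mF3 F30); apply: eq_integral => y1 _.
have [_ nd5] := nondeg_cons y1 nd4.
have g4 := gproc_cond cG g3 (1, 0) a y1; rewrite /= in nd5; set X4 := cpath P X3 m3 (1, 0) a y1 in g4 nd5 *; set m4 := cmean P X3 m3 (1, 0) a y1 in g4 nd5 *.
have [v5 _] := nondeg_cons 0 nd5.
have mF3X : measurable_fun setT (fun x => F3 (X4 x)) := measurableT_comp mF3 (gp_meas g4).
set ga := gauss_pdf (sd P X3 m3 (1, 0) a) (y1 - Lf (1, 0) m3 a).
have ga0 : 0 <= ga by exact: gauss_pdf_ge0.
apply: (etrans (esym (ge0_integralZr P measurableT mF3X (fun x _ => F30 (X4 x)) (_ : (0 <= ga%:E)%E)))); first by rewrite lee_fin.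
pose F4 (w : path R) := (F3 w * ga%:E)%E.
have mF4 : measurable_fun setT F4 := emeasurable_funM mF3 (measurable_cst ga%:E).
have F40 w : (0 <= F4 w)%E by apply: mule_ge0; [exact: F30|rewrite lee_fin].
rewrite -[LHS]/(\int[P]_x F4 (X4 x))%E.
rewrite (conditioning_formula cG g4 v5 mF4 F40); apply: eq_integral => y2 _.
have g5 := gproc_cond cG g4 (1, 0) c y2.
rewrite -[cpath P X4 m4 (1, 0) c y2]/(conditioned5 a b c y1 y2).
have D0 : 0 <= density5 a b c y1 y2 by exact: chain_pdf_ge0.
have mc5 : measurable_fun setT (conditioned5 a b c y1 y2) := gp_meas g5.
have mF4c : measurable_fun setT (fun x => F4 (conditioned5 a b c y1 y2 x)) := measurableT_comp mF4 mc5.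
apply: (etrans (esym (ge0_integralZr P measurableT mF4c (fun x _ => F40 (conditioned5 a b c y1 y2 x)) (_ : (0 <= (gauss_pdf (sd P X4 m4 (1, 0) c) (y2 - Lf (1, 0) m4 c))%:E)%E)))).
  by rewrite lee_fin gauss_pdf_ge0.
have mJc : measurable_fun setT (fun x => F (conditioned5 a b c y1 y2 x) * (jacobian a b c (conditioned5 a b c y1 y2 x))%:E)%E.
  apply: (emeasurable_funM (measurableT_comp mF mc5)).
  have mx e t : measurable_fun setT (fun x => Num.max (- Lf' e (conditioned5 a b c y1 y2 x) t) 0).
    apply: measurable_maxr => //; apply: measurableT_comp => //.
    exact: (measurable_Lf' e (measurable_cst t) mc5).
  apply/measurable_EFinP.
  exact: (measurable_funM (measurable_funM (mx (1, 0) b) (mx (0, 1) a)) (mx (0, -1) c)).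
have Jc0 x : (0 <= F (conditioned5 a b c y1 y2 x) * (jacobian a b c (conditioned5 a b c y1 y2 x))%:E)%E.
  by apply: mule_ge0 => //; rewrite lee_fin /jacobian !mulr_ge0// le_max lexx orbT.
apply: (etrans _ (ge0_integralZr P measurableT mJc (fun x _ => Jc0 x) (_ : (0 <= (density5 a b c y1 y2)%:E)%E))); last by rewrite lee_fin.
apply: eq_integral => x _; rewrite /F4 /F3 /F2 /F1 /jacobian -!muleA -!EFinM; congr (_ * _%:E)%E.
have -> : density5 a b c y1 y2 = gauss_pdf (sd P X m (1, 0) b) (0 - Lf (1, 0) m b) *
  (gauss_pdf (sd P X1 m1 (0, 1) a) (0 - Lf (0, 1) m1 a) * (gauss_pdf (sd P X2 m2 (0, 1) c) (0 - Lf (0, 1) m2 c) *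
  (ga * (gauss_pdf (sd P X4 m4 (1, 0) c) (y2 - Lf (1, 0) m4 c) * 1)))) by [].
have alg (x1 g1' x2 g2' x3 g3' g4' g5' : R) : x1 * g1' * (x2 * g2' * (x3 * g3' * (g4' * g5'))) =
  x1 * x2 * x3 * (g1' * (g2' * (g3' * (g4' * (g5' * 1))))) by ring.
exact: (alg _ _ _ _ _ _ _ _).
Qed.

End triple_rice.

(** * Isolation and counting of marked triples by rational strips *)

Section counting.
Variables (R : realType) (Z : choiceType).

(** Several indices may designate the same point; keeping only the first of them gives a bijection
    with [S]. *)
Lemma counting_first_hits (A : set nat) (z : nat -> Z) (S : set Z) :
  (forall x, S x -> exists2 j, A j & z j = x) ->
  counting S = (\sum_(0 <= j <oo)
    (\1_[set j | [/\ A j, S (z j) & forall i, (i < j)%N -> A i -> z i <> z j]] j : R)%:E)%E.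
Proof.
move=> hS; set J : set nat := [set j | _].
have SE : S = z @` J.
  apply/seteqP; split=> [x Sx|_ [j [_ Sj _] <-]//].
  have [j Aj zj] := hS x Sx.
  have ex : exists j, `[< A j /\ z j = x >] by exists j; exact/asboolP.
  case: (ex_minnP ex) => k /asboolP[Ak zk] kmin; exists k => //; split=> //; first by rewrite zk.
  move=> i ik Ai zik; have : (k <= i)%N by apply: kmin; apply/asboolP; rewrite zik.
  by rewrite leqNgt ik.
have inj : {in J &, injective z}.
  move=> i j; rewrite !inE => -[Ai _ hi] [Aj _ hj] zij; have [ij|ji|//] := ltngtP i j.
    by case: (hj _ ij Ai).
  by case: (hi _ ji Aj).
have e := inj_card_eq inj.
transitivity (counting J : \bar R).
  rewrite SE /counting (eq_finite_set e); case: ifPn => // /asboolP /finite_setP[n Jn].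
  by rewrite (card_fset_set Jn) (card_fset_set (card_eq_trans e Jn)).
by rewrite counting_dirac; apply: eq_eseriesr => j _; rewrite diracE indicE.
Qed.

End counting.

Section dense_bounds.
Variable R : realType.

(** The projection onto [0, 1] in closed form: it maps the enumeration of the rationals continuously
    to a sequence dense in [0, 1], and then in any segment. *)
Definition unit_clamp (x : R) : R := (1 + `|x| - `|x - 1|) / 2.

Lemma unit_clamp_ge0_le1 x : 0 <= unit_clamp x <= 1.
Proof.
rewrite /unit_clamp; have [h|h] := leP 0 x; have [h'|h'] := leP 0 (x - 1);
  rewrite ?(ger0_norm h) ?(ltr0_norm h) ?(ger0_norm h') ?(ltr0_norm h'); apply/andP; split; move: h h'; lra.
Qed.

Lemma unit_clamp_id x : 0 <= x <= 1 -> unit_clamp x = x.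
Proof.
move=> /andP[h h']; rewrite /unit_clamp (ger0_norm h) ler0_norm ?subr_le0//; by field.
Qed.

Lemma le_segment_dense (f : R -> R) p q k : continuous f -> p <= q ->
  (forall n : nat, f (p + unit_clamp (ratr (odflt 0 (unpickle n : option rat))) * (q - p)) <= k) ->
  forall t, p <= t <= q -> f t <= k.
Proof.
move=> cf pq h t /andP[pt tq]; rewrite leNgt; apply/negP => kt.
pose g (x : R) := f (p + unit_clamp x * (q - p)).
have cg : continuous g.
  move=> x; apply: (@continuous_comp _ _ _ (fun x : R => p + unit_clamp x * (q - p)) f); last exact: cf.
  apply: cvgD; [exact: cvg_cst|apply: cvgM; [|exact: cvg_cst]]; apply: cvgM; [|exact: cvg_cst].
  apply: cvgB; [apply: cvgD; [exact: cvg_cst|apply: cvg_norm; exact: cvg_id]|].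
  by apply: cvg_norm; apply: cvgB; [exact: cvg_id|exact: cvg_cst].
have oO : open (g @^-1` [set u | k < u]).
  by apply: open_comp; [move=> x _; exact: cg|exact: open_gt].
have [|x [hg [r _ rx]]] := @dense_rat R _ _ oO.
  have [eqpq|/eqP npq] := eqVneq p q.
    by exists 0; rewrite /g /= -eqpq subrr mulr0 addr0 (_ : p = t)//; apply/eqP; rewrite eq_le pt eqpq.
  have qp0 : 0 < q - p by rewrite subr_gt0 lt_neqAle pq andbT; apply/eqP.
  exists ((t - p) / (q - p)); rewrite /g /= unit_clamp_id ?divfK ?gt_eqF// ?subrKC//.
  by rewrite divr_ge0 ?subr_ge0//= ler_pdivrMr// mul1r lerD2r.
have hx : k < g x := hg.
by have := h (pickle r); rewrite pickleK/= rx leNgt => /negP; apply.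
Qed.

Lemma measurable_set_ler d (S : measurableType d) (f g : S -> R) : measurable_fun setT f -> measurable_fun setT g ->
  measurable [set s | f s <= g s].
Proof.
move=> mf mg; rewrite (_ : [set s | _] = (fun s => f s - g s) @^-1` `]-oo, 0]).
  by rewrite -[X in measurable X]setTI; apply: measurable_funB => //; exact: measurable_itv.
by apply/seteqP; split => s /=; rewrite in_itv/= subr_le0.
Qed.

Lemma measurable_set_ltr d (S : measurableType d) (f g : S -> R) : measurable_fun setT f -> measurable_fun setT g ->
  measurable [set s | f s < g s].
Proof.
move=> mf mg; rewrite (_ : [set s | _] = (fun s => f s - g s) @^-1` `]-oo, 0[).
  by rewrite -[X in measurable X]setTI; apply: measurable_funB => //; exact: measurable_itv.
by apply/seteqP; split => s /=; rewrite in_itv/= subr_lt0.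
Qed.

Lemma measurable_set_eqr d (S : measurableType d) (f g : S -> R) : measurable_fun setT f -> measurable_fun setT g ->
  measurable [set s | f s = g s].
Proof.
move=> mf mg; rewrite (_ : [set s | _] = [set s | f s <= g s] `&` [set s | g s <= f s]).
  by apply: measurableI; exact: measurable_set_ler.
by apply/seteqP; split => s /=; [move=> ->|case=> h1 h2; apply/eqP; rewrite eq_le h1].
Qed.

Lemma measurable_Lf'_le d (S : measurableType d) (e : R * R) (w : S -> path R) (p q : S -> R) (k : R) :
  measurable_fun setT w -> measurable_fun setT p -> measurable_fun setT q ->
  measurable [set s | p s <= q s /\ forall t, p s <= t <= q s -> Lf' e (w s) t <= k].
Proof.
move=> mw mp mq; pose th n : R := unit_clamp (ratr (odflt 0 (unpickle n : option rat))).
rewrite (_ : [set s | _] = [set s | p s <= q s] `&`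
    \bigcap_n [set s | Lf' e (w s) (p s + th n * (q s - p s)) <= k]).
  apply: measurableI; first exact: measurable_set_ler.
  apply: bigcapT_measurable => n; apply: measurable_set_ler; last exact: measurable_cst.
  apply: measurable_Lf' => //; apply: measurable_funD => //; apply: measurable_funM => //.
  exact: measurable_funB.
apply/seteqP; split=> s /= [pq h]; split=> //.
  move=> n _; apply: h; have /andP[t0 t1] := unit_clamp_ge0_le1 (ratr (odflt 0 (unpickle n : option rat))).
  rewrite -/(th n) in t0 t1; have d0 : 0 <= q s - p s by rewrite subr_ge0.
  by have := mulr_ge0 t0 d0; have := ler_wpM2r d0 t1; rewrite mul1r; move: (th n * _) => y h1 h2; apply/andP; split; lra.
by apply: (le_segment_dense (Lf'_continuous (path_C2 (w s))) pq) => n; exact: h.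
Qed.

End dense_bounds.

Section strips.
Variable R : realType.
Notation mu := (@lebesgue_measure R).
Implicit Types (e : R * R) (w : path R) (p q t : R).

(** The zero is p plus the length of the set where the observable is positive, a formula measurable
    in the path by Tonelli and meaningful for every path. *)
Definition strip_zero e p q w : R :=
  p + fine (\int[mu]_u (\1_[set u | p <= u <= q /\ 0 < Lf e w u] u : R)%:E)%E.

Definition strip_adm e p q w := descending e p q w /\ crosses e p q w.

Lemma strip_zeroE e p q w t : descending e p q w -> p <= t <= q -> Lf e w t = 0 -> strip_zero e p q w = t.
Proof.
move=> dw /andP[pt tq] wt; rewrite /strip_zero.
rewrite (_ : [set u | _] = `[p, t[%classic); last first.
  apply/seteqP; split=> u /=; rewrite in_itv/=.
    move=> [/andP[pu uq] u0]; rewrite pu/= ltNge; apply/negP; rewrite le_eqVlt => /orP[/eqP tu|tu].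
      by move: u0; rewrite -tu wt ltxx.
    by have := descending_lt dw pt tu uq; rewrite wt => /(lt_trans u0); rewrite ltxx.
  move=> /andP[pu ut]; rewrite pu (ltW (lt_le_trans ut tq)); split=> //.
  by rewrite -wt; exact: (descending_lt dw pu ut tq).
have mI : measurable (`[p, t[%classic : set R) by exact: measurable_itv.
rewrite integral_indic// setIT.
suff mE : lebesgue_measure (`[p, t[%classic : set R) = (t - p)%:E.
  by apply: (etrans (congr1 (fun x => p + fine x) mE)); rewrite /= subrKC.
apply: (etrans (lebesgue_measure_itv `[p, t[)); rewrite /= lte_fin; case: ltP => // h.
by rewrite (_ : t = p) ?subrr//; apply/eqP; rewrite eq_le h pt.
Qed.

Lemma measurable_strip_zero e p q : measurable_fun setT (strip_zero e p q : path R -> R).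
Proof.
apply: measurable_funD => //; apply: (measurableT_comp (@fine_measurable R _ measurableT)) => //.
pose f (z : path R * R) : \bar R := (\1_[set z : path R * R | p <= z.2 <= q /\ 0 < Lf e z.1 z.2] z : R)%:E.
have mf : measurable_fun setT f.
  apply/measurable_EFinP; apply: measurable_indic.
  have m2 : measurable_fun setT (fun z : path R * R => z.2) by exact: measurable_snd.
  have mL : measurable_fun setT (fun z : path R * R => Lf e z.1 z.2) by apply: measurable_Lf => //; exact: measurable_fst.
  rewrite (_ : [set z | _] = [set z : path R * R | p <= z.2] `&` [set z : path R * R | z.2 <= q] `&` [set z : path R * R | 0 < Lf e z.1 z.2]).
    apply: measurableI; last exact: (@measurable_set_ltr _ _ _ (fun=> 0) (fun z : path R * R => Lf e z.1 z.2) (measurable_cst (0 : R)) mL).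
    apply: measurableI; first exact: (measurable_set_ler (measurable_cst p) m2).
    exact: (measurable_set_ler m2 (measurable_cst q)).
  by apply/seteqP; split => z /=; [move=> [/andP[h1 h2] h3]|move=> [[h1 h2] h3]]; split=> //; rewrite h1.
have := measurable_lebesgue_integral mf (fun z => _); move=> /(_ _)/wrap[]; first by move=> z; rewrite lee_fin.
apply: eq_measurable_fun => w _; apply: eq_integral => u _.
by rewrite /f !indicE; congr ((nat_of_bool _)%:R%:E); apply/idP/idP; rewrite !inE.
Qed.

Lemma strip_adm_zero e p q w : p <= q -> strip_adm e p q w -> exists2 t, p < t <= q & Lf e w t = 0.
Proof.
move=> pq [_ [h1 h2]]; have cw := Lf_continuous (e := e) (path_C2 w).
have [||t] := @IVT R (Lf e w) p q 0 pq; first exact: continuous_subspaceT.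
  by rewrite ge_min h2 orbT le_max ltW.
rewrite in_itv/= => /andP[pt tq] t0; exists t => //; rewrite tq andbT lt_neqAle pt andbT.
by apply/eqP => pE; move: h1; rewrite pE t0 ltxx.
Qed.

(** On a compact strip a negative continuous derivative is at most - 1/(n+1) for some n, which
    reduces strict descent to countably many weak bounds. *)
Lemma measurable_strip_adm e p q : p <= q -> measurable [set w | strip_adm e p q w].
Proof.
move=> pq; rewrite (_ : [set w | _] = (\bigcup_n [set w : path R | p <= q /\ forall t, p <= t <= q -> Lf' e w t <= - n.+1%:R^-1])
    `&` [set w | crosses e p q w]).
  apply: measurableI; last exact: measurable_crosses.
  apply: bigcupT_measurable => n.
  exact: (measurable_Lf'_le e _ (@measurable_id _ _ setT) (measurable_cst p) (measurable_cst q)).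
apply/seteqP; split => w /= [h1 h2]; split=> //.
  have [c pcq hc] := EVT_max pq (continuous_subspaceT (Lf'_continuous (e := e) (path_C2 w))).
  have c0 : Lf' e w c < 0 by apply: h1; move: pcq; rewrite in_itv.
  exists (Num.truncn (- Lf' e w c)^-1) => //; split=> // t tpq.
  apply: (le_trans (hc t _)); first by rewrite in_itv.
  have cN : 0 < - Lf' e w c by rewrite oppr_gt0.
  rewrite lerNr; apply: ltW; rewrite invf_plt ?posrE ?ltr0n//; exact: truncnS_gt.
case: h1 => n _ [_ h] t tpq; apply: (le_lt_trans (h t tpq)).
by rewrite oppr_lt0 invr_gt0 ltr0n.
Qed.

Lemma strip_exists e w t (l r : R) : Lf e w t = 0 -> Lf' e w t < 0 -> l < t < r ->
  exists p q : rat, [/\ l < ratr p, ratr p < t, t < ratr q, ratr q < r & strip_adm e (ratr p) (ratr q) w].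
Proof.
move=> w0 w'0 /andP[lt tr].
have : \forall u \near t, Lf' e w u < 0.
  have hN : 0 < - Lf' e w t by rewrite oppr_gt0.
  have cL : Lf' e w u @[u --> t] --> Lf' e w t := @Lf'_continuous R e w (path_C2 w) t.
  move/cvgrPdist_lt : cL => /(_ _ hN); apply: filterS => u; rewrite ltr_norml => /andP[h1 h2].
  by move: (Lf' e w t) (Lf' e w u) h1 h2 => x y h1 h2; lra.
move=> /nbhs_ballP[k /= k0 hk].
have lt1 : Num.max l (t - k) < t by rewrite gt_max lt/= ltrBlDr ltrDl.
have lt2 : t < Num.min r (t + k) by rewrite lt_min tr/= ltrDl.
have [p] := rat_in_itvoo lt1.
rewrite in_itv/= gt_max => /andP[/andP[lp tkp] pt].
have [q] := rat_in_itvoo lt2.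
rewrite in_itv/= lt_min => /andP[tq /andP[qr qtk]].
exists p, q; split=> //.
have dw : descending e (ratr p) (ratr q) w.
  move=> u /andP[pu uq]; apply: hk; rewrite /ball/= ltr_distlC; apply/andP; split.
    exact: lt_le_trans tkp pu.
  exact: le_lt_trans uq qtk.
split=> //; split.
  by rewrite -w0; apply: (descending_lt dw _ pt (ltW tq)).
by rewrite -w0 ltW//; apply: (descending_lt dw (ltW pt) tq).
Qed.

End strips.


Section marked_points.
Variable R : realType.
Implicit Types (w : path R) (x : R * R * R) (r s u v : R).

Lemma LfE (w : R -> R) t : (Lf (1, 0) w t = w t) * (Lf (0, 1) w t = w^`()%classic t) *
  (Lf (0, -1) w t = - w^`()%classic t) * (Lf' (1, 0) w t = w^`()%classic t) *
  (Lf' (0, 1) w t = derive1n 2 w t) * (Lf' (0, -1) w t = - derive1n 2 w t).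
Proof. by rewrite /Lf /Lf' /= !mul0r !mul1r !mulN1r !addr0 !add0r. Qed.

Lemma measurable_nonincreasing d (S : measurableType d) (w : S -> path R) (t1 t2 t3 : S -> R) :
  measurable_fun setT w -> measurable_fun setT t1 -> measurable_fun setT t2 -> measurable_fun setT t3 ->
  measurable [set z | nonincreasing_on_Gamma (w z) (t1 z, t2 z, t3 z)].
Proof.
move=> mw m1 m2 m3; have ma := measurable_funB m1 m2; have mc := measurable_funD m1 m3.
rewrite (_ : [set z | _] = [set z | t1 z - t2 z <= t1 z + t3 z /\
    forall t, t1 z - t2 z <= t <= t1 z + t3 z -> Lf' (1, 0) (w z) t <= 0] `|` [set z | t1 z + t3 z < t1 z - t2 z]).
  apply: measurableU; first exact: (measurable_Lf'_le (1, 0) 0 mw ma mc).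
  exact: (measurable_set_ltr mc ma).
apply/seteqP; split => z /=.
  move=> h; have [le|lt] := leP (t1 z - t2 z) (t1 z + t3 z); last by right.
  by left; split=> // t ht; rewrite LfE; exact: h.
move=> [[_ h]|lt] t /= ht; first by have := h t ht; rewrite LfE.
by have /andP[h1 h2] := ht; have := le_trans h1 h2; rewrite leNgt lt.
Qed.

Lemma measurable_alpha d (S : measurableType d) (w : S -> path R) (t1 t2 t3 : S -> R) :
  measurable_fun setT w -> measurable_fun setT t1 -> measurable_fun setT t2 -> measurable_fun setT t3 ->
  measurable_fun setT (fun z => alpha (w z) (t1 z, t2 z, t3 z)).
Proof.
move=> mw m1 m2 m3; have ma := measurable_funB m1 m2; have mc := measurable_funD m1 m3.
have E : (fun z => alpha (w z) (t1 z, t2 z, t3 z)) = (fun z => Num.max (- Lf' (1, 0) (w z) (t1 z)) 0 *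
    Num.max (- Lf' (0, 1) (w z) (t1 z - t2 z)) 0 * Num.max (Lf' (0, 1) (w z) (t1 z + t3 z)) 0 *
    \1_[set z | nonincreasing_on_Gamma (w z) (t1 z, t2 z, t3 z)] z).
  apply/funext => z.
  have e : ((w z : R -> R) \in [set w' : R -> R | nonincreasing_on_Gamma w' (t1 z, t2 z, t3 z)]) =
    (z \in [set z | nonincreasing_on_Gamma (w z) (t1 z, t2 z, t3 z)]) by apply/idP/idP; rewrite !inE.
  by rewrite !LfE /alpha /neg_part /pos_part !indicE e.
rewrite E; apply: measurable_funM; last by apply: measurable_indic; exact: measurable_nonincreasing.
have mp (f : S -> R) : measurable_fun setT f -> measurable_fun setT (fun z => Num.max (f z) 0).
  by move=> mf; exact: measurable_maxr.
have mN (f : S -> R) : measurable_fun setT f -> measurable_fun setT (fun z => - f z).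
  by move=> mf; exact: measurableT_comp.
apply: measurable_funM; [apply: measurable_funM|]; apply: mp; [apply: mN|apply: mN|].
- exact: (measurable_Lf' (1, 0) m1 mw).
- exact: (measurable_Lf' (0, 1) ma mw).
- exact: (measurable_Lf' (0, 1) mc mw).
Qed.

Lemma alpha_ge0 (w : R -> R) x : 0 <= alpha w x.
Proof. by case: x => [[x1 x2] x3]; rewrite /alpha !mulr_ge0// ?indicE// /neg_part /pos_part le_max lexx orbT. Qed.

Lemma measurable_marked d (S : measurableType d) (w : S -> path R) (t1 t2 t3 : S -> R) r s u v :
  measurable_fun setT w -> measurable_fun setT t1 -> measurable_fun setT t2 -> measurable_fun setT t3 ->
  measurable [set z | marked_downcrossings r s u v (w z) (t1 z, t2 z, t3 z)].
Proof.
move=> mw m1 m2 m3; have ma := measurable_funB m1 m2; have mc := measurable_funD m1 m3.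
pose a z := t1 z - t2 z; pose c z := t1 z + t3 z; have mk (k : R) := @measurable_cst _ _ S R setT k.
have h1 : measurable [set z | 0 <= t1 z] by exact: (measurable_set_ler (mk 0) m1).
have h2 : measurable [set z | t1 z <= 1] by exact: (measurable_set_ler m1 (mk 1)).
have h3 : measurable [set z | 0 < t2 z] by exact: (measurable_set_ltr (mk 0) m2).
have h4 : measurable [set z | t2 z <= r] by exact: (measurable_set_ler m2 (mk r)).
have h5 : measurable [set z | 0 < t3 z] by exact: (measurable_set_ltr (mk 0) m3).
have h6 : measurable [set z | t3 z <= s] by exact: (measurable_set_ler m3 (mk s)).
have h7 : measurable [set z | Lf (1, 0) (w z) (t1 z) = 0] by exact: (measurable_set_eqr (measurable_Lf (1, 0) m1 mw) (mk 0)).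
have h8 : measurable [set z | Lf (0, 1) (w z) (a z) = 0] by exact: (measurable_set_eqr (measurable_Lf (0, 1) ma mw) (mk 0)).
have h9 : measurable [set z | Lf (0, 1) (w z) (c z) = 0] by exact: (measurable_set_eqr (measurable_Lf (0, 1) mc mw) (mk 0)).
have h10 : measurable [set z | Lf' (0, 1) (w z) (a z) < 0] by exact: (measurable_set_ltr (measurable_Lf' (0, 1) ma mw) (mk 0)).
have h11 : measurable [set z | 0 < Lf' (0, 1) (w z) (c z)] by exact: (measurable_set_ltr (mk 0) (measurable_Lf' (0, 1) mc mw)).
have h12 := measurable_nonincreasing mw m1 m2 m3.
have h13 : measurable [set z | Lf (1, 0) (w z) (a z) <= u] by exact: (measurable_set_ler (measurable_Lf (1, 0) ma mw) (mk u)).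
have h14 : measurable [set z | Lf (1, 0) (w z) (c z) <= v] by exact: (measurable_set_ler (measurable_Lf (1, 0) mc mw) (mk v)).
have := measurableI _ _ h1 (measurableI _ _ h2 (measurableI _ _ h3 (measurableI _ _ h4 (measurableI _ _ h5 (measurableI _ _ h6
  (measurableI _ _ h7 (measurableI _ _ h8 (measurableI _ _ h9 (measurableI _ _ h10 (measurableI _ _ h11 (measurableI _ _ h12
  (measurableI _ _ h13 h14)))))))))))).
congr measurable; apply/seteqP; split => z /=; rewrite !LfE.
  move=> [k1 [k2 [k3 [k4 [k5 [k6 [k7 [k8 [k9 [k10 [k11 [k12 [k13 k14]]]]]]]]]]]]].
  by split=> /=; [split; apply/andP|rewrite k7 k8 k9| |].
move=> [[/andP[k1 k2] /andP[k3 k4] /andP[k5 k6]] [k7 k8 k9] [k10 k11 k12] [k13 k14]].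
by do !split.
Qed.

(** Indices that encode nothing receive three copies of the strip (0, 0), which [ordered_strips]
    rejects. *)
Definition strip_code (j : nat) : (rat * rat) * (rat * rat) * (rat * rat) :=
  odflt ((0, 0), (0, 0), (0, 0)) (unpickle j).
Definition strip_a j : R * R := (ratr (strip_code j).1.1.1, ratr (strip_code j).1.1.2).
Definition strip_b j : R * R := (ratr (strip_code j).1.2.1, ratr (strip_code j).1.2.2).
Definition strip_c j : R * R := (ratr (strip_code j).2.1, ratr (strip_code j).2.2).
Definition ordered_strips j : bool :=
  [&& (strip_a j).1 <= (strip_a j).2, (strip_a j).2 < (strip_b j).1, (strip_b j).1 <= (strip_b j).2,
      (strip_b j).2 < (strip_c j).1 & (strip_c j).1 <= (strip_c j).2].
Definition triple_adm j w := ordered_strips j /\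
  [/\ strip_adm (1, 0) (strip_b j).1 (strip_b j).2 w, strip_adm (0, 1) (strip_a j).1 (strip_a j).2 w
    & strip_adm (0, -1) (strip_c j).1 (strip_c j).2 w].
Definition triple_zero j w : R * R * R :=
  let b := strip_zero (1, 0) (strip_b j).1 (strip_b j).2 w in
  (b, b - strip_zero (0, 1) (strip_a j).1 (strip_a j).2 w, strip_zero (0, -1) (strip_c j).1 (strip_c j).2 w - b).
Definition triple_box j : set (R * R * R) :=
  [set x | [/\ (strip_b j).1 < x.1.1 <= (strip_b j).2, (strip_a j).1 < x.1.1 - x.1.2 <= (strip_a j).2
             & (strip_c j).1 < x.1.1 + x.2 <= (strip_c j).2]].

Lemma triple_zero_box j w : triple_adm j w -> triple_box j (triple_zero j w).
Proof.
move=> [/and5P[oa _ ob _ oc] [ab aa ac]].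
have [b bI b0] := strip_adm_zero ob ab; have [a aI a0] := strip_adm_zero oa aa; have [c cI c0] := strip_adm_zero oc ac.
have h (p q t : R) : p < t <= q -> p <= t <= q by case/andP => /ltW ->.
rewrite /triple_box /triple_zero /= (strip_zeroE ab.1 (h _ _ _ bI) b0) (strip_zeroE aa.1 (h _ _ _ aI) a0) (strip_zeroE ac.1 (h _ _ _ cI) c0).
by split=> //; [rewrite opprB addrC subrK|rewrite addrC subrK].
Qed.

Lemma triple_zero_unique j w x : triple_adm j w -> xi w x = (0, 0, 0) -> triple_box j x -> triple_zero j w = x.
Proof.
move=> [_ [ab aa ac]]; case: x => [[x1 x2] x3] /= [e1 e2 e3] [/= bI aI cI].
have h (p q t : R) : p < t <= q -> p <= t <= q by case/andP => /ltW ->.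
rewrite /triple_zero (strip_zeroE ab.1 (h _ _ _ bI)) ?LfE// (strip_zeroE aa.1 (h _ _ _ aI)) ?LfE// (strip_zeroE ac.1 (h _ _ _ cI)) ?LfE ?e3 ?oppr0//.
by congr (_, _, _); ring.
Qed.

Lemma triple_cover w (x1 x2 x3 : R) : xi w (x1, x2, x3) = (0, 0, 0) -> (w : R -> R)^`()%classic x1 < 0 ->
  derive1n 2 w (x1 - x2) < 0 -> 0 < derive1n 2 w (x1 + x3) -> 0 < x2 -> 0 < x3 ->
  exists2 j, triple_adm j w & triple_zero j w = (x1, x2, x3).
Proof.
move=> xi0 d1 d2 d3 p2 p3; have [e1 e2 e3] := xi0.
(* Cutting at the midpoints between consecutive zeros keeps the three strips disjoint. *)
have I1 : x1 - x2 / 2 < x1 < x1 + x3 / 2 by apply/andP; split; lra.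
have I2 : x1 - x2 - 1 < x1 - x2 < x1 - x2 / 2 by apply/andP; split; lra.
have I3 : x1 + x3 / 2 < x1 + x3 < x1 + x3 + 1 by apply/andP; split; lra.
have z1 : Lf (1, 0) w x1 = 0 by rewrite LfE.
have z2 : Lf (0, 1) w (x1 - x2) = 0 by rewrite LfE.
have z3 : Lf (0, -1) w (x1 + x3) = 0 by rewrite LfE e3 oppr0.
have s1 : Lf' (1, 0) w x1 < 0 by rewrite LfE.
have s2 : Lf' (0, 1) w (x1 - x2) < 0 by rewrite LfE.
have s3 : Lf' (0, -1) w (x1 + x3) < 0 by rewrite LfE oppr_lt0.
have [pb [qb [b1 b2 b3 b4 ab]]] := strip_exists z1 s1 I1.
have [pa [qa [a1 a2 a3 a4 aa]]] := strip_exists z2 s2 I2.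
have [pc [qc [c1 c2 c3 c4 ac]]] := strip_exists z3 s3 I3.
pose code : (rat * rat) * (rat * rat) * (rat * rat) := ((pa, qa), (pb, qb), (pc, qc)).
have cE : strip_code (pickle code) = code by rewrite /strip_code pickleK.
have adm : triple_adm (pickle code) w.
  split; last by rewrite /strip_a /strip_b /strip_c cE.
  rewrite /ordered_strips /strip_a /strip_b /strip_c cE /=.
  apply/and5P; split; [exact/ltW/(lt_trans a2)|exact: lt_trans b1|exact/ltW/(lt_trans b2)|exact: lt_trans c1|exact/ltW/(lt_trans c2)].
exists (pickle code) => //; apply: triple_zero_unique => //.
by rewrite /triple_box /strip_a /strip_b /strip_c cE /=; split; apply/andP; split=> //; exact: ltW.
Qed.

Definition hits r s u v j : set (path R) :=
  [set w | [/\ triple_adm j w, marked_downcrossings r s u v w (triple_zero j w)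
    & forall i, (i < j)%N -> triple_adm i w -> triple_zero i w <> triple_zero j w]].

Lemma measurable_hits r s u v j : measurable (hits r s u v j).
Proof.
have mb i := measurable_strip_zero (1, 0) (strip_b i).1 (strip_b i).2.
have ma i := measurable_strip_zero (0, 1) (strip_a i).1 (strip_a i).2.
have mc i := measurable_strip_zero (0, -1) (strip_c i).1 (strip_c i).2.
have mA i : measurable [set w | triple_adm i w].
  have [ho|hno] := boolP (ordered_strips i); last first.
    by rewrite (_ : [set w | _] = set0)//; apply/seteqP; split => w //= [h]; rewrite h in hno.
  have /and5P[oa _ ob _ oc] := ho.
  have := measurableI _ _ (measurable_strip_adm (1, 0) ob) (measurableI _ _ (measurable_strip_adm (0, 1) oa) (measurable_strip_adm (0, -1) oc)).
  by congr measurable; apply/seteqP; split => w /=; [case=> h1 [h2 h3]|case=> _ [h1 h2 h3]].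
have mM := measurable_marked r s u v (@measurable_id _ _ setT) (mb j) (measurable_funB (mb j) (ma j)) (measurable_funB (mc j) (mb j)).
have mE i k : measurable [set w | triple_zero i w = triple_zero k w].
  have := measurableI _ _ (measurable_set_eqr (mb i) (mb k)) (measurableI _ _
    (measurable_set_eqr (measurable_funB (mb i) (ma i)) (measurable_funB (mb k) (ma k)))
    (measurable_set_eqr (measurable_funB (mc i) (mb i)) (measurable_funB (mc k) (mb k)))).
  congr measurable; apply/seteqP; split => w /=; first by rewrite /triple_zero => -[-> [-> ->]].
  by rewrite /triple_zero => -[h1 h2 h3].
have mF : measurable (\bigcap_i (if (i < j)%N then ~` ([set w | triple_adm i w] `&` [set w | triple_zero i w = triple_zero j w]) else setT)).
  by apply: bigcapT_measurable => i; case: ifP => _ //; apply: measurableC; exact: measurableI.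
have := measurableI _ _ (mA j) (measurableI _ _ mM mF).
congr measurable; apply/seteqP; split => w /=.
  move=> [h1 [h2 h3]]; split=> // i ij hi hz; have := h3 i I; rewrite ij /=; exact.
move=> [h1 h2 h3]; do !split=> //; move=> i _; case: ifP => // ij [hi hz]; exact: (h3 i ij hi hz).
Qed.

(** Condition (i) gives nonpositive slope at the centre and strict curvature at the extremes;
    excluding tangential zeros makes the slope negative, so every marked triple is isolated by some
    strips. *)
Lemma counting_marked r s u v w : (forall b, 0 <= b <= 1 -> w b = 0 -> (w : R -> R)^`()%classic b <> 0) ->
  counting (marked_downcrossings r s u v w) = (\sum_(0 <= j <oo) (\1_(hits r s u v j) w : R)%:E)%E.
Proof.
move=> nd; rewrite (@counting_first_hits R _ [set j | triple_adm j w] (fun j => triple_zero j w)).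
  by apply: eq_eseriesr => j _; rewrite !indicE; congr ((nat_of_bool _)%:R%:E); apply/idP/idP; rewrite !inE.
move=> [[x1 x2] x3] [[h1 h2 h3] x0 [c1 c2 c3] _].
apply: triple_cover => //; [|by case/andP: h2|by case/andP: h3].
have [e1 _ _] := x0; rewrite lt_neqAle; apply/andP; split; first by apply/eqP; exact: nd.
apply: c3; move: h2 h3 => /andP[h2 _] /andP[h3 _]; rewrite /Gamma/=; apply/andP; split; lra.
Qed.

(** For a path with zeros prescribed at x, the strips containing x have their zeros exactly there,
    so the sum counts the intersection of the marked triples with {x}. *)
Lemma hits_sum r s u v w (x1 x2 x3 : R) : xi w (x1, x2, x3) = (0, 0, 0) -> (w : R -> R)^`()%classic x1 < 0 ->
  derive1n 2 w (x1 - x2) < 0 -> 0 < derive1n 2 w (x1 + x3) -> 0 < x2 -> 0 < x3 ->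
  (\sum_(0 <= j <oo) (\1_(triple_box j) (x1, x2, x3) * \1_(hits r s u v j) w : R)%:E =
   (\1_(marked_downcrossings r s u v w) (x1, x2, x3) : R)%:E)%E.
Proof.
move=> xi0 d1 d2 d3 p2 p3; have cov := triple_cover xi0 d1 d2 d3 p2 p3; set x := (x1, x2, x3) in xi0 cov *.
have cnt : counting (marked_downcrossings r s u v w `&` [set x]) = (\1_(marked_downcrossings r s u v w) x : R)%:E.
  rewrite indicE; case: (asboolP (x \in marked_downcrossings r s u v w)) => [|h].
    move=> h; rewrite h; move: h; rewrite inE => h.
    rewrite (_ : _ `&` _ = [set x]); last by apply/seteqP; split => [y []//|y ->].
    rewrite /counting ifT; last by apply/asboolP; exact: finite_set1.
    by rewrite fset_set1 finmap.cardfs1.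
  rewrite (negbTE (introN idP h)) (_ : _ `&` _ = set0); last first.
    by apply/seteqP; split => // y [hy yx]; apply: h; rewrite inE -yx.
  by rewrite /counting ifT ?fset_set0 ?finmap.cardfs0//; apply/asboolP; exact: finite_set0.
rewrite -cnt (@counting_first_hits R _ [set j | triple_adm j w] (fun j => triple_zero j w)); last first.
  by move=> y [_ ->].
apply: eq_eseriesr => j _; rewrite !indicE -natrM mulnb; congr ((nat_of_bool _)%:R%:E).
apply/idP/idP; rewrite ?inE => h.
  by move: h => /andP[]; rewrite !inE => hb [h1 h2 h3]; have E := triple_zero_unique h1 xi0 hb; split=> //; split.
by case: h => h1 [h2 h4] h3; apply/andP; rewrite !inE; split=> //; rewrite -h4; exact: triple_zero_box.
Qed.

End marked_points.

(** * Values taken by the conditioned path *)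

Section chain_values.
Context d (T : measurableType d) (R : realType) (P : probability T R).
Variables (G : set (T -> R)) (cG : cgauss P G).

(** A deterministic observable has zero covariance with everything, so later slides do not move
    it. *)
Lemma chain_keeps l v (X : T -> path R) m e t y : gproc G X m -> (forall x, Lf e (X x) t = y) -> Lf e m t = y ->
  forall x, Lf e ((chain P l v X m).1 x) t = y.
Proof.
elim: l v X m => [|c l IH] v X m gX hX hm; first exact: hX.
have k0 : Lf e (kpath P X m (cL X m c.1 c.2)) t = 0.
  rewrite (Lf_kpath cG gX); last exact: (cg_sqint cG (cL_G cG gX c.1 c.2)).
  rewrite (_ : ip _ _ _ = 0) ?mul0r// /ip /Rintegral integral0_eq// => x _.
  by rewrite /cL hX hm subrr mul0r.
apply: IH; first exact: (gproc_cond cG gX).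
  by move=> x; apply: (etrans (Lf_cpath P X m c.1 c.2 (head 0 v) e t x)); rewrite k0 mulr0 addr0.
by apply: (etrans (Lf_cmean P X m c.1 c.2 (head 0 v) e t)); rewrite k0 mulr0 addr0.
Qed.

Lemma chain_values l v (X : T -> path R) m : gproc G X m -> nondeg P l X m ->
  forall i, (i < size l)%N -> forall x, Lf (nth (0, 0, 0) l i).1 ((chain P l v X m).1 x) (nth (0, 0, 0) l i).2 = v`_i.
Proof.
elim: l v X m => [|c l IH] v X m gX nd // [_ x|i il x].
  have [v0 _] := nondeg_cons (head 0 v) nd; apply: etrans (esym (nth0 (0 : R) v)).
  apply: (@chain_keeps l (behead v) _ _ c.1 c.2 (head 0 v) (gproc_cond cG gX c.1 c.2 (head 0 v))).
    by move=> y; apply: (etrans (Lf_cpath _ _ _ _ _ _ _ _ _)); rewrite (Lf_kpath_diag cG gX v0) mulr1; ring.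
  by apply: (etrans (Lf_cmean _ _ _ _ _ _ _ _)); rewrite (Lf_kpath_diag cG gX v0) mulr1; ring.
have [_ nd'] := nondeg_cons (head 0 v) nd.
have := IH (behead v) _ _ (gproc_cond cG gX c.1 c.2 (head 0 v)) nd' i il x.
by rewrite nth_behead.
Qed.

End chain_values.

(** * Iterated integrals over products of Lebesgue measures *)

Section sigma_finite_products.
Context d1 d2 (T1 : measurableType d1) (T2 : measurableType d2) (R : realType).
Variables (m1 : {measure set T1 -> \bar R}) (m2 : {sigma_finite_measure set T2 -> \bar R}).
Hypothesis sf : sigma_finite setT m1.
Local Open Scope ereal_scope.

Lemma sigma_finite_product : sigma_finite setT (m1 \x m2).
Proof.
have /sigma_finiteP[F [TF ndF Foo]] := sf.
have /sigma_finiteP[G [TG ndG Goo]] := sigma_finiteT m2.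
exists (fun n => F n `*` G n).
  rewrite -setXTT TF TG predeqE => -[x y]; split.
    move=> [/= [n _ Fnx] [k _ Gky]]; exists (maxn n k) => //; split.
    - by move: x Fnx; exact/subsetPset/ndF/leq_maxl.
    - by move: y Gky; exact/subsetPset/ndG/leq_maxr.
  by move=> [n _ []/= ? ?]; split; exists n.
move=> k; have [? ?] := Foo k; have [? ?] := Goo k.
split; first exact: measurableX.
by rewrite product_measure1E// lte_mul_pinfty// ge0_fin_numE.
Qed.

End sigma_finite_products.

Section product_tonelli.
Context d1 d2 d3 d4 d5 (T1 : measurableType d1) (T2 : measurableType d2) (T3 : measurableType d3)
  (T4 : measurableType d4) (T5 : measurableType d5) (R : realType).
Variables (m1 : {sigma_finite_measure set T1 -> \bar R}) (m2 : {sigma_finite_measure set T2 -> \bar R})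
  (m3 : {sigma_finite_measure set T3 -> \bar R}) (m4 : {sigma_finite_measure set T4 -> \bar R})
  (m5 : {sigma_finite_measure set T5 -> \bar R}).
Local Open Scope ereal_scope.

Lemma product_tonelli3 (f : T1 * T2 * T3 -> \bar R) : measurable_fun setT f -> (forall z, 0 <= f z) ->
  \int[(m1 \x m2) \x m3]_z f z = \int[m1]_x \int[m2]_y \int[m3]_t f (x, y, t).
Proof.
move=> mf f0; transitivity (\int[m1 \x m2]_z \int[m3]_t f (z, t)).
  (* Inference does not find the sigma-finite structure of a product here. *)
  pose mm : {sigma_finite_measure set (T1 * T2)%type -> \bar R} := HB.pack (m1 \x m2) (Measure_isSigmaFinite.Build _ _ _ (m1 \x m2) (sigma_finite_product m2 (sigma_finiteT m1))).
  exact: (@fubini_tonelli1 _ _ _ _ R mm m3 f mf f0).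
have mF := @measurable_fun_fubini_tonelli_F _ _ _ _ R m3 f mf f0.
by apply: (@fubini_tonelli1 _ _ _ _ R m1 m2 _ mF) => z; exact: integral_ge0.
Qed.

Lemma product_tonelli4 (f : T1 * T2 * T3 * T4 -> \bar R) : measurable_fun setT f -> (forall z, 0 <= f z) ->
  \int[((m1 \x m2) \x m3) \x m4]_z f z = \int[m1]_x \int[m2]_y \int[m3]_t \int[m4]_t' f (x, y, t, t').
Proof.
move=> mf f0; transitivity (\int[(m1 \x m2) \x m3]_z \int[m4]_t f (z, t)).
  pose mm : {sigma_finite_measure set (T1 * T2 * T3)%type -> \bar R} := HB.pack ((m1 \x m2) \x m3) (Measure_isSigmaFinite.Build _ _ _ ((m1 \x m2) \x m3) (sigma_finite_product m3 (sigma_finite_product m2 (sigma_finiteT m1)))).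
  exact: (@fubini_tonelli1 _ _ _ _ R mm m4 f mf f0).
have mF := @measurable_fun_fubini_tonelli_F _ _ _ _ R m4 f mf f0.
by apply: (product_tonelli3 mF) => z; exact: integral_ge0.
Qed.

Lemma product_tonelli5 (f : T1 * T2 * T3 * T4 * T5 -> \bar R) : measurable_fun setT f -> (forall z, 0 <= f z) ->
  \int[(((m1 \x m2) \x m3) \x m4) \x m5]_z f z =
  \int[m1]_x \int[m2]_y \int[m3]_t \int[m4]_t' \int[m5]_t'' f (x, y, t, t', t'').
Proof.
move=> mf f0; transitivity (\int[((m1 \x m2) \x m3) \x m4]_z \int[m5]_t f (z, t)).
  pose mm : {sigma_finite_measure set (T1 * T2 * T3 * T4)%type -> \bar R} := HB.pack (((m1 \x m2) \x m3) \x m4) (Measure_isSigmaFinite.Build _ _ _ (((m1 \x m2) \x m3) \x m4) (sigma_finite_product m4 (sigma_finite_product m3 (sigma_finite_product m2 (sigma_finiteT m1))))).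
  exact: (@fubini_tonelli1 _ _ _ _ R mm m5 f mf f0).
have mF := @measurable_fun_fubini_tonelli_F _ _ _ _ R m5 f mf f0.
by apply: (product_tonelli4 mF) => z; exact: integral_ge0.
Qed.

End product_tonelli.

Lemma lebesgue_tonelli4 (R : realType) (f : R * R * R * R -> \bar R) : measurable_fun setT f -> (forall z, 0 <= f z)%E ->
  let mu := @lebesgue_measure R in
  (\int[((mu \x mu) \x mu) \x mu]_z f z = \int[mu]_x \int[mu]_y \int[mu]_t \int[mu]_t' f (x, y, t, t'))%E.
Proof.
move=> mf f0 mu; exact: (@product_tonelli4 _ _ _ _ (measurableTypeR R) (measurableTypeR R) (measurableTypeR R) (measurableTypeR R) R mu mu mu mu f mf f0).
Qed.

Lemma lebesgue_tonelli5 (R : realType) (f : R * R * R * R * R -> \bar R) : measurable_fun setT f -> (forall z, 0 <= f z)%E ->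
  let mu := @lebesgue_measure R in
  (\int[(((mu \x mu) \x mu) \x mu) \x mu]_z f z =
   \int[mu]_x \int[mu]_y \int[mu]_t \int[mu]_t' \int[mu]_t'' f (x, y, t, t', t''))%E.
Proof.
move=> mf f0 mu; exact: (@product_tonelli5 _ _ _ _ _ (measurableTypeR R) (measurableTypeR R) (measurableTypeR R) (measurableTypeR R) (measurableTypeR R) R mu mu mu mu mu f mf f0).
Qed.


Section iterated_lebesgue.
Context (R : realType).
Notation mu := (@lebesgue_measure R).
Local Open Scope ereal_scope.

Lemma integral_box5 (A B C : set R) (h h' : R -> R -> R -> R -> R -> \bar R) :
  (forall b a c y1 y2, B b -> A a -> C c -> h b a c y1 y2 = h' b a c y1 y2) ->
  (forall b a c y1 y2, ~ (B b /\ A a /\ C c) -> h' b a c y1 y2 = 0) ->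
  \int[mu]_(b in B) \int[mu]_(a in A) \int[mu]_(c in C) \int[mu]_y1 \int[mu]_y2 h b a c y1 y2 =
  \int[mu]_b \int[mu]_a \int[mu]_c \int[mu]_y1 \int[mu]_y2 h' b a c y1 y2.
Proof.
move=> hh' h0; rewrite integral_mkcond; apply: eq_integral => b _; rewrite patchE.
case: ifPn => [|/negP hb]; last first.
  rewrite integral0_eq// => a _; rewrite integral0_eq// => c _; rewrite integral0_eq// => y1 _.
  by rewrite integral0_eq// => y2 _; apply: h0 => -[Bb _]; apply: hb; rewrite inE.
rewrite inE => Bb; rewrite integral_mkcond; apply: eq_integral => a _; rewrite patchE.
case: ifPn => [|/negP ha]; last first.
  rewrite integral0_eq// => c _; rewrite integral0_eq// => y1 _.
  by rewrite integral0_eq// => y2 _; apply: h0 => -[_ [Aa _]]; apply: ha; rewrite inE.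
rewrite inE => Aa; rewrite integral_mkcond; apply: eq_integral => c _; rewrite patchE.
case: ifPn => [|/negP hc]; last first.
  rewrite integral0_eq// => y1 _.
  by rewrite integral0_eq// => y2 _; apply: h0 => -[_ [_ Cc]]; apply: hc; rewrite inE.
by rewrite inE => Cc; apply: eq_integral => y1 _; apply: eq_integral => y2 _; exact: hh'.
Qed.

Lemma ge0_integral_reflect (b : R) (f : R -> \bar R) : measurable_fun setT f -> (forall x, 0 <= f x) ->
  \int[mu]_x f x = \int[mu]_x f (b - x)%R.
Proof.
move=> mf f0; rewrite (ge0_integral_shift b mf f0) (@ge0_integral_opp R (fun x => f (b + x)%R))//.
by apply: (measurableT_comp mf); apply: measurable_funD.
Qed.

End iterated_lebesgue.

(** * Expected number of marked downcrossings *)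

Section marked_intensity.
Context d (T : measurableType d) (R : realType) (P : probability T R).
Notation mu := (@lebesgue_measure R).
Variables (G : set (T -> R)) (cG : cgauss P G) (X : T -> path R) (m : path R) (gX : gproc G X m).

Lemma measurable_conditioned5 d' (S : measurableType d') (a b c y1 y2 : S -> R) :
  measurable_fun setT a -> measurable_fun setT b -> measurable_fun setT c -> measurable_fun setT y1 -> measurable_fun setT y2 ->
  measurable_fun setT (fun z : S * T => conditioned5 P X m (a z.1) (b z.1) (c z.1) (y1 z.1) (y2 z.1) z.2) /\
  measurable_fun setT (fun s => density5 P X m (a s) (b s) (c s) (y1 s) (y2 s)).
Proof.
move=> ma mb mc m1 m2.
have mX2 : measurable_fun setT (fun z : S * T => X z.2).
  exact: (measurableT_comp (gp_meas gX) (@measurable_snd _ _ _ _)).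
have := @measurable_chain _ T R P G cG _ S [:: ((1, 0), b); ((0, 1), a); ((0, 1), c); ((1, 0), a); ((1, 0), c)]
  [:: fun=> 0; fun=> 0; fun=> 0; y1; y2] (fun _ => X) (fun _ => m) _ _ mX2 (measurable_cst m) (fun _ => gX).
by apply; [move=> k /= [<-|[<-|[<-|[<-|[<-|//]]]]]|move=> k /= [<-|[<-|[<-|[<-|[<-|//]]]]] //; exact: measurable_cst].
Qed.

Lemma measurable_conditioned_integral d' (S : measurableType d') (a b c y1 y2 : S -> R) (Phi : S * path R -> R) :
  measurable_fun setT a -> measurable_fun setT b -> measurable_fun setT c -> measurable_fun setT y1 -> measurable_fun setT y2 ->
  measurable_fun setT Phi -> (forall z, 0 <= Phi z) ->
  measurable_fun setT (fun z : S * T => (Phi (z.1, conditioned5 P X m (a z.1) (b z.1) (c z.1) (y1 z.1) (y2 z.1) z.2) *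
       density5 P X m (a z.1) (b z.1) (c z.1) (y1 z.1) (y2 z.1))%:E) /\
  measurable_fun setT (fun s => \int[P]_x (Phi (s, conditioned5 P X m (a s) (b s) (c s) (y1 s) (y2 s) x) *
       density5 P X m (a s) (b s) (c s) (y1 s) (y2 s))%:E)%E.
Proof.
move=> ma mb mc m1 m2 mPhi Phi0; have [h1 h2] := measurable_conditioned5 ma mb mc m1 m2.
pose f (z : S * T) : \bar R := (Phi (z.1, conditioned5 P X m (a z.1) (b z.1) (c z.1) (y1 z.1) (y2 z.1) z.2) *
    density5 P X m (a z.1) (b z.1) (c z.1) (y1 z.1) (y2 z.1))%:E.
have mf : measurable_fun setT f.
  apply/measurable_EFinP; apply: measurable_funM; last exact: (measurableT_comp h2 (@measurable_fst _ _ _ _)).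
  exact: (measurableT_comp mPhi (measurable_fun_pair (@measurable_fst _ _ _ _) h1)).
split; first exact: mf.
apply: (@measurable_fun_fubini_tonelli_F _ _ S T R P f mf) => z.
by rewrite lee_fin mulr_ge0//; exact: chain_pdf_ge0.
Qed.

Hypothesis nd : forall a b c, a != b -> b != c -> a != c -> nondeg P (five a b c) X m.

Lemma conditioned5_values a b c y1 y2 x : a < b -> b < c ->
  let w := conditioned5 P X m a b c y1 y2 x in
  [/\ w b = 0, (w : R -> R)^`()%classic a = 0, (w : R -> R)^`()%classic c = 0, w a = y1 & w c = y2].
Proof.
move=> ab bc w; have nf : nondeg P (five a b c) X m by apply: nd; rewrite lt_eqF//; exact: lt_trans bc.
have h i (il : (i < 5)%N) := chain_values cG [:: 0; 0; 0; y1; y2] gX nf il x.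
have := h 0%N isT; have := h 1%N isT; have := h 2%N isT; have := h 3%N isT; have := h 4%N isT.
by rewrite /= -/(conditioned5 P X m a b c y1 y2 x) -/w !LfE.
Qed.

Variables r s u v : R.

Definition marks : set (R * R * R * R * R) := [set z | let '(b, a, c, y1, y2) := z in
  [/\ 0 <= b <= 1, 0 < b - a <= r, 0 < c - b <= s & y1 <= u /\ y2 <= v]].

Let j5 (z : R * R * R * R * R) (w : path R) : R := jacobian z.1.1.1.2 z.1.1.1.1 z.1.1.2 w.
Let mk (z : R * R * R * R * R) : R * R * R := (z.1.1.1.1, z.1.1.1.1 - z.1.1.1.2, z.1.1.2 - z.1.1.1.1).
Let c5 (z : R * R * R * R * R) := conditioned5 P X m z.1.1.1.2 z.1.1.1.1 z.1.1.2 z.1.2 z.2.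
Let d5 (z : R * R * R * R * R) := density5 P X m z.1.1.1.2 z.1.1.1.1 z.1.1.2 z.1.2 z.2.

Let term j z x : R := \1_(triple_box j) (mk z) * \1_(hits r s u v j) (c5 z x) * j5 z (c5 z x).
Let total z x : R := alpha (c5 z x) (mk z) * \1_marks z.

Let j50 z w : 0 <= j5 z w.
Proof. by rewrite /j5 /jacobian !mulr_ge0// le_max lexx orbT. Qed.

Let d50 z : 0 <= d5 z. Proof. exact: chain_pdf_ge0. Qed.

(** The conditioned path has its three zeros and two heights prescribed, so [hits_sum] applies
    wherever the Jacobian is nonzero: the requirement on the heights becomes one on y1 and y2, and
    the Jacobian times the indicator of monotonicity is [alpha]. Without a < b < c both sides
    vanish. *)
Let term_sum z x : (\sum_(0 <= j <oo) (term j z x * d5 z)%:E = (total z x * d5 z)%:E)%E.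
Proof.
case: z => [[[[b a] c] y1] y2]; set z := (b, a, c, y1, y2).
have [abc|nabc] := boolP ((a < b) && (b < c)); last first.
  rewrite (_ : total z x = 0) ?mul0r; last first.
    rewrite /total indicE; case: (asboolP (z \in marks)) => [h|/(introN idP)/negbTE->]; last by rewrite mulr0.
    move: h; rewrite inE => -[_ /andP[h1 _] /andP[h2 _] _]; move: nabc.
    by rewrite -subr_gt0 h1 -subr_gt0 h2.
  apply: eseries0 => j _ _; rewrite /term !indicE; case: (asboolP (mk z \in triple_box j)) => [h|/(introN idP)/negbTE->]; last by rewrite !mul0r.
  case: (asboolP (c5 z x \in hits r s u v j)) => [h'|/(introN idP)/negbTE->]; last by rewrite mulr0 !mul0r.
  move: h h'; rewrite !inE => -[/= h1 h2 h3] [[/and5P[_ o1 _ o2 _] _] _ _]; move: h1 h2 h3 o1 o2 nabc.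
  rewrite opprB !(addrC b) !subrK => /andP[h1 h2] /andP[h3 h4] /andP[h5 h6] o1 o2.
  by rewrite (le_lt_trans h4 (lt_trans o1 h1)) (le_lt_trans h2 (lt_trans o2 h5)).
have /andP[ab bc] := abc; have [w1 w2 w3 w4 w5] := @conditioned5_values a b c y1 y2 x ab bc.
rewrite -/(c5 z x) in w1 w2 w3 w4 w5; set w := c5 z x in w1 w2 w3 w4 w5.
have e1 : b - (b - a) = a by ring.
have e2 : b + (c - b) = c by ring.
have xi0 : xi w (b, b - a, c - b) = (0, 0, 0) by rewrite /xi e1 e2 w1 w2 w3.
have aE : alpha w (mk z) = j5 z w * \1_[set w' : R -> R | nonincreasing_on_Gamma w' (mk z)] w.
  by rewrite /alpha /mk /j5 /jacobian /= e1 e2 /neg_part /pos_part !LfE opprK.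
have [J0|Jn] := eqVneq (j5 z w) 0.
  rewrite /total -/w aE J0 !mul0r; apply: eseries0 => j _ _.
  by rewrite /term -/w J0 mulr0 mul0r.
have pos (y : R) : Num.max y 0 != 0 -> 0 < y.
  by apply: contra_neqT; rewrite -leNgt => y0; rewrite max_r.
have := Jn; rewrite /j5 /jacobian !mulf_eq0 !negb_or !LfE opprK => /andP[/andP[/pos p1 /pos p2] /pos p3].
rewrite oppr_gt0 in p1; rewrite oppr_gt0 in p2; rewrite /= in p1 p2 p3.
have M : \1_(marked_downcrossings r s u v w) (b, b - a, c - b) =
    \1_[set w' : R -> R | nonincreasing_on_Gamma w' (mk z)] w * \1_marks z :> R.
  rewrite !indicE -natrM mulnb; congr ((nat_of_bool _)%:R); apply/idP/idP => [|/andP[]]; rewrite !inE.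
    move=> [h1 h2 [h3 h4 h5] [h6 h7]]; rewrite e1 w4 in h6; rewrite e2 w5 in h7; case: h1 => i1 i2 i3.
    by apply/andP; rewrite !inE.
  move=> h [h1 h2 h3 [h4 h5]].
  have hi : condition_i w (b, b - a, c - b) by rewrite /condition_i e1 e2; split.
  have hii : condition_ii u v w (b, b - a, c - b) by rewrite /condition_ii e1 e2 w4 w5.
  exact: (And4 (And3 h1 h2 h3) xi0 hi hii).
have E j : (term j z x * d5 z)%:E = ((j5 z w * d5 z)%:E * (\1_(triple_box j) (b, b - a, c - b) * \1_(hits r s u v j) w)%:E)%E.
  by rewrite -EFinM /term -/w; congr (_%:E); rewrite /mk /=; ring.
under eq_eseriesr do rewrite E.
rewrite nneseriesZl; last by move=> j _; rewrite lee_fin mulr_ge0// indicE.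
rewrite hits_sum ?e1 ?e2 ?subr_gt0// M -EFinM; congr (_%:E); rewrite /total -/w aE; ring.
Qed.

Let mu5 := ((((mu \x mu) \x mu) \x mu) \x mu)%E.

Let mz : [/\ measurable_fun setT (fun z : R * R * R * R * R => z.1.1.1.1), measurable_fun setT (fun z : R * R * R * R * R => z.1.1.1.2),
  measurable_fun setT (fun z : R * R * R * R * R => z.1.1.2), measurable_fun setT (fun z : R * R * R * R * R => z.1.2) &
  measurable_fun setT (fun z : R * R * R * R * R => z.2)].
Proof.
split; do ?[exact: measurable_snd|exact: measurable_fst|apply: (measurableT_comp (@measurable_snd _ _ _ _))|apply: (measurableT_comp (@measurable_fst _ _ _ _))].
Qed.

Let term_meas j : measurable_fun setT (fun z : (R * R * R * R * R) * T => (term j z.1 z.2 * d5 z.1)%:E) /\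
  measurable_fun setT (fun z => \int[P]_x (term j z x * d5 z)%:E)%E.
Proof.
have [mb ma mc m1 m2] := mz.
pose Phi (z : (R * R * R * R * R) * path R) : R := \1_(triple_box j) (mk z.1) * \1_(hits r s u v j) z.2 * j5 z.1 z.2.
have f1 (f : R * R * R * R * R -> R) : measurable_fun setT f -> measurable_fun setT (fun z : (R * R * R * R * R) * path R => f z.1).
  by move=> mf; exact: (measurableT_comp mf (@measurable_fst _ _ _ _)).
have mw : measurable_fun setT (fun z : (R * R * R * R * R) * path R => z.2) by exact: measurable_snd.
have mPhi : measurable_fun setT Phi.
  apply: measurable_funM; [apply: measurable_funM|].
  - have mB : measurable [set z : (R * R * R * R * R) * path R | triple_box j (mk z.1)].
      have itv (f : (R * R * R * R * R) * path R -> R) (p q : R) : measurable_fun setT f -> measurable [set z | p < f z <= q].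
        move=> mf; rewrite (_ : [set z | _] = f @^-1` `]p, q]).
          by rewrite -[X in measurable X]setTI; apply: mf => //; exact: measurable_itv.
        by apply/seteqP; split => z /=; rewrite in_itv.
      have := measurableI _ _ (itv _ (strip_b R j).1 (strip_b R j).2 (f1 _ mb)) (measurableI _ _
        (itv _ (strip_a R j).1 (strip_a R j).2 (f1 _ (measurable_funB mb (measurable_funB mb ma))))
        (itv _ (strip_c R j).1 (strip_c R j).2 (f1 _ (measurable_funD mb (measurable_funB mc mb))))).
      by congr measurable; apply/seteqP; split => z /=; [case=> ? [? ?]|case].
    have := measurable_indic (R := R) mB; move/(_ setT); apply: eq_measurable_fun => z _.
    by rewrite !indicE; congr ((nat_of_bool _)%:R); apply/idP/idP; rewrite !inE.
  - exact: (measurableT_comp (measurable_indic (measurable_hits r s u v j)) mw).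
  - have mp e (t : R * R * R * R * R -> R) : measurable_fun setT t ->
        measurable_fun setT (fun z : (R * R * R * R * R) * path R => Num.max (- Lf' e z.2 (t z.1)) 0).
      by move=> mt; apply: measurable_maxr => //; apply: measurableT_comp => //; exact: (measurable_Lf' e (f1 _ mt) mw).
    exact: (measurable_funM (measurable_funM (mp _ _ mb) (mp _ _ ma)) (mp _ _ mc)).
apply: (measurable_conditioned_integral ma mb mc m1 m2 mPhi) => z.
by rewrite /Phi; apply: mulr_ge0; [apply: mulr_ge0; [by rewrite indicE|by rewrite indicE]|exact: j50].
Qed.

Let mc5 z : measurable_fun setT (c5 z).
Proof.
have [h _] := @measurable_conditioned5 _ (measurableTypeR R) (fun=> z.1.1.1.2) (fun=> z.1.1.1.1) (fun=> z.1.1.2) (fun=> z.1.2) (fun=> z.2)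
  (measurable_cst _) (measurable_cst _) (measurable_cst _) (measurable_cst _) (measurable_cst _).
exact: (measurableT_comp h (measurable_fun_pair (measurable_cst (0 : R)) (@measurable_id _ T setT))).
Qed.

Let term0 j z x : 0 <= term j z x * d5 z.
Proof.
rewrite /term; apply: mulr_ge0; [apply: mulr_ge0; [apply: mulr_ge0; [by rewrite indicE|by rewrite indicE]|exact: j50]|exact: d50].
Qed.

Let strip_term j : (\int[P]_x (\1_(hits r s u v j) (X x) : R)%:E = \int[mu5]_z \int[P]_x (term j z x * d5 z)%:E)%E.
Proof.
have [ho|hno] := boolP (ordered_strips R j); last first.
  have h0 w : \1_(hits r s u v j) w = 0 :> R.
    by rewrite indicE memNset// => -[[ho _] _ _]; rewrite ho in hno.
  rewrite integral0_eq; last by move=> x _; rewrite h0.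
  rewrite integral0_eq// => z _; rewrite integral0_eq// => x _.
  by rewrite /term h0 mulr0 !mul0r.
have /and5P[q1 q2 q3 q4 q5] := ho.
have mF : measurable_fun setT (fun w : path R => (\1_(hits r s u v j) w : R)%:E).
  by apply/measurable_EFinP; apply: measurable_indic; exact: measurable_hits.
have F0 (w : path R) : (0 <= (\1_(hits r s u v j) w : R)%:E)%E by rewrite lee_fin indicE.
have Fn (w : path R) : (\1_(hits r s u v j) w : R)%:E != 0%E -> triple_adm j w.
  rewrite indicE; case: (asboolP (w \in hits r s u v j)) => [h _|/(introN idP)/negbTE->]; last by rewrite eqxx.
  by move: h; rewrite inE => -[].
rewrite (triple_rice cG gX nd q1 q2 q3 q4 q5 mF F0); [|by move=> w /Fn[_ [[? _] [? _] [? _]]]|by move=> w /Fn[_ [[_ ?] [_ ?] [_ ?]]]].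
have tm := (term_meas j).2.
have t0 z : (0 <= \int[P]_x (term j z x * d5 z)%:E)%E by apply: integral_ge0 => x _; rewrite lee_fin; exact: term0.
rewrite (@integral_box5 R _ _ _ _ (fun b a c y1 y2 => \int[P]_x (term j (b, a, c, y1, y2) x * d5 (b, a, c, y1, y2))%:E)%E).
- exact: (esym (lebesgue_tonelli5 tm t0)).
- move=> b a c y1 y2; rewrite /= !in_itv/= => hb ha hc.
  have D0 : (0 <= (density5 P X m a b c y1 y2)%:E)%E by rewrite lee_fin; exact: d50 (b, a, c, y1, y2).
  have mw := mc5 (b, a, c, y1, y2); rewrite /c5/= in mw.
  have mG : measurable_fun setT (fun x => (\1_(hits r s u v j) (conditioned5 P X m a b c y1 y2 x) : R)%:E *
      (jacobian a b c (conditioned5 P X m a b c y1 y2 x))%:E)%E.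
    apply: (emeasurable_funM (measurableT_comp mF mw)).
    have mx e t : measurable_fun setT (fun x => Num.max (- Lf' e (conditioned5 P X m a b c y1 y2 x) t) 0).
      apply: measurable_maxr => //; apply: measurableT_comp => //.
      exact: (measurable_Lf' e (measurable_cst t) mw).
    apply/measurable_EFinP.
    exact: (measurable_funM (measurable_funM (mx (1, 0) b) (mx (0, 1) a)) (mx (0, -1) c)).
  have G0 x : (0 <= (\1_(hits r s u v j) (conditioned5 P X m a b c y1 y2 x) : R)%:E *
      (jacobian a b c (conditioned5 P X m a b c y1 y2 x))%:E)%E.
    by apply: mule_ge0; [exact: F0|rewrite lee_fin; exact: (j50 (b, a, c, y1, y2))].
  apply: (etrans (esym (ge0_integralZr P measurableT mG (fun x _ => G0 x) D0))).
  apply: eq_integral => x _; rewrite -!EFinM; congr (_%:E).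
  rewrite /term /= (_ : \1_(triple_box j) _ = 1) ?mul1r//.
  rewrite indicE mem_set// /triple_box /mk /= (_ : b - (b - a) = a); last by ring.
  by rewrite (_ : b + (c - b) = c)//; ring.
- move=> b a c y1 y2 nbox; apply: integral0_eq => x _.
  rewrite /term indicE memNset ?mul0r// => -[/= hb ha hc]; apply: nbox; rewrite /= !in_itv/=.
  move: ha hc; rewrite (_ : b - (b - a) = a); last by ring.
  by rewrite (_ : b + (c - b) = c)//; ring.
Qed.

Let Mt z : \bar R := (\int[P]_x (total z x * d5 z)%:E)%E.

Let mMt : measurable_fun setT Mt.
Proof.
rewrite (_ : Mt = fun z => (\sum_(0 <= j <oo) \int[P]_x (term j z x * d5 z)%:E)%E).
  apply: (@ge0_emeasurable_sum _ _ R setT (fun j z => (\int[P]_x (term j z x * d5 z)%:E)%E) predT) => j; last by move=> _; exact: (term_meas j).2.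
  by move=> z _ _; apply: integral_ge0 => x _; rewrite lee_fin; exact: term0.
apply/funext => z; rewrite -integral_nneseries//.
- by apply: eq_integral => x _; rewrite term_sum.
- move=> j; exact: (measurableT_comp (term_meas j).1 (measurable_fun_pair (measurable_cst z) (@measurable_id _ T setT))).
- by move=> j x _; rewrite lee_fin; exact: term0.
Qed.

Let Mt0 z : (0 <= Mt z)%E.
Proof.
apply: integral_ge0 => x _; rewrite lee_fin /total.
by apply: mulr_ge0; [apply: mulr_ge0; [exact: alpha_ge0|rewrite indicE]|exact: d50].
Qed.

Variables (c0 : R) (mE : m = (fun=> c0) :> (R -> R)).
Hypothesis statR : forall h (Psi : path R -> R), measurable_fun setT Psi ->
  \int[P]_x Psi (pshift h (X x)) = \int[P]_x Psi (X x).
Hypothesis statE : forall h (Phi : path R -> \bar R), measurable_fun setT Phi -> (forall w, 0 <= Phi w)%E ->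
  (\int[P]_x Phi (pshift h (X x)) = \int[P]_x Phi (X x))%E.
Variables (N : set T) (mN : measurable N) (N0 : P N = 0%E).
Hypothesis simple : forall x, ~ N x -> forall b, 0 <= b <= 1 -> X x b = 0 -> (X x : R -> R)^`()%classic b <> 0.
Variables (Y : T -> R -> R) (XY : forall x, ~ N x -> X x = Y x :> (R -> R)).

Let count_total : (\int[P]_x counting (marked_downcrossings r s u v (Y x)) = \int[mu5]_z Mt z)%E.
Proof.
have mh j : measurable_fun setT (fun x => (\1_(hits r s u v j) (X x) : R)%:E).
  apply/measurable_EFinP; exact: (measurableT_comp (measurable_indic (measurable_hits r s u v j)) (gp_meas gX)).
have h0 j x : (0 <= (\1_(hits r s u v j) (X x) : R)%:E)%E by rewrite lee_fin indicE.
rewrite (integral_null_modification (N := N) mN N0 (g := fun x => (\sum_(0 <= j <oo) (\1_(hits r s u v j) (X x) : R)%:E)%E)).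
- rewrite integral_nneseries//.
  under eq_eseriesr do rewrite strip_term.
  rewrite -integral_nneseries//.
  + apply: eq_integral => z _; rewrite -integral_nneseries//.
    * by apply: eq_integral => x _; rewrite term_sum.
    * move=> j; exact: (measurableT_comp (term_meas j).1 (measurable_fun_pair (measurable_cst z) (@measurable_id _ T setT))).
    * by move=> j x _; rewrite lee_fin; exact: term0.
  + by move=> j; exact: (term_meas j).2.
  + by move=> j z _; apply: integral_ge0 => x _; rewrite lee_fin; exact: term0.
- by apply: (@ge0_emeasurable_sum _ T R setT (fun j x => (\1_(hits r s u v j) (X x) : R)%:E) predT).
- by move=> x Nx; rewrite -(XY Nx); apply: counting_marked => b hb; exact: simple.
Qed.

Definition below_heights : set (R * R * R * R) := [set q | let '(x2, x3, y1, y2) := q in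
  [/\ 0 < x2 <= r, 0 < x3 <= s & y1 <= u /\ y2 <= v]].

Let alpha_shift b (f g : R -> R) x2 x3 : f^`()%classic = (fun t => g^`()%classic (t + b)) ->
  derive1n 2 f = (fun t => derive1n 2 g (t + b)) -> alpha f (0, x2, x3) = alpha g (b, x2, x3).
Proof.
move=> h1 h2.
have e : (f \in [set w : R -> R | nonincreasing_on_Gamma w (0, x2, x3)]) = (g \in [set w : R -> R | nonincreasing_on_Gamma w (b, x2, x3)]).
  apply/idP/idP; rewrite !inE /nonincreasing_on_Gamma/= => h z hz.
    have := h (z - b); rewrite h1 subrK; apply; move: hz => /andP[z1 z2].
    by apply/andP; split; [move: z1|move: z2]; lra.
  rewrite h1; apply: h; move: hz => /andP[z1 z2].
  by apply/andP; split; [move: z1|move: z2]; lra.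
have a1 : f^`()%classic 0 = g^`()%classic b.
  by apply: (etrans (congr1 (fun k => k 0) h1)); apply: (congr1 (g^`()%classic)); ring.
have a2 : derive1n 2 f (0 - x2) = derive1n 2 g (b - x2).
  by apply: (etrans (congr1 (fun k => k (0 - x2)) h2)); apply: (congr1 (derive1n 2 g)); ring.
have a3 : derive1n 2 f (0 + x3) = derive1n 2 g (b + x3).
  by apply: (etrans (congr1 (fun k => k (0 + x3)) h2)); apply: (congr1 (derive1n 2 g)); ring.
by rewrite /alpha a1 a2 a3 !indicE e.
Qed.

Definition marked_intensity (q : R * R * R * R) : \bar R := let '(x2, x3, y1, y2) := q in
  (\int[P]_x (alpha (conditioned5 P X m (0 - x2) 0 (0 + x3) y1 y2 x) (0, x2, x3) *
     density5 P X m (0 - x2) 0 (0 + x3) y1 y2)%:E)%E.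

Lemma marked_intensity_ge0 q : (0 <= marked_intensity q)%E.
Proof.
case: q => [[[x2 x3] y1] y2]; apply: integral_ge0 => x _; rewrite lee_fin mulr_ge0 ?alpha_ge0//.
exact: chain_pdf_ge0.
Qed.

(** Translating the configuration to b = 0 changes neither the density nor the mean of [alpha], by
    [chain_stationary]; the constraint on b becomes a separate factor. *)
Let Mt_stationary b x2 x3 y1 y2 : Mt (b, b - x2, b + x3, y1, y2) =
  (marked_intensity (x2, x3, y1, y2) * (\1_below_heights (x2, x3, y1, y2) : R)%:E * (\1_(`[0, 1]%classic) b : R)%:E)%E.
Proof.
have e1 : b - (b - x2) = x2 by ring.
have e2 : b + x3 - b = x3 by ring.
have mkE : \1_marks (b, b - x2, b + x3, y1, y2) = \1_below_heights (x2, x3, y1, y2) * \1_(`[0, 1]%classic) b :> R.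
  have mq : marks (b, b - x2, b + x3, y1, y2) <-> below_heights (x2, x3, y1, y2) /\ 0 <= b <= 1.
    rewrite /marks /below_heights /= e1 e2; split; first by move=> [h1 h2 h3 h4]; split.
    by move=> [[h2 h3 h4] h1]; split.
  have bI : (b \in `[0, 1]%classic) = (0 <= b <= 1) by apply/idP/idP; rewrite inE/= in_itv.
  rewrite !indicE bI -natrM mulnb; congr ((nat_of_bool _)%:R); apply/idP/idP.
    by rewrite inE => /mq[h1 h2]; apply/andP; split=> //; rewrite inE.
  by move=> /andP[]; rewrite !inE => h1 h2; apply/mq; split.
rewrite -muleA -EFinM -mkE.
have [|hn] := pselect (marks (b, b - x2, b + x3, y1, y2)); last first.
  rewrite indicE memNset// mule0; apply: integral0_eq => x _.
  by rewrite /total indicE memNset// mulr0 mul0r.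
move=> hm; rewrite indicE mem_set// mule1.
pose k := density5 P X m (0 - x2) 0 (0 + x3) y1 y2.
have k0 : 0 <= k by exact: chain_pdf_ge0.
have mid : measurable_fun setT (fun w : path R => w) by exact: measurable_id.
have mA := measurable_alpha mid (measurable_cst (0 : R)) (measurable_cst x2) (measurable_cst x3).
pose Phi (w : path R) := (alpha w (0%R, x2, x3) * k)%:E.
have mPhi : measurable_fun setT Phi by apply/measurable_EFinP; exact: measurable_funM.
have Phi0 w : (0 <= Phi w)%E by rewrite lee_fin mulr_ge0 ?alpha_ge0.
have [h1 h2] := chain_stationary cG gX mE statR statE b (five (0 - x2) 0 (0 + x3)) [:: 0; 0; 0; y1; y2] mPhi Phi0.
have fE : five (b - x2) b (b + x3) = [seq (c.1, c.2 + b) | c <- five (0 - x2) 0 (0 + x3)].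
  by rewrite /five /= !add0r (addrC x3) (addrC (- x2)).
rewrite /marked_intensity -[RHS]h1; apply: eq_integral => x _.
have hk : density5 P X m (b - x2) b (b + x3) y1 y2 = k by rewrite /density5 fE; exact: h2.
have [d1 d2] := pshift_derive b ((chain P [seq (c.1, c.2 + b) | c <- five (0 - x2) 0 (0 + x3)] [:: 0; 0; 0; y1; y2] X m).1 x).
have hA : total (b, b - x2, b + x3, y1, y2) x =
    alpha (pshift b ((chain P [seq (c.1, c.2 + b) | c <- five (0 - x2) 0 (0 + x3)] [:: 0; 0; 0; y1; y2] X m).1 x)) (0, x2, x3).
  apply: (etrans _ (esym (alpha_shift x2 x3 d1 d2))).
  have t1 : total (b, b - x2, b + x3, y1, y2) x = alpha (c5 (b, b - x2, b + x3, y1, y2) x) (mk (b, b - x2, b + x3, y1, y2)).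
    have tm : \1_marks (b, b - x2, b + x3, y1, y2) = 1 :> R by rewrite indicE mem_set.
    exact: (etrans (congr1 (fun y => alpha (c5 (b, b - x2, b + x3, y1, y2) x) (mk (b, b - x2, b + x3, y1, y2)) * y) tm) (mulr1 _)).
  have t2 : mk (b, b - x2, b + x3, y1, y2) = (b, x2, x3) by rewrite /mk /= e1 e2.
  apply: (etrans t1); apply: (etrans (congr1 (fun q => alpha (c5 (b, b - x2, b + x3, y1, y2) x) q) t2)).
  exact: (congr1 (fun l => alpha ((chain P l [:: 0; 0; 0; y1; y2] X m).1 x) (b, x2, x3)) fE).
exact: (congr1 EFin (congr2 *%R hA hk)).
Qed.

(** After the substitutions a = b - x2 and c = b + x3 the integrand depends on b only through the
    indicator of [0, 1], whose integral is 1. *)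
Lemma expected_marked_count :
  (\int[P]_x counting (marked_downcrossings r s u v (Y x)) =
   \int[mu]_x2 \int[mu]_x3 \int[mu]_y1 \int[mu]_y2
     (marked_intensity (x2, x3, y1, y2) * (\1_below_heights (x2, x3, y1, y2) : R)%:E))%E.
Proof.
rewrite count_total; apply: (etrans (lebesgue_tonelli5 mMt Mt0)).
have m1 := measurable_lebesgue_integral mMt Mt0.
have p1 z : (0 <= \int[mu]_y Mt (z, y))%E by exact: integral_ge0.
have m2 := measurable_lebesgue_integral m1 p1.
have p2 z : (0 <= \int[mu]_y1 \int[mu]_y Mt (z, y1, y))%E by apply: integral_ge0 => *; exact: p1.
have m3 := measurable_lebesgue_integral m2 p2.
have p3 z : (0 <= \int[mu]_c \int[mu]_y1 \int[mu]_y Mt (z, c, y1, y))%E by apply: integral_ge0 => *; exact: p2.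
set C := (X in _ = X).
have C0 : (0 <= C)%E.
  do 4 (apply: integral_ge0 => ? _); apply: mule_ge0; first exact: marked_intensity_ge0.
  by rewrite lee_fin indicE.
transitivity (\int[mu]_b (C * (\1_(`[0%R, 1%R]%classic) b : R)%:E))%E; last first.
  have mI : measurable (`[0%R, 1%R]%classic : set R) by exact: measurable_itv.
  have mI1 : measurable_fun setT (fun b : R => (\1_(`[0%R, 1%R]%classic) b : R)%:E).
    by apply/measurable_EFinP; exact: measurable_indic.
  have mI0 (b : R) : (0 <= (\1_(`[0%R, 1%R]%classic) b : R)%:E)%E by rewrite lee_fin indicE.
  apply: (etrans (ge0_integralZl mu measurableT mI1 (fun b _ => mI0 b) C0)).
  rewrite integral_indic// setIT.
  apply: (etrans (congr1 (fun y => C * y)%E (lebesgue_measure_itv `[0%R, 1%R]))).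
  by rewrite /= lte_fin ltr01 -EFinB subr0 mule1.
apply: eq_integral => b _.
have mb : measurable_fun setT (fun a : R => (b, a)) by exact: measurable_fun_pair.
rewrite (ge0_integral_reflect b (measurableT_comp m3 mb) (fun a => p3 (b, a))) /=.
rewrite indicE; have [hb|hb] := boolP (b \in _); last first.
  rewrite mule0; apply: integral0_eq => x2 _; apply: integral0_eq => c _; apply: integral0_eq => y1 _; apply: integral0_eq => y2 _.
  have hb0 : (\1_(`[0%R, 1%R]%classic) b : R)%:E = 0%E by rewrite indicE (negbTE hb).
  by rewrite (_ : c = b + (c - b)); [rewrite Mt_stationary hb0 mule0|ring].
rewrite mule1; apply: eq_integral => x2 _.
have mbc : measurable_fun setT (fun c : R => (b, b - x2, c)) by exact: measurable_fun_pair.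
rewrite (ge0_integral_shift b (measurableT_comp m2 mbc) (fun c => p2 (b, b - x2, c))) /=.
apply: eq_integral => x3 _; apply: eq_integral => y1 _; apply: eq_integral => y2 _.
have hb1 : (\1_(`[0%R, 1%R]%classic) b : R)%:E = 1%E by rewrite indicE hb.
by rewrite Mt_stationary hb1 mule1.
Qed.

End marked_intensity.


(** * Expected number of downcrossings *)

Lemma Lf'_pshift10 (R : realType) (b : R) (w : path R) t : Lf' (1, 0) (pshift b w) t = Lf' (1, 0) w (t + b).
Proof.
have [d1 _] := pshift_derive b w; apply: (etrans (LfE _ _).1.1.2); apply: etrans (esym (LfE _ _).1.1.2).
exact: (congr1 (fun f => f t) d1).
Qed.

Section downcrossing_intensity.
Context d (T : measurableType d) (R : realType) (P : probability T R).
Notation mu := (@lebesgue_measure R).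
Variables (G : set (T -> R)) (cG : cgauss P G) (X : T -> path R) (m : path R) (gX : gproc G X m).
Hypothesis v0 : forall b, 0 < ip P (cL X m (1, 0) b) (cL X m (1, 0) b).
Variables (c0 : R) (mE : m = (fun=> c0) :> (R -> R)).
Hypothesis statR : forall h (Psi : path R -> R), measurable_fun setT Psi ->
  \int[P]_x Psi (pshift h (X x)) = \int[P]_x Psi (X x).
Hypothesis statE : forall h (Phi : path R -> \bar R), measurable_fun setT Phi -> (forall w, 0 <= Phi w)%E ->
  (\int[P]_x Phi (pshift h (X x)) = \int[P]_x Phi (X x))%E.
Variables (N : set T) (mN : measurable N) (N0 : P N = 0%E).
Variables (Y : T -> R -> R) (XY : forall x, ~ N x -> X x = Y x :> (R -> R)).

Definition level_strip (j : nat) : R * R :=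
  let c : rat * rat := odflt (0, 0) (unpickle j) in (ratr c.1, ratr c.2).
Let lo j := (level_strip j).1.
Let hi j := (level_strip j).2.
Let zero j (w : path R) := strip_zero (1, 0) (lo j) (hi j) w.
Let adm j (w : path R) := lo j <= hi j /\ strip_adm (1, 0) (lo j) (hi j) w.
Let hit j : set (path R) := [set w | [/\ adm j w, 0 <= zero j w <= 1
    & forall i, (i < j)%N -> adm i w -> zero i w <> zero j w]].

Let madm j : measurable [set w | adm j w].
Proof.
have [h|h] := leP (lo j) (hi j).
  by have := measurable_strip_adm (1, 0) h; congr measurable; apply/seteqP; split => w /=; [move=> k; split|case].
rewrite (_ : [set w | _] = set0)//; apply/seteqP; split => w //= [k _].
by move: h; rewrite ltNge k.
Qed.

Let mhit j : measurable (hit j).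
Proof.
have mz i : measurable_fun setT (zero i) := measurable_strip_zero (1, 0) (lo i) (hi i).
have mF : measurable (\bigcap_i (if (i < j)%N then ~` ([set w | adm i w] `&` [set w | zero i w = zero j w]) else setT)).
  apply: bigcapT_measurable => i; case: ifP => _ //; apply: measurableC; apply: measurableI; first exact: madm.
  exact: measurable_set_eqr.
have := measurableI _ _ (madm j) (measurableI _ _ (measurable_set_ler (measurable_cst (0 : R)) (mz j))
  (measurableI _ _ (measurable_set_ler (mz j) (measurable_cst (1 : R))) mF)).
congr measurable; apply/seteqP; split => w /=.
  move=> [h1 [h2 [h3 h4]]]; split=> //; first by rewrite h2.
  by move=> i ij ai zi; have := h4 i I; rewrite ij /=; exact.
move=> [h1 /andP[h2 h3] h4]; do !split=> //; move=> i _; case: ifP => // ij [ai zi]; exact: (h4 i ij ai zi).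
Qed.

Let h01 (p q t : R) : p < t <= q -> p <= t <= q. Proof. by case/andP => /ltW ->. Qed.

Let adm_zero j w : adm j w -> [/\ lo j < zero j w <= hi j, w (zero j w) = 0 & (w : R -> R)^`()%classic (zero j w) < 0].
Proof.
move=> [h a]; have [t tI t0] := strip_adm_zero h a.
rewrite /zero (strip_zeroE a.1 (h01 tI) t0); split=> //; first by rewrite -t0 LfE.
by have := a.1 t (h01 tI); rewrite LfE.
Qed.

Let adm_unique j w t : adm j w -> lo j < t <= hi j -> w t = 0 -> zero j w = t.
Proof. by move=> [_ a] tI t0; apply: (strip_zeroE a.1 (h01 tI)); rewrite LfE. Qed.

Let cover (w : path R) t : w t = 0 -> (w : R -> R)^`()%classic t < 0 -> exists2 j, adm j w & lo j < t <= hi j.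
Proof.
move=> wt w't.
have I1 : t - 1 < t < t + 1 by apply/andP; split; lra.
have z1 : Lf (1, 0) w t = 0 by rewrite LfE.
have s1 : Lf' (1, 0) w t < 0 by rewrite LfE.
have [p [q [_ b2 b3 _ ab]]] := strip_exists z1 s1 I1.
have cE : level_strip (pickle (p, q)) = (ratr p, ratr q) by rewrite /level_strip pickleK.
exists (pickle (p, q)); rewrite /adm /lo /hi cE /=; last by rewrite b2 ltW.
by split=> //; exact/ltW/(lt_trans b2).
Qed.

Let term j (t : R) (w : path R) : R := \1_(`]lo j, hi j]%classic) t * \1_(hit j) w.
Let c1 t x := cpath P X m (1, 0) t 0 x.
Let g t := gauss_pdf (sd P X m (1, 0) t) (0 - Lf (1, 0) m t).
Let k t x := Num.max (- Lf' (1, 0) (c1 t x) t) 0 * g t.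

Let k0 t x : 0 <= k t x.
Proof. by rewrite /k mulr_ge0 ?gauss_pdf_ge0// le_max lexx orbT. Qed.

Let c1z t x : c1 t x t = 0.
Proof.
have h : Lf (1, 0) (c1 t x) t = 0.
  by apply: (etrans (Lf_cpath _ _ _ _ _ _ _ _ _)); rewrite (Lf_kpath_diag cG gX (v0 t)); ring.
by rewrite -h LfE.
Qed.

Let term_sum t x : (\sum_(0 <= j <oo) (term j t (c1 t x) * k t x)%:E = (k t x * \1_(`[0, 1]%classic) t : R)%:E)%E.
Proof.
have [K0|Kn] := eqVneq (k t x) 0.
  by rewrite K0 mul0r; apply: eseries0 => j _ _; rewrite mulr0.
have w't : (c1 t x : R -> R)^`()%classic t < 0.
  apply: contraNT Kn; rewrite -leNgt => h; rewrite /k LfE max_r ?mul0r//.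
  by rewrite oppr_le0.
have E j : (term j t (c1 t x) * k t x)%:E = ((k t x)%:E * (term j t (c1 t x))%:E)%E by rewrite -EFinM mulrC.
under eq_eseriesr do rewrite E.
rewrite nneseriesZl; last by move=> j _; rewrite lee_fin mulr_ge0// indicE.
rewrite [RHS]EFinM.
apply: (congr1 (fun y => (k t x)%:E * y)%E).
set w := c1 t x in w't *; have wt : w t = 0 := c1z t x.
have cnt : counting ([set y | 0 <= y <= 1] `&` [set t]) = (\1_(`[0, 1]%classic) t : R)%:E.
  rewrite indicE; case: (asboolP (t \in `[0, 1]%classic)) => [h|h].
    rewrite h; move: h; rewrite inE /= in_itv/= => h.
    rewrite (_ : _ `&` _ = [set t]); last by apply/seteqP; split => [y []//|y ->].
    rewrite /counting ifT; last by apply/asboolP; exact: finite_set1.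
    by rewrite fset_set1 finmap.cardfs1.
  rewrite (negbTE (introN idP h)) (_ : _ `&` _ = set0); last first.
    by apply/seteqP; split => // y [hy yx]; apply: h; rewrite inE -yx /= in_itv.
  by rewrite /counting ifT ?fset_set0 ?finmap.cardfs0//; apply/asboolP; exact: finite_set0.
rewrite -cnt (@counting_first_hits R _ [set j | adm j w] (fun j => zero j w)); last first.
  by move=> y [_ ->]; have [j aj tj] := cover wt w't; exists j => //; exact: adm_unique.
apply: eq_eseriesr => j _; rewrite /term !indicE -natrM mulnb; congr ((nat_of_bool _)%:R%:E).
apply/idP/idP; rewrite ?inE => h.
  move: h => /andP[]; rewrite !inE /= in_itv/= => hb [h1 h2 h3].
  by have e := adm_unique h1 hb wt; split.
case: h => h1 [h2 h4] h3; apply/andP; rewrite !inE /= in_itv/=; split=> //.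
by rewrite -h4; have [] := adm_zero h1.
Qed.

Let mc1 : measurable_fun setT (fun z : R * T => c1 z.1 z.2) /\ measurable_fun setT g.
Proof.
have mX2 : measurable_fun setT (fun z : R * T => X z.2).
  exact: (measurableT_comp (gp_meas gX) (@measurable_snd _ _ _ _)).
have := @measurable_chain _ T R P G cG _ R [:: ((1, 0), fun t => t)] [:: fun=> 0] (fun _ => X) (fun _ => m) _ _ mX2 (measurable_cst m) (fun _ => gX).
case.
- by move=> ? /= [<-|//]; exact: measurable_id.
- by move=> ? /= [<-|//]; exact: measurable_cst.
move=> h1 h2; split; first exact: h1.
by apply: (eq_measurable_fun _ _ h2) => t _; rewrite /= mulr1.
Qed.

Let mk : measurable_fun setT (fun z : R * T => k z.1 z.2).
Proof.
have [h1 h2] := mc1; apply: measurable_funM; last exact: (measurableT_comp h2 (@measurable_fst _ _ _ _)).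
apply: measurable_maxr => //; apply: measurableT_comp => //.
exact: (measurable_Lf' (1, 0) (@measurable_fst _ _ _ _) h1).
Qed.

Let mterm j : measurable_fun setT (fun z : R * T => (term j z.1 (c1 z.1 z.2) * k z.1 z.2)%:E).
Proof.
have [h1 h2] := mc1; apply/measurable_EFinP; apply: measurable_funM mk; apply: measurable_funM.
  have mI : measurable (`]lo j, hi j]%classic : set R) by exact: measurable_itv.
  exact: (measurableT_comp (measurable_indic mI) (@measurable_fst _ _ _ _)).
exact: (measurableT_comp (measurable_indic (mhit j)) h1).
Qed.

Let term0 j t x : (0 <= (term j t (c1 t x) * k t x)%:E)%E.
Proof. by rewrite lee_fin mulr_ge0// mulr_ge0// indicE. Qed.

Let strip_term j : (\int[P]_x (\1_(hit j) (X x) : R)%:E = \int[mu]_t \int[P]_x (term j t (c1 t x) * k t x)%:E)%E.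
Proof.
have [ho|hno] := leP (lo j) (hi j); last first.
  have h0 w : \1_(hit j) w = 0 :> R.
    by rewrite indicE memNset// => -[[ho _] _ _]; move: hno; rewrite ltNge ho.
  rewrite integral0_eq; last by move=> x _; rewrite h0.
  by rewrite integral0_eq// => t _; rewrite integral0_eq// => x _; rewrite /term h0 mulr0 mul0r.
have mF : measurable_fun setT (fun w : path R => (\1_(hit j) w : R)%:E).
  by apply/measurable_EFinP; apply: measurable_indic; exact: mhit.
have F0 (w : path R) : (0 <= (\1_(hit j) w : R)%:E)%E by rewrite lee_fin indicE.
have Fn (w : path R) : (\1_(hit j) w : R)%:E != 0%E -> adm j w.
  rewrite indicE; case: (asboolP (w \in hit j)) => [h _|/(introN idP)/negbTE->]; last by rewrite eqxx.
  by move: h; rewrite inE => -[].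
rewrite (rice_step cG gX ho (fun u _ => v0 u) mF F0); [|by move=> w /Fn[_ []]|by move=> w /Fn[_ []]].
rewrite integral_mkcond; apply: eq_integral => t _; rewrite patchE /term indicE.
case: ifPn => ht; last by rewrite integral0_eq// => x _; rewrite !mul0r.
by apply: eq_integral => x _; rewrite mul1r -EFinM.
Qed.

(** The one-point analogue of the marked count. The negative slope in the definition of a
    downcrossing provides an isolating strip for each of them, and stationarity makes the Rice
    integrand constant in t. *)
Lemma expected_downcrossings : (\int[P]_x counting (downcrossings (Y x)) =
  \int[P]_x (neg_part ((c1 0 x : R -> R)^`()%classic 0) * chain_pdf P [:: ((1, 0), 0)] [:: 0] X m)%:E)%E.
Proof.
have mh j : measurable_fun setT (fun x => (\1_(hit j) (X x) : R)%:E).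
  apply/measurable_EFinP; exact: (measurableT_comp (measurable_indic (mhit j)) (gp_meas gX)).
have h0 j x : (0 <= (\1_(hit j) (X x) : R)%:E)%E by rewrite lee_fin indicE.
have mt j t : measurable_fun setT (fun x => (term j t (c1 t x) * k t x)%:E).
  exact: (measurableT_comp (mterm j) (measurable_fun_pair (measurable_cst t) (@measurable_id _ T setT))).
rewrite (integral_null_modification (N := N) mN N0 (g := fun x => (\sum_(0 <= j <oo) (\1_(hit j) (X x) : R)%:E)%E)).
- rewrite integral_nneseries//.
  under eq_eseriesr do rewrite strip_term.
  rewrite -integral_nneseries//; last 2 first.
  + by move=> j; exact: (@measurable_fun_fubini_tonelli_F _ _ R T R P _ (mterm j) (fun z => term0 j z.1 z.2)).
  + by move=> j t _; apply: integral_ge0 => x _; exact: term0.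
  set I := (X in _ = X).
  transitivity (\int[mu]_t (I * (\1_(`[0%R, 1%R]%classic) t : R)%:E))%E; last first.
    have I0 : (0 <= I)%E.
      apply: integral_ge0 => x _; rewrite lee_fin mulr_ge0//; last exact: chain_pdf_ge0.
      by rewrite /neg_part le_max lexx orbT.
    have mI : measurable (`[0%R, 1%R]%classic : set R) by exact: measurable_itv.
    have mI1 : measurable_fun setT (fun b : R => (\1_(`[0%R, 1%R]%classic) b : R)%:E).
      by apply/measurable_EFinP; exact: measurable_indic.
    have mI0 (b : R) : (0 <= (\1_(`[0%R, 1%R]%classic) b : R)%:E)%E by rewrite lee_fin indicE.
    apply: (etrans (ge0_integralZl mu measurableT mI1 (fun b _ => mI0 b) I0)).
    rewrite integral_indic// setIT.
    apply: (etrans (congr1 (fun y => I * y)%E (lebesgue_measure_itv `[0%R, 1%R]))).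
    by rewrite /= lte_fin ltr01 -EFinB subr0 mule1.
  apply: eq_integral => t _; rewrite -integral_nneseries//.
  under eq_integral do rewrite term_sum.
  rewrite indicE; case: (t \in _); last first.
    by rewrite mule0 integral0_eq// => x _; rewrite mulr0.
  rewrite mule1; under eq_integral do rewrite mulr1.
  pose q := chain_pdf P [:: ((1, 0), 0)] [:: 0] X m.
  have q0 : 0 <= q by exact: chain_pdf_ge0.
  pose Phi (w : path R) := (Num.max (- Lf' (1, 0) w 0) 0 * q)%:E.
  have mPhi : measurable_fun setT Phi.
    apply/measurable_EFinP; apply: measurable_funM => //; apply: measurable_maxr => //; apply: measurableT_comp => //.
    exact: (measurable_Lf' (1, 0) (measurable_cst (0 : R)) (@measurable_id _ _ setT)).
  have Phi0 w : (0 <= Phi w)%E by rewrite lee_fin mulr_ge0// le_max lexx orbT.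
  have [h1 h2] := chain_stationary cG gX mE statR statE t [:: ((1, 0), 0)] [:: 0] mPhi Phi0.
  have IE : I = (\int[P]_x Phi ((chain P [:: ((1%R, 0%R), 0%R)] [:: 0%R] X m).1 x))%E.
    by apply: eq_integral => x _; rewrite /Phi LfE.
  have lE : [seq (c.1, c.2 + t) | c <- [:: ((1, 0), 0)]] = [:: ((1, 0), t)] :> seq (R * R * R) by rewrite /= add0r.
  have gE : g t = q by rewrite /q -h2 lE /= mulr1.
  rewrite IE -h1; apply: eq_integral => x _.
  have dE : Lf' (1, 0) (c1 t x) t =
      Lf' (1, 0) (pshift t ((chain P [seq (c.1, c.2 + t) | c <- [:: ((1, 0), 0)]] [:: 0] X m).1 x)) 0.
    apply: esym; apply: (etrans (Lf'_pshift10 t _ 0)).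
    exact: (congr2 (fun (w : path R) (y : R) => Lf' (1, 0) w y) (congr1 (fun l => (chain P l [:: 0] X m).1 x) lE) (add0r t)).
  exact: (congr1 EFin (congr2 (fun a c => Num.max (- a) 0 * c) dE gE)).
- by apply: (@ge0_emeasurable_sum _ T R setT (fun j x => (\1_(hit j) (X x) : R)%:E) predT).
- move=> x Nx; rewrite -(XY Nx) (@counting_first_hits R _ [set j | adm j (X x)] (fun j => zero j (X x))).
    apply: eq_eseriesr => j _; rewrite !indicE; congr ((nat_of_bool _)%:R%:E); apply/idP/idP; rewrite !inE.
      by move=> [h1 [h2 _ _] h3]; split.
    move=> [h1 h2 h3]; split=> //; have [_ z0 z1] := adm_zero h1; split=> //.
  move=> t [ht t0 t1]; have [j aj tj] := cover t0 t1; exists j => //; exact: adm_unique.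
Qed.

End downcrossing_intensity.

(** * Identification of the Palm distribution and its density *)

Section palm_distribution.
Context d (T : measurableType d) (R : realType) (P : probability T R).
Notation mu := (@lebesgue_measure R).
Variable W : R -> {RV P >-> R}.
Variables (N : set T) (mN : measurable N) (N0 : P N = 0%E).
Variables (G : set (T -> R)) (cG : cgauss P G) (X : T -> path R) (m : path R) (gX : gproc G X m).
Hypothesis XW : forall x, ~ N x -> X x = sample_path W x :> (R -> R).
Hypothesis nd : forall a b c, a != b -> b != c -> a != c -> nondeg P (five a b c) X m.

Let XWt x : ~ N x -> forall t, W t x = X x t.
Proof. by move=> Nx t; rewrite XW. Qed.

Let row_seqE n (s : seq R) : size s = n -> [seq (row_of_seq n s) 0 i | i <- enum 'I_n] = s.
Proof.
move=> sz; apply: (@eq_from_nth _ 0); rewrite size_map size_enum_ord ?sz// => i il.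
by rewrite (nth_map (Ordinal il)) ?size_enum_ord// mxE nth_enum_ord.
Qed.

Let mA (Z : T -> path R) (f : path R -> R) : measurable_fun setT Z -> measurable_fun setT f ->
  measurable_fun setT (fun x => (f (Z x))%:E).
Proof. by move=> mZ mf; apply/measurable_EFinP; exact: (measurableT_comp mf mZ). Qed.

(** Positive distances make the three points distinct, hence the five variables nondegenerate, so
    that [density_chain] and [conditioned_path_chain] put both factors of [h_s] in chain form. *)
Lemma h_s_marked_intensity x2 x3 y1 y2 : 0 < x2 -> 0 < x3 ->
  h_s W (0, x2, x3) y1 y2 = marked_intensity P X m (x2, x3, y1, y2).
Proof.
move=> p2 p3; set V := fun x => xi_heights (sample_path W x) (0, x2, x3).
have ndl : nondeg P (five (0 - x2) 0 (0 + x3)) X m.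
  by apply: nd; rewrite lt_eqF//; lra.
have VE x : ~ N x -> forall i : 'I_5, V x 0 i =
    Lf (nth (0, 0, 0) (five (0 - x2) 0 (0 + x3)) i).1 (X x) (nth (0, 0, 0) (five (0 - x2) 0 (0 + x3)) i).2.
  by move=> Nx [[|[|[|[|[|//]]]]] hi]; rewrite /V -(XW Nx) mxE /= LfE.
pose v := row_of_seq 5 [:: 0; 0; 0; y1; y2].
have vE : [seq v 0 i | i <- enum 'I_5] = [:: 0; 0; 0; y1; y2] by exact: row_seqE.
rewrite /h_s -/V -/v (density_chain cG mN N0 gX (erefl : size (five _ _ _) = 5%N) ndl VE) vE.
have mc : measurable_fun setT (conditioned5 P X m (0 - x2) 0 (0 + x3) y1 y2).
  have [h _] := @measurable_conditioned5 _ _ _ P G cG X m gX _ (measurableTypeR R) (fun=> 0 - x2) (fun=> 0) (fun=> 0 + x3) (fun=> y1) (fun=> y2)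
    (measurable_cst _) (measurable_cst _) (measurable_cst _) (measurable_cst _) (measurable_cst _).
  exact: (measurableT_comp h (measurable_fun_pair (measurable_cst (0 : R)) (@measurable_id _ T setT))).
have ma := measurable_alpha (@measurable_id _ (path R) setT) (measurable_cst (0 : R)) (measurable_cst x2) (measurable_cst x3).
have mac : measurable_fun setT (fun x => (alpha (conditioned5 P X m (0 - x2) 0 (0 + x3) y1 y2 x) (0, x2, x3))%:E) := mA mc ma.
have k0 : (0 <= (density5 P X m (0 - x2) 0 (0 + x3) y1 y2)%:E)%E by rewrite lee_fin; exact: chain_pdf_ge0.
have a0 x : (0 <= (alpha (conditioned5 P X m (0 - x2) 0 (0 + x3) y1 y2 x) (0%R, x2, x3))%:E)%E by rewrite lee_fin alpha_ge0.
have -> : cond_expectation W V (fun w => alpha w (0, x2, x3)) v =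
    (\int[P]_x (alpha (conditioned5 P X m (0 - x2) 0 (0 + x3) y1 y2 x) (0%R, x2, x3))%:E)%E.
  rewrite /cond_expectation expectation.unlock; apply: (integral_null_modification mN N0 mac) => x Nx.
  congr (_%:E); rewrite (conditioned_path_chain cG mN N0 gX (erefl : size (five _ _ _) = 5%N) ndl VE XWt v Nx).
  by rewrite vE.
exact: (esym (ge0_integralZr P measurableT mac (fun x _ => a0 x) k0)).
Qed.

Lemma downcrossing_intensityE : downcrossing_intensity W =
  (\int[P]_x (neg_part ((cpath P X m (1, 0) 0 0 x : R -> R)^`()%classic 0) * chain_pdf P [:: ((1, 0), 0)] [:: 0] X m)%:E)%E.
Proof.
set V := fun x => row_of_seq 1 [:: W 0 x].
have [v0 _] : 0 < ip P (cL X m (1, 0) 0) (cL X m (1, 0) 0) /\ True.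
  have n5 : nondeg P (five (-1) 0 1) X m by apply: nd; rewrite lt_eqF//; lra.
  by have [] := nondeg_cons 0 n5.
have ndl : nondeg P [:: ((1, 0), 0)] X m.
  move=> u nu; have u0 : head 0 u != 0 by move: nu; rewrite /= orbF.
  have sY := cg_sqint cG (cL_G cG gX (1, 0) 0).
  rewrite (_ : lcomb _ _ _ _ = fun x => head 0 u * cL X m (1, 0) 0 x); last by apply/funext => x /=; rewrite addr0.
  rewrite ip_scalel ?ip_scaler//; last exact: sqint_scale.
  by rewrite mulrA -expr2 mulr_gt0// lt_neqAle eq_sym expf_neq0//= sqr_ge0.
have VE x : ~ N x -> forall i : 'I_1, V x 0 i =
    Lf (nth ((0 : R), (0 : R), (0 : R)) [:: ((1, 0), 0)] i).1 (X x) (nth ((0 : R), (0 : R), (0 : R)) [:: ((1, 0), 0)] i).2.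
  by move=> Nx [[|//] hi]; rewrite mxE /= LfE XWt.
have sz : size [:: ((1, 0), 0) : (R * R) * R] = 1%N by [].
have vE : [seq (0 : 'rV[R]_1) 0 i | i <- enum 'I_1] = [:: 0].
  by rewrite -[RHS](row_seqE (n := 1))//; apply: eq_map => i; rewrite !mxE; case: i => [[|]].
rewrite /downcrossing_intensity -/V (density_chain cG mN N0 gX sz ndl VE) vE.
have mc := gp_meas (gproc_cond cG gX (1, 0) 0 0).
have mf : measurable_fun setT (fun w : path R => neg_part ((w : R -> R)^`()%classic 0)).
  by apply: measurable_maxr => //; apply: measurableT_comp => //; exact: measurable_path_derive.
have mac := mA mc mf.
have k0 : (0 <= (chain_pdf P [:: ((1, 0), 0)] [:: 0] X m)%:E)%E by rewrite lee_fin; exact: chain_pdf_ge0.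
have a0 x : (0 <= (neg_part ((cpath P X m (1, 0)%R 0%R 0%R x : R -> R)^`()%classic 0%R))%:E)%E by rewrite lee_fin /neg_part le_max lexx orbT.
have -> : cond_expectation W V (fun w => neg_part (derive1 w 0)) 0 =
    (\int[P]_x (neg_part ((cpath P X m (1, 0)%R 0%R 0%R x : R -> R)^`()%classic 0%R))%:E)%E.
  rewrite /cond_expectation expectation.unlock; apply: (integral_null_modification mN N0 mac) => x Nx.
  congr (_%:E); rewrite (conditioned_path_chain cG mN N0 gX sz ndl VE XWt 0 Nx).
  by rewrite vE.
exact: (esym (ge0_integralZr P measurableT mac (fun x _ => a0 x) k0)).
Qed.

Lemma downcrossing_intensity_ge0 : (0 <= downcrossing_intensity W)%E.
Proof.
rewrite downcrossing_intensityE; apply: integral_ge0 => x _; rewrite lee_fin mulr_ge0 ?chain_pdf_ge0//.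
by rewrite /neg_part le_max lexx orbT.
Qed.

(* A path descending from height [y1] at [- x2] to height 0 at 0 has [0 <= y1]. *)
Lemma marked_intensity_neg x2 x3 y1 y2 : 0 < x2 -> 0 < x3 -> y1 < 0 -> marked_intensity P X m (x2, x3, y1, y2) = 0%E.
Proof.
move=> p2 p3 y0; apply: integral0_eq => x _; congr (_%:E).
have ab : 0 - x2 < 0 by lra.
have bc : 0 < 0 + x3 by lra.
have [w0 _ _ wa _] := conditioned5_values cG gX nd y1 y2 x ab bc.
set w := conditioned5 _ _ _ _ _ _ _ _ _ in w0 wa *.
rewrite /alpha indicE memNset ?mulr0 ?mul0r//= => h.
have [d1 _ _] := C2_derive (path_C2 w); have [c0 _ _] := C2_continuous (path_C2 w).
have [c] := @MVT R w ((w : R -> R)^`()%classic) (0 - x2) 0 ab (fun u _ => d1 u) (continuous_subspaceT c0).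
rewrite in_itv/= => /andP[c1 c2]; rewrite w0 wa => E.
have : (w : R -> R)^`()%classic c <= 0 by apply: h; apply/andP; split; move: c1 c2; lra.
by move: E p2 y0; move: (_^`()%classic c) => D E p2 y0 D0; nra.
Qed.

Lemma measurable_marked_intensity : measurable_fun setT (marked_intensity P X m).
Proof.
have m1 : measurable_fun setT (fun q : R * R * R * R => q.1.1.1).
  by do 2 (apply: (measurableT_comp (@measurable_fst _ _ _ _))); exact: measurable_fst.
have m2 : measurable_fun setT (fun q : R * R * R * R => q.1.1.2).
  by apply: (measurableT_comp (@measurable_snd _ _ _ _)); apply: (measurableT_comp (@measurable_fst _ _ _ _)); exact: measurable_fst.
have m3 : measurable_fun setT (fun q : R * R * R * R => q.1.2).
  by apply: (measurableT_comp (@measurable_snd _ _ _ _)); exact: measurable_fst.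
have m4 : measurable_fun setT (fun q : R * R * R * R => q.2) by exact: measurable_snd.
have f1 (f : R * R * R * R -> R) : measurable_fun setT f -> measurable_fun setT (fun z : (R * R * R * R) * path R => f z.1).
  by move=> mf; exact: (measurableT_comp mf (@measurable_fst _ _ _ _)).
have ma := measurable_alpha (@measurable_snd _ _ (R * R * R * R)%type (path R) : measurable_fun setT _) (measurable_cst (0 : R)) (f1 _ m1) (f1 _ m2).
have := (measurable_conditioned_integral cG gX (measurable_funB (measurable_cst (0 : R)) m1) (measurable_cst (0 : R))
  (measurable_funD (measurable_cst (0 : R)) m2) m3 m4 ma (fun z => alpha_ge0 _ _)).2.
by apply: eq_measurable_fun => -[[[x2 x3] y1] y2].
Qed.

Lemma measurable_orthants r s u v :
  measurable (below_heights r s u v) /\ measurable (below_heights r s u v `&` [set q : R * R * R * R | 0 < q.1.2 /\ q.2 < 0]).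
Proof.
have m1 : measurable_fun setT (fun q : R * R * R * R => q.1.1.1).
  by do 2 (apply: (measurableT_comp (@measurable_fst _ _ _ _))); exact: measurable_fst.
have m2 : measurable_fun setT (fun q : R * R * R * R => q.1.1.2).
  by apply: (measurableT_comp (@measurable_snd _ _ _ _)); apply: (measurableT_comp (@measurable_fst _ _ _ _)); exact: measurable_fst.
have m3 : measurable_fun setT (fun q : R * R * R * R => q.1.2).
  by apply: (measurableT_comp (@measurable_snd _ _ _ _)); exact: measurable_fst.
have m4 : measurable_fun setT (fun q : R * R * R * R => q.2) by exact: measurable_snd.
have mk (k : R) := @measurable_cst _ _ (R * R * R * R)%type R setT k.
have mb : measurable (below_heights r s u v).
  have := measurableI _ _ (measurable_set_ltr (mk 0) m1) (measurableI _ _ (measurable_set_ler m1 (mk r))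
    (measurableI _ _ (measurable_set_ltr (mk 0) m2) (measurableI _ _ (measurable_set_ler m2 (mk s))
    (measurableI _ _ (measurable_set_ler m3 (mk u)) (measurable_set_ler m4 (mk v)))))).
  congr measurable; apply/seteqP; split => -[[[x2 x3] y1] y2] /=.
    by move=> [h1 [h2 [h3 [h4 [h5 h6]]]]]; split=> //; apply/andP.
  by move=> [/andP[h1 h2] /andP[h3 h4] [h5 h6]].
split=> //; apply: measurableI => //.
have := measurableI _ _ (measurable_set_ltr (mk 0) m3) (measurable_set_ltr m4 (mk 0)).
by congr measurable.
Qed.

Variables r s u v : R.
Hypothesis v0 : v < 0.
Notation mi := (marked_intensity P X m).
Let K q := (mi q * (\1_(below_heights r s u v) q : R)%:E)%E.

Let mK : measurable_fun setT K.
Proof.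
apply: emeasurable_funM; first exact: measurable_marked_intensity.
by apply/measurable_EFinP; apply: measurable_indic; have [] := measurable_orthants r s u v.
Qed.

Let K0 q : (0 <= K q)%E.
Proof. by apply: mule_ge0; [exact: marked_intensity_ge0|rewrite lee_fin indicE]. Qed.

Let mset0 : measurable ([set 0] : set R) /\ mu [set 0] = 0%E.
Proof. by split; [exact: measurable_set1|exact: lebesgue_measure_set1]. Qed.

Let partials : [/\ measurable_fun setT (fun q : R * R * R => \int[mu]_y K (q, y))%E,
  measurable_fun setT (fun q : R * R => \int[mu]_y \int[mu]_t K (q, y, t))%E &
  measurable_fun setT (fun q : R => \int[mu]_x \int[mu]_y \int[mu]_t K (q, x, y, t))%E].
Proof.
have m1 := measurable_lebesgue_integral mK K0.
have p1 z : (0 <= \int[mu]_y K (z, y))%E by exact: integral_ge0.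
have m2 := measurable_lebesgue_integral m1 p1.
have p2 z : (0 <= \int[mu]_x \int[mu]_y K (z, x, y))%E by apply: integral_ge0 => *; exact: p1.
by split=> //; exact: (measurable_lebesgue_integral m2 p2).
Qed.

Let Kout x2 x3 y1 y2 : ~ below_heights r s u v (x2, x3, y1, y2) -> K (x2, x3, y1, y2) = 0%E.
Proof. by move=> h; rewrite /K indicE memNset// mule0. Qed.

(** The endpoints x2 = 0 and x3 = 0, where observables coincide, form null sets. The lower limit 0
    for y1 loses nothing, since the intensity vanishes for y1 < 0 by [marked_intensity_neg]. *)
Lemma integral_h_s : (\int[mu]_(x2 in `[0%R, r]) \int[mu]_(x3 in `[0%R, s]) \int[mu]_(y1 in `[0%R, u])
    \int[mu]_(y2 in `]-oo, v]) h_s W (0%R, x2, x3) y1 y2 =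
  \int[mu]_x2 \int[mu]_x3 \int[mu]_y1 \int[mu]_y2 K (x2, x3, y1, y2))%E.
Proof.
have [mz z0] := mset0; have [m1 m2 m3] := partials.
rewrite integral_mkcond; apply: (integral_null_modification (P := mu) mz z0 m3) => x2 /= n2.
rewrite patchE; case: ifPn => [|h2]; last first.
  rewrite integral0_eq// => x3 _; rewrite integral0_eq// => y1 _; rewrite integral0_eq// => y2 _.
  apply: Kout => -[/andP[a b] _ _]; move/negP: h2; apply; rewrite inE /= in_itv/= b andbT; exact: ltW.
rewrite inE /= in_itv/= => /andP[a2 b2]; have p2 : 0 < x2 by rewrite lt_neqAle a2 eq_sym andbT; exact/eqP.
have mx : measurable_fun setT (fun x3 : R => (x2, x3)) by exact: measurable_fun_pair.
rewrite integral_mkcond; apply: (integral_null_modification (P := mu) mz z0 (measurableT_comp m2 mx)) => x3 /= n3.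
rewrite patchE; case: ifPn => [|h3]; last first.
  rewrite integral0_eq// => y1 _; rewrite integral0_eq// => y2 _.
  apply: Kout => -[_ /andP[a b] _]; move/negP: h3; apply; rewrite inE /= in_itv/= b andbT; exact: ltW.
rewrite inE /= in_itv/= => /andP[a3 b3]; have p3 : 0 < x3 by rewrite lt_neqAle a3 eq_sym andbT; exact/eqP.
rewrite integral_mkcond; apply: eq_integral => y1 _; rewrite patchE; case: ifPn => [|h1]; last first.
  rewrite integral0_eq// => y2 _; have [y10|y10] := ltP y1 0; first by rewrite /K marked_intensity_neg// mul0e.
  apply: Kout => -[_ _ [a b]]; move/negP: h1; apply; by rewrite inE /= in_itv/= y10.
rewrite inE /= in_itv/= => /andP[a1 b1].
rewrite integral_mkcond; apply: eq_integral => y2 _; rewrite patchE; case: ifPn => [|h4]; last first.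
  by apply/esym/Kout => -[_ _ [a b]]; move/negP: h4; apply; rewrite inE /= in_itv/=.
rewrite inE /= in_itv/= => b4; rewrite h_s_marked_intensity// /K indicE mem_set ?mule1//.
by split=> //=; [rewrite p2|rewrite p3].
Qed.

(** The domain of the density and the orthant of the distribution function differ only where y1 <=
    0: the intensity is 0 for y1 < 0, and y1 = 0 is a null set. The sign of y2 follows from y2 <= v
    < 0. *)
Lemma integral_density (D : set (R * R * R * R)) (g : R * R * R * R -> \bar R) :
  D = below_heights r s u v `&` [set q | 0 < q.1.2 /\ q.2 < 0] ->
  (forall x2 x3 y1 y2, 0 < x2 -> 0 < x3 -> g (x2, x3, y1, y2) = (h_s W (0%R, x2, x3) y1 y2 / downcrossing_intensity W)%E) ->
  (\int[((mu \x mu) \x mu) \x mu]_(q in D) g q =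
   (\int[mu]_x2 \int[mu]_x3 \int[mu]_y1 \int[mu]_y2 K (x2, x3, y1, y2)) / downcrossing_intensity W)%E.
Proof.
move=> -> gE; have [_ mD] := measurable_orthants r s u v; set D' := _ `&` _ in mD *.
pose K' q := (mi q * (\1_D' q : R)%:E)%E.
have mK' : measurable_fun setT K'.
  apply: emeasurable_funM; first exact: measurable_marked_intensity.
  by apply/measurable_EFinP; exact: measurable_indic.
have K'0 q : (0 <= K' q)%E by apply: mule_ge0; [exact: marked_intensity_ge0|rewrite lee_fin indicE].
have I0 : (0 <= (downcrossing_intensity W)^-1)%E by rewrite inve_ge0 downcrossing_intensity_ge0.
have mKI : measurable_fun setT (fun q => K' q * (downcrossing_intensity W)^-1)%E by apply: emeasurable_funM.
have KI0 q : (0 <= K' q * (downcrossing_intensity W)^-1)%E by exact: mule_ge0.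
rewrite integral_mkcond.
transitivity (\int[((mu \x mu) \x mu) \x mu]_q (K' q * (downcrossing_intensity W)^-1))%E.
  apply: eq_integral => q _; rewrite patchE; case: ifPn => [|h]; last first.
    by rewrite /K' indicE (negbTE h) mule0 mul0e.
  rewrite /K' indicE => h; rewrite h mule1; move: h; rewrite inE; case: q => [[[x2 x3] y1] y2] [[/andP[p2 _] /andP[p3 _] _] _].
  by rewrite gE// h_s_marked_intensity.
transitivity ((\int[((mu \x mu) \x mu) \x mu]_q K' q) * (downcrossing_intensity W)^-1)%E.
  exact: (@ge0_integralZr _ (measurableTypeR R * measurableTypeR R * measurableTypeR R * measurableTypeR R)%type R
     (((mu \x mu) \x mu) \x mu)%E setT measurableT K' mK' (downcrossing_intensity W)^-1%E (fun q _ => K'0 q) I0).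
apply: (congr1 (fun y => y * (downcrossing_intensity W)^-1)%E); apply: (etrans (lebesgue_tonelli4 mK' K'0)).
apply: eq_integral => x2 _; apply: eq_integral => x3 _.
have [mz z0] := mset0; have [m1 _ _] := partials.
have mx : measurable_fun setT (fun y1 : R => (x2, x3, y1)) by exact: measurable_fun_pair.
apply: (integral_null_modification (P := mu) mz z0 (measurableT_comp m1 mx)) => y1 /= n1.
apply: eq_integral => y2 _; rewrite /K /K'; have [y10|y10] := ltP y1 0.
  have [p|p] := pselect (0 < x2 /\ 0 < x3); first by rewrite marked_intensity_neg ?mul0e; case: p.
  rewrite !indicE !memNset ?mule0//; first by move=> -[/andP[p2 _] /andP[p3 _] _]; exact: p.
  by move=> -[[/andP[p2 _] /andP[p3 _] _] _]; exact: p.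
have py : 0 < y1 by rewrite lt_neqAle y10 eq_sym andbT; exact/eqP.
rewrite !indicE; congr (_ * (nat_of_bool _)%:R%:E)%E; apply/idP/idP; rewrite !inE; first by case.
by move=> h; split=> //; case: h => _ _ [_ h]; split=> //; exact: le_lt_trans h v0.
Qed.

End palm_distribution.

Theorem theorem7p2 (R : realType) (d : measure_display) (T : measurableType d)
    (P : probability T R) (W : R -> {RV P >-> R})
    (hgauss : gaussian_process W)
    (hstat : stationary_process W)
    (hsmooth : {ae P, forall omega, C2 (sample_path W omega)})
    (hspec : spectrum_has_continuous_component W)
    (hvar : finite_variance P
              (fun omega => counting (derivative_zeros (sample_path W omega)))) :
  (forall r s u w : R, 0 < r -> 0 < s -> 0 < u -> w < 0 ->
     F_space W r s u w =
     ((\int[lebesgue_measure]_(x2 in `[0%R, r])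
        \int[lebesgue_measure]_(x3 in `[0%R, s])
         \int[lebesgue_measure]_(y1 in `[0%R, u])
          \int[lebesgue_measure]_(y2 in `]-oo, w]) h_s W (0%R, x2, x3) y1 y2)
      / downcrossing_intensity W)%E)
  /\ has_density4 (F_space W)
       (fun r s u w =>
          (h_s W (0%R, r, s) u w / downcrossing_intensity W)%E).
Proof.
case: hsmooth => N1 [mN1 N10 hN1].
have C2W x : ~ N1 x -> C2 (sample_path W x) by move=> Nx; apply: contrapT => nc; apply: Nx; exact: hN1.
have [X mX XW] := path_version mN1 C2W.
pose mean0 := \int[P]_x X x 0.
have mE : mkpath (fun=> mean0) = (fun=> mean0) :> (R -> R) by apply: mkpathE; case: (C2_cst mean0).
(* The mean path is generalized; only its being a constant function is kept. *)
move: (mkpath (fun=> mean0)) mE => m mE.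
have cG := cgauss_space hgauss hstat mN1 N10 mX XW (erefl mean0) mE.
have gX := gproc_path hgauss hstat mN1 N10 mX XW (erefl mean0) mE.
set G := gauss_space X m in cG gX.
have [F [_ covF] Fc] := hspec.
have WX x : ~ N1 x -> forall t, W t x = m t + (X x t - m t).
  by move=> Nx t; rewrite subrKC XW.
have ipF s t : ip P (fun x => X x s - m s) (fun x => X x t - m t) = \int[F]_l cos (l * (t - s)).
  rewrite -(covariance_null_modification cG mN1 N10 (gp_eval gX s) (gp_eval gX t) (fun x Nx => WX x Nx s) (fun x Nx => WX x Nx t)).
  by rewrite covF.
have nd := nondeg_five cG gX ipF Fc.
have cLE t : cL X m (1, 0) t = fun x => X x t - m t by apply/funext => x; rewrite /cL !LfE.
have varE t : ip P (cL X m (1, 0) t) (cL X m (1, 0) t) = \int[F]_l cos (l * 0) by rewrite cLE ipF subrr.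
have v0 b : 0 < ip P (cL X m (1, 0) b) (cL X m (1, 0) b).
  have n5 : nondeg P (five (b - 1) b (b + 1)) X m by apply: nd; rewrite lt_eqF//; lra.
  by have [] := nondeg_cons 0 n5.
have s20 : 0 < \int[F]_l cos (l * 0) by rewrite -(varE 0).
have [N2 [mN2 N20 nz]] := no_double_zeros cG gX s20 varE.
(* Outside [N] the sample path is smooth and has no tangential zero in [0, 1]. *)
pose N := N1 `|` N2.
have mN : measurable N by exact: measurableU.
have N0 : P N = 0%E by exact: null_set_setU.
have simple x : ~ N x -> forall b, 0 <= b <= 1 -> X x b = 0 -> (X x : R -> R)^`()%classic b <> 0.
  by move=> Nx; apply: nz => ?; apply: Nx; right.
have XWN x : ~ N x -> X x = sample_path W x :> (R -> R) by move=> Nx; apply: XW => ?; apply: Nx; left.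
have statR h (Psi : path R -> R) (mPsi : measurable_fun setT Psi) := stationary_path_Rintegral hstat mN1 N10 mX XW h mPsi.
have statE h (Phi : path R -> \bar R) (mPhi : measurable_fun setT Phi) (Phi0 : (forall w, 0 <= Phi w)%E) :=
  stationary_path hstat mN1 N10 mX XW h mPhi Phi0.
have Fnum r s u w := expected_marked_count cG gX nd r s u w mE statR statE mN N0 simple XWN.
have Fden := expected_downcrossings cG gX v0 mE statR statE mN N0 XWN.
have IE := downcrossing_intensityE mN N0 cG gX XWN nd.
have FE r s u w : F_space W r s u w = ((\int[lebesgue_measure]_x2 \int[lebesgue_measure]_x3 \int[lebesgue_measure]_y1 \int[lebesgue_measure]_y2
    (marked_intensity P X m (x2, x3, y1, y2) * (\1_(below_heights r s u w) (x2, x3, y1, y2) : R)%:E)) / downcrossing_intensity W)%E.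
  by rewrite /F_space Fnum Fden IE.
(* Both claims evaluate the same numerator integral in [FE], here as iterated integrals and below
   over the product measure. *)
split; first by move=> r s u w _ _ u0 w0; rewrite FE (integral_h_s mN N0 cG gX XWN nd).
have I0 := downcrossing_intensity_ge0 mN N0 cG gX XWN nd.
split.
- have mg : measurable_fun setT (fun q => marked_intensity P X m q * (downcrossing_intensity W)^-1)%E.
    by apply: emeasurable_funM; [exact: (measurable_marked_intensity cG gX)|exact: measurable_cst].
  apply: (eq_measurable_fun _ _ (measurable_funTS mg)) => -[[[x2 x3] y1] y2]; rewrite inE => -[p2 p3 _ _].
  by rewrite (h_s_marked_intensity mN N0 cG gX XWN nd).
- move=> [[[x2 x3] y1] y2] [p2 p3 _ _]; apply: mule_ge0; last by rewrite inve_ge0.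
  by rewrite (h_s_marked_intensity mN N0 cG gX XWN nd)//; exact: marked_intensity_ge0.
- move=> r s u w r0 s0 u0 w0; rewrite FE; apply: esym.
  apply: (integral_density mN N0 cG gX XWN nd w0) => //.
  apply/seteqP; split => -[[[x2 x3] y1] y2] /=.
    by move=> [[h1 h2 h3 h4] [k1 k2 k3 k4]]; split; split=> //; apply/andP.
  by move=> [[/andP[h1 h2] /andP[h3 h4] [h5 h6]] [k1 k2]].
Qed.
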